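(* Let $\hat M^{Toda}$ be the almost duality of the Frobenius manifold $M^{Toda}$. Then the Hamiltonian densities of the principal hierarchy for $\hat M^{Toda}$ are given by $$F_{\tilde\gamma,p}=\frac1{2\pi\mathrm i}\int_{\tilde\gamma}\frac{(\log(\lambda(z)))^{p+1}}{(p+1)!}\,\frac{dz}z,$$ where $\tilde\gamma$ is a simple closed curve in the complex plane $\mathbb C$ such that the winding number of $\lambda(z)$ along $\tilde\gamma$ is zero. In particular, let $q_1,\dots,q_k$ and $p_1,\dots,p_k$ be the zeros and poles of $\lambda(z)$, respectively, within the region enclosed by $\tilde\gamma$. Additionally, let $q_{k+1},\dots,q_n$ and $p_{k+1},\dots,p_r$ be the zeros and poles outside this region. Then $$F_{\tilde\gamma,0}=\begin{cases}\displaystyle\sum_{s=1}^k\log(p_s)-\sum_{s=1}^k\log(q_s),&\text{if }0\in\mathbb C\text{ is outside the region enclosed by }\tilde\gamma,\\[2mm]\displaystyle\sum_{s=k+1}^r\log(p_s)-\sum_{s=k+1}^n\log(q_s),&\text{if }0\in\mathbb C\text{ is inside the region enclosed by }\tilde\gamma.\end{cases}$$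
   Context: **The manifold.** Let $m\ge1$ and let $n_0,\dots,n_m$ be positive integers. $M^{Toda}$ is the space of functions of $z=e^\varphi$: $\lambda=\frac1{n_0}z^{n_0}+a_{0,n_0-1}z^{n_0-1}+\dots+a_{0,0}+\sum_{i=1}^m\sum_{j=1}^{n_i}a_{i,j}(z-a_{i,0})^{-j}$ with $a_{1,0}=0$, $a_{i,n_i}\ne0$ and $a_{1,0},\dots,a_{m,0}$ pairwise distinct. A tangent vector $\partial$ is identified with $\partial\lambda(z)$; $'=d/dz$. The Frobenius structure is: $\eta(\partial',\partial'')=\sum_{\lambda'(z_0)=0}\operatorname{Res}_{z_0}\frac{\partial'\lambda\,\partial''\lambda}{z^2\lambda'}dz$; $\ \eta(\partial'\circ\partial'',\partial''')=\sum_{\lambda'(z_0)=0}\operatorname{Res}_{z_0}\frac{\partial'\lambda\,\partial''\lambda\,\partial'''\lambda}{z^2\lambda'}dz$; unit field $e$ with $e\lambda=1$; Euler field $E$ with $E\lambda=\lambda-\frac z{n_0}\lambda'$. **Almost duality.** For a Frobenius manifold $M$ with flat coordinates $t^\alpha$ of $\eta$, the intersection form is $g^{\alpha\beta}=i_E(dt^\alpha\circ dt^\beta)$, where the product on $T^*M$ is the one transported from $TM$ by $\eta$. Put $\hat M=M\setminus\{\det(g^{\alpha\beta})=0\}$ and $u\star v=E^{-1}\circ u\circ v$ on $T\hat M$, with $E^{-1}$ the inverse of $E$ for $\circ$. The data $(\hat M,g^{\alpha\beta},\star)$ is the almost duality of $M$. **Principal hierarchy of the almost duality.** Let $\hat t^1,\dots,\hat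 t^N$ be flat coordinates of the flat metric $g$ and $\hat c^{\,\epsilon}_{\beta\gamma}$ the structure constants of $\star$ in them. The Hamiltonian densities $\hat\theta_{\alpha,p}$ ($1\le\alpha\le N$, $p\ge0$) satisfy $\frac{\partial^2\hat\theta_{\alpha,p+1}}{\partial\hat t^\beta\partial\hat t^\gamma}=\hat c^{\,\epsilon}_{\beta\gamma}\frac{\partial\hat\theta_{\alpha,p}}{\partial\hat t^\epsilon}$ and $\hat\theta_{\alpha,0}=g_{\alpha\beta}\hat t^\beta$, and the principal hierarchy for $\hat M$ is the Hamiltonian system $\frac{\partial\hat t^\gamma}{\partial\hat T^{\alpha,p}}=g^{\gamma\beta}\frac{\partial}{\partial x}\Big(\frac{\partial\hat\theta_{\alpha,p+1}}{\partial\hat t^\beta}\Big)$ on the loop space of $\hat M$. The vanishing of the winding number of $\lambda$ along $\tilde\gamma$ presupposes that $\lambda$ has no zeros or poles on $\tilde\gamma$, and makes $\log\lambda$ single-valued along $\tilde\gamma$.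
   Formalization: The formula for F_{γ,0} is corrected: modulo 2πi, counterclockwise, the case 0 inside equals −(Σlog p_s − Σlog q_s + log n_0 + iπn_0) over outside zeros and poles, the case 0 outside is as printed, and both change sign for clockwise curves; curves are C^1-parametrized. *)

(* Defs.v *)
From HB Require Import structures.
From mathcomp Require Import all_boot all_order all_algebra.
From mathcomp Require Import complex.
From mathcomp Require Import all_classical all_reals all_analysis.

Set Implicit Arguments.
Unset Strict Implicit.
Unset Printing Implicit Defensive.

Import Order.TTheory GRing.Theory Num.Theory.
Import numFieldNormedType.Exports.

Local Open Scope classical_set_scope.
Local Open Scope ring_scope.
Local Open Scope complex_scope.

(* R[i] as a normed space over itself, so that 'D_v, derive1, differentiable
   below are complex derivatives. *)
HB.instance Definition _ (R : rcfType) :=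
  NormedModule.copy R[i] (R[i] : numFieldType)^o.

Section Curves.
Variable R : realType.
Local Notation C := R[i].
Implicit Types (g : R -> C) (f : C -> C).

Definition cexp (z : C) : C :=
  (expR (complex.Re z))%:C * (cos (complex.Im z) +i* sin (complex.Im z)).

Definition two_pi_i : C := 0 +i* (2 * pi).

Definition cint (h : R -> C) : C :=
  (\int[lebesgue_measure]_(t in `[0%R, 1%R]) complex.Re (h t))%R +i*
  (\int[lebesgue_measure]_(t in `[0%R, 1%R]) complex.Im (h t))%R.

Definition curve_deriv g (t : R) : C :=
  derive1 (fun s => complex.Re (g s)) t +i*
  derive1 (fun s => complex.Im (g s)) t.

Definition contour_int g f : C := cint (fun t => f (g t) * curve_deriv g t).

Definition winding g (z : C) : C :=
  two_pi_i^-1 * contour_int g (fun w => (w - z)^-1).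

(* A C^1 curve parametrized by [0, 1] and extended in a C^1 way to the real
   line.  The speed may vanish, so that a piecewise C^1 curve is covered after
   a reparametrization that stops at its corners. *)
Definition C1_curve g :=
  [/\ forall t, derivable (fun s => complex.Re (g s)) t 1,
      forall t, derivable (fun s => complex.Im (g s)) t 1,
      continuous (derive1 (fun s => complex.Re (g s))) &
      continuous (derive1 (fun s => complex.Im (g s)))].

Definition simple_closed_curve g :=
  [/\ C1_curve g, g 0 = g 1 &
      forall s t, 0 <= s < 1 -> 0 <= t < 1 -> g s = g t -> s = t].

(* The union of the bounded components of the complement of the curve. *)
Definition enclosed g : set C :=
  [set z | (~` (g @` `[0, 1])) z /\
           bounded_set (connected_component (~` (g @` `[0, 1])) z)].

(* [b = false] is the counterclockwise orientation, [b = true] the clockwise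
   one. *)
Definition has_orientation (b : bool) g :=
  forall z, enclosed g z -> winding g z = (-1) ^+ b.

Definition circle (z0 : C) (r : R) (t : R) : C :=
  z0 + r%:C * (cos (2 * pi * t) +i* sin (2 * pi * t)).

Definition residue f (z0 : C) : C :=
  lim (two_pi_i^-1 * contour_int (circle z0 r) f @[r --> (0 : R)^'+]).

(* [q] and [p] list the zeros and the poles of the rational function [f], with
   multiplicities. *)
Definition zeros_and_poles f (q p : seq C) :=
  (forall z, ~ (z \in q /\ z \in p)) /\
  exists2 c : C, c != 0 & forall z, z \notin p ->
    f z = c * (\prod_(w <- q) (z - w)) / (\prod_(w <- p) (z - w)).

(* Holomorphy is stated as complex differentiability to all orders. *)
Definition holomorphic_on N (U : set 'rV[C]_N) (f : 'rV[C]_N -> C) :=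
  forall (vs : seq 'rV[C]_N) (a : 'rV[C]_N), U a ->
    differentiable (foldr (fun v (h : 'rV[C]_N -> C) b => 'D_v h b) f vs) a.

End Curves.

(* Linear algebra of a Frobenius manifold at one point; [eta] and [c] are the
   metric and the tensor eta (u o v, w) on a tangent space, [e] and [E] the
   values of the unit and Euler fields.  Covectors are row vectors of
   components. *)
Section Frobenius.
Variables (K : fieldType) (N : nat).
Variables (eta : 'rV[K]_N -> 'rV[K]_N -> K).
Variables (c : 'rV[K]_N -> 'rV[K]_N -> 'rV[K]_N -> K).
Variables (e E : 'rV[K]_N).
Implicit Types u v w : 'rV[K]_N.

Definition lower u : 'rV[K]_N := \row_k eta u (delta_mx 0 k).
Definition raise w : 'rV[K]_N :=
  w *m invmx (\matrix_(i < N, j < N) eta (delta_mx 0 i) (delta_mx 0 j)).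

Definition frob_mul u v : 'rV[K]_N := raise (\row_k c u v (delta_mx 0 k)).
Definition cofrob_mul w1 w2 : 'rV[K]_N :=
  lower (frob_mul (raise w1) (raise w2)).

(* i_E (w1 o w2) *)
Definition intersection_form w1 w2 : K := (cofrob_mul w1 w2 *m E^T) 0 0.
Definition intersection_mx : 'M[K]_N :=
  \matrix_(i, j) intersection_form (delta_mx 0 i) (delta_mx 0 j).

(* the solution x of E o x = e *)
Definition euler_inv : 'rV[K]_N := e *m invmx (lin1_mx (frob_mul E)).
Definition star u v : 'rV[K]_N := frob_mul (frob_mul euler_inv u) v.

End Frobenius.

Section Toda.
Variables (R : realType) (m : nat) (n : nat -> nat).
Local Notation C := R[i].

(* The pairs (i, j) for which a_{i,j} is a coordinate; (1, 0) is absent. *)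
Definition toda_index : seq (nat * nat) :=
  [seq (i, j) | i <- iota 0%N m.+1,
                j <- match i with
                     | 0%N => iota 0%N (n 0%N)
                     | 1%N => iota 1%N (n 1%N)
                     | _ => iota 0%N (n i).+1
                     end].

Definition toda_dim : nat := size toda_index.
Local Notation N := toda_dim.
Implicit Types (a u v w : 'rV[C]_N) (z : C).

(* a_{i,j}; it is 0 when (i, j) is not in toda_index, so that a_{1,0} = 0. *)
Definition coef a (i j : nat) : C :=
  \sum_(k < N | nth (0%N, 0%N) toda_index k == (i, j)) a 0 k.

Definition lam a z : C :=
  (n 0%N)%:R^-1 * z ^+ n 0%N + \sum_(0 <= j < n 0%N) coef a 0%N j * z ^+ j +
  \sum_(1 <= i < m.+1) \sum_(1 <= j < (n i).+1)
     coef a i j * (z - coef a i 0%N) ^- j.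

Definition lam_pole a : set C :=
  [set z | exists2 i : nat, (1 <= i <= m)%N & z = coef a i 0%N].

Definition toda_manifold : set 'rV[C]_N :=
  [set a | (forall i : nat, (1 <= i <= m)%N -> coef a i (n i) != 0) /\
           (forall i j : nat, (1 <= i <= m)%N -> (1 <= j <= m)%N -> i <> j ->
              coef a i 0%N != coef a j 0%N)].

Definition lam' a z : C := derive1 (lam a) z.

(* the tangent vector [u] at [a] applied to lambda (z) *)
Definition tangent_lam a u z : C := 'D_u (fun b => lam b z) a.

Definition lam_crit a : set C := [set z | ~ lam_pole a z /\ lam' a z = 0].

Definition toda_eta a u v : C :=
  \sum_(z0 \in lam_crit a)
    residue (fun z => tangent_lam a u z * tangent_lam a v z /
                      (z ^+ 2 * lam' a z)) z0.

Definition toda_c a u v w : C :=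
  \sum_(z0 \in lam_crit a)
    residue (fun z => tangent_lam a u z * tangent_lam a v z *
                      tangent_lam a w z / (z ^+ 2 * lam' a z)) z0.

Definition toda_unit_field (e : 'rV[C]_N -> 'rV[C]_N) :=
  forall a z, toda_manifold a -> ~ lam_pole a z -> tangent_lam a (e a) z = 1.

Definition toda_euler_field (E : 'rV[C]_N -> 'rV[C]_N) :=
  forall a z, toda_manifold a -> ~ lam_pole a z ->
    tangent_lam a (E a) z = lam a z - z / (n 0%N)%:R * lam' a z.

Section AlmostDuality.
Variables e E : 'rV[C]_N -> 'rV[C]_N.

Definition toda_dual_form a : 'rV[C]_N -> 'rV[C]_N -> C :=
  intersection_form (toda_eta a) (toda_c a) (E a).

Definition toda_dual_star a : 'rV[C]_N -> 'rV[C]_N -> 'rV[C]_N :=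
  star (toda_eta a) (toda_c a) (e a) (E a).

Definition toda_dual_manifold : set 'rV[C]_N :=
  [set a | toda_manifold a /\
           \det (intersection_mx (toda_eta a) (toda_c a) (E a)) != 0].

Definition differential (f : 'rV[C]_N -> C) a : 'rV[C]_N :=
  \row_k 'D_(delta_mx 0 k) f a.

Definition jac_mx (t : 'I_N -> 'rV[C]_N -> C) a : 'M[C]_N :=
  \matrix_(i, k) differential (t i) a 0 k.

(* [t] is a system of flat coordinates on [U] of the intersection form, whose
   contravariant components in these coordinates are [G]. *)
Record flat_coordinates (U : set 'rV[C]_N) (t : 'I_N -> 'rV[C]_N -> C)
    (G : 'M[C]_N) : Prop := FlatCoordinates {
  flat_open : open U;
  flat_connected : connected U;
  flat_sub : U `<=` toda_dual_manifold;
  flat_holomorphic : forall i, holomorphic_on U (t i);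
  flat_inj : forall a b, U a -> U b -> (forall i, t i a = t i b) -> a = b;
  flat_jac : forall a, U a -> jac_mx t a \in unitmx;
  flat_const : forall a i j, U a ->
    toda_dual_form a (differential (t i) a) (differential (t j) a) = G i j }.

(* the coordinate vector field d/dt^i, by duality with the dt^i *)
Definition coord_field (t : 'I_N -> 'rV[C]_N -> C) (i : 'I_N) a : 'rV[C]_N :=
  (col i (invmx (jac_mx t a)))^T.

Definition coord_deriv t (i : 'I_N) (f : 'rV[C]_N -> C) a : C :=
  'D_(coord_field t i a) f a.

(* the components of d/dt^j * d/dt^k in the coordinates [t] *)
Definition dual_structure_const t (i j k : 'I_N) a : C :=
  'D_(toda_dual_star a (coord_field t j a) (coord_field t k a)) (t i) a.

Definition density_recursion (U : set 'rV[C]_N) t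
    (theta : nat -> 'rV[C]_N -> C) :=
  forall (p : nat) (j k : 'I_N) a, U a ->
    coord_deriv t j (coord_deriv t k (theta p.+1)) a =
    \sum_(i < N) dual_structure_const t i j k a * coord_deriv t i (theta p) a.

Definition hamiltonian_densities (U : set 'rV[C]_N) t (G : 'M[C]_N)
    (theta : 'I_N -> nat -> 'rV[C]_N -> C) :=
  [/\ forall i p, holomorphic_on U (theta i p),
      forall i a, U a -> theta i 0%N a = \sum_(j < N) invmx G i j * t j a &
      forall i, density_recursion U t (theta i)].

End AlmostDuality.

Definition zero_winding a (g : R -> C) :=
  (forall t, 0 <= t <= 1 -> ~ lam_pole a (g t) /\ lam a (g t) != 0) /\
  winding (fun t => lam a (g t)) 0 = 0.

Definition log_along a (g L : R -> C) :=
  {within `[0, 1]%classic, continuous L} /\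
  forall t, 0 <= t <= 1 -> cexp (L t) = lam a (g t).

Definition log_branch (U : set 'rV[C]_N) (g : R -> C)
    (L : 'rV[C]_N -> R -> C) :=
  {within U `*` `[0, 1]%classic, continuous (fun x => L x.1 x.2)} /\
  forall a, U a -> log_along a g (L a).

(* F_{g,p}, computed with the determination [L] of log lambda along [g] *)
Definition toda_F (g L : R -> C) (p : nat) : C :=
  (two_pi_i R)^-1 *
  cint (fun t => L t ^+ p.+1 / (p.+1)`!%:R * (curve_deriv g t / g t)).

End Toda.

(* Main.v *)
From HB Require Import structures.
Require Import Defs.
From mathcomp Require Import all_boot all_order all_algebra.
From mathcomp Require Import complex.
From mathcomp Require Import all_classical all_reals all_analysis.
From mathcomp Require Import separable.
From mathcomp Require Import ring lra zify.

(* Let S be the product of the numerator of lambda and of the linear factors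
   z - a_{i,0} with i >= 2, let rho_r be its roots, and let eps_r = 1 at a zero
   of lambda and eps_r = - n_i at a pole.  The rho_r are local coordinates and
   d lambda / lambda = - sum_r eps_r rho_r (d log rho_r) / (z - rho_r).
   Computing the residues at the critical points of lambda from those at the
   rho_r, the intersection form has the constant matrix
   1 / n_0 - delta_{rs} / eps_r in the coframe d log rho_r, and a symmetry
   argument shows that the coordinate fields X of flat coordinates have constant
   components X_r = X log rho_r.  For two such fields, with
   chi = sum_r eps_r rho_r X_r Y_r / (z - rho_r),
     X Y log lambda = z d chi / dz,
     (X * Y) log lambda = (X log lambda) (Y log lambda) - z (log lambda)' chi,
   so that an integration by parts gives the recursion.
   Completeness: the differential of F_{g,0} is a combination of the
   d log rho_r with coefficients given by the winding numbers of g, and these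
   coefficients span when g runs around all sets of roots for which the winding
   number of lambda vanishes.  The value of F_{g,0} rests on
     exp (1/(2 pi i) oint l (e^l)' / (e^l - rho)) = rho^k
   for a loop l, where k is the winding number of e^l around rho. *)

Set Implicit Arguments.
Unset Strict Implicit.
Unset Printing Implicit Defensive.

Import Order.TTheory GRing.Theory Num.Theory.
Import numFieldNormedType.Exports.

Local Open Scope classical_set_scope.
Local Open Scope ring_scope.
Local Open Scope complex_scope.

Local Notation Re := complex.Re.
Local Notation Im := complex.Im.

(** * The complex exponential *)

Section Modulus.
Variable R : realType.
Local Notation C := R[i].
Implicit Types z w : C.

(** The residues at the critical points are never evaluated one by one: they enter through the
    polynomial [lamW] = z D lambda', D being the common denominator of tangent vectors. Tangent
    vectors become polynomials of degree below N, the algebra becomes C[z] / ([lamW]), and z and D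
    are units in it. The intersection form is then nondegenerate exactly when [lamS] and [lamW] are
    coprime, and this makes the rho_r distinct. The pole a_{1,0} = 0 is not among them because it
    does not move. The rho_r are functions of the point only locally, while flat coordinates live on
    an arbitrary connected domain. Facts about flat coordinates are therefore proved on small balls
    and extended by local constancy. Contour integrals obey one principle: if the derivative of the
    integrand in a parameter is the derivative of a closed path along the curve, the integral does
    not depend on the parameter. Indices, integrals of logarithms and the vanishing second
    derivatives of F_{g,0} are all instances. A logarithm of lambda along g closes up because the
    winding number vanishes, which removes the boundary terms of the integration by parts. *)

Definition cabs z : R := Num.sqrt (Re z ^+ 2 + Im z ^+ 2).

(** The norm of [R[i]] takes values in [R[i]]. Estimates are made with the real number [cabs z], to
    which real arithmetic applies. *)
Lemma normcabs z : `|z| = (cabs z)%:C.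
Proof. by case: z. Qed.

Lemma cplx_eq z w : Re z = Re w -> Im z = Im w -> z = w.
Proof. by case: z => ? ?; case: w => ? ? /= -> ->. Qed.

Lemma ReD z w : Re (z + w) = Re z + Re w. Proof. by case: z; case: w. Qed.
Lemma ImD z w : Im (z + w) = Im z + Im w. Proof. by case: z; case: w. Qed.
Lemma ReN z : Re (- z) = - Re z. Proof. by case: z. Qed.
Lemma ImN z : Im (- z) = - Im z. Proof. by case: z. Qed.
Lemma ReM z w : Re (z * w) = Re z * Re w - Im z * Im w.
Proof. by case: z; case: w. Qed.
Lemma ImM z w : Im (z * w) = Re z * Im w + Im z * Re w.
Proof. by case: z; case: w. Qed.

Definition cplxE := (ReD, ImD, ReN, ImN, ReM, ImM).

Lemma cabs_ge0 z : 0 <= cabs z. Proof. exact: sqrtr_ge0. Qed.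

Lemma cabs_triangle z w : cabs (z + w) <= cabs z + cabs w.
Proof. by rewrite -lecR -normcabs rmorphD /= -!normcabs ler_normD. Qed.
Lemma cabsM z w : cabs (z * w) = cabs z * cabs w.
Proof. by apply: complexI; rewrite -normcabs rmorphM /= -!normcabs normrM. Qed.
Lemma cabsN z : cabs (- z) = cabs z.
Proof. by apply: complexI; rewrite -!normcabs normrN. Qed.
Lemma cabsV z : cabs z^-1 = (cabs z)^-1.
Proof. by apply: complexI; rewrite -normcabs normfV normcabs fmorphV. Qed.
Lemma cabs0 : cabs 0 = 0.
Proof. by apply: complexI; rewrite -normcabs normr0. Qed.
Lemma cabs1 : cabs 1 = 1.
Proof. by apply: complexI; rewrite -normcabs normr1. Qed.
Lemma cabs_eq0 z : (cabs z == 0) = (z == 0).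
Proof. by rewrite -[RHS]normr_eq0 normcabs -[LHS](inj_eq (@complexI R)). Qed.
Lemma cabs_gt0 z : (0 < cabs z) = (z != 0).
Proof. by rewrite lt0r cabs_ge0 andbT cabs_eq0. Qed.
Lemma cabsR (x : R) : cabs x%:C = `|x|.
Proof. by rewrite /cabs /= expr0n addr0 sqrtr_sqr. Qed.
Lemma cabs_distC z w : cabs (z - w) = cabs (w - z).
Proof. by rewrite -opprB cabsN. Qed.
Lemma cabs_tri3 z w u : cabs (z - w) <= cabs (z - u) + cabs (u - w).
Proof. by have := cabs_triangle (z - u) (u - w); rewrite addrA subrK. Qed.
Lemma cabs_lowtri z w : cabs z - cabs w <= cabs (z - w).
Proof. by have := cabs_triangle (z - w) w; rewrite subrK; lra. Qed.
Lemma cabsX z k : cabs (z ^+ k) = cabs z ^+ k.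
Proof. by elim: k => [|k IH]; rewrite ?expr0 ?cabs1// !exprS cabsM IH. Qed.
Lemma Re_cabs z : `|Re z| <= cabs z.
Proof.
by rewrite -(sqrtr_sqr (Re z)) ler_wsqrtr// lerDl sqr_ge0.
Qed.
Lemma Im_cabs z : `|Im z| <= cabs z.
Proof.
by rewrite -(sqrtr_sqr (Im z)) ler_wsqrtr// lerDr sqr_ge0.
Qed.
Lemma cabs_ReIm z : cabs z <= `|Re z| + `|Im z|.
Proof.
rewrite {1}(complexE z); apply: (le_trans (cabs_triangle _ _)).
rewrite cabsM !cabsR; have -> : cabs 'i = 1.
  by rewrite /cabs /= expr0n add0r expr1n sqrtr1.
by rewrite mul1r.
Qed.
Lemma cabs_sum (I : Type) (s : seq I) (P : pred I) (F : I -> C) :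
  cabs (\sum_(i <- s | P i) F i) <= \sum_(i <- s | P i) cabs (F i).
Proof.
elim/big_rec2 : _ => [|i x y _ le]; first by rewrite cabs0.
by apply: (le_trans (cabs_triangle _ _)); rewrite lerD2l.
Qed.
Lemma cabs_nat k : cabs k%:R = k%:R.
Proof.
have -> : (k%:R : C) = (k%:R : R)%:C by rewrite rmorph_nat.
by rewrite cabsR ger0_norm.
Qed.

Lemma normr_ltc z (e : R) : (`|z| < e%:C) = (cabs z < e).
Proof. by rewrite normcabs ltcR. Qed.

Lemma posc_real (e : C) : 0 < e -> exists2 r : R, 0 < r & e = r%:C.
Proof.
move=> e0; have /complex_realP[r er] : e \is Num.real by exact: gtr0_real.
by exists r => //; move: e0; rewrite er ltcR.
Qed.

Lemma nbhs_cabs (z : C) (P : C -> Prop) :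
  (\forall w \near z, P w) <->
  exists2 d : R, 0 < d & forall w, cabs (w - z) < d -> P w.
Proof.
split.
  move=> /nbhs_ballP[e /posc_real[r r0 ->] H]; exists r => // w zw.
  by apply: H; rewrite /= /ball /= distrC normr_ltc.
move=> [d d0 H]; apply/nbhs_ballP; exists d%:C; first by rewrite /= ltcR.
by move=> w /=; rewrite /ball /= distrC normr_ltc; exact: H.
Qed.

End Modulus.

Section RealDerivative.
Variable R : realType.

(** Without division the condition holds trivially at [y = x], and real and imaginary parts can be
    estimated together. *)
Lemma is_derive_eps (f : R -> R) (x d : R) :
  is_derive x 1 f d <->
  (forall e : R, 0 < e -> exists2 del : R, 0 < del &
     forall y : R, `|y - x| < del -> `|f y - f x - (y - x) * d| <= e * `|y - x|).
Proof.
split.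
  move=> [/cvg_ex[/= l fl] dfl] e e0.
  have {dfl} ld : l = d by rewrite -dfl /derive; apply/esym/cvg_lim.
  subst l; move/cvgrPdist_le/(_ _ e0): fl.
  move=> /nbhs_ballP[r /= r0 H].
  exists r => // y yx; have [->|yx0] := eqVneq y x.
    by rewrite !subrr mul0r subr0 normr0 mulr0.
  have yx1 : y - x != 0 by rewrite subr_eq0.
  have := H (y - x); rewrite /ball /= sub0r normrN => /(_ yx yx1).
  rewrite /GRing.scale /= mulr1 subrK => H1.
  have -> : f y - f x - (y - x) * d = (y - x) * - (d - (y - x)^-1 * (f y - f x)).
    by rewrite opprB mulrBr mulVKf.
  by rewrite normrM normrN mulrC ler_wpM2r.
move=> H; have fl : h^-1 *: ((f \o shift x) (h *: (1 : R)) - f x) @[h --> (0:R)^'] --> d.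
  apply/cvgrPdist_le => e e0; have [r r0 {}H] := H _ e0.
  apply/nbhs_ballP; exists r => //= h; rewrite /ball /= sub0r normrN => hr h0.
  have := H (h + x); rewrite addrK => /(_ hr).
  rewrite /GRing.scale /= mulr1 => H1.
  rewrite -(ler_pM2r (x := `|h|)) ?normr_gt0// -normrM.
  suff -> : (d - h^-1 * (f (h + x) - f x)) * h = - (f (h + x) - f x - h * d).
    by rewrite normrN.
  by rewrite mulrBl mulrAC mulVf// mul1r; ring.
apply: DeriveDef; first by apply/cvg_ex; exists d; exact: fl.
by apply/cvg_lim.
Qed.

End RealDerivative.

Section Exponential.
Variable R : realType.
Local Notation C := R[i].
Implicit Types z w : C.

Lemma cexpD z w : cexp (z + w) = cexp z * cexp w.
Proof.
by apply: cplx_eq; rewrite /cexp !cplxE /= !(mul0r, addr0, subr0) expRD ?cosD ?sinD; ring.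
Qed.

Lemma cexp0 : cexp (0 : C) = 1.
Proof. by rewrite /cexp /= expR0 cos0 sin0 mul1r. Qed.

Lemma cabs_cexp z : cabs (cexp z) = expR (Re z).
Proof.
rewrite /cexp cabsM cabsR ger0_norm ?expR_ge0// /cabs /= cos2Dsin2 sqrtr1.
by rewrite mulr1.
Qed.

Lemma cexp_neq0 z : cexp z != 0.
Proof. by rewrite -cabs_gt0 cabs_cexp expR_gt0. Qed.

Lemma cexpN z : cexp (- z) = (cexp z)^-1.
Proof.
by apply: (mulfI (cexp_neq0 z)); rewrite -cexpD subrr cexp0 mulfV ?cexp_neq0.
Qed.

Lemma cexpB z w : cexp (z - w) = cexp z / cexp w.
Proof. by rewrite cexpD cexpN. Qed.

Lemma cexpMn z k : cexp (k%:R * z) = cexp z ^+ k.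
Proof.
by elim: k => [|k IH]; rewrite ?mul0r ?cexp0// -natr1 mulrDl mul1r cexpD IH exprSr.
Qed.

Lemma cexp_sum (s : seq C) : cexp (\sum_(x <- s) x) = \prod_(x <- s) cexp x.
Proof. by apply: (big_morph _ cexpD cexp0). Qed.

Lemma cexpMz z (k : int) : cexp (k%:~R * z) = cexp z ^ k.
Proof.
by case: k => k; rewrite ?cexpMn// NegzE mulrNz mulNr cexpN cexpMn exprnN.
Qed.

(** This estimate at 0, obtained from the derivatives of [expR], [cos] and [sin] there, yields the
    derivative of the exponential everywhere through [cexpD]. *)
Lemma cexp_first_order (e : R) : 0 < e ->
  exists2 d : R, 0 < d &
    forall w, cabs w < d -> cabs (cexp w - 1 - w) <= e * cabs w.
Proof.
move=> e0.
(* The error terms below add up to at most 7 k |w|; the bound 8 k <= 1 keeps [expR (Re w)] below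
   2. *)
pose k := Num.min e 1 / 8.
have m0 : 0 < Num.min e 1 by rewrite lt_min e0 ltr01.
have k0 : 0 < k by rewrite /k divr_gt0.
have ke : 8 * k <= e by rewrite /k mulrCA divff// mulr1 ge_min lexx.
have k1 : 8 * k <= 1 by rewrite /k mulrCA divff// mulr1 ge_min lexx orbT.
have [d1 d10 H1] := (is_derive_eps expR 0 (expR 0)).1 (is_derive_expR _) _ k0.
have [d2 d20 H2] := (is_derive_eps cos 0 (- sin 0)).1 (is_derive_cos _) _ k0.
have [d3 d30 H3] := (is_derive_eps sin 0 (cos 0)).1 (is_derive_sin _) _ k0.
exists (Num.min (Num.min d1 d2) (Num.min d3 k)); first by rewrite !lt_min d10 d20 d30 k0.
move=> w; rewrite !lt_min => /andP[/andP[w1 w2] /andP[w3 w4]].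
have rw := Re_cabs w; have iw := Im_cabs w.
have := H1 (Re w); have := H2 (Im w); have := H3 (Im w).
rewrite !subr0 expR0 cos0 sin0 oppr0 mulr0 subr0 !mulr1.
move=> /(_ (le_lt_trans iw w3)) s /(_ (le_lt_trans iw w2)) c /(_ (le_lt_trans rw w1)) x.
set X := expR (Re w) in x *.
apply: (le_trans (cabs_ReIm _)); rewrite /cexp -/X !cplxE /= !(mul0r, addr0, subr0, oppr0).
set a := Re w in x rw *; set b := Im w in s c iw *; set r := cabs w in rw iw w4 *.
have ra := normr_ge0 a; have rb := normr_ge0 b.
have X1 : `|X - 1| <= 2 * `|a|.
  have -> : X - 1 = (X - 1 - a) + a by ring.
  by apply: (le_trans (ler_normD _ _)); nra.
have X2 : `|X| <= 2.
  have -> : X = (X - 1) + 1 by ring.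
  by apply: (le_trans (ler_normD _ _)); rewrite normr1; nra.
have -> : X * cos b - 1 - a = (X - 1 - a) + X * (cos b - 1) by ring.
have -> : X * sin b - b = X * (sin b - b) + (X - 1) * b by ring.
apply: (@le_trans _ _ (k * `|a| + 2 * (k * `|b|) + (2 * (k * `|b|) + 2 * `|a| * `|b|))).
  apply: lerD; apply: (le_trans (ler_normD _ _)); apply: lerD => //; rewrite normrM.
  - by apply: ler_pM.
  - by apply: ler_pM => //; rewrite addr0 in s.
  - by apply: ler_pM.
nra.
Qed.

(** The principal logarithm, meaningful only for [0 < Re z], where the argument is the arctangent of
    the slope. *)
Definition clog z : C := ln (cabs z) +i* atan (Im z / Re z).

Lemma clogK z : 0 < Re z -> cexp (clog z) = z.
Proof.
move=> z0; have zc : 0 < cabs z.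
  by apply: (lt_le_trans z0); apply: (le_trans _ (Re_cabs z)); exact: ler_norm.
have sE : Num.sqrt (1 + (Im z / Re z) ^+ 2) = cabs z / Re z.
  have -> : 1 + (Im z / Re z) ^+ 2 = (Re z ^+ 2 + Im z ^+ 2) / Re z ^+ 2.
    by field; rewrite gt_eqF.
  by rewrite sqrtrM ?addr_ge0 ?sqr_ge0// sqrtrV ?sqr_ge0// sqrtr_sqr gtr0_norm.
have ca : cos (atan (Im z / Re z)) = Re z / cabs z by rewrite cos_atan sE invf_div.
have cn : cos (atan (Im z / Re z)) != 0 by rewrite ca mulf_neq0 ?invr_eq0 ?gt_eqF.
have sa : sin (atan (Im z / Re z)) = Im z / cabs z.
  have := atanK (Im z / Re z); rewrite /tan => /(canRL (mulfVK cn)) ->.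
  by rewrite ca; field; rewrite !gt_eqF.
by apply: cplx_eq; rewrite /cexp !cplxE /= lnK// !(mul0r, addr0, subr0) ?ca ?sa;
  field; rewrite gt_eqF.
Qed.

Lemma cabs_continuous_at (z w : C) : `|cabs z - cabs w| <= cabs (z - w).
Proof.
rewrite ler_norml; have := cabs_lowtri z w; have := cabs_lowtri w z.
by rewrite (cabs_distC w z); lra.
Qed.

Lemma clog_small (e : R) : 0 < e ->
  exists2 d : R, 0 < d & forall z, cabs (z - 1) < d -> 0 < Re z /\ cabs (clog z) < e.
Proof.
move=> e0; have e2 : 0 < e / 2 by rewrite divr_gt0.
have /cvgrPdist_lt/(_ _ e2) := @continuous_ln R 1 ltr01.
move=> /nbhs_ballP[d1 /= d10 H1].
have /cvgrPdist_lt/(_ _ e2) := @continuous_atan R 0.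
move=> /nbhs_ballP[d2 /= d20 H2].
exists (Num.min (Num.min d1 (d2 / 2)) (1/2)); first by rewrite !lt_min d10 divr_gt0// divr_gt0.
move=> z; rewrite !lt_min => /andP[/andP[z1 z2] z3].
have rz : `|Re z - 1| <= cabs (z - 1).
  by have := Re_cabs (z - 1); rewrite !cplxE.
have iz : `|Im z| <= cabs (z - 1).
  by have := Im_cabs (z - 1); rewrite !cplxE /= subr0.
have R2 : 1/2 < Re z by move: rz; rewrite ler_norml; lra.
split; first lra.
apply: (le_lt_trans (cabs_ReIm _)) => /=.
have H3 := H1 (cabs z); have H4 := H2 (Im z / Re z).
have {}H3 : `|ln (cabs z)| < e / 2.
  have := H3; rewrite /ball /= ln1 sub0r normrN; apply.
  rewrite distrC; apply: le_lt_trans z1.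
  by have := cabs_continuous_at z 1; rewrite cabs1.
have {}H4 : `|atan (Im z / Re z)| < e / 2.
  have := H4; rewrite /ball /= atan0 !sub0r !normrN; apply.
  rewrite normrM normfV (gtr0_norm (x := Re z)); last lra.
  rewrite ltr_pdivrMr; last lra.
  by have := normr_ge0 (Im z); nra.
lra.
Qed.

(** The imaginary part is reduced to [0, 2 pi). There cos is injective on [0, pi], and the other
    half is reflected by y -> 2 pi - y. *)
Lemma cexp_eq1 z : cexp z = 1 -> exists k : int, z = k%:~R * two_pi_i R.
Proof.
move=> z1; have := congr1 (@cabs R) z1; rewrite cabs_cexp cabs1 => er.
have r0 : Re z = 0 by rewrite -(expRK (Re z)) er ln1.
have cs : cos (Im z) = 1.
  by have := congr1 (@Re R) z1; rewrite /cexp r0 expR0 mul1r.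
have pp : 0 < 2 * (pi : R) by rewrite mulr_gt0// pi_gt0.
pose k := Num.floor (Im z / (2 * pi)).
pose y := Im z - k%:~R * (2 * pi).
have y0 : 0 <= y.
  rewrite /y subr_ge0 -ler_pdivlMr//; exact: floor_le_tmp.
have y1 : y < 2 * pi.
  rewrite /y ltrBlDl -[X in _ + X]mul1r -mulrDl -ltr_pdivrMr//.
  by have := floorD1_gt (Im z / (2 * pi)); rewrite intrD.
have E (u : R) (n : nat) : cos (u + n%:R * (2 * pi)) = cos u :> R.
  rewrite -[RHS](periodicn (@cosD2pi R) n); congr (cos (_ + _)).
  by rewrite mulr_natl mulr_natl.
have cy : cos y = 1.
  rewrite /y -[RHS]cs; case: (k) => n; last first.
    by rewrite NegzE mulrNz mulNr opprK E.
  by rewrite -[LHS](E _ n) subrK.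
have [yp|yp] := leP y pi.
  have : y = 0 by apply: cos_inj; rewrite ?cos0// in_itv /= ?y0 ?lexx ?pi_ge0.
  move=> y00; exists k; rewrite -(rmorph_int (real_complex R)).
  apply: cplx_eq; rewrite !cplxE /= ?r0 ?mulr0 ?mul0r ?subr0 ?addr0//.
  by move: y00; rewrite /y; lra.
have yy : 2 * pi - y = 0.
  apply: cos_inj; rewrite ?cos0 ?in_itv /= ?lexx ?pi_ge0//; first by apply/andP; split; lra.
  rewrite -[RHS]cy -[RHS]cosN -[RHS](cosD2pi (- y)); congr cos.
  by rewrite -[pi *+ 2]mulr_natl addrC.
by exfalso; clear z1; lra.
Qed.

Lemma cexp_period (k : int) : cexp (k%:~R * two_pi_i R) = 1.
Proof.
rewrite cexpMz; suff -> : cexp (two_pi_i R) = 1 by rewrite exp1rz.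
rewrite /cexp /= expR0 mul1r mulr_natl.
by rewrite -[pi *+ 2]add0r cosD2pi sinD2pi cos0 sin0.
Qed.

Lemma two_pi_i_neq0 : two_pi_i R != 0.
Proof.
by rewrite eq_complex /= negb_and mulf_neq0 ?orbT// gt_eqF// pi_gt0.
Qed.

End Exponential.

(** * First-order expansions along a filter, uniform in a parameter *)

Section Expansion.
Variables (R : realType) (B : Type) (F : set_system B).
Context {FF : Filter F}.
Local Notation C := R[i].
Variable nu : B -> R.
Hypothesis nu_ge0 : forall b, 0 <= nu b.
Hypothesis nu_small : forall e : R, 0 < e -> \forall b \near F, nu b < e.
Variables (T : Type) (S : set T).
Implicit Types (f g l k : B -> T -> C) (u v : T -> C).

Definition ubound u := exists K : R, forall t, S t -> cabs (u t) <= K.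

(* [f b = u + l b + o(nu b)] uniformly on [S]. *)
Definition expansion f (u : T -> C) l :=
  (exists K : R, forall b t, S t -> cabs (l b t) <= K * nu b) /\
  (forall e : R, 0 < e -> \forall b \near F, forall t, S t ->
     cabs (f b t - u t - l b t) <= e * nu b).

Lemma ubound_pos u : ubound u ->
  exists2 K : R, 0 < K & forall t, S t -> cabs (u t) <= K.
Proof.
move=> [K H]; exists (`|K| + 1); first by rewrite ltr_wpDl.
move=> t St; apply: (le_trans (H t St)).
by apply: (le_trans (ler_norm _)); rewrite lerDl.
Qed.

Lemma expansion_lipschitz f u l : expansion f u l ->
  exists2 K : R, 0 < K & \forall b \near F, forall t, S t ->
    cabs (f b t - u t) <= K * nu b /\ cabs (l b t) <= K * nu b.
Proof.
move=> [[K Kl] H]; exists (`|K| + 1); first by rewrite ltr_wpDl.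
apply: filterS (H 1 ltr01) => b Hb t St.
have n0 := nu_ge0 b; have h := Hb t St; have h' := Kl b t St; have kk := ler_norm K.
have := cabs_triangle (f b t - u t - l b t) (l b t); rewrite subrK.
set x := cabs (f b t - u t); set y := cabs (l b t) in h' *.
set z := cabs (_ - l b t) in h *.
by move=> h''; split; nra.
Qed.

Lemma expansion_cvg f u l (e : R) : expansion f u l -> 0 < e ->
  \forall b \near F, forall t, S t -> cabs (f b t - u t) < e.
Proof.
move=> /expansion_lipschitz[K K0 H] e0.
have eK : 0 < e / K by rewrite divr_gt0.
apply: filterS2 H (nu_small eK) => b Hb nb t St.
apply: (le_lt_trans (Hb t St).1).
by rewrite mulrC -ltr_pdivlMr.
Qed.

Lemma expansion_ext f u l f' u' l' :
  (\forall b \near F, forall t, S t -> f b t = f' b t) ->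
  (forall t, S t -> u t = u' t) ->
  (forall b t, S t -> l b t = l' b t) ->
  expansion f u l -> expansion f' u' l'.
Proof.
move=> ff f00 ll [[K Kl] H]; split.
  by exists K => b t St; rewrite -ll//; exact: Kl.
move=> e e0; apply: filterS2 (H e e0) ff => b Hb fb t St.
by rewrite -fb// -f00// -ll//; exact: Hb.
Qed.

Lemma expansion_cst u : expansion (fun=> u) u (fun _ _ => 0).
Proof.
split; first by exists 0 => b t _; rewrite cabs0 mul0r.
move=> e e0; near=> b => t _; rewrite subrr subr0 cabs0.
by rewrite mulr_ge0// ltW.
Unshelve. all: by end_near. Qed.

Lemma expansionD f u l g v k : expansion f u l -> expansion g v k ->
  expansion (fun b t => f b t + g b t) (fun t => u t + v t)
            (fun b t => l b t + k b t).
Proof.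
move=> [[K Kl] H] [[K' Kl'] H']; split.
  exists (K + K') => b t St; apply: (le_trans (cabs_triangle _ _)).
  by rewrite mulrDl lerD ?Kl ?Kl'.
move=> e e0; have e2 : 0 < e / 2 by rewrite divr_gt0.
apply: filterS2 (H _ e2) (H' _ e2) => b Hb Hb' t St.
have -> : f b t + g b t - (u t + v t) - (l b t + k b t) =
  (f b t - u t - l b t) + (g b t - v t - k b t) by ring.
apply: (le_trans (cabs_triangle _ _)).
by have := Hb t St; have := Hb' t St; lra.
Qed.

Lemma expansionM f u l g v k : ubound u -> ubound v ->
  expansion f u l -> expansion g v k ->
  expansion (fun b t => f b t * g b t) (fun t => u t * v t)
            (fun b t => u t * k b t + l b t * v t).
Proof.
move=> /ubound_pos[A A0 fA] /ubound_pos[A' A'0 gA] Ef Eg.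
have [K K0 H1] := expansion_lipschitz Ef.
have [K' K'0 H1'] := expansion_lipschitz Eg.
move: Ef Eg => [[L fL] Hf] [[L' gL] Hg]; split.
  exists (A * L' + L * A') => b t St; apply: (le_trans (cabs_triangle _ _)).
  rewrite !cabsM mulrDl; apply: lerD.
    by rewrite -mulrA; apply: ler_pM; rewrite ?cabs_ge0 ?fA ?gL.
  by rewrite mulrAC; apply: ler_pM; rewrite ?cabs_ge0 ?gA ?fL.
move=> e e0.
have d1 : 0 < e / (4 * A') by rewrite divr_gt0// mulr_gt0.
have d2 : 0 < e / (4 * A) by rewrite divr_gt0// mulr_gt0.
have d3 : 0 < e / (2 * (K * K')) by rewrite divr_gt0// !mulr_gt0.
near=> b => t St.
have -> : f b t * g b t - u t * v t - (u t * k b t + l b t * v t) =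
  (f b t - u t - l b t) * v t + u t * (g b t - v t - k b t) +
  (f b t - u t) * (g b t - v t) by ring.
have nb := nu_ge0 b.
have /(_ t St)[h1 _] : forall t, S t -> cabs (f b t - u t) <= K * nu b /\ cabs (l b t) <= K * nu b by near: b.
have /(_ t St)[h2 _] : forall t, S t -> cabs (g b t - v t) <= K' * nu b /\ cabs (k b t) <= K' * nu b by near: b.
have /(_ t St) h3 : forall t, S t -> cabs (f b t - u t - l b t) <= e / (4 * A') * nu b by near: b; exact (Hf _ d1).
have /(_ t St) h4 : forall t, S t -> cabs (g b t - v t - k b t) <= e / (4 * A) * nu b by near: b; exact (Hg _ d2).
have h5 : nu b < e / (2 * (K * K')) by near: b; exact: nu_small.
apply: (le_trans (cabs_triangle _ _)).
apply: (le_trans (lerD (cabs_triangle _ _) (lexx _))); rewrite !cabsM.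
have -> : e * nu b = e / (4 * A') * nu b * A' + A * (e / (4 * A) * nu b) +
   K * nu b * (K' * (e / (2 * (K * K')))).
  by field; rewrite !gt_eqF.
apply: lerD; first apply: lerD.
- by apply: ler_pM; rewrite ?cabs_ge0 ?gA.
- by apply: ler_pM; rewrite ?cabs_ge0 ?fA.
- apply: ler_pM; rewrite ?cabs_ge0//; apply: (le_trans h2).
  by rewrite ler_pM2l// ltW.
Unshelve. all: by end_near. Qed.

Lemma expansionV f u l : ubound u -> ubound (fun t => (u t)^-1) ->
  (forall t, S t -> u t != 0) -> expansion f u l ->
  expansion (fun b t => (f b t)^-1) (fun t => (u t)^-1)
            (fun b t => - l b t / u t ^+ 2).
Proof.
move=> _ /ubound_pos[A A0 fA] fn0 Ef.
have [K K0 H1] := expansion_lipschitz Ef.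
have A1 : 0 < A^-1 / 2 by rewrite divr_gt0// invr_gt0.
have H2 := expansion_cvg Ef A1.
move: Ef => [[L fL] Hf]; split.
  exists (L * A ^+ 2) => b t St; rewrite -exprVn cabsM cabsN cabsX mulrAC.
  apply: ler_pM; rewrite ?cabs_ge0 ?exprn_ge0 ?cabs_ge0 ?fL//.
  by rewrite ler_pXn2r// ?nnegrE ?cabs_ge0 ?(ltW A0)// fA.
move=> e e0.
have d1 : 0 < e / (2 * A ^+ 2) by rewrite divr_gt0// mulr_gt0// exprn_gt0.
have d2 : 0 < e / (4 * (K ^+2 * A ^+ 3)) by rewrite divr_gt0// !mulr_gt0// exprn_gt0.
near=> b => t St.
have nb := nu_ge0 b.
have /(_ t St)[h1 _] : forall t, S t -> cabs (f b t - u t) <= K * nu b /\ cabs (l b t) <= K * nu b by near: b.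
have /(_ t St) h3 : forall t, S t -> cabs (f b t - u t - l b t) <= e / (2 * A ^+ 2) * nu b by near: b; exact (Hf _ d1).
have /(_ t St) h4 : forall t, S t -> cabs (f b t - u t) < A^-1 / 2 by near: b; exact H2.
have h5 : nu b < e / (4 * (K ^+2 * A ^+ 3)) by near: b; exact: nu_small.
have f00 := fn0 t St; have fAt := fA t St.
have a0 : A^-1 <= cabs (u t).
  by move: fAt; rewrite cabsV -lef_pV2 ?posrE ?invr_gt0 ?cabs_gt0// invrK.
have fb : A^-1 / 2 < cabs (f b t).
  have := cabs_lowtri (u t) (f b t); rewrite cabs_distC; lra.
have fb0 : f b t != 0 by rewrite -cabs_gt0; lra.
have -> : (f b t)^-1 - (u t)^-1 - - l b t / u t ^+ 2 =
  - ((f b t - u t - l b t) * (u t)^-1 ^+ 2) +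
  (f b t - u t) ^+ 2 * (u t)^-1 ^+ 2 * (f b t)^-1.
  by field; apply/andP.
apply: (le_trans (cabs_triangle _ _)); rewrite cabsN.
have cM2 (x y : C) : cabs (x * y ^+ 2) = cabs x * cabs y ^+ 2 by rewrite cabsM cabsX.
rewrite (cabsM (_ * _)) !cM2 (cabsX (_ - _)).
have -> : e * nu b = e / (2 * A ^+ 2) * nu b * A ^+ 2 +
  K ^+ 2 * nu b * (e / (4 * (K ^+2 * A ^+ 3))) * A ^+ 2 * (2 * A).
  by field; rewrite !gt_eqF.
have fA2 : cabs (u t)^-1 ^+ 2 <= A ^+ 2.
  by rewrite ler_pXn2r// ?nnegrE ?cabs_ge0 ?(ltW A0).
apply: lerD.
  by apply: ler_pM; rewrite ?cabs_ge0 ?exprn_ge0 ?cabs_ge0.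
apply: ler_pM; rewrite ?mulr_ge0 ?exprn_ge0 ?cabs_ge0//.
  apply: ler_pM; rewrite ?mulr_ge0 ?exprn_ge0 ?cabs_ge0//.
  apply: (@le_trans _ _ ((K * nu b) ^+ 2)).
    by rewrite ler_pXn2r// ?nnegrE ?cabs_ge0// mulr_ge0// ltW.
  rewrite exprMn -mulrA; apply: ler_wpM2l; first by rewrite exprn_ge0// ltW.
  by rewrite expr2 ler_wpM2l// ltW.
rewrite cabsV -(invrK (2 * A)) lef_pV2 ?posrE ?invr_gt0 ?mulr_gt0//; last by lra.
by rewrite invfM mulrC ltW.
Unshelve. all: by end_near. Qed.

(** Closeness of [L b] to [L0] excludes jumps by multiples of 2 pi i. For w = [L b - L0] one has exp
    w = f / u, and exp w - 1 - w = o(w) transfers the expansion of f / u to w. *)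
Lemma expansion_log f u l (L : B -> T -> C) (L0 : T -> C) :
  ubound (fun t => (u t)^-1) ->
  (forall t, S t -> cexp (L0 t) = u t) ->
  (\forall b \near F, forall t, S t -> cexp (L b t) = f b t) ->
  (forall e : R, 0 < e -> \forall b \near F, forall t, S t -> cabs (L b t - L0 t) < e) ->
  expansion f u l ->
  expansion L L0 (fun b t => l b t / u t).
Proof.
move=> /ubound_pos[A A0 fA] E0 EL cL Ef.
have [K K0 H1] := expansion_lipschitz Ef.
move: Ef => [[M fM] Hf]; split.
  exists (M * A) => b t St; rewrite cabsM mulrAC.
  by apply: ler_pM; rewrite ?cabs_ge0 ?fA ?fM.
move=> e e0.
have d1 : 0 < e / (2 * A) by rewrite divr_gt0// mulr_gt0.
(* The bound 1/2 allows absorption: |w| <= 2 |exp w - 1|. The other bound makes the quadratic error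
   half of the total. *)
pose k := Num.min (e / (4 * (A * K))) (1/2).
have k0 : 0 < k by rewrite lt_min !divr_gt0// !mulr_gt0.
have [r r0 Hr] := cexp_first_order k0.
near=> b => t St.
have nb := nu_ge0 b.
have /(_ t St)[h1 _] : forall t, S t -> cabs (f b t - u t) <= K * nu b /\ cabs (l b t) <= K * nu b by near: b.
have /(_ t St) h3 : forall t, S t -> cabs (f b t - u t - l b t) <= e / (2 * A) * nu b by near: b; exact (Hf _ d1).
have /(_ t St) h4 : forall t, S t -> cabs (L b t - L0 t) < r by near: b; exact (cL _ r0).
have /(_ t St) h5 : forall t, S t -> cexp (L b t) = f b t by near: b; exact EL.
have f00 : u t != 0 by rewrite -E0// cexp_neq0.
have := Hr _ h4; rewrite cexpB h5 E0//.
have fAt := fA t St; rewrite cabsV in fAt.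
set w := L b t - L0 t; move=> h6.
have k2 : k <= 1/2 by rewrite ge_min lexx orbT.
have ke : k <= e / (4 * (A * K)) by rewrite ge_min lexx.
have h7 : cabs (f b t / u t - 1) <= A * (K * nu b).
  have -> : f b t / u t - 1 = (u t)^-1 * (f b t - u t) by field.
  by rewrite cabsM cabsV; apply: ler_pM; rewrite ?invr_ge0 ?cabs_ge0.
have h8 : cabs w <= 2 * (A * (K * nu b)).
  have := cabs_triangle (- (f b t / u t - 1 - w)) (f b t / u t - 1).
  rewrite cabsN opprB subrK.
  have := cabs_ge0 w; nra.
have -> : w - l b t / u t = - (f b t / u t - 1 - w) + (u t)^-1 * (f b t - u t - l b t).
  by field.
apply: (le_trans (cabs_triangle _ _)); rewrite cabsN cabsM cabsV.
have -> : e * nu b = e / (4 * (A * K)) * (2 * (A * (K * nu b))) + A * (e / (2 * A) * nu b).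
  by field; rewrite !gt_eqF.
apply: lerD; last by apply: ler_pM; rewrite ?invr_ge0 ?cabs_ge0.
apply: (le_trans h6); apply: ler_pM; rewrite ?cabs_ge0//; exact: ltW.
Unshelve. all: by end_near. Qed.

End Expansion.

(** * Paths and their integrals *)

Section Paths.
Variable R : realType.
Local Notation C := R[i].
Implicit Types (h k : R -> C) (t : R).

(** Only parameters in [0, 1] are compared, so continuity at the end points is one-sided and values
    outside do not matter. *)
Definition pcont h := forall t, 0 <= t <= 1 -> forall e : R, 0 < e ->
  exists2 d : R, 0 < d & forall s, 0 <= s <= 1 -> `|s - t| < d -> cabs (h s - h t) < e.

Lemma pcontP h : pcont h <->
  {within `[0, 1]%classic, continuous (fun t => Re (h t))} /\
  {within `[0, 1]%classic, continuous (fun t => Im (h t))}.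
Proof.
split=> [ch|[cr ci]].
  split; apply/subspace_continuousP => t; rewrite /= in_itv /= => t01;
    apply/cvgrPdist_lt => e e0; have [d d0 H] := ch t t01 e e0;
    apply/nbhs_ballP; exists d => // s; rewrite /ball /= distrC => sd;
    rewrite in_itv /= => s01; rewrite distrC; apply: le_lt_trans (H s s01 sd).
    by have := Re_cabs (h s - h t); rewrite !cplxE.
  by have := Im_cabs (h s - h t); rewrite !cplxE.
move=> t t01 e e0; have e2 : 0 < e / 2 by rewrite divr_gt0.
have t01' : `[0, 1]%classic t by rewrite /= in_itv.
move/subspace_continuousP/(_ t t01')/cvgrPdist_lt/(_ _ e2)/nbhs_ballP: cr => [d /= d0 H].
move/subspace_continuousP/(_ t t01')/cvgrPdist_lt/(_ _ e2)/nbhs_ballP: ci => [d' /= d'0 H'].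
exists (Num.min d d'); first by rewrite lt_min d0.
move=> s s01; rewrite lt_min => /andP[sd sd'].
have s01' : `[0, 1]%classic s by rewrite /= in_itv.
have := H s; rewrite /ball /= distrC => /(_ sd s01') h1.
have := H' s; rewrite /ball /= distrC => /(_ sd' s01') h2.
apply: (le_lt_trans (cabs_ReIm _)); rewrite !cplxE.
by rewrite distrC in h1; rewrite distrC in h2; lra.
Qed.

Lemma pcont_ext h k : (forall t, 0 <= t <= 1 -> h t = k t) -> pcont h -> pcont k.
Proof.
move=> hk ch t t01 e e0; have [d d0 H] := ch t t01 e e0.
by exists d => // s s01 sd; rewrite -!hk//; exact: H.
Qed.

Lemma pcont_bounded h : pcont h ->
  exists2 K : R, 0 < K & forall t, 0 <= t <= 1 -> cabs (h t) <= K.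
Proof.
move=> /pcontP[cr ci].
have nc (f : R -> R) : {within `[0, 1]%classic, continuous f} ->
    exists K : R, forall t, 0 <= t <= 1 -> `|f t| <= K.
  move=> cf; have cn : {within `[0, 1]%classic, continuous (fun t => `|f t|)}.
    by move=> t; apply: cvg_norm; exact: cf.
  have [c _ H] := EVT_max (@ler01 R) cn.
  by exists `|f c| => t t01; apply: H; rewrite in_itv.
have [K HK] := nc _ cr; have [K' HK'] := nc _ ci.
exists (`|K| + `|K'| + 1); first by rewrite ltr_wpDl// addr_ge0.
move=> t t01; apply: (le_trans (cabs_ReIm _)).
have := HK t t01; have := HK' t t01; have := ler_norm K; have := ler_norm K'.
lra.
Qed.

Lemma pcont_cst (c : C) : pcont (fun=> c).
Proof. by move=> t _ e e0; exists 1 => // s _ _; rewrite subrr cabs0. Qed.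

Lemma pcontD h k : pcont h -> pcont k -> pcont (fun t => h t + k t).
Proof.
move=> ch ck t t01 e e0; have e2 : 0 < e / 2 by rewrite divr_gt0.
have [d d0 H] := ch t t01 _ e2; have [d' d'0 H'] := ck t t01 _ e2.
exists (Num.min d d'); first by rewrite lt_min d0.
move=> s s01; rewrite lt_min => /andP[sd sd'].
have -> : h s + k s - (h t + k t) = (h s - h t) + (k s - k t) by ring.
apply: (le_lt_trans (cabs_triangle _ _)).
by have := H s s01 sd; have := H' s s01 sd'; lra.
Qed.

Lemma pcontN h : pcont h -> pcont (fun t => - h t).
Proof.
move=> ch t t01 e e0; have [d d0 H] := ch t t01 e e0.
by exists d => // s s01 sd; rewrite -opprD cabsN; exact: H.
Qed.

Lemma pcontM h k : pcont h -> pcont k -> pcont (fun t => h t * k t).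
Proof.
move=> ch ck; have [A A0 hA] := pcont_bounded ch; have [B B0 kB] := pcont_bounded ck.
move=> t t01 e e0.
have eA : 0 < e / (2 * A) by rewrite divr_gt0// mulr_gt0.
have eB : 0 < e / (2 * B) by rewrite divr_gt0// mulr_gt0.
have [d d0 H] := ch t t01 _ eB; have [d' d'0 H'] := ck t t01 _ eA.
exists (Num.min d d'); first by rewrite lt_min d0.
move=> s s01; rewrite lt_min => /andP[sd sd'].
have -> : h s * k s - (h t * k t) = (h s - h t) * k s + h t * (k s - k t) by ring.
apply: (le_lt_trans (cabs_triangle _ _)); rewrite !cabsM.
have -> : e = e / (2 * B) * B + A * (e / (2 * A)) by field; rewrite !gt_eqF.
apply: ltr_leD.
  apply: (@le_lt_trans _ _ (cabs (h s - h t) * B)).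
    by rewrite ler_wpM2l ?cabs_ge0 ?kB.
  by rewrite ltr_pM2r// H.
by apply: ler_pM; rewrite ?cabs_ge0 ?hA// ltW// H'.
Qed.

Lemma pcontX h n : pcont h -> pcont (fun t => h t ^+ n).
Proof.
move=> ch; elim: n => [|n IH]; first exact: pcont_cst.
by apply: (@pcont_ext (fun t => h t * h t ^+ n)); [move=> t _; rewrite exprS|exact: pcontM].
Qed.

Lemma pcont_sum (I : Type) (r : seq I) (P : pred I) (F : I -> R -> C) :
  (forall i, P i -> pcont (F i)) -> pcont (fun t => \sum_(i <- r | P i) F i t).
Proof.
move=> cF; elim: r => [|i r IH].
  by apply: (pcont_ext _ (pcont_cst 0)) => t _; rewrite big_nil.
case Pi: (P i).
  by apply: (pcont_ext _ (pcontD (cF i Pi) IH)) => t _; rewrite big_cons Pi.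
by apply: (pcont_ext _ IH) => t _; rewrite big_cons Pi.
Qed.

Lemma pcont_lower h : pcont h -> (forall t, 0 <= t <= 1 -> h t != 0) ->
  exists2 K : R, 0 < K & forall t, 0 <= t <= 1 -> K <= cabs (h t).
Proof.
move=> ch h0.
have cn : {within `[0, 1]%classic, continuous (fun t => cabs (h t))}.
  apply/subspace_continuousP => t; rewrite /= in_itv /= => t01.
  apply/cvgrPdist_lt => e e0; have [d d0 H] := ch t t01 e e0.
  apply/nbhs_ballP; exists d => // s; rewrite /ball /= distrC => sd.
  rewrite in_itv /= => s01; apply: le_lt_trans (H s s01 sd).
  by rewrite distrC; exact: cabs_continuous_at.
have [c c01 H] := EVT_min (@ler01 R) cn.
rewrite in_itv /= in c01; exists (cabs (h c)); first by rewrite cabs_gt0 h0.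
by move=> t t01; apply: H; rewrite in_itv.
Qed.

Lemma pcontV h : pcont h -> (forall t, 0 <= t <= 1 -> h t != 0) ->
  pcont (fun t => (h t)^-1).
Proof.
move=> ch h0; have [K K0 hK] := pcont_lower ch h0 => t t01 e e0.
have eK : 0 < e * K ^+ 2 by rewrite mulr_gt0// exprn_gt0.
have [d d0 H] := ch t t01 _ eK; exists d => // s s01 sd.
have hs := h0 s s01; have ht := h0 t t01.
have -> : (h s)^-1 - (h t)^-1 = - (h s - h t) / (h s * h t).
  by field; apply/andP.
rewrite cabsM cabsN cabsV cabsM ltr_pdivrMr; last by rewrite mulr_gt0 ?cabs_gt0.
apply: (lt_le_trans (H s s01 sd)); rewrite expr2.
by rewrite ler_pM2l//; apply: ler_pM; rewrite ?hK// ltW.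
Qed.

Definition cder h t (d : C) := forall e : R, 0 < e ->
  exists2 r : R, 0 < r & forall s, `|s - t| < r ->
    cabs (h s - h t - (s - t)%:C * d) <= e * `|s - t|.

(** With a one-point parameter set a derivative is an expansion, so the rules for products, inverses
    and logarithms are inherited. *)
Lemma cder_expansion h t d : cder h t d <->
  expansion (nbhs t) (fun s => `|s - t|) [set: unit] (fun s _ => h s) (fun _ => h t)
    (fun s _ => (s - t)%:C * d).
Proof.
split=> [H|[_ H]].
  split; first by exists (cabs d) => s _ _; rewrite cabsM cabsR mulrC.
  move=> e e0; have [r r0 {}H] := H e e0.
  by apply/nbhs_ballP; exists r => // s; rewrite /ball /= distrC => sr _ _; exact: H.
move=> e e0; have /nbhs_ballP[r /= r0 {}H] := H e e0; exists r => // s sr.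
by apply: (H s _ tt I); rewrite /ball /= distrC.
Qed.

Let expansion_cder h t d f u l : (forall s, f s tt = h s) -> u tt = h t ->
  (forall s, l s tt = (s - t)%:C * d) ->
  expansion (nbhs t) (fun s => `|s - t|) [set: unit] f u l -> cder h t d.
Proof.
move=> fh uh lh [_ H] e e0; have /nbhs_ballP[r /= r0 {}H] := H e e0.
exists r => // s sr; rewrite -fh -uh -lh.
by apply: (H s _ tt I); rewrite /ball /= distrC.
Qed.

Lemma cder_ext h k t d : (\forall s \near t, h s = k s) -> cder h t d -> cder k t d.
Proof.
move=> hk H e e0; have ht : h t = k t := nbhs_singleton hk.
move: hk => /nbhs_ballP[r /= r0 hk]; have [r' r'0 {}H] := H e e0.
exists (Num.min r r'); first by rewrite lt_min r0.
move=> s; rewrite lt_min => /andP[sr sr']; rewrite -ht -hk; first exact: H.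
by rewrite /ball /= distrC.
Qed.

Let nu0 t : forall s, 0 <= `|s - t|. Proof. by []. Qed.
Let nus t : forall e : R, 0 < e -> \forall s \near t, `|s - t| < e.
Proof.
by move=> e e0; apply/nbhs_ballP; exists e => // s; rewrite /ball /= distrC.
Qed.
Let ub1 (c : C) : ubound [set: unit] (fun=> c).
Proof. by exists (cabs c). Qed.

Lemma cder_cst (c : C) t : cder (fun=> c) t 0.
Proof.
move=> e e0; exists 1 => // s _; rewrite mulr0 subr0 subrr cabs0.
by apply: mulr_ge0 => //; exact: ltW.
Qed.

Lemma cderD h k t d d' : cder h t d -> cder k t d' -> cder (fun s => h s + k s) t (d + d').
Proof.
move=> /cder_expansion H /cder_expansion H'.
by apply: expansion_cder (expansionD H H') => // s; rewrite mulrDr.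
Qed.

Lemma cderM h k t d d' : cder h t d -> cder k t d' ->
  cder (fun s => h s * k s) t (h t * d' + d * k t).
Proof.
move=> /cder_expansion H /cder_expansion H'.
apply: expansion_cder (expansionM (FF := nbhs_filter t) (@nu0 t) (@nus t) (ub1 _) (ub1 _) H H') => // s.
by ring.
Qed.

Lemma cderZ h t d (c : C) : cder h t d -> cder (fun s => c * h s) t (c * d).
Proof.
by move=> H; have := cderM (cder_cst c t) H; rewrite mul0r addr0.
Qed.

Lemma cderN h t d : cder h t d -> cder (fun s => - h s) t (- d).
Proof.
move=> H e e0; have [r r0 {}H] := H e e0; exists r => // s sr.
by rewrite mulrN -!opprD cabsN; exact: H.
Qed.

Lemma cderV h t d : h t != 0 -> cder h t d -> cder (fun s => (h s)^-1) t (- d / h t ^+ 2).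
Proof.
move=> h0 /cder_expansion H.
apply: expansion_cder (expansionV (FF := nbhs_filter t) (@nu0 t) (@nus t) (ub1 _) (ub1 _) (fun _ _ => h0) H) => // s.
by rewrite mulrA mulrN.
Qed.

Lemma cderX h t d n : cder h t d -> cder (fun s => h s ^+ n.+1) t (n.+1%:R * h t ^+ n * d).
Proof.
move=> H; elim: n => [|n IH]; first by rewrite expr0 !mul1r.
have E : (fun s => h s ^+ n.+2) = (fun s => h s * h s ^+ n.+1).
  by apply/funext => s; rewrite exprS.
have := cderM H IH; rewrite -E; congr cder.
by rewrite -[n.+2%:R]natr1 exprS; ring.
Qed.

Lemma cder_log h L t d : (\forall s \near t, cexp (L s) = h s) ->
  (forall e : R, 0 < e -> \forall s \near t, cabs (L s - L t) < e) ->
  cder h t d -> cder L t (d / h t).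
Proof.
move=> E cL; have E0 : cexp (L t) = h t by exact: (nbhs_singleton E).
move=> /cder_expansion H.
have E1 : \forall s \near t, forall u : unit, [set: unit] u -> cexp (L s) = h s.
  by apply: filterS E => s Es _ _.
have cL1 : forall e : R, 0 < e -> \forall s \near t, forall u : unit, [set: unit] u ->
    cabs (L s - L t) < e by move=> e e0; apply: filterS (cL e e0) => s Es _ _.
apply: expansion_cder (expansion_log (FF := nbhs_filter t) (L := fun s _ => L s) (L0 := fun=> L t) (u := fun=> h t) (@nu0 t) (ub1 _) (fun _ _ => E0) E1 cL1 H) => // s.
by rewrite mulrA.
Qed.

Lemma cder_is_derive h t d : cder h t d ->
  is_derive t 1 (fun s => Re (h s)) (Re d) /\ is_derive t 1 (fun s => Im (h s)) (Im d).
Proof.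
move=> H; split; apply/is_derive_eps => e e0; have [r r0 {}H] := H e e0;
  exists r => // s /H; apply: le_trans.
- have := Re_cabs (h s - h t - (s - t)%:C * d).
  by rewrite !cplxE /= mul0r subr0.
- have := Im_cabs (h s - h t - (s - t)%:C * d).
  by rewrite !cplxE /= mul0r addr0.
Qed.

Lemma is_derive_cder h t d : is_derive t 1 (fun s => Re (h s)) (Re d) ->
  is_derive t 1 (fun s => Im (h s)) (Im d) -> cder h t d.
Proof.
move=> /is_derive_eps Hr /is_derive_eps Hi e e0.
have e2 : 0 < e / 2 by rewrite divr_gt0.
have [r r0 {}Hr] := Hr _ e2; have [r' r'0 {}Hi] := Hi _ e2.
exists (Num.min r r'); first by rewrite lt_min r0.
move=> s; rewrite lt_min => /andP[/Hr h1 /Hi h2].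
apply: (le_trans (cabs_ReIm _)); rewrite !cplxE /= !mul0r subr0 addr0; lra.
Qed.

Lemma cder_cont h t d (e : R) : cder h t d -> 0 < e ->
  exists2 r : R, 0 < r & forall s, `|s - t| < r -> cabs (h s - h t) < e.
Proof.
move=> /cder_expansion H e0; have := expansion_cvg (FF := nbhs_filter t) (@nu0 t) (@nus t) H e0.
move=> /nbhs_ballP[r /= r0 {}H].
by exists r => // s sr; apply: (H s _ tt I); rewrite /ball /= distrC.
Qed.

Lemma cder_pcont h (h' : R -> C) : (forall t, 0 <= t <= 1 -> cder h t (h' t)) -> pcont h.
Proof.
move=> H t t01 e e0; have [r r0 {}H] := cder_cont (H t t01) e0.
by exists r => // s _; exact: H.
Qed.

Local Notation mu := (@lebesgue_measure R).

Lemma pcont_integrable h : pcont h ->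
  mu.-integrable `[0, 1]%classic (EFin \o (fun t => Re (h t))) /\
  mu.-integrable `[0, 1]%classic (EFin \o (fun t => Im (h t))).
Proof.
move=> /pcontP[cr ci].
by split; apply: continuous_compact_integrable => //; exact: segment_compact.
Qed.

Lemma cint_ext h k : (forall t, 0 <= t <= 1 -> h t = k t) -> cint h = cint k.
Proof.
move=> hk; rewrite /cint; congr (_ +i* _); apply: eq_Rintegral => t;
  by rewrite inE /= in_itv /= => /hk ->.
Qed.

Lemma cintD h k : pcont h -> pcont k -> cint (fun t => h t + k t) = cint h + cint k.
Proof.
move=> /pcont_integrable[hr hi] /pcont_integrable[kr ki]; rewrite /cint.
apply: cplx_eq; rewrite !cplxE /=.
  by rewrite -RintegralD//; apply: eq_Rintegral => t _; rewrite ReD.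
by rewrite -RintegralD//; apply: eq_Rintegral => t _; rewrite ImD.
Qed.

Lemma cintZ (c : C) h : pcont h -> cint (fun t => c * h t) = c * cint h.
Proof.
move=> ch; have [hr hi] := pcont_integrable ch; rewrite /cint.
have I1 (a : R) : mu.-integrable `[0, 1]%classic (EFin \o (fun t => a * Re (h t))) /\
    mu.-integrable `[0, 1]%classic (EFin \o (fun t => a * Im (h t))).
  have := pcont_integrable (pcontM (pcont_cst a%:C) ch).
  rewrite (_ : (fun t => Re (_ * h t)) = fun t => a * Re (h t)); last first.
    by apply/funext => t; case: (h t) => x y; rewrite /= mul0r subr0.
  rewrite (_ : (fun t => Im (_ * h t)) = fun t => a * Im (h t))//.
  by apply/funext => t; case: (h t) => x y; rewrite /= mul0r addr0.
have I2 a := (I1 a).2; have {}I1 a := (I1 a).1.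
apply: cplx_eq; rewrite !cplxE /=.
  rewrite -!RintegralZl// -RintegralB//.
  by apply: eq_Rintegral => t _; rewrite /= cplxE.
rewrite -!RintegralZl// -RintegralD//.
by apply: eq_Rintegral => t _; rewrite /= cplxE.
Qed.

Lemma cintB h k : pcont h -> pcont k -> cint (fun t => h t - k t) = cint h - cint k.
Proof.
move=> ch ck; rewrite -[- cint k]mulN1r -cintZ// -cintD//.
  by apply: cint_ext => t _; rewrite mulN1r.
by apply: pcontM => //; exact: pcont_cst.
Qed.

Lemma cint0 : cint (fun=> 0 : C) = 0.
Proof.
rewrite -[RHS](mul0r (cint (fun=> 0))) -cintZ; last exact: pcont_cst.
by apply: cint_ext => t _; rewrite mul0r.
Qed.

Lemma cint_sum (I : Type) (r : seq I) (P : pred I) (F : I -> R -> C) :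
  (forall i, P i -> pcont (F i)) ->
  cint (fun t => \sum_(i <- r | P i) F i t) = \sum_(i <- r | P i) cint (F i).
Proof.
move=> cF; elim: r => [|i r IH].
  by rewrite big_nil -[RHS]cint0; apply: cint_ext => t _; rewrite big_nil.
rewrite big_cons; case Pi: (P i).
  rewrite -IH -cintD; [|exact: cF|exact: pcont_sum].
  by apply: cint_ext => t _; rewrite big_cons Pi.
by rewrite -IH; apply: cint_ext => t _; rewrite big_cons Pi.
Qed.

(** The factor 2 comes from bounding the real and the imaginary part separately. *)
Lemma cint_bound h (K : R) : pcont h -> (forall t, 0 <= t <= 1 -> cabs (h t) <= K) ->
  cabs (cint h) <= 2 * K.
Proof.
move=> /pcont_integrable[hr hi] hK.
have cstK : mu.-integrable `[0, 1]%classic (EFin \o (fun=> K)).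
  by have [] := pcont_integrable (pcont_cst K%:C).
have IK : \int[mu]_(t in `[0, 1]) K = K.
  have -> := Rintegral_cst mu (measurable_itv `[0, 1]) K.
  rewrite -[RHS]mulr1; congr (_ * _).
  apply: (etrans (congr1 fine (lebesgue_measure_itv `[0%R, 1%R]))).
  by rewrite /= lte_fin ltr01 oppr0 adde0.
have B (f : R -> R) : mu.-integrable `[0, 1]%classic (EFin \o f) ->
    (forall t, 0 <= t <= 1 -> `|f t| <= K) -> `|\int[mu]_(t in `[0, 1]) f t| <= K.
  move=> fi fK; apply: (le_trans (le_normr_Rintegral _ fi)) => //.
  rewrite -[leRHS]IK; apply: le_Rintegral => //; first exact: integrable_norm fi.
apply: (le_trans (cabs_ReIm _)); rewrite mulr_natl mulr2n lerD//=; apply: B => // t t01.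
  by apply: (le_trans (Re_cabs _)); exact: hK.
by apply: (le_trans (Im_cabs _)); exact: hK.
Qed.

Lemma cint_FTC h (h' : R -> C) : pcont h -> pcont h' ->
  (forall t, 0 < t < 1 -> cder h t (h' t)) -> cint h' = h 1 - h 0.
Proof.
move=> /pcontP[cr ci] /pcontP[cr' ci'] H.
have key (f f' : R -> R) : {within `[0, 1]%classic, continuous f} ->
    {within `[0, 1]%classic, continuous f'} ->
    (forall t, 0 < t < 1 -> is_derive t 1 f (f' t)) ->
    \int[mu]_(t in `[0, 1]) f' t = f 1 - f 0.
  move=> cf cf' ff'; have [_ f0 f1] := (continuous_within_itvP f (@ltr01 R)).1 cf.
  rewrite /Rintegral (@continuous_FTC2 _ _ f _ _ ltr01 cf')//.
    by split => // t; rewrite in_itv /= => /ff' [].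
  by move=> t; rewrite in_itv /= => /ff' fd; rewrite derive1E derive_val.
have HH t : 0 < t < 1 -> _ := fun t01 => cder_is_derive (H t t01).
apply: cplx_eq; rewrite !cplxE /=.
  by apply: (key (fun t => Re (h t)) (fun t => Re (h' t))) => // t /HH[].
by apply: (key (fun t => Im (h t)) (fun t => Im (h' t))) => // t /HH[].
Qed.

Lemma C1_cder g : C1_curve g -> forall t, cder g t (curve_deriv g t).
Proof.
move=> [dr di _ _] t; apply: is_derive_cder; rewrite /curve_deriv /=.
  by apply: DeriveDef; [exact: dr|rewrite derive1E].
by apply: DeriveDef; [exact: di|rewrite derive1E].
Qed.

Lemma cder_curve_deriv h t d : cder h t d -> curve_deriv h t = d.
Proof.
move=> /cder_is_derive[[_ r] [_ i]]; rewrite /curve_deriv !derive1E r i.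
by case: d {r i}.
Qed.

Lemma C1_pcont g : C1_curve g -> pcont g /\ pcont (curve_deriv g).
Proof.
move=> Cg; split; first by apply: (cder_pcont (h' := curve_deriv g)) => t _; exact: C1_cder.
case: Cg => _ _ cr ci; apply/pcontP; split => /=; exact: continuous_subspaceT.
Qed.

End Paths.

(** * Families depending on several complex variables *)

Section Several.
Variables (R : realType) (N : nat).
Local Notation C := R[i].
Implicit Types (a b v : 'rV[C]_N).

(** The real-valued l^1 norm; [vabs_norm] and [norm_vabs] compare it with the maximum norm of row
    vectors. *)
Definition vabs v : R := \sum_k cabs (v 0 k).

Lemma vabs_ge0 v : 0 <= vabs v.
Proof. by apply: sumr_ge0 => k _; exact: cabs_ge0. Qed.

Lemma vabs_entry v k : cabs (v 0 k) <= vabs v.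
Proof.
by rewrite /vabs (bigD1 k)//= lerDl; apply: sumr_ge0 => i _; exact: cabs_ge0.
Qed.

Lemma vabs0 : vabs 0 = 0.
Proof. by rewrite /vabs big1// => k _; rewrite mxE cabs0. Qed.

Lemma vabsD u v : vabs (u + v) <= vabs u + vabs v.
Proof.
by rewrite /vabs -big_split; apply: ler_sum => k _; rewrite mxE cabs_triangle.
Qed.

Lemma vabsZ (c : C) v : vabs (c *: v) = cabs c * vabs v.
Proof. by rewrite /vabs mulr_sumr; apply: eq_bigr => k _; rewrite mxE cabsM. Qed.

Lemma nbhs_vabs a (P : 'rV[C]_N -> Prop) :
  (\forall b \near a, P b) <->
  exists2 d : R, 0 < d & forall b, vabs (b - a) < d -> P b.
Proof.
split.
  move=> /nbhs_ballP[e e0 H]; have [d d0 ed] := posc_real e0.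
  exists d => // b bd; apply: H; split=> // i j; rewrite ord1 ed.
  rewrite /ball /= distrC normr_ltc; apply: le_lt_trans bd.
  by have := vabs_entry (b - a) j; rewrite !mxE.
move=> [d d0 H]; apply/nbhs_ballP.
have d1 : 0 < d / N.+1%:R by rewrite divr_gt0.
exists (d / N.+1%:R)%:C; first by rewrite /= ltcR.
move=> b [_ ab]; apply: H; apply: (@le_lt_trans _ _ (N%:R * (d / N.+1%:R))).
  rewrite /vabs (le_trans (y := \sum_(k < N) (d / N.+1%:R)))//.
    apply: ler_sum => k _; apply: ltW.
    by have := ab 0 k; rewrite /ball /= distrC normr_ltc !mxE.
  by rewrite sumr_const card_ord mulr_natl.
rewrite mulrCA -[ltRHS]mulr1 ltr_pM2l// ltr_pdivrMr// mul1r ltr_nat.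
exact: ltnSn.
Qed.

Lemma vabs_norm v : `|v| <= (vabs v)%:C.
Proof.
rewrite {1}/Num.norm /=; have [->|] := eqVneq (mx_norm v) 0.
  by rewrite lecR vabs_ge0.
move=> /mx_norm_neq0[[i j] ->] /=; rewrite ord1 normcabs lecR.
exact: vabs_entry.
Qed.

Lemma norm_vabs v : (vabs v)%:C <= N%:R * `|v|.
Proof.
have H k : (cabs (v 0 k))%:C <= `|v|.
  rewrite -normcabs [leRHS]/Num.norm /= mx_normE -[leLHS]nngE num_le.
  exact: (le_bigmax _ (fun i : 'I_1 * 'I_N => `|v i.1 i.2|%:nng) (0, k)).
rewrite /vabs rmorph_sum /= (le_trans (y := \sum_(k < N) `|v|))//.
  exact: ler_sum.
by rewrite sumr_const card_ord mulr_natl.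
Qed.

(* The expansion at [a] of a family of functions of [a], uniform in the curve
   parameter. *)
Definition ud (h : 'rV[C]_N -> R -> C) a (c : 'I_N -> R -> C) :=
  expansion (nbhs a) (fun b => vabs (b - a)) [set t | 0 <= t <= 1] h (h a)
    (fun b t => \sum_k (b - a) 0 k * c k t).

Let nu0 a : forall b, 0 <= vabs (b - a). Proof. by move=> b; exact: vabs_ge0. Qed.
Let nus a : forall e : R, 0 < e -> \forall b \near a, vabs (b - a) < e.
Proof. by move=> e e0; apply/nbhs_vabs; exists e. Qed.

Lemma ubound_pcont (h : R -> C) : pcont h -> ubound [set t | 0 <= t <= 1] h.
Proof. by move=> /pcont_bounded[K _ H]; exists K. Qed.

Lemma udP h a c : (forall k, pcont (c k)) ->
  ud h a c <-> forall e : R, 0 < e -> exists2 d : R, 0 < d & forall b, vabs (b - a) < d ->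
    forall t, 0 <= t <= 1 -> cabs (h b t - h a t - \sum_k (b - a) 0 k * c k t) <= e * vabs (b - a).
Proof.
move=> cc; split=> [[_ H] e /H|H]; first by move=> /nbhs_vabs.
split; last by move=> e /H ?; apply/nbhs_vabs.
have /(_ _)/cid2 K k := pcont_bounded (cc k).
exists (\sum_k s2val (K k)) => b t t01; apply: (le_trans (cabs_sum _ _ _)).
rewrite mulr_suml; apply: ler_sum => k _; rewrite cabsM mulrC.
apply: ler_pM; rewrite ?cabs_ge0 ?vabs_entry//.
by case: (K k) => /= K' _; apply.
Qed.

Lemma ud_ext h h' a c c' : (\forall b \near a, forall t, 0 <= t <= 1 -> h b t = h' b t) ->
  (forall k t, 0 <= t <= 1 -> c k t = c' k t) ->
  ud h a c -> ud h' a c'.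
Proof.
move=> hh cc; apply: (@expansion_ext _ _ _ (nbhs_filter a)) => //.
  by move=> t t01; apply: (nbhs_singleton hh).
by move=> b t t01; apply: eq_bigr => k _; rewrite cc.
Qed.

Lemma ud_eq h h' a c c' : (forall b t, h b t = h' b t) -> (forall k t, c k t = c' k t) ->
  ud h a c -> ud h' a c'.
Proof. by move=> hh cc; apply: ud_ext => //; apply/nbhs_vabs; exists 1 => // b _ t _; exact: hh. Qed.

Lemma ud_cst h a : ud (fun=> h) a (fun _ _ => 0).
Proof.
have := @expansion_cst _ _ _ (nbhs_filter a) _ (@nu0 a) _ [set t | 0 <= t <= 1] h.
apply: (@expansion_ext _ _ _ (nbhs_filter a)) => //; first exact: nearW.
by move=> b t _; rewrite big1// => k _; rewrite mulr0.
Qed.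

Lemma ud_linear (w : 'I_N -> C) a :
  ud (fun b _ => \sum_k b 0 k * w k) a (fun k _ => w k).
Proof.
apply/udP; first by move=> k; exact: pcont_cst.
move=> e e0; exists 1 => // b _ t _.
rewrite -sumrB -sumrB big1 ?cabs0 ?mulr_ge0 ?vabs_ge0 ?ltW// => k _.
by rewrite !mxE; ring.
Qed.

Lemma udD h h' a c c' : ud h a c -> ud h' a c' ->
  ud (fun b t => h b t + h' b t) a (fun k t => c k t + c' k t).
Proof.
move=> H H'; have := @expansionD _ _ _ (nbhs_filter a) _ _ _ _ _ _ _ _ _ H H'.
apply: (@expansion_ext _ _ _ (nbhs_filter a)) => //; first exact: nearW.
by move=> b t _; rewrite -big_split; apply: eq_bigr => k _; rewrite mulrDr.
Qed.

Lemma udM h h' a c c' : pcont (h a) -> pcont (h' a) -> ud h a c -> ud h' a c' ->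
  ud (fun b t => h b t * h' b t) a (fun k t => h a t * c' k t + c k t * h' a t).
Proof.
move=> ch ch' H H'.
have := @expansionM _ _ _ (nbhs_filter a) _ (@nu0 a) (@nus a) _ _ _ _ _ _ _ _
  (ubound_pcont ch) (ubound_pcont ch') H H'.
apply: (@expansion_ext _ _ _ (nbhs_filter a)) => //; first exact: nearW.
move=> b t _; rewrite mulr_sumr mulr_suml -big_split.
by apply: eq_bigr => k _ /=; ring.
Qed.

Lemma udV h a c : pcont (h a) -> (forall t, 0 <= t <= 1 -> h a t != 0) -> ud h a c ->
  ud (fun b t => (h b t)^-1) a (fun k t => - c k t / h a t ^+ 2).
Proof.
move=> ch h0 H.
have := @expansionV _ _ _ (nbhs_filter a) _ (@nu0 a) (@nus a) _ _ _ _ _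
  (ubound_pcont ch) (ubound_pcont (pcontV ch h0)) h0 H.
apply: (@expansion_ext _ _ _ (nbhs_filter a)) => //; first exact: nearW.
move=> b t _; rewrite -sumrN mulr_suml.
by apply: eq_bigr => k _ /=; ring.
Qed.

Lemma ud_log h L a c : pcont (h a) ->
  (\forall b \near a, forall t, 0 <= t <= 1 -> cexp (L b t) = h b t) ->
  (forall e : R, 0 < e -> \forall b \near a, forall t, 0 <= t <= 1 -> cabs (L b t - L a t) < e) ->
  ud h a c -> ud L a (fun k t => c k t / h a t).
Proof.
move=> ch E cL H; have E0 : forall t, 0 <= t <= 1 -> cexp (L a t) = h a t := nbhs_singleton E.
have h0 t : 0 <= t <= 1 -> h a t != 0 by move=> /E0 <-; exact: cexp_neq0.
have := @expansion_log _ _ _ (nbhs_filter a) _ (@nu0 a) _ _ _ _ _ _ _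
  (ubound_pcont (pcontV ch h0)) E0 E cL H.
apply: (@expansion_ext _ _ _ (nbhs_filter a)) => //; first exact: nearW.
by move=> b t _; rewrite mulr_suml; apply: eq_bigr => k _ /=; rewrite mulrA.
Qed.

Lemma ud_cint h a c : (\forall b \near a, pcont (h b)) -> (forall k, pcont (c k)) ->
  ud h a c -> ud (fun b _ => cint (h b)) a (fun k _ => cint (c k)).
Proof.
move=> ch cc /udP-/(_ cc) H; apply/udP; first by move=> k; exact: pcont_cst.
move=> e e0; have e2 : 0 < e / 2 by rewrite divr_gt0.
have [d d0 {}H] := H _ e2; have ca := nbhs_singleton ch.
have [d' d'0 {}ch] := (nbhs_vabs _ _).1 ch.
exists (Num.min d d'); first by rewrite lt_min d0.
move=> b; rewrite lt_min => /andP[bd bd'] _ _.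
pose S t := \sum_k (b - a) 0 k * c k t.
have cS : pcont S by apply: pcont_sum => k _; apply: pcontM => //; exact: pcont_cst.
have -> : cint (h b) - cint (h a) - \sum_k (b - a) 0 k * cint (c k) =
   cint (fun t => h b t + (-1 * h a t + -1 * S t)).
  rewrite cintD; [|exact: ch|by apply: pcontD; apply: pcontM => //; exact: pcont_cst].
  rewrite cintD; [|by apply: pcontM => //; exact: pcont_cst..].
  rewrite !cintZ// !mulN1r addrA; congr (_ - _); rewrite cint_sum.
    by apply: eq_bigr => k _; rewrite cintZ.
  by move=> k _; apply: pcontM => //; exact: pcont_cst.
have -> : e * vabs (b - a) = 2 * (e / 2 * vabs (b - a)) by field.
apply: cint_bound.
  apply: pcontD; first exact: ch.
  by apply: pcontD; apply: pcontM => //; exact: pcont_cst.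
by move=> t t01; have := H b bd t t01; rewrite !mulN1r addrA.
Qed.

Definition lincomb (c : 'I_N -> C) v : C := \sum_k v 0 k * c k.

Lemma lincomb_is_linear c : linear (lincomb c).
Proof.
move=> x u v; rewrite /lincomb scaler_sumr -big_split; apply: eq_bigr => k _.
by rewrite !mxE /= mulrDl -mulrA.
Qed.
HB.instance Definition _ c := GRing.isLinear.Build _ _ _ _ (lincomb c) (lincomb_is_linear c).

Lemma lincomb_bound c v : cabs (lincomb c v) <= (\sum_k cabs (c k)) * vabs v.
Proof.
apply: (le_trans (cabs_sum _ _ _)); rewrite mulr_suml; apply: ler_sum => k _.
by rewrite cabsM mulrC ler_wpM2l ?cabs_ge0 ?vabs_entry.
Qed.

Lemma lincomb_continuous c : continuous (lincomb c).
Proof.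
move=> a; apply/(@cvgrPdist_le _ _ _ _ (nbhs_filter a)) => e e0; have [r r0 ->] := posc_real e0.
have [K0 K1] : 0 < \sum_k cabs (c k) + 1 /\ \sum_k cabs (c k) < \sum_k cabs (c k) + 1.
  by split; [rewrite ltr_wpDl// sumr_ge0// => k _; exact: cabs_ge0|lra].
set K := \sum_k cabs (c k) in K0 K1.
apply/nbhs_vabs; exists (r / (K + 1)); first by rewrite divr_gt0.
move=> b ab; rewrite distrC -linearB normcabs lecR.
apply: (le_trans (lincomb_bound _ _)); rewrite -/K.
have := vabs_ge0 (b - a); move: ab; rewrite ltr_pdivlMr//; nra.
Qed.

Lemma ud_differentiable (f : 'rV[C]_N -> C) a (c : 'I_N -> C) :
  ud (fun b _ => f b) a (fun k _ => c k) ->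
  differentiable f a /\ forall v, 'D_v f a = lincomb c v.
Proof.
move=> /(udP _ _ (fun k => pcont_cst (c k))) H.
have LO (e : C) : 0 < e -> \forall v \near (0 : 'rV[C]_N),
    `|f (v + a) - (f a + lincomb c v)| <= e * `|v|.
  move=> e0; have [r r0 ->] := posc_real e0.
  (* [vabs] may exceed the maximum norm by a factor up to N, which is divided out in advance. *)
  have rN : 0 < r / N.+1%:R by rewrite divr_gt0.
  have [d d0 {}H] := H _ rN; apply/nbhs_vabs; exists d => // v; rewrite subr0 => vd.
  have := H (v + a); rewrite addrK => /(_ vd 0); rewrite lexx ler01 => /(_ erefl) h.
  rewrite opprD addrA normcabs (le_trans (y := (r / N.+1%:R * vabs v)%:C)) ?lecR//.
  rewrite rmorphM /=; apply: (@le_trans _ _ ((r / N.+1%:R)%:C * (N%:R * `|v|))).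
    by apply: ler_wpM2l; [rewrite lecR ltW|exact: norm_vabs].
  rewrite mulrA; apply: ler_wpM2r => //.
  rewrite -[N%:R](rmorph_nat (real_complex R)) -rmorphM lecR.
  by rewrite -mulrA ger_pMr// mulrC ler_pdivrMr// mul1r ler_nat.
pose dl : {linear 'rV[C]_N -> C} := lincomb c.
have D : 'd f a = dl :> (_ -> _).
  apply: diff_unique; first exact: lincomb_continuous.
  by apply/eqaddoP => e e0; apply: filterS (LO e e0).
have df : differentiable f a.
  apply/diff_locallyP; rewrite D; split; first exact: lincomb_continuous.
  by apply/eqaddoP => e e0; apply: filterS (LO e e0).
by split=> // v; rewrite deriveE// D.
Qed.

Lemma differentiable_ud (f : 'rV[C]_N -> C) a : differentiable f a ->
  ud (fun b _ => f b) a (fun k _ => 'D_(delta_mx 0 k) f a).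
Proof.
move=> df; apply/udP; first by move=> k; exact: pcont_cst.
move=> e e0; have ec : 0 < e%:C by rewrite ltcR.
have /eqaddoP/(_ _ ec)/nbhs_vabs[d d0 H] := diff_locally df.
exists d => // b bd t _; have := H (b - a); rewrite subr0 => /(_ bd).
have -> : (f \o shift a - (cst (f a) + 'd f a)) (b - a) =
    f b - f a - \sum_k (b - a) 0 k * 'D_(delta_mx 0 k) f a.
  rewrite !fctE /= subrK opprD addrA; congr (_ - _).
  rewrite {1}(row_sum_delta (b - a)) linear_sum; apply: eq_bigr => k _.
  by rewrite linearZ deriveE.
move=> h; rewrite -lecR -normcabs (le_trans h)// rmorphM; apply: ler_wpM2l; [exact: ltW|exact: vabs_norm].
Qed.

End Several.

Lemma addDBK (V : zmodType) (a x y : V) : a + x + y - a = x + y.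
Proof. by rewrite -(addrA a) [a + _]addrC addrK. Qed.

(** * Repeated differentiability and calculus in several complex variables *)

Section Smooth.
Variables (R : realType) (N : nat).
Local Notation C := R[i].
Local Notation V := 'rV[C]_N.
Implicit Types (a b v : V) (U : set V) (h : V -> R -> C).

(* n-fold differentiability in [a], uniformly in the curve parameter. *)
Fixpoint smooth (n : nat) U h {struct n} : Prop :=
  (forall a, U a -> pcont (h a)) /\
  match n with
  | 0%N => True
  | n'.+1 => exists d : 'I_N -> V -> R -> C,
     (forall a, U a -> ud h a (fun k => d k a)) /\ forall k, smooth n' U (d k)
  end.

Lemma smoothSE n U h : smooth n.+1 U h <->
  (forall a, U a -> pcont (h a)) /\
  exists d : 'I_N -> V -> R -> C,
    (forall a, U a -> ud h a (fun k => d k a)) /\ forall k, smooth n U (d k).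
Proof. by []. Qed.

Lemma smooth_pcont n U h a : smooth n U h -> U a -> pcont (h a).
Proof. by case: n => [|n] [H _] /H. Qed.

Lemma smoothS n U h : smooth n.+1 U h -> smooth n U h.
Proof.
elim: n h => [|n IH] h; first by move=> [ch _]; split.
move=> /smoothSE[ch [d [hd dd]]]; apply/smoothSE; split=> //.
by exists d; split=> // k; apply: IH.
Qed.

Lemma smooth_subset n U U' h : U' `<=` U -> smooth n U h -> smooth n U' h.
Proof.
move=> UU; elim: n h => [|n IH] h.
  by move=> [ch _]; split=> // a /UU; exact: ch.
move=> /smoothSE[ch [d [hd dd]]]; apply/smoothSE; split; first by move=> a /UU; exact: ch.
by exists d; split=> [a /UU|k]; [exact: hd|exact: IH].
Qed.

Lemma smooth_ext n U h h' : open U ->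
  (forall a t, U a -> 0 <= t <= 1 -> h a t = h' a t) -> smooth n U h -> smooth n U h'.
Proof.
move=> oU hh; have cP : (forall a, U a -> pcont (h a)) -> forall a, U a -> pcont (h' a).
  by move=> ch a Ua; apply: pcont_ext (ch a Ua) => t; exact: hh.
case: n => [|n]; first by move=> [ch _]; split=> //; exact: cP.
move=> /smoothSE[ch [d [hd dd]]]; apply/smoothSE; split; first exact: cP.
exists d; split=> // a Ua.
apply: ud_ext (hd a Ua) => //.
have : nbhs a U by exact: open_nbhs_nbhs.
by apply: filterS => b Ub t; exact: hh.
Qed.

Lemma smooth_cst n U (h : R -> C) : pcont h -> smooth n U (fun=> h).
Proof.
elim: n h => [|n IH] h ch; first by split.
apply/smoothSE; split=> //; exists (fun _ _ _ => 0); split; first by move=> a _; exact: ud_cst.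
by move=> k; apply: IH; exact: pcont_cst.
Qed.

Lemma smoothD n U h h' : smooth n U h -> smooth n U h' ->
  smooth n U (fun a t => h a t + h' a t).
Proof.
elim: n h h' => [|n IH] h h'.
  by move=> [ch _] [ch' _]; split=> // a Ua; apply: pcontD; [exact: ch|exact: ch'].
move=> /smoothSE[ch [d [hd dd]]] /smoothSE[ch' [d' [hd' dd']]].
apply/smoothSE; split; first by move=> a Ua; apply: pcontD; [exact: ch|exact: ch'].
exists (fun k a t => d k a t + d' k a t); split=> [a Ua|k]; last exact: IH.
by apply: udD; [exact: hd|exact: hd'].
Qed.

Lemma smoothM n U h h' : smooth n U h -> smooth n U h' ->
  smooth n U (fun a t => h a t * h' a t).
Proof.
elim: n h h' => [|n IH] h h'.
  by move=> [ch _] [ch' _]; split=> // a Ua; apply: pcontM; [exact: ch|exact: ch'].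
move=> H H'; have sh := smoothS H; have sh' := smoothS H'.
move: H H' => /smoothSE[ch [d [hd dd]]] /smoothSE[ch' [d' [hd' dd']]].
apply/smoothSE; split; first by move=> a Ua; apply: pcontM; [exact: ch|exact: ch'].
exists (fun k a t => h a t * d' k a t + d k a t * h' a t); split=> [a Ua|k].
  by apply: udM; [exact: ch|exact: ch'|exact: hd|exact: hd'].
by apply: smoothD; exact: IH.
Qed.

Lemma smoothZ n U h (c : C) : smooth n U h -> smooth n U (fun a t => c * h a t).
Proof. by move=> H; apply: smoothM => //; apply: smooth_cst; exact: pcont_cst. Qed.

Lemma smoothN n U h : open U -> smooth n U h -> smooth n U (fun a t => - h a t).
Proof.
move=> oU H; apply: (@smooth_ext _ _ (fun a t => -1 * h a t)) => //; last exact: smoothZ.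
by move=> a t _ _; rewrite mulN1r.
Qed.

Lemma smooth_sum n U (I : Type) (r : seq I) (F : I -> V -> R -> C) : open U ->
  (forall i, smooth n U (F i)) -> smooth n U (fun a t => \sum_(i <- r) F i a t).
Proof.
move=> oU sF; elim: r => [|i r IH].
  apply: (@smooth_ext _ _ (fun _ _ => 0)) => //; first by move=> *; rewrite big_nil.
  by apply: smooth_cst; exact: pcont_cst.
by apply: smooth_ext (smoothD (sF i) IH) => // a t _ _; rewrite big_cons.
Qed.

Lemma smoothX n U h p : open U -> smooth n U h -> smooth n U (fun a t => h a t ^+ p).
Proof.
move=> oU H; elim: p => [|p IH].
  by apply: (@smooth_cst _ _ (fun=> 1)); exact: pcont_cst.
by apply: smooth_ext (smoothM H IH) => // a t _ _; rewrite exprS.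
Qed.

Lemma smoothV n U h : open U -> (forall a t, U a -> 0 <= t <= 1 -> h a t != 0) ->
  smooth n U h -> smooth n U (fun a t => (h a t)^-1).
Proof.
move=> oU h0; elim: n => [|n IH].
  by move=> [ch _]; split=> // a Ua; apply: pcontV; [exact: ch|move=> t; exact: h0].
move=> H; have sh := smoothS H; case/smoothSE: H => ch [d [hd dd]].
apply/smoothSE; split; first by move=> a Ua; apply: pcontV; [exact: ch|move=> t; exact: h0].
exists (fun k a t => - d k a t / h a t ^+ 2); split=> [a Ua|k].
  by apply: udV; [exact: ch|move=> t; exact: h0|exact: hd].
apply: smoothM; first exact: smoothN.
apply: (@smooth_ext _ _ (fun a t => (h a t)^-1 ^+ 2)) => //.
  by move=> a t _ _; rewrite exprVn.
by apply: smoothX => //; exact: IH.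
Qed.

Lemma smooth_coord n U (w : 'I_N -> C) : smooth n U (fun a _ => \sum_k a 0 k * w k).
Proof.
have ch (c : C) : pcont (fun=> c) by exact: pcont_cst.
case: n => [|n]; first by split.
apply/smoothSE; split=> //; exists (fun k _ _ => w k); split=> [a _|k].
  exact: ud_linear.
by apply: smooth_cst.
Qed.

Lemma smooth_log n U h L : open U -> (forall a, U a -> pcont (L a)) ->
  (forall a t, U a -> 0 <= t <= 1 -> cexp (L a t) = h a t) ->
  (forall a, U a -> forall e : R, 0 < e -> \forall b \near a, forall t, 0 <= t <= 1 ->
      cabs (L b t - L a t) < e) ->
  smooth n U h -> smooth n U L.
Proof.
move=> oU cL E uL; case: n => [|n]; first by split.
move=> H; have sh := smoothS H; case/smoothSE: H => ch [d [hd dd]]; apply/smoothSE; split=> //.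
exists (fun k a t => d k a t / h a t); split=> [a Ua|k].
  apply: ud_log; [exact: ch| |exact: uL|exact: hd].
  have : nbhs a U by exact: open_nbhs_nbhs.
  by apply: filterS => b Ub t; exact: E.
by apply: smoothM => //; apply: smoothV => // a t Ua t01; rewrite -E// cexp_neq0.
Qed.

Lemma smooth_cint n U h : open U -> smooth n U h -> smooth n U (fun a _ => cint (h a)).
Proof.
move=> oU; elim: n h => [|n IH] h.
  by move=> _; split=> // a _; exact: pcont_cst.
move=> /smoothSE[ch [d [hd dd]]]; apply/smoothSE; split; first by move=> a _; exact: pcont_cst.
exists (fun k a _ => cint (d k a)); split=> [a Ua|k]; last exact: IH.
apply: ud_cint; last exact: hd.
  have : nbhs a U by exact: open_nbhs_nbhs.
  by apply: filterS.
by move=> k; exact: smooth_pcont (dd k) Ua.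
Qed.

(** The derivatives supplied by [smooth] may depend on the curve parameter even for a family that
    does not. Evaluation at 0 removes this dependence. *)
Lemma smooth_eval n U h : smooth n U h -> smooth n U (fun a _ => h a 0).
Proof.
elim: n h => [|n IH] h; first by split=> // a _; exact: pcont_cst.
move=> /smoothSE[ch [d [hd dd]]]; apply/smoothSE; split; first by move=> a _; exact: pcont_cst.
exists (fun k a _ => d k a 0); split=> [a Ua|k]; last exact: IH.
apply/udP; first by move=> k; exact: pcont_cst.
have H := (udP _ _ (fun k => smooth_pcont (dd k) Ua)).1 (hd a Ua).
move=> e /H[r r0 {}H]; exists r => // b bd t _.
by apply: H => //; rewrite lexx ler01.
Qed.

Lemma smooth_derive n U (f : V -> C) : smooth n.+1 U (fun a _ => f a) ->
  exists d : 'I_N -> V -> C, [/\ forall k, smooth n U (fun a _ => d k a),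
    forall a, U a -> ud (fun b _ => f b) a (fun k _ => d k a),
    forall a, U a -> differentiable f a &
    forall a v, U a -> 'D_v f a = \sum_k v 0 k * d k a].
Proof.
move=> /smooth_eval/smoothSE[_ [d [hd dd]]]; exists (fun k a => d k a 0).
have H a : U a -> ud (fun b _ => f b) a (fun k _ => d k a 0).
  move=> Ua; apply/udP; first by move=> k; exact: pcont_cst.
  have H := (udP _ _ (fun k => smooth_pcont (dd k) Ua)).1 (hd a Ua).
  move=> e /H[r r0 {}H]; exists r => // b bd t _.
  by apply: (H b bd 0); rewrite lexx ler01.
split=> //; first by move=> k; exact: smooth_eval.
  by move=> a /H /ud_differentiable[].
by move=> a v /H /ud_differentiable[_ ->].
Qed.

(** The inductive notion [smooth] passes through products, inverses, logarithms and integrals; this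
    lemma and the next translate between it and the iterated directional derivatives of
    [holomorphic_on]. *)
Lemma smooth_holomorphic U (f : V -> C) : open U ->
  (forall n, smooth n U (fun a _ => f a)) -> holomorphic_on U f.
Proof.
move=> oU sf vs a Ua.
suff H n : smooth n U (fun a _ => foldr (fun v (h : V -> C) b => 'D_v h b) f vs a).
  by have [_ [_ _ D _]] := smooth_derive (H 1%N); exact: D.
elim: vs n => [|v vs IH] n /=; first exact: sf.
have [d [sd _ _ E]] := smooth_derive (IH n.+1).
apply: (@smooth_ext _ _ (fun a _ => \sum_k v 0 k * d k a)) => //.
  by move=> b t Ub _; rewrite -E.
by apply: smooth_sum => // k; apply: smoothZ.
Qed.

Lemma holomorphic_smooth U (f : V -> C) : holomorphic_on U f ->
  forall n, smooth n U (fun a _ => f a).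
Proof.
move=> Hf n; rewrite -[f]/(foldr (fun v (h : V -> C) b => 'D_v h b) f [::]).
elim: n [::] => [|n IH] vs; first by split=> // a _; exact: pcont_cst.
apply/smoothSE; split; first by move=> a _; exact: pcont_cst.
exists (fun k a _ => foldr (fun v (h : V -> C) b => 'D_v h b) f (delta_mx 0 k :: vs) a).
by split=> [a Ua|k]; [exact: differentiable_ud (Hf vs a Ua)|exact: IH].
Qed.

(** The real and the imaginary part have different mean value points, whence the factor 2. *)
Lemma cder_mean_value (h h' : R -> C) (w : C) (e : R) :
  (forall t, 0 <= t <= 1 -> cder h t (h' t)) ->
  (forall t, 0 <= t <= 1 -> cabs (h' t - w) <= e) ->
  cabs (h 1 - h 0 - w) <= 2 * e.
Proof.
move=> H hw; have /pcontP[cr ci] := cder_pcont H.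
have D (t : R) : t \in `]0, 1[%R -> 0 <= t <= 1 by rewrite in_itv /= => /andP[/ltW-> /ltW->].
have [t] := MVT (@ltr01 R) (fun t t01 => (cder_is_derive (H t (D t t01))).1) cr.
move=> /D t01; rewrite subr0 mulr1 => Er.
have [s] := MVT (@ltr01 R) (fun t t01 => (cder_is_derive (H t (D t t01))).2) ci.
move=> /D s01; rewrite subr0 mulr1 => Ei.
apply: (le_trans (cabs_ReIm _)); rewrite !cplxE mulr_natl mulr2n lerD//.
  by rewrite Er -ReN -ReD (le_trans (Re_cabs _))// hw.
by rewrite Ei -ImN -ImD (le_trans (Im_cabs _))// hw.
Qed.

Lemma cder_line (f : V -> C) a v (s : R) (c : 'I_N -> C) :
  ud (fun b _ => f b) (a + s%:C *: v) (fun k _ => c k) ->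
  cder (fun s => f (a + s%:C *: v)) s (\sum_k v 0 k * c k).
Proof.
move=> /(udP _ _ (fun k => pcont_cst (c k))) H e e0.
have v1 : 0 < vabs v + 1 by rewrite ltr_wpDl// vabs_ge0.
have ev : 0 < e / (vabs v + 1) by rewrite divr_gt0.
have [r r0 {}H] := H _ ev; exists (r / (vabs v + 1)); first by rewrite divr_gt0.
move=> s' ss; pose b := a + s'%:C *: v.
have ba : b - (a + s%:C *: v) = (s' - s)%:C *: v.
  by rewrite /b opprD addrACA subrr add0r -scalerBl -rmorphB.
have vb : vabs (b - (a + s%:C *: v)) = `|s' - s| * vabs v.
  by rewrite ba vabsZ cabsR.
have := H b; rewrite vb => /(_ _ 0); rewrite lexx ler01 => /(_ _ erefl) h.
have n0 := normr_ge0 (s' - s); have v0 := vabs_ge0 v.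
have {}h := h _; have lt : `|s' - s| * vabs v < r.
  by move: ss; rewrite ltr_pdivlMr//; nra.
move: (h lt) => {h}; rewrite ba.
have -> : \sum_k ((s' - s)%:C *: v) 0 k * c k = (s' - s)%:C * \sum_k v 0 k * c k.
  by rewrite mulr_sumr; apply: eq_bigr => k _; rewrite mxE mulrA.
move=> h; apply: (le_trans h); rewrite -mulrA (mulrC _^-1) ler_pM2l//.
by rewrite ler_pdivrMr// ler_wpM2l// lerDl.
Qed.

Lemma mean_value (f : V -> C) (c : 'I_N -> V -> C) a v (w : C) (e : R) :
  (forall s : R, 0 <= s <= 1 -> ud (fun b _ => f b) (a + s%:C *: v) (fun k _ => c k (a + s%:C *: v))) ->
  (forall s : R, 0 <= s <= 1 -> cabs (\sum_k v 0 k * c k (a + s%:C *: v) - w) <= e) ->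
  cabs (f (a + v) - f a - w) <= 2 * e.
Proof.
move=> H hw; have := cder_mean_value (fun s s01 => cder_line (H s s01)) hw.
by rewrite scale0r addr0 scale1r.
Qed.

(** Level sets of [f] are open in [U], hence relatively open and closed in [D]. *)
Lemma locally_constant_connected (T : topologicalType) (X : Type) (U D : set T) (f : T -> X) :
  open U -> D `<=` U -> connected D -> (forall a : T, U a -> \forall b \near a, f b = f a) ->
  forall a b : T, D a -> D b -> f a = f b.
Proof.
move=> oU DU cD lc a b Da Db.
have op (P : X -> Prop) : open [set b | U b /\ P (f b)].
  rewrite openE => c [Uc Pc]; have : nbhs c U by exact: open_nbhs_nbhs.
  by apply: filterS2 (lc c Uc) => d /= -> Ud; split.
suff E : [set b | D b /\ f b = f a] = D by move: Db; rewrite -E => -[].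
apply: cD; first by exists a.
  exists [set b | U b /\ f b = f a]; first exact: (op (fun x => x = f a)).
  by apply/seteqP; split=> x [] Dx; [move=> fx; split=> //; split=> //; exact: DU|move=> []].
exists (~` [set b | U b /\ f b <> f a]); first exact: open_closedC (op (fun x => x <> f a)).
apply/seteqP; split=> x [Dx fx]; split=> //; first by move=> [].
by apply: contrapT => nf; apply: fx; split=> //; exact: DU.
Qed.

Lemma derivative0_constant U (f : V -> C) : open U -> connected U ->
  (forall a, U a -> ud (fun b _ => f b) a (fun _ _ => 0)) ->
  forall a b, U a -> U b -> f a = f b.
Proof.
move=> oU cU D; apply: (locally_constant_connected (U := U)) => // a Ua.
have /nbhs_vabs[d d0 H] : nbhs a U by exact: open_nbhs_nbhs.
apply/nbhs_vabs; exists d => // b bd.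
have : cabs (f (a + (b - a)) - f a - 0) <= 2 * 0.
  apply: (@mean_value f (fun _ _ => 0)); last first.
    by move=> s _; rewrite big1 ?subr0 ?cabs0// => k _; rewrite mulr0.
  move=> s /andP[s0 s1]; apply: D; apply: H.
  rewrite addrC addKr vabsZ cabsR ger0_norm//; apply: le_lt_trans bd.
  by rewrite ler_piMl// vabs_ge0.
rewrite mulr0 subr0 [a + _]addrC subrK => h; apply/eqP.
by rewrite -subr_eq0 -cabs_eq0 eq_le cabs_ge0 andbT.
Qed.

(** The second difference [D k l s] is symmetric in k and l. The mean value inequality, applied to
    the increment [phi] along the other direction, shows that it equals s^2 (cc l k + o(1)), and s
    tends to 0. *)
Lemma Clairaut U (f : V -> C) (c : 'I_N -> V -> C) (cc : 'I_N -> 'I_N -> C) a :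
  open U -> U a ->
  (forall b, U b -> ud (fun b _ => f b) b (fun k _ => c k b)) ->
  (forall k, ud (fun b _ => c k b) a (fun l _ => cc k l)) ->
  forall k l, cc k l = cc l k.
Proof.
move=> oU Ua fc ccd.
have /nbhs_vabs[d0 d00 UH] : nbhs a U by exact: open_nbhs_nbhs.
pose D k l (s : R) := f (a + s%:C *: delta_mx 0 k + s%:C *: delta_mx 0 l)
   - f (a + s%:C *: delta_mx 0 k) - f (a + s%:C *: delta_mx 0 l) + f a.
have vd (s : R) k : vabs (s%:C *: delta_mx 0 k : V) = `|s|.
  rewrite vabsZ cabsR /vabs (bigD1 k)//= mxE !eqxx cabs1 big1 ?addr0 ?mulr1// => i ik.
  by rewrite mxE eqxx (negPf ik) cabs0.
have sumd (F : 'I_N -> C) (s : R) k : \sum_j (s%:C *: delta_mx 0 k : V) 0 j * F j = s%:C * F k.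
  rewrite (bigD1 k)//= !mxE !eqxx mulr1 big1 ?addr0// => i ik.
  by rewrite !mxE eqxx (negPf ik) mulr0 mul0r.
have sumB (F : 'I_N -> C) (X Y : V) :
    \sum_j (X + Y) 0 j * F j = \sum_j X 0 j * F j + \sum_j Y 0 j * F j.
  by rewrite -big_split; apply: eq_bigr => j _; rewrite mxE mulrDl.
have key k l (e : R) : 0 < e -> exists2 r : R, 0 < r & forall s : R, 0 < s < r ->
    cabs (D k l s - (s ^+ 2)%:C * cc l k) <= 6 * e * s ^+ 2.
  move=> e0; have [r r0 H] := (udP _ _ (fun j => pcont_cst (cc l j))).1 (ccd l) _ e0.
  exists (Num.min r d0 / 2); first by rewrite divr_gt0// lt_min r0.
  move=> s /andP[s0 sr].
  have sr1 : 2 * s < r.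
    by rewrite mulrC -ltr_pdivlMr//; apply: lt_le_trans sr _; rewrite ler_pM2r ?ge_min ?lexx ?invr_gt0.
  have sr2 : 2 * s < d0.
    by rewrite mulrC -ltr_pdivlMr//; apply: lt_le_trans sr _; rewrite ler_pM2r ?ge_min ?lexx ?orbT ?invr_gt0.
  have small (x y : R) i j : 0 <= x <= 1 -> 0 <= y <= 1 ->
      vabs ((a + (x * s)%:C *: delta_mx 0 i + (y * s)%:C *: delta_mx 0 j) - a) <= 2 * s.
    move=> /andP[x0 x1] /andP[y0 y1]; rewrite addDBK.
    apply: (le_trans (vabsD _ _)); rewrite !vd !ger0_norm ?mulr_ge0//; [nra|exact: ltW..].
  pose phi x := f (x + s%:C *: delta_mx 0 k) - f x.
  pose dphi j x := c j (x + s%:C *: delta_mx 0 k) - c j x.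
  have -> : D k l s - (s ^+ 2)%:C * cc l k =
     phi (a + s%:C *: delta_mx 0 l) - phi a - s%:C * (s%:C * cc l k).
    rewrite /D /phi expr2 rmorphM /= [a + _ + s%:C *: delta_mx 0 k]addrAC.
    move: (f _) (f _) (f _) => x y z; ring.
  have -> : 6 * e * s ^+ 2 = 2 * (s * (3 * e * s)) by ring.
  apply: (@mean_value phi dphi) => x x01.
    have U1 : U (a + x%:C *: (s%:C *: delta_mx 0 l)).
      apply: UH; have := @small 0 x k l; rewrite lexx ler01 => /(_ erefl x01).
      by rewrite mul0r scale0r addr0 scalerA -rmorphM => h; apply: le_lt_trans h sr2.
    have U2 : U (a + x%:C *: (s%:C *: delta_mx 0 l) + s%:C *: delta_mx 0 k).
      apply: UH; have := @small x 1 l k x01; rewrite lexx ler01 => /(_ erefl).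
      by rewrite mul1r scalerA -rmorphM => h; apply: le_lt_trans h sr2.
    have T (z w : V) : U (z + w) -> ud (fun b _ => f (b + w)) z (fun j _ => c j (z + w)).
      move=> /fc /(udP _ _ (fun j => pcont_cst (c j (z + w)))) G.
      apply/udP; first by move=> j; exact: pcont_cst.
      move=> e' /G[r' r'0 {}G]; exists r' => // b bz t t01.
      have E : b + w - (z + w) = b - z by rewrite opprD addrACA subrr addr0.
      by have GG := G (b + w); rewrite E in GG; exact: (GG bz t t01).
    have := udD (T _ _ U2) (udM (pcont_cst (-1)) (pcont_cst (f (a + x%:C *: (s%:C *: delta_mx 0 l)))) (ud_cst (fun=> -1) _) (fc _ U1)).
    apply: ud_eq; first by move=> b t; rewrite /phi mulN1r.
    by move=> j t; rewrite /dphi mul0r addr0 mulN1r.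
  have s0' := ltW s0.
  rewrite sumd -mulrBr cabsM cabsR ger0_norm// ler_wpM2l//.
  have h1 := H (a + x%:C *: (s%:C *: delta_mx 0 l)).
  have h2 := H (a + x%:C *: (s%:C *: delta_mx 0 l) + s%:C *: delta_mx 0 k).
  have n1 := @small 0 x k l; rewrite lexx ler01 in n1; have {}n1 := n1 erefl x01.
  rewrite mul0r scale0r addr0 in n1.
  have n2 := @small x 1 l k x01; rewrite lexx ler01 in n2; have {}n2 := n2 erefl.
  rewrite mul1r in n2; rewrite !rmorphM -!scalerA /= in n1 n2.
  have {}h1 := h1 (le_lt_trans n1 sr1) 0; have {}h2 := h2 (le_lt_trans n2 sr1) 0.
  rewrite lexx ler01 in h1 h2; have {}h1 := h1 erefl; have {}h2 := h2 erefl.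
  have n1' : vabs (a + x%:C *: (s%:C *: delta_mx 0 l) - a) <= s.
    rewrite addrAC subrr add0r scalerA -rmorphM vd.
    by case/andP: x01 => x0 x1; rewrite ger0_norm ?mulr_ge0// ler_piMl.
  set P1 := a + x%:C *: (s%:C *: delta_mx 0 l) in h1 h2 n1 n2 n1' *.
  have dP := addrAC P1 (s%:C *: delta_mx 0 k) (- a).
  have -> : dphi l P1 - s%:C * cc l k =
    (c l (P1 + s%:C *: delta_mx 0 k) - c l a - \sum_j (P1 + s%:C *: delta_mx 0 k - a) 0 j * cc l j)
    - (c l P1 - c l a - \sum_j (P1 - a) 0 j * cc l j).
    have E1 : \sum_j (P1 + s%:C *: delta_mx 0 k - a) 0 j * cc l j =
        \sum_j (P1 - a) 0 j * cc l j + s%:C * cc l k.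
      apply: (etrans (congr1 (fun X : V => \sum_j X 0 j * cc l j) dP)).
      exact: (etrans (sumB _ _ _) (congr1 _ (sumd _ _ _))).
    have aux (x1 x2 x3 x4 x5 x6 : C) : x6 = x4 + x5 ->
      x1 - x2 - x5 = x1 - x3 - x6 - (x2 - x3 - x4) by move=> ->; ring.
    exact: aux E1.
  apply: (le_trans (cabs_triangle _ _)); rewrite cabsN.
  have -> : 3 * e * s = e * (2 * s) + e * s by ring.
  apply: lerD; first by apply: (le_trans h2); rewrite ler_pM2l.
  by apply: (le_trans h1); rewrite ler_pM2l.
move=> k l; apply/eqP; rewrite -subr_eq0 -cabs_eq0 eq_le cabs_ge0 andbT.
apply/ler_addgt0Pr => e e0; rewrite add0r.
(* The two errors 6 (e / 12) s^2 add up to e s^2. *)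
have e12 : 0 < e / 12 by rewrite divr_gt0.
have [r r0 H] := key k l _ e12; have [r' r'0 H'] := key l k _ e12.
pose s := Num.min r r' / 2.
have s0 : 0 < s by rewrite divr_gt0// lt_min r0.
have m0 : 0 < Num.min r r' by rewrite lt_min r0.
have sr : s < Num.min r r' by rewrite /s; lra.
move: sr; rewrite lt_min => /andP[sr sr'].
have {H}h := H s; rewrite s0 sr in h; have {}h := h erefl.
have {H'}h' := H' s; rewrite s0 sr' in h'; have {}h' := h' erefl.
have DD : D k l s = D l k s by rewrite /D [a + _ + _]addrAC [X in X + f a]addrAC.
have s2 : 0 < s ^+ 2 by rewrite exprn_gt0.
rewrite -(ler_pM2l s2) -[X in X * _ <= _]ger0_norm ?(ltW s2)// -cabsR -cabsM.
have -> : (s ^+ 2)%:C * (cc k l - cc l k) =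
  (D k l s - (s ^+ 2)%:C * cc l k) - (D l k s - (s ^+ 2)%:C * cc k l) by rewrite DD; ring.
apply: (le_trans (cabs_triangle _ _)); rewrite cabsN; lra.
Qed.

End Smooth.

(** * Winding numbers *)

Section C1Paths.
Variable R : realType.
Local Notation C := R[i].
Implicit Types (f g h L : R -> C) (t : R) (c z w : C).

(** The derivative is asked for on the open interval only, so the notion depends on values in [0, 1]
    alone ([C1path_ext]). *)
Definition C1path f (f' : R -> C) :=
  [/\ pcont f, pcont f' & forall t, 0 < t < 1 -> cder f t (f' t)].

Lemma near_oo (t : R) (P : R -> Prop) : 0 < t < 1 -> (forall s, 0 <= s <= 1 -> P s) ->
  \forall s \near t, P s.
Proof.
move=> /andP[t0 t1] H; apply/nbhs_ballP; exists (Num.min t (1 - t)).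
  by rewrite /= lt_min t0 subr_gt0.
move=> s; rewrite /ball /= lt_min !ltr_norml => /andP[/andP[a1 a2] /andP[b1 b2]].
by apply: H; apply/andP; split; lra.
Qed.

Let cc t : 0 < t < 1 -> 0 <= t <= 1.
Proof. by move=> /andP[/ltW-> /ltW->]. Qed.

Lemma C1path_ext f f1 g g1 : (forall t, 0 <= t <= 1 -> f t = g t) ->
  (forall t, 0 <= t <= 1 -> f1 t = g1 t) -> C1path f f1 -> C1path g g1.
Proof.
move=> fg fg1 [cf cf1 D]; split; [exact: pcont_ext cf|exact: pcont_ext cf1|].
move=> t t01; rewrite -fg1 ?cc//; apply: cder_ext (D t t01).
exact: near_oo.
Qed.

Lemma C1path_cst c : C1path (fun=> c) (fun=> 0).
Proof. by split; [exact: pcont_cst|exact: pcont_cst|move=> t _; exact: cder_cst]. Qed.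

Lemma C1pathD f f' g g' : C1path f f' -> C1path g g' ->
  C1path (fun t => f t + g t) (fun t => f' t + g' t).
Proof.
move=> [cf cf' df] [cg cg' dg]; split; [exact: pcontD|exact: pcontD|].
by move=> t t01; apply: cderD; [exact: df|exact: dg].
Qed.

Lemma C1pathM f f' g g' : C1path f f' -> C1path g g' ->
  C1path (fun t => f t * g t) (fun t => f t * g' t + f' t * g t).
Proof.
move=> [cf cf' df] [cg cg' dg]; split; [exact: pcontM|by apply: pcontD; exact: pcontM|].
by move=> t t01; apply: cderM; [exact: df|exact: dg].
Qed.

Lemma C1pathZ c f f' : C1path f f' -> C1path (fun t => c * f t) (fun t => c * f' t).
Proof.
move=> H; apply: C1path_ext (C1pathM (C1path_cst c) H) => // t _.
by rewrite mul0r addr0.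
Qed.

Lemma C1pathN f f' : C1path f f' -> C1path (fun t => - f t) (fun t => - f' t).
Proof. by move=> /(C1pathZ (-1)); apply: C1path_ext => t _; rewrite mulN1r. Qed.

Lemma C1pathB f f' g g' : C1path f f' -> C1path g g' ->
  C1path (fun t => f t - g t) (fun t => f' t - g' t).
Proof. by move=> H /C1pathN; exact: C1pathD. Qed.

Lemma C1pathV f f' : C1path f f' -> (forall t, 0 <= t <= 1 -> f t != 0) ->
  C1path (fun t => (f t)^-1) (fun t => - f' t / f t ^+ 2).
Proof.
move=> [cf cf' df] f0; split; first exact: pcontV.
  apply: (@pcont_ext _ (fun t => - f' t * ((f t)^-1 * (f t)^-1))).
    by move=> t _; rewrite -expr2 exprVn.
  by apply: pcontM; [exact: pcontN|apply: pcontM; exact: pcontV].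
by move=> t t01; apply: cderV; [exact: f0 (cc t01)|exact: df].
Qed.

Lemma C1pathX f f' n : C1path f f' ->
  C1path (fun t => f t ^+ n.+1) (fun t => n.+1%:R * f t ^+ n * f' t).
Proof.
move=> [cf cf' df]; split; first exact: pcontX.
  by apply: pcontM => //; apply: pcontM; [exact: pcont_cst|exact: pcontX].
by move=> t t01; apply: cderX; exact: df.
Qed.

Lemma C1path_integral f f' : C1path f f' -> cint f' = f 1 - f 0.
Proof. by move=> [cf cf' df]; apply: cint_FTC. Qed.

Lemma C1path_log f f' L : C1path f f' -> pcont L ->
  (forall t, 0 <= t <= 1 -> cexp (L t) = f t) -> C1path L (fun t => f' t / f t).
Proof.
move=> [cf cf' df] cL E.
have f0 t : 0 <= t <= 1 -> f t != 0 by move=> /E <-; exact: cexp_neq0.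
split=> //; first by apply: pcontM => //; exact: pcontV.
move=> t t01; apply: cder_log (df t t01); first exact: near_oo.
move=> e e0; have [d d0 H] := cL t (cc t01) e e0.
have : \forall s \near t, 0 <= s <= 1 by exact: near_oo.
move=> /nbhs_ballP[r /= r0 Hr]; apply/nbhs_ballP; exists (Num.min d r).
  by rewrite /= lt_min d0.
move=> s; rewrite /ball /= lt_min => /andP[sd sr]; apply: H; last by rewrite distrC.
exact: Hr.
Qed.

Lemma C1_path g : C1_curve g -> C1path g (curve_deriv g).
Proof.
move=> Cg; have [cg cg'] := C1_pcont Cg; split=> // t _; exact: C1_cder.
Qed.

Local Notation mu := (@lebesgue_measure R).

Let real_primitive (f : R -> R) : {within `[0, 1]%classic, continuous f} ->
  exists2 F : R -> R, {within `[0, 1]%classic, continuous F} &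
    forall t, 0 < t < 1 -> is_derive t 1 F (f t).
Proof.
move=> cf; have fi : mu.-integrable `[0, 1]%classic (EFin \o f).
  by apply: continuous_compact_integrable => //; exact: segment_compact.
exists (fun x => \int[mu]_(t in `[0, x]) f t).
  exact: parameterized_integral_continuous.
move=> t /andP[t0 t1].
have ct : {for t, continuous f}.
  have [co _ _] := (continuous_within_itvP f (@ltr01 R)).1 cf.
  by apply: co; rewrite in_itv /= t0.
have [d e] := continuous_FTC1_closed t1 fi t0 ct.
by split; [exact: d|exact: etrans (esym (derive1E _ _)) e].
Qed.

Lemma primitive_exists h : pcont h -> exists H, C1path H h.
Proof.
move=> /[dup] ch /pcontP[/real_primitive[F cF dF] /real_primitive[G cG dG]].
exists (fun t => F t +i* G t); split=> //; first by apply/pcontP.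
by move=> t t01; apply: is_derive_cder; [exact: dF|exact: dG].
Qed.

Lemma C1path_cexp L L' : C1path L L' -> C1path (fun t => cexp (L t)) (fun t => cexp (L t) * L' t).
Proof.
move=> [cL cL' dL].
have cE : pcont (fun t => cexp (L t)).
  move=> t t01 e e0; have A0 : 0 < cabs (cexp (L t)) by rewrite cabs_gt0 cexp_neq0.
  have [d d0 H] := @cexp_first_order R 1 ltr01.
  have m0 : 0 < Num.min d (e / (2 * cabs (cexp (L t)))).
    by rewrite lt_min d0 divr_gt0// mulr_gt0.
  have [r r0 Hr] := cL t t01 _ m0; exists r => // s s01 sr.
  have := Hr s s01 sr; rewrite lt_min => /andP[h1 h2].
  have := H _ h1; rewrite mul1r; set w := L s - L t in h1 h2 *; move=> h3.
  have -> : cexp (L s) - cexp (L t) = cexp (L t) * (cexp w - 1 - w + w).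
    have cw : cexp (L s) = cexp (L t) * cexp w by rewrite -cexpD /w addrC subrK.
    by rewrite cw; ring.
  rewrite cabsM mulrC -ltr_pdivlMr//; apply: (le_lt_trans (cabs_triangle _ _)).
  by move: h2; rewrite invfM mulrA; lra.
split=> //; first exact: pcontM.
move=> t t01 e e0; have A0 : 0 < cabs (cexp (L t)) by rewrite cabs_gt0 cexp_neq0.
pose B := cabs (L' t) + 1.
have B0 : 0 < B by rewrite ltr_wpDl// cabs_ge0.
have m1 : 0 < e / (2 * B * cabs (cexp (L t))) by rewrite divr_gt0// !mulr_gt0.
have m2 : 0 < Num.min 1 (e / (2 * cabs (cexp (L t)))).
  by rewrite lt_min ltr01 divr_gt0// mulr_gt0.
have [d d0 H] := @cexp_first_order R _ m1.
have [r r0 Hr] := dL t t01 _ m2; have [r' r'0 Hr'] := cder_cont (dL t t01) d0.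
exists (Num.min r r'); first by rewrite lt_min r0.
move=> s; rewrite lt_min => /andP[/Hr h1 /Hr' /H].
set w := L s - L t in h1 *; move=> h2.
have n0 := normr_ge0 (s - t).
have mm1 : Num.min 1 (e / (2 * cabs (cexp (L t)))) <= 1 by rewrite ge_min lexx.
have mm2 : Num.min 1 (e / (2 * cabs (cexp (L t)))) <= e / (2 * cabs (cexp (L t))).
  by rewrite ge_min lexx orbT.
have h3 : cabs w <= B * `|s - t|.
  have := cabs_triangle (w - (s - t)%:C * L' t) ((s - t)%:C * L' t).
  by rewrite subrK cabsM cabsR /B; nra.
have -> : cexp (L s) - cexp (L t) - (s - t)%:C * (cexp (L t) * L' t) =
   cexp (L t) * ((cexp w - 1 - w) + (w - (s - t)%:C * L' t)).
  have -> : cexp (L s) = cexp (L t) * cexp w by rewrite -cexpD /w addrC subrK.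
  by ring.
rewrite cabsM mulrC -ler_pdivlMr//; apply: (le_trans (cabs_triangle _ _)).
have -> : e * `|s - t| / cabs (cexp (L t)) = e / (2 * B * cabs (cexp (L t))) * (B * `|s - t|)
    + e / (2 * cabs (cexp (L t))) * `|s - t| by field; rewrite !gt_eqF.
apply: lerD; first by apply: (le_trans h2); rewrite ler_pM2l.
by apply: (le_trans h1); rewrite ler_wpM2r.
Qed.

Lemma C1path_constant f : C1path f (fun=> 0) -> forall t, 0 <= t <= 1 -> f t = f 0.
Proof.
move=> [cf _ df] t /andP[t0 t1].
have key (u : R -> R) : {within `[0, 1]%classic, continuous u} ->
    (forall s : R, 0 < s < 1 -> is_derive s 1 u 0) -> u t = u 0.
  move=> cu du; have cu' : {within `[0, t]%classic, continuous u}.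
    by apply: continuous_subspaceW cu => s /=; rewrite !in_itv /= => /andP[-> /le_trans->].
  have du' (s : R) : s \in `]0, t[%R -> is_derive s 1 u ((fun=> 0) s).
    by rewrite in_itv /= => /andP[s0 st]; apply: du; rewrite s0 (lt_le_trans st).
  have [s _] := MVT_segment t0 du' cu'; rewrite mul0r => h.
  by apply/eqP; rewrite -subr_eq0 h.
have /pcontP[cr ci] := cf.
apply: cplx_eq.
  by apply: (key (fun t => Re (f t))) => // s /df /cder_is_derive[].
by apply: (key (fun t => Im (f t))) => // s /df /cder_is_derive[].
Qed.

Lemma cexp_surj z : z != 0 -> exists w, cexp w = z.
Proof.
move=> n0; have [r0|r0] := ltP 0 (Re z); first by exists (clog z); rewrite clogK.
have [r1|r1] := ltP (Re z) 0.
  exists (clog (- z) + 0 +i* pi); rewrite cexpD clogK ?ReN ?oppr_gt0//.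
  rewrite /cexp /= expR0 cospi sinpi mul1r.
  by apply: cplx_eq; rewrite !cplxE /=; ring.
have rz : Re z = 0 by apply/le_anti; rewrite r0.
have [i0|i0] := ltP 0 (Im z).
  exists (clog (z * (0 -i* 1)) + 0 +i* (pi / 2)); rewrite cexpD clogK.
    rewrite /cexp /= expR0 cos_pihalf sin_pihalf mul1r.
    by apply: cplx_eq; rewrite !cplxE /=; ring.
  by rewrite !cplxE /= rz; lra.
have iz : Im z < 0.
  by rewrite lt_neqAle i0 andbT; apply: contra n0 => /eqP iz; apply/eqP; apply: cplx_eq.
exists (clog (z * (0 +i* 1)) + 0 -i* (pi / 2)); rewrite cexpD clogK.
  rewrite /cexp /= cosN sinN expR0 cos_pihalf sin_pihalf mul1r.
  by apply: cplx_eq; rewrite !cplxE /=; ring.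
by rewrite !cplxE /= rz; lra.
Qed.

(** For a primitive H of f' / f the product exp (- H) f is constant, so H plus a constant is a
    logarithm of f. *)
Lemma log_exists f f' : C1path f f' -> (forall t, 0 <= t <= 1 -> f t != 0) ->
  exists2 L, C1path L (fun t => f' t / f t) & forall t, 0 <= t <= 1 -> cexp (L t) = f t.
Proof.
move=> Hf f0; have [cf cf' _] := Hf.
have [H PH] : exists H, C1path H (fun t => f' t / f t).
  by apply: primitive_exists; apply: pcontM => //; exact: pcontV.
have P1 := C1pathM (C1path_cexp (C1pathN PH)) Hf.
have {}P1 : C1path (fun t => cexp (- H t) * f t) (fun=> 0).
  by apply: C1path_ext P1 => // t t01; field; exact: f0.
have K := C1path_constant P1.
have z01 : 0 <= (0 : R) <= 1 by rewrite lexx ler01.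
have [w ww] : exists w, cexp w = cexp (- H 0) * f 0.
  by apply: cexp_surj; rewrite mulf_neq0 ?cexp_neq0 ?f0.
exists (fun t => H t + w).
  by apply: C1path_ext (C1pathD PH (C1path_cst w)) => // t _; rewrite addr0.
by move=> t t01; rewrite cexpD ww -(K t t01) cexpN; field; exact: cexp_neq0.
Qed.

Lemma closed_path_integer f f' : C1path f f' -> f 0 = f 1 ->
  (forall t, 0 <= t <= 1 -> f t != 0) ->
  exists k : int, cint (fun t => f' t / f t) = k%:~R * two_pi_i R.
Proof.
move=> Hf f01 f0; have [L PL E] := log_exists Hf f0.
rewrite (C1path_integral PL); apply: cexp_eq1.
have E0 : cexp (L 0) = f 0 by apply: E; rewrite lexx ler01.
have E1 : cexp (L 1) = f 1 by apply: E; rewrite lexx ler01.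
by rewrite cexpB E0 E1 -f01 divff// f0// lexx ler01.
Qed.

(** Two candidates have imaginary parts differing by less than 3 pi / 2, hence by no nonzero
    multiple of 2 pi. *)
Lemma clog_unique z w : 0 < Re z -> `|Im w| <= pi -> cexp w = z -> w = clog z.
Proof.
move=> z0 iw E; have : cexp (w - clog z) = 1.
  by rewrite cexpB clogK// E divff//; apply: contraTneq z0 => ->; rewrite ltxx.
move=> /cexp_eq1[k Ek]; have pp : 0 < (pi : R) by exact: pi_gt0.
have := congr1 (@Im R) Ek; rewrite -(rmorph_int (real_complex R)) !cplxE /= mul0r addr0.
move: (atan_gtNpi2 (Im z / Re z)) (atan_ltpi2 (Im z / Re z)); set x := atan _ => x1 x2 Ei.
move: iw; rewrite ler_norml => /andP[w1 w2].
suff k0 : k = 0 by apply/eqP; rewrite -subr_eq0 Ek k0 mul0r.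
have a1 : (k%:~R : R) < 1 by rewrite -(ltr_pM2r pp); lra.
have a2 : -1 < (k%:~R : R) by rewrite -(ltr_pM2r pp); lra.
have : (k < 1)%R by rewrite -(ltr_int R).
have : (-1 < k)%R by rewrite -(ltr_int R).
lia.
Qed.

Lemma clog_ratio z w : 0 < Re z -> 0 < Re w -> 0 < Re (z / w) ->
  clog z - clog w = clog (z / w).
Proof.
move=> z0 w0 zw; have E : cexp (clog z - clog w) = z / w by rewrite cexpB !clogK.
apply: clog_unique => //; rewrite !cplxE /=.
move: (atan_gtNpi2 (Im z / Re z)) (atan_ltpi2 (Im z / Re z)).
move: (atan_gtNpi2 (Im w / Re w)) (atan_ltpi2 (Im w / Re w)).
by move=> *; rewrite ler_norml; apply/andP; split; lra.
Qed.

Lemma Re_gt0_neq0 z : 0 < Re z -> z != 0.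
Proof. by apply: contraTneq => ->; rewrite ltxx. Qed.

(** Once |w| is bounded below, the ratio z / w is uniformly close to 1, and the difference of
    logarithms is the logarithm of the ratio. *)
Lemma clog_cont (K e : R) : 0 < K -> 0 < e -> exists2 d : R, 0 < d &
  forall z w, 0 < Re z -> 0 < Re w -> K <= cabs w -> cabs (z - w) < d ->
    cabs (clog z - clog w) < e.
Proof.
move=> K0 /clog_small[r r0 H]; exists (r * K); first by rewrite mulr_gt0.
move=> z w z0 w0 Kw zw; have wn := Re_gt0_neq0 w0.
have h : cabs (z / w - 1) < r.
  have -> : z / w - 1 = (z - w) / w by field.
  rewrite cabsM cabsV ltr_pdivrMr ?cabs_gt0//; apply: (lt_le_trans zw).
  by rewrite ler_pM2l.
by rewrite clog_ratio// ; have [] := H _ h.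
Qed.

Lemma C1path_clog f f' : C1path f f' -> (forall t, 0 <= t <= 1 -> 0 < Re (f t)) ->
  C1path (fun t => clog (f t)) (fun t => f' t / f t).
Proof.
move=> Hf fr; have [cf _ _] := Hf; apply: C1path_log => //; last first.
  by move=> t t01; rewrite clogK// fr.
have [K K0 HK] := pcont_lower cf (fun t t01 => Re_gt0_neq0 (fr t t01)).
move=> t t01 e e0; have [d d0 H] := clog_cont K0 e0.
have [r r0 Hr] := cf t t01 d d0; exists r => // s s01 sr.
by apply: H; [exact: fr|exact: fr|exact: HK|exact: Hr].
Qed.

End C1Paths.

(** * Homotopy invariance of contour integrals *)

Section Homotopy.
Variable R : realType.
Local Notation C := R[i].

Lemma ud_near (N : nat) (h : 'rV[C]_N -> R -> C) a c (e : R) : ud h a c -> 0 < e ->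
  \forall b \near a, forall t, 0 <= t <= 1 -> cabs (h b t - h a t) < e.
Proof.
move=> H e0; apply: (@expansion_cvg _ _ _ (nbhs_filter a) _ _ _ _ _ _ _ _ _ H e0).
  by move=> b; exact: vabs_ge0.
by move=> r r0; apply/nbhs_vabs; exists r.
Qed.

Lemma ud_near_neq0 (N : nat) (h : 'rV[C]_N -> R -> C) a c : ud h a c -> pcont (h a) ->
  (forall t, 0 <= t <= 1 -> h a t != 0) ->
  \forall b \near a, forall t, 0 <= t <= 1 -> h b t != 0.
Proof.
move=> H ch h0; have [K K0 HK] := pcont_lower ch h0.
apply: filterS (ud_near H K0) => b Hb t t01; rewrite -cabs_gt0.
have := cabs_lowtri (h a t) (h b t); rewrite cabs_distC.
by have := Hb t t01; have := HK t t01; lra.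
Qed.

Local Notation V := 'rV[C]_1.

(** The parameter derivative [d s] of the integrand is the derivative of a closed path [k s], so the
    integral has derivative 0. The parameter is placed in a one-dimensional complex space in order
    to reuse [ud]. *)
Lemma homotopy_constant (h : V -> R -> C) (d k : R -> R -> C) :
  (forall s : R, 0 <= s <= 1 -> \forall b \near (const_mx s%:C : V), pcont (h b)) ->
  (forall s : R, 0 <= s <= 1 -> ud h (const_mx s%:C) (fun _ => d s)) ->
  (forall s : R, 0 <= s <= 1 -> C1path (k s) (d s) /\ k s 0 = k s 1) ->
  cint (h (const_mx 0)) = cint (h (const_mx 1)).
Proof.
move=> ch hd kd; pose v : V := const_mx 1.
have sv (s : R) : 0 + s%:C *: v = const_mx s%:C.
  by rewrite add0r; apply/matrixP => i j; rewrite !mxE mulr1.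
have D (s : R) : 0 <= s <= 1 -> cder (fun s => cint (h (0 + s%:C *: v))) s 0.
  move=> s01; have [P P01] := kd s s01; have cd : pcont (d s) by case: P.
  have : ud (fun b _ => cint (h b)) (0 + s%:C *: v) (fun _ _ => cint (d s)).
    rewrite sv; apply: ud_cint; [exact: ch|by []|exact: hd].
  move=> /(@cder_line R 1 (fun b => cint (h b)) 0 v s (fun=> cint (d s))).
  by rewrite big_ord1 (C1path_integral P) P01 subrr mulr0.
have Z (t : R) : 0 <= t <= 1 -> cabs ((fun=> 0) t - 0 : C) <= 0 by rewrite subrr cabs0.
have := cder_mean_value D Z; rewrite mulr0.
rewrite !sv subr0 => H; apply/esym/eqP; rewrite -subr_eq0 -cabs_eq0 eq_le cabs_ge0 andbT.
exact: H.
Qed.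

Lemma ud_affine (al be : R -> C) (a : V) : pcont be ->
  ud (fun b t => al t + b 0 0 * be t) a (fun _ => be).
Proof.
move=> cb; apply/udP => // e e0; exists 1 => // b _ t _.
rewrite big_ord1 !mxE; set x := _ - _ - _; have -> : x = 0 by rewrite /x; ring.
by rewrite cabs0 mulr_ge0 ?vabs_ge0 ?ltW.
Qed.

Lemma pcont_affine (al be : R -> C) (z : C) : pcont al -> pcont be ->
  pcont (fun t => al t + z * be t).
Proof. by move=> ca cb; apply: pcontD => //; apply: pcontM => //; exact: pcont_cst. Qed.

Lemma C1path_affine (al al' be be' : R -> C) (z : C) : C1path al al' -> C1path be be' ->
  C1path (fun t => al t + z * be t) (fun t => al' t + z * be' t).
Proof. by move=> ca cb; apply: C1pathD => //; exact: C1pathZ. Qed.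

(** The s-derivative of (al' + s be') / (al + s be) is the t-derivative of the closed path be / (al
    + s be). *)
Lemma homotopy_winding (al al' be be' : R -> C) : C1path al al' -> C1path be be' ->
  al 0 = al 1 -> be 0 = be 1 ->
  (forall s t : R, 0 <= s <= 1 -> 0 <= t <= 1 -> al t + s%:C * be t != 0) ->
  cint (fun t => al' t / al t) = cint (fun t => (al' t + be' t) / (al t + be t)).
Proof.
move=> Pa Pb a01 b01 n0; have [ca ca' _] := Pa; have [cb cb' _] := Pb.
have := @homotopy_constant (fun b t => (al' t + b 0 0 * be' t) * (al t + b 0 0 * be t)^-1)
  (fun s t => (al' t + s%:C * be' t) * (- be t / (al t + s%:C * be t) ^+ 2)
        + be' t * (al t + s%:C * be t)^-1)
  (fun s t => be t * (al t + s%:C * be t)^-1).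
have n0' (s : R) : 0 <= s <= 1 -> \forall b \near (const_mx s%:C : V),
    forall t, 0 <= t <= 1 -> al t + (b : V) 0 0 * be t != 0.
  move=> s01; apply: (ud_near_neq0 (ud_affine al (const_mx s%:C) cb)).
    exact: pcont_affine.
  by move=> t t01; rewrite mxE; exact: n0.
move=> /(_ _ _ _)/wrap[].
- move=> s s01; apply: filterS (n0' s s01) => b Hb.
  by apply: pcontM; [exact: pcont_affine|apply: pcontV => //; exact: pcont_affine].
- move=> s s01.
  have H1 := ud_affine al' (const_mx s%:C : V) cb'.
  have H2 := ud_affine al (const_mx s%:C : V) cb.
  have := udM _ _ H1 (udV _ _ H2); rewrite !mxE; apply.
  + exact: pcont_affine.
  + by apply: pcontV; [exact: pcont_affine|move=> t; exact: n0].
  + exact: pcont_affine.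
  + by move=> t t01; exact: n0.
- move=> s s01; split; last by rewrite a01 b01.
  have P := C1path_affine s%:C Pa Pb.
  apply: C1path_ext (C1pathM Pb (C1pathV P (fun t => n0 s t s01))) => // t t01.
  by field; exact: n0.
move=> H; transitivity (cint (fun t => (al' t + (const_mx 0 : V) 0 0 * be' t) *
    (al t + (const_mx 0 : V) 0 0 * be t)^-1)).
  by apply: cint_ext => t _; rewrite mxE !mul0r !addr0.
by rewrite H; apply: cint_ext => t _; rewrite mxE !mul1r.
Qed.

Section Contraction.
Variables (y y' : R -> C) (p : C).
Hypotheses (Py : C1path y y') (y01 : y 0 = y 1).
Hypotheses (yd : forall t, 0 <= t <= 1 -> cabs (y t - 1) < 1/2) (pd : cabs (p - 1) < 1/2).

Let ys (z : C) t := p + z * (y t - p).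

Let Re_disc (z : C) : cabs (z - 1) < 1 -> 0 < Re z.
Proof.
move=> h; have := Re_cabs (z - 1); rewrite !cplxE /= ler_norml; lra.
Qed.

Let ys_disc (s : R) (z : C) t : 0 <= s <= 1 -> cabs (z - s%:C) < 1/2 -> 0 <= t <= 1 ->
  cabs (ys z t - 1) < 1.
Proof.
move=> /andP[s0 s1] zs t01.
have -> : ys z t - 1 = (1 - s)%:C * (p - 1) + s%:C * (y t - 1) + (z - s%:C) * (y t - p).
  by rewrite /ys rmorphB rmorph1; ring.
have h1 := yd t01; have h2 := pd.
have h3 : cabs (y t - p) < 1.
  by have := cabs_tri3 (y t) p 1; rewrite (cabs_distC 1 p); lra.
apply: (le_lt_trans (cabs_triangle _ _)); rewrite cabsM.
apply: (@le_lt_trans _ _ ((1 - s) * cabs (p - 1) + s * cabs (y t - 1) + cabs (z - s%:C) * cabs (y t - p))).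
  rewrite lerD2r; apply: (le_trans (cabs_triangle _ _)).
  by rewrite !cabsM !cabsR !ger0_norm// subr_ge0.
have := cabs_ge0 (y t - p); have := cabs_ge0 (z - s%:C).
have : (1 - s) * cabs (p - 1) + s * cabs (y t - 1) < 1/2.
  have [->|sp] := eqVneq s 0; first by lra.
  have : 0 < s by rewrite lt0r sp.
  by nra.
by nra.
Qed.

Let ys_near (s : R) : 0 <= s <= 1 -> \forall b \near (const_mx s%:C : V),
  forall t, 0 <= t <= 1 -> 0 < Re (ys ((b : V) 0 0) t).
Proof.
move=> s01; apply/nbhs_vabs; exists (1/2) => // b.
rewrite /vabs big_ord1 !mxE => bs t t01; apply: Re_disc.
exact: (ys_disc s01).
Qed.

Let ysc (s : R) t : 0 <= s <= 1 -> 0 <= t <= 1 -> 0 < Re (ys s%:C t).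
Proof.
move=> s01 t01; apply: Re_disc; apply: (ys_disc s01) => //.
by rewrite subrr cabs0.
Qed.

Let Pyp : C1path (fun t => y t - p) y'.
Proof. by apply: C1path_ext (C1pathB Py (C1path_cst p)) => // t _; rewrite subr0. Qed.

Let Pys (z : C) : C1path (ys z) (fun t => z * y' t).
Proof.
by apply: C1path_ext (C1pathD (C1path_cst p) (C1pathZ z Pyp)) => // t _; rewrite add0r.
Qed.

Let cys z : pcont (ys z). Proof. by case: (Pys z). Qed.

Let ud_ys (s : R) : ud (fun b => ys (b 0 0)) (const_mx s%:C : V) (fun _ t => y t - p).
Proof. by apply: (ud_affine (fun=> p)); case: Pyp. Qed.

Let ud_clog (s : R) : 0 <= s <= 1 ->
  ud (fun b t => clog (ys (b 0 0) t)) (const_mx s%:C : V) (fun _ t => (y t - p) / ys s%:C t).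
Proof.
move=> s01; have := @ud_log R 1 (fun b => ys (b 0 0)) (fun b t => clog (ys (b 0 0) t))
  (const_mx s%:C) _ _ _ _ (ud_ys s); rewrite !mxE; apply.
- exact: cys.
- by apply: filterS (ys_near s01) => b Hb t /Hb; exact: clogK.
move=> e e0.
have [K K0 HK] := pcont_lower (cys s%:C) (fun t t01 => Re_gt0_neq0 (ysc s01 t01)).
have [d d0 H] := clog_cont K0 e0.
have := ud_near (ud_ys s) d0; rewrite !mxE => nd.
apply: filterS2 nd (ys_near s01) => b Hb1 Hb2 t t01.
by apply: H; [exact: Hb2|exact: ysc|exact: HK|exact: Hb1].
Qed.

Let pcont_clog z : (forall t, 0 <= t <= 1 -> 0 < Re (ys z t)) -> pcont (fun t => clog (ys z t)).
Proof. by move=> /(C1path_clog (Pys z))[]. Qed.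

Let ysn (s : R) t : 0 <= s <= 1 -> 0 <= t <= 1 -> ys s%:C t != 0.
Proof. by move=> s01 t01; apply: Re_gt0_neq0; exact: ysc. Qed.

(** The contraction leaves y' / (y - p) unchanged and turns log y into the constant log p. The
    s-derivative of the integrand is y' / y_s, with primitive (log y_s) / s, or y / p at s = 0. *)
Lemma contract_inside : (forall t, 0 <= t <= 1 -> y t != p) ->
  cint (fun t => clog (y t) * (y' t / (y t - p))) = clog p * cint (fun t => y' t / (y t - p)).
Proof.
move=> yp; have yp0 t : 0 <= t <= 1 -> y t - p != 0 by move=> /yp; rewrite subr_eq0.
have [cyp cy' _] := Pyp.
have cq : pcont (fun t => y' t / (y t - p)) by apply: pcontM => //; exact: pcontV.
have := @homotopy_constant (fun b t => clog (ys (b 0 0) t) * (y' t / (y t - p)))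
  (fun s t => y' t / ys s%:C t)
  (fun s t => if s == 0 then p^-1 * y t else s%:C^-1 * clog (ys s%:C t)).
move=> /(_ _ _ _)/wrap[].
- move=> s s01; apply: filterS (ys_near s01) => b Hb; apply: pcontM => //.
  exact: pcont_clog.
- move=> s s01; have := udM _ _ (ud_clog s01) (ud_cst (fun t => y' t / (y t - p)) _).
  rewrite !mxE => H; have {}H := H (pcont_clog (fun t => ysc s01)) cq.
  apply: ud_ext H; first by apply/nbhs_vabs; exists 1.
  by move=> k t t01; rewrite mulr0 add0r; field; rewrite ysn// yp0.
- move=> s s01; have [->|s0] := eqVneq s 0; split; rewrite ?y01//.
  + apply: C1path_ext (C1pathZ p^-1 Py) => // t _.
    by rewrite /ys mul0r addr0 mulrC.
  + have sc : s%:C != 0 by rewrite -[0]/(0%:C) (inj_eq (@complexI R)).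
    apply: C1path_ext (C1pathZ s%:C^-1 (C1path_clog (Pys s%:C) _)) => // t t01; last exact: ysc.
    by field; rewrite sc ysn.
  + by rewrite /ys y01.
move=> H; transitivity (cint (fun t => clog (ys ((const_mx 1 : V) 0 0) t) * (y' t / (y t - p)))).
  by apply: cint_ext => t _; rewrite mxE /ys mul1r [p + _]addrC subrK.
by rewrite -H -cintZ//; apply: cint_ext => t _; rewrite mxE /ys mul0r addr0.
Qed.

(** During the contraction to 1 the loop never meets [r]. The s-derivative of the integrand has the
    closed primitive (y - p) log y_s / (y_s - r), and the integrand vanishes at s = 0. *)
Lemma contract_outside (r : C) : 1/2 <= cabs (r - 1) -> p = 1 ->
  cint (fun t => clog (y t) * (y' t / (y t - r))) = 0 /\
  cint (fun t => y' t / (y t - r)) = 0.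
Proof.
move=> r2 p1; have [cyp cy' _] := Pyp.
have ysr (s : R) t : 0 <= s <= 1 -> 0 <= t <= 1 -> ys s%:C t - r != 0.
  move=> /andP[s0 s1] t01; rewrite subr_eq0; apply/negP => /eqP E.
  have : cabs (r - 1) < 1/2; last lra.
  have h := yd t01; have := cabs_ge0 (y t - 1).
  have -> : r - 1 = s%:C * (y t - 1) by rewrite -E /ys p1 addrC addKr.
  by rewrite cabsM cabsR ger0_norm//; nra.
have Pyr z : C1path (fun t => ys z t - r) (fun t => z * y' t).
  by apply: C1path_ext (C1pathB (Pys z) (C1path_cst r)) => // t _; rewrite subr0.
have yr t : 0 <= t <= 1 -> y t - r != 0.
  by move=> t01; have := @ysr 1 t; rewrite lexx ler01 /ys mul1r [p + _]addrC subrK; exact.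
split; last first.
  have := @homotopy_winding (fun=> p - r) (fun=> 0) (fun t => y t - p) y' (C1path_cst _) Pyp.
  move=> /(_ erefl); rewrite y01 => /(_ erefl)/(_ _)/wrap[].
    by move=> s t s01 t01; have := ysr s t s01 t01; rewrite /ys addrAC.
  move=> H; rewrite -[RHS](mul0r (cint (fun=> 0))) -cintZ; last exact: pcont_cst.
  transitivity (cint (fun t => (0 + y' t) / (p - r + (y t - p)))).
    by apply: cint_ext => t _; rewrite add0r [p - r + _]addrC addrA subrK.
  by rewrite -H; apply: cint_ext => t _; rewrite !mul0r.
have udr (s : R) : ud (fun b t => ys (b 0 0) t - r) (const_mx s%:C : V) (fun _ t => y t - p).
  have := @ud_affine (fun=> p - r) (fun t => y t - p) (const_mx s%:C) cyp.
  by apply: ud_eq => // b t; rewrite /ys addrAC.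
have near_r (s : R) : 0 <= s <= 1 -> \forall b \near (const_mx s%:C : V),
    forall t, 0 <= t <= 1 -> ys ((b : V) 0 0) t - r != 0.
  move=> s01; apply: (ud_near_neq0 (udr s)); rewrite !mxE; last by move=> t; exact: ysr.
  by case: (Pyr s%:C).
have := @homotopy_constant (fun b t => clog (ys (b 0 0) t) * ((0 + b 0 0 * y' t) * (ys (b 0 0) t - r)^-1))
  (fun s t => clog (ys s%:C t) * (s%:C * y' t * (- (y t - p) / (ys s%:C t - r) ^+ 2) + y' t * (ys s%:C t - r)^-1) + (y t - p) / ys s%:C t * (s%:C * y' t * (ys s%:C t - r)^-1))
  (fun s t => (y t - p) * (clog (ys s%:C t) * (ys s%:C t - r)^-1)).
move=> /(_ _ _ _)/wrap[].
- move=> s s01; apply: filterS2 (ys_near s01) (near_r s s01) => b Hb Hr; apply: pcontM.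
    exact: pcont_clog.
  apply: pcontM; last by apply: pcontV => //; case: (Pyr (b 0 0)).
  by apply: pcont_affine => //; exact: pcont_cst.
- move=> s s01.
  have H1 := ud_affine (fun=> 0) (const_mx s%:C : V) cy'.
  have cr : pcont (fun t => (ys s%:C t - r)^-1).
    by apply: pcontV; [case: (Pyr s%:C)|move=> t; exact: ysr].
  have cs : pcont (fun t => 0 + s%:C * y' t).
    by apply: pcont_affine => //; exact: pcont_cst.
  have H2 := udV _ _ (udr s); rewrite !mxE in H2.
  have {}H2 := H2 (let: And3 a _ _ := Pyr s%:C in a) (fun t => ysr s t s01).
  have H3 := udM _ _ H1 H2; rewrite !mxE in H3; have {}H3 := H3 cs cr.
  have H4 := udM _ _ (ud_clog s01) H3; rewrite !mxE in H4.
  have {}H4 := H4 (pcont_clog (fun t => ysc s01)) (pcontM cs cr).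
  by apply: ud_eq H4 => // k t; rewrite !add0r.
- move=> s s01; split; last by rewrite /ys y01.
  have P := C1pathV (Pyr s%:C) (fun t => ysr s t s01).
  have P1 := C1path_clog (Pys s%:C) (fun t => ysc s01).
  apply: C1path_ext (C1pathM Pyp (C1pathM P1 P)) => // t t01.
  by field; rewrite ysr// ysn.
move=> H; transitivity (cint (fun t => clog (ys ((const_mx 1 : V) 0 0) t) * ((0 + (const_mx 1 : V) 0 0 * y' t) * (ys ((const_mx 1 : V) 0 0) t - r)^-1))).
  by apply: cint_ext => t _; rewrite !mxE /ys mul1r [p + _]addrC subrK add0r mul1r.
rewrite -H -[RHS](mul0r (cint (fun=> 0))) -cintZ; last exact: pcont_cst.
by apply: cint_ext => t _; rewrite !mxE !mul0r addr0 mul0r mulr0.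
Qed.

End Contraction.

End Homotopy.

Section LogarithmicDerivative.
Variable F : fieldType.

Lemma horner_prodXsubC (s : seq F) (x : F) :
  (\prod_(c <- s) ('X - c%:P)).[x] = \prod_(c <- s) (x - c).
Proof. by rewrite horner_prod; apply: eq_bigr => c _; rewrite hornerXsubC. Qed.

Lemma prodXsubC_logderiv (s : seq F) (x : F) : x \notin s ->
  (\prod_(c <- s) ('X - c%:P))^`().[x] =
  (\prod_(c <- s) ('X - c%:P)).[x] * \sum_(c <- s) (x - c)^-1.
Proof.
elim: s => [|c s IH]; first by rewrite !big_nil derivC horner0 mulr0.
rewrite inE negb_or => /andP[xc xs].
have xc0 : x - c != 0 by rewrite subr_eq0.
rewrite !big_cons derivM derivXsubC mul1r hornerD !hornerM hornerXsubC (IH xs).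
by field.
Qed.

End LogarithmicDerivative.

(** * Loops with a closed logarithm *)

Section ExponentialLoops.
Variable R : realType.
Local Notation C := R[i].

(** A residue computation for log w / (w - r) along w = exp z, by two contractions: to [r] when [r]
    lies in the disc of radius 1/2 around 1, and to 1 otherwise. The number [s] is a logarithm of
    [r] as soon as the index [j] is not 0. *)
Lemma winding_step (z z' : R -> C) (r : C) : C1path z z' -> z 0 = z 1 ->
  (forall t, 0 <= t <= 1 -> cabs (cexp (z t) - 1) < 1/2) ->
  (forall t, 0 <= t <= 1 -> cabs (z t) <= 1) ->
  (forall t, 0 <= t <= 1 -> cexp (z t) != r) ->
  exists (j : int) (s : C), [/\
    cint (fun t => cexp (z t) * z' t / (cexp (z t) - r)) = j%:~R * two_pi_i R,
    cint (fun t => z t * (cexp (z t) * z' t / (cexp (z t) - r))) = j%:~R * s * two_pi_i R &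
    j != 0 -> cexp s = r].
Proof.
move=> Pz z01 yd z1 yr; have Py := C1path_cexp Pz.
pose y t := cexp (z t); have y01 : y 0 = y 1 by rewrite /y z01.
have Rey t : 0 <= t <= 1 -> 0 < Re (y t).
  move=> /yd h; have := Re_cabs (y t - 1); rewrite !cplxE /= ler_norml => /andP[h1 h2].
  by rewrite -/(y t) in h; lra.
have zE t : 0 <= t <= 1 -> z t = clog (y t).
  move=> t01; apply: clog_unique => //; first exact: Rey.
  apply: (le_trans (Im_cabs _)); apply: (le_trans (z1 t t01)).
  by have := @pi_ge2 R; lra.
have Pyr : C1path (fun t => y t - r) (fun t => cexp (z t) * z' t).
  by apply: C1path_ext (C1pathB Py (C1path_cst r)) => // t _; rewrite subr0.
have [j Ej] : exists j : int, cint (fun t => cexp (z t) * z' t / (y t - r)) = j%:~R * two_pi_i R.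
  apply: closed_path_integer Pyr _ _; first by rewrite y01.
  by move=> t t01; rewrite subr_eq0; exact: yr.
have Ez u : cint (fun t => z t * (cexp (z t) * z' t / (cexp (z t) - u))) =
    cint (fun t => clog (y t) * (cexp (z t) * z' t / (y t - u))).
  by apply: cint_ext => t t01; congr (_ * _); exact: zE.
have [rd|rd] := ltP (cabs (r - 1)) (1/2).
  exists j, (clog r); split=> //.
    rewrite Ez (contract_inside Py y01 yd rd) ?Ej; first by ring.
    by move=> t t01; exact: yr.
  move=> _; apply: clogK.
  by have := Re_cabs (r - 1); rewrite !cplxE /= ler_norml; lra.
have d1 : cabs (1 - 1 : C) < 1/2 by rewrite subrr cabs0.
have [h1 h2] := contract_outside Py y01 yd d1 rd erefl.
(* Outside the disc the index is 0 and the value of [s] is irrelevant. *)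
by exists 0, 0; split; rewrite ?eqxx ?mul0r// Ez.
Qed.

(* A logarithm [l] of the loop [exp l] is divided by a large [n]; then
   [X^n - r] splits and each factor contributes one winding number. *)
Lemma exponential_loop (l l' : R -> C) (r : C) : C1path l l' -> l 0 = l 1 ->
  (forall t, 0 <= t <= 1 -> cexp (l t) != r) ->
  exists j : int,
    cint (fun t => cexp (l t) * l' t / (cexp (l t) - r)) = j%:~R * two_pi_i R /\
    cexp ((two_pi_i R)^-1 * cint (fun t => l t * (cexp (l t) * l' t / (cexp (l t) - r)))) = r ^ j.
Proof.
move=> Pl l01 lr; have [cl cl' _] := Pl.
have [M M0 lM] := pcont_bounded cl.
have [d d0 Hd] := @cexp_first_order R 1 ltr01.
(* For |z| < [d] one has |exp z - 1| <= 2 |z|, so 1/4 keeps exp z within 1/2 of 1. *)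
pose e := Num.min d (1/4).
have e0 : 0 < e by rewrite lt_min d0 divr_gt0.
have ed : e <= d by rewrite ge_min lexx.
have e4 : e <= 1/4 by rewrite ge_min lexx orbT.
pose n := Num.bound (M / e).
have nM : M / e < n%:R by apply: archi_boundP; rewrite divr_ge0// ltW.
have n0 : 0 < (n%:R : R) by apply: le_lt_trans nM; rewrite divr_ge0// ltW.
have nC : (n%:R : C) != 0 by rewrite pnatr_eq0 -lt0n -(ltr_nat R).
have n0' : (0 < n)%N by rewrite -(ltr_nat R).
pose z t := n%:R^-1 * l t.
have Pz : C1path z (fun t => n%:R^-1 * l' t) := C1pathZ _ Pl.
have z01 : z 0 = z 1 by rewrite /z l01.
have ze t : 0 <= t <= 1 -> cabs (z t) < e.
  move=> t01; rewrite /z cabsM cabsV cabs_nat mulrC ltr_pdivrMr//.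
  by apply: (le_lt_trans (lM t t01)); rewrite mulrC -ltr_pdivrMr.
have zd t : 0 <= t <= 1 -> cabs (cexp (z t) - 1) < 1/2.
  move=> /ze h; have := Hd _ (lt_le_trans h ed); rewrite mul1r => h2.
  have := cabs_triangle (cexp (z t) - 1 - z t) (z t); rewrite subrK; lra.
have z1 t : 0 <= t <= 1 -> cabs (z t) <= 1 by move=> /ze; lra.
have lz t : l t = n%:R * z t by rewrite /z mulVKf.
have yn t : cexp (l t) = cexp (z t) ^+ n by rewrite lz cexpMn.
have [s Es] := closed_field_poly_normal ('X^n - r%:P : {poly C}).
rewrite lead_coefXnsubC// scale1r in Es.
have sr c : c \in s -> c ^+ n = r.
  move=> cs; apply/eqP; rewrite -subr_eq0; have : root ('X^n - r%:P) c.
    by rewrite Es root_prod_XsubC.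
  by rewrite rootE hornerD hornerN hornerXn hornerC.
have ys t c : 0 <= t <= 1 -> c \in s -> cexp (z t) != c.
  by move=> t01 cs; apply: contra (lr t t01) => /eqP E; rewrite yn E sr.
(* The logarithmic derivative of exp l - r = prod (exp z - c) over the roots c of X^n - r, where l =
   n z. *)
have ld t : 0 <= t <= 1 -> cexp (l t) * l' t / (cexp (l t) - r) =
    \sum_(c <- s) cexp (z t) * (n%:R^-1 * l' t) / (cexp (z t) - c).
  move=> t01; have xs : cexp (z t) \notin s by apply/negP => /(ys t _ t01); rewrite eqxx.
  have := prodXsubC_logderiv xs; rewrite -Es derivB derivC subr0 derivXn.
  rewrite hornerMn hornerXn hornerD hornerN hornerXn hornerC => E.
  have nz : cexp (z t) ^+ n - r != 0 by rewrite subr_eq0 -yn; exact: lr.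
  rewrite -mulr_sumr; have -> : \sum_(c <- s) (cexp (z t) - c)^-1 =
      (cexp (z t) ^+ n.-1 *+ n) / (cexp (z t) ^+ n - r) by rewrite E mulrC mulKf.
  rewrite yn -[_ *+ n]mulr_natl; have E' := exprS (cexp (z t)) n.-1.
  rewrite prednK// in E'; rewrite {1}E'; field.
  by rewrite nz nC.
have key c : c \in s -> exists js : int * C, [/\
    cint (fun t => cexp (z t) * (n%:R^-1 * l' t) / (cexp (z t) - c)) = js.1%:~R * two_pi_i R,
    cint (fun t => z t * (cexp (z t) * (n%:R^-1 * l' t) / (cexp (z t) - c))) = js.1%:~R * js.2 * two_pi_i R &
    js.1 != 0 -> cexp js.2 = c].
  move=> cs; have [|j [w H]] := winding_step Pz z01 zd z1 (r := c); last by exists (j, w).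
  by move=> t t01; exact: ys.
have cI c : c \in s -> pcont (fun t => cexp (z t) * (n%:R^-1 * l' t) / (cexp (z t) - c)).
  move=> cs; have [cz' cz'' _] := C1path_cexp Pz; apply: pcontM => //.
  apply: pcontV; first by apply: pcontD => //; exact: pcont_cst.
  by move=> t t01; rewrite subr_eq0 ys.
have [cz _ _] := Pz.
have cs1 (f : C -> R -> C) (q : seq C) : {subset q <= s} -> (forall c, c \in s -> pcont (f c)) ->
    pcont (fun t => \sum_(c <- q) f c t) /\
    cint (fun t => \sum_(c <- q) f c t) = \sum_(c <- q) cint (f c).
  elim: q => [|c q IH] qs cf.
    split; first by apply: (pcont_ext _ (pcont_cst 0)) => t _; rewrite big_nil.
    by rewrite big_nil -[RHS](mul0r (cint (fun=> 0))) -cintZ; [apply: cint_ext => t _; rewrite big_nil mul0r|exact: pcont_cst].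
  have [c1 c2] := IH (fun x xq => qs x (mem_behead (s := c :: q) xq)) cf.
  have cc : pcont (f c) by apply: cf; apply: qs; exact: mem_head.
  split; first by apply: (pcont_ext _ (pcontD cc c1)) => t _; rewrite big_cons.
  by rewrite big_cons -c2 -cintD//; apply: cint_ext => t _; rewrite big_cons.
have I1 : cint (fun t => cexp (l t) * l' t / (cexp (l t) - r)) =
    \sum_(c <- s) cint (fun t => cexp (z t) * (n%:R^-1 * l' t) / (cexp (z t) - c)).
  by rewrite (cint_ext ld); apply: (cs1 (fun c t => _) s _ cI).2.
have I2 : cint (fun t => l t * (cexp (l t) * l' t / (cexp (l t) - r))) =
    n%:R * \sum_(c <- s) cint (fun t => z t * (cexp (z t) * (n%:R^-1 * l' t) / (cexp (z t) - c))).
  have cI' c : c \in s -> pcont (fun t => z t * (cexp (z t) * (n%:R^-1 * l' t) / (cexp (z t) - c))).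
    by move=> cs; apply: pcontM => //; exact: cI.
  have [c1 <-] := cs1 (fun c t => z t * (cexp (z t) * (n%:R^-1 * l' t) / (cexp (z t) - c))) s (fun _ => id) cI'.
  rewrite -cintZ//; apply: cint_ext => t t01; rewrite ld// lz -mulrA; congr (_ * _).
  by rewrite mulr_sumr.
suff H (q : seq C) : {subset q <= s} -> exists j : int,
    \sum_(c <- q) cint (fun t => cexp (z t) * (n%:R^-1 * l' t) / (cexp (z t) - c)) = j%:~R * two_pi_i R /\
    cexp ((two_pi_i R)^-1 * (n%:R * \sum_(c <- q) cint (fun t => z t * (cexp (z t) * (n%:R^-1 * l' t) / (cexp (z t) - c))))) = r ^ j.
  by have [j [E1 E2]] := H s (fun _ => id); exists j; rewrite I1 I2.
have tpi := two_pi_i_neq0 R.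
elim: q => [|c q IH] qs.
  by exists 0; rewrite !big_nil !mul0r !mulr0 cexp0.
have [j [E1 E2]] := IH (fun x xq => qs x (mem_behead (s := c :: q) xq)).
have cs : c \in s by apply: qs; exact: mem_head.
have [[i w] /= [F1 F2 F3]] := key c cs.
have rn0 : i != 0 -> r != 0.
  by move=> /F3 E; rewrite -(sr c cs) -E -cexpMn cexp_neq0.
exists (i + j); rewrite !big_cons E1 F1 F2 intrD mulrDl; split=> //.
rewrite !mulrDr cexpD E2; have [->|i0] := eqVneq i 0.
  by rewrite !mul0r !mulr0 cexp0 mul1r add0r.
rewrite expfzDr ?rn0//; congr (_ * _).
(* The factor n turns the logarithm w of c into a logarithm of c^n = r. *)
have -> : (two_pi_i R)^-1 * (n%:R * (i%:~R * w * two_pi_i R)) = i%:~R * (n%:R * w) by field.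
by rewrite cexpMz cexpMn F3// sr.
Qed.

End ExponentialLoops.

(** * The index of a point, and integrals of logarithms against dz / z *)

Section WindingNumbers.
Variable R : realType.
Local Notation C := R[i].
Variables (g g' : R -> C).
Hypotheses (Pg : C1path g g') (g01 : g 0 = g 1).

Definition off_curve (z : C) := forall t : R, 0 <= t <= 1 -> g t != z.

Definition index_integral (z : C) : C := cint (fun t => g' t / (g t - z)).

Let Pgz z : C1path (fun t => g t - z) g'.
Proof. by apply: C1path_ext (C1pathB Pg (C1path_cst z)) => // t _; rewrite subr0. Qed.

Let gz z t : off_curve z -> 0 <= t <= 1 -> g t - z != 0.
Proof. by move=> oz t01; rewrite subr_eq0 oz. Qed.

Lemma index_integer z : off_curve z -> exists k : int, index_integral z = k%:~R * two_pi_i R.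
Proof.
move=> oz; apply: closed_path_integer (Pgz z) _ _; first by rewrite g01.
by move=> t; exact: gz.
Qed.

Lemma index_homotopy z w : (forall s t : R, 0 <= s <= 1 -> 0 <= t <= 1 -> g t - z - s%:C * (w - z) != 0) ->
  index_integral z = index_integral w.
Proof.
move=> H; have := homotopy_winding (Pgz z) (C1path_cst (z - w)) _ erefl.
rewrite g01 => /(_ erefl) /(_ _)/wrap[].
  by move=> s t s01 t01; have := H s t s01 t01; rewrite -mulrN opprB.
move=> E; apply: (etrans E); apply: cint_ext => t _; rewrite addr0; congr (_ / _); ring.
Qed.

Lemma index_locally_constant z : off_curve z ->
  exists2 d : R, 0 < d & forall w, cabs (w - z) < d -> off_curve w /\ index_integral w = index_integral z.
Proof.
move=> oz; have [cg _ _] := Pgz z.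
have [K K0 HK] := pcont_lower cg (fun t => gz oz); exists K => // w wz.
have H (s t : R) : 0 <= s <= 1 -> 0 <= t <= 1 -> g t - z - s%:C * (w - z) != 0.
  move=> /andP[s0 s1] t01; rewrite -cabs_gt0.
  have := cabs_lowtri (g t - z) (s%:C * (w - z)); have := HK t t01.
  rewrite cabsM cabsR ger0_norm//; have := cabs_ge0 (w - z); nra.
split; last by rewrite (index_homotopy H).
move=> t t01; have := H 1 t; rewrite lexx ler01 => /(_ erefl t01).
by rewrite mul1r opprB addrA subrK subr_eq0.
Qed.

(** The family - z + s g shrinks the loop to a constant; it avoids 0 when |z| exceeds the bound of
    g. *)
Lemma index_far : exists2 M : R, 0 < M & forall z, M < cabs z -> off_curve z /\ index_integral z = 0.
Proof.
have [cg _ _] := Pg; have [M M0 HM] := pcont_bounded cg; exists M => // z Mz.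
have oz : off_curve z.
  by move=> t t01; apply: contraTneq Mz => <-; rewrite -leNgt HM.
split=> //; have := homotopy_winding (C1path_cst (- z)) Pg erefl g01.
move=> /(_ _)/wrap[].
  move=> s t /andP[s0 s1] t01; rewrite -cabs_gt0.
  have := cabs_lowtri (- z) (- (s%:C * g t)); rewrite opprK !cabsN cabsM cabsR ger0_norm//.
  by have := HM t t01; have := cabs_ge0 (g t); nra.
move=> H; rewrite -[RHS](mul0r (cint (fun=> 0))) -cintZ; last exact: pcont_cst.
transitivity (cint (fun t => (0 + g' t) / (- z + g t))).
  by apply: cint_ext => t _; rewrite add0r [- z + _]addrC.
by rewrite -H; apply: cint_ext => t _; rewrite !mul0r.
Qed.

Lemma off_curve_open : open [set z | off_curve z].
Proof.
rewrite openE => z oz; apply/nbhs_cabs.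
by have [d d0 H] := index_locally_constant oz; exists d => // w /H[].
Qed.

(** The component of z in the complement is unbounded, so it contains a point covered by
    [index_far]; the index is locally constant on it. *)
Lemma not_enclosed_index z : off_curve z -> ~ enclosed g z -> index_integral z = 0.
Proof.
move=> oz nez; have E : (~` (g @` `[0, 1]%classic)) = [set z | off_curve z].
  apply/seteqP; split=> w /= H.
    move=> t t01; apply/eqP => gw; by apply: H; exists t.
  by move=> [t t01 gw]; have := H t t01; rewrite gw eqxx.
rewrite /enclosed E in nez.
pose D : set C := connected_component [set z | off_curve z] z; have DU : D `<=` [set z | off_curve z].
  exact: connected_component_sub.
have Dz : D z by exact: connected_component_refl.
have cD : connected D by exact: component_connected.
have [M M0 HM] := index_far.
have [w Dw Mw] : exists2 w, D w & M < cabs w.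
  apply: contrapT => H; apply: nez; split=> //; rewrite -/D; exists M%:C; split.
    by apply: gtr0_real; rewrite ltcR.
  move=> x Mx w Dw; apply: ltW; apply: le_lt_trans Mx.
  rewrite normcabs lecR leNgt; apply/negP => h; apply: H; by exists w.
rewrite -[RHS](HM w Mw).2.
apply: (locally_constant_connected off_curve_open DU cD) => // b ob.
by apply/nbhs_cabs; have [d d0 H] := index_locally_constant ob; exists d => // x /H[].
Qed.

Hypothesis g0 : off_curve 0.

Definition log_integral (l : R -> C) : C := (two_pi_i R)^-1 * cint (fun t => l t * (g' t / g t)).

Let cdg : pcont (fun t => g' t / g t).
Proof.
have [cg cg' _] := Pg; apply: pcontM => //; apply: pcontV => // t; exact: g0.
Qed.

Lemma log_integralD l m : pcont l -> pcont m ->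
  log_integral (fun t => l t + m t) = log_integral l + log_integral m.
Proof.
move=> cl cm; rewrite /log_integral -mulrDr -cintD; [|exact: pcontM..].
by congr (_ * _); apply: cint_ext => t _; rewrite mulrDl.
Qed.

Lemma log_integral_cst (c : C) (k : int) : index_integral 0 = k%:~R * two_pi_i R ->
  cexp (log_integral (fun=> c)) = cexp c ^ k.
Proof.
move=> Ek; rewrite /log_integral cintZ//.
have -> : cint (fun t => g' t / g t) = k%:~R * two_pi_i R.
  by rewrite -Ek; apply: cint_ext => t _; rewrite subr0.
have tp := two_pi_i_neq0 R.
have -> : (two_pi_i R)^-1 * (c * (k%:~R * two_pi_i R)) = k%:~R * c by field.
exact: cexpMz.
Qed.

Section Logarithms.
Variable lg : C -> R -> C.
Hypothesis Plg : forall z, off_curve z -> C1path (lg z) (fun t => g' t / (g t - z)).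
Hypothesis Elg : forall z, off_curve z -> forall t : R, 0 <= t <= 1 -> cexp (lg z t) = g t - z.

Lemma lg_jump z : off_curve z -> lg z 1 - lg z 0 = index_integral z.
Proof. by move=> oz; rewrite -(C1path_integral (Plg oz)). Qed.

Let intC (k k' : int) : k%:~R * two_pi_i R = k'%:~R * two_pi_i R -> k = k'.
Proof. by move=> /(mulIf (two_pi_i_neq0 R)) /intr_inj. Qed.

(* [z] has index 0, so [g - z] has a closed logarithm and [g'/g] is
   [(g - z)' / ((g - z) - (- z))]. *)
Lemma log_integral_outside z (k : int) : off_curve z -> index_integral z = 0 ->
  index_integral 0 = k%:~R * two_pi_i R ->
  cexp (log_integral (lg z)) = (- z) ^ k.
Proof.
move=> oz iz ik; have [|t t01|j [E1 E2]] := exponential_loop (r := - z) (Plg oz).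
- by apply/esym/eqP; rewrite -subr_eq0 lg_jump// iz.
- by rewrite Elg// subr_eq addNr g0.
have H t : 0 <= t <= 1 -> cexp (lg z t) * (g' t / (g t - z)) / (cexp (lg z t) - - z) = g' t / g t.
  by move=> t01; rewrite Elg// opprK subrK; field; rewrite gz// g0.
rewrite (_ : k = j); last first.
  apply: intC; rewrite -ik -E1; apply: cint_ext => t t01; rewrite H//.
  by rewrite subr0.
rewrite -E2; congr (cexp (_ * _)); apply: cint_ext => t t01; by rewrite H.
Qed.

(* With [f = (g - q) / (g - p)] one has [g = (q - p f) / (1 - f)]. *)
Lemma log_integral_pair q p (k i : int) : off_curve q -> off_curve p -> q != p ->
  index_integral q = i%:~R * two_pi_i R -> index_integral p = i%:~R * two_pi_i R ->
  index_integral 0 = k%:~R * two_pi_i R ->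
  cexp (log_integral (fun t => lg q t - lg p t)) = (q / p) ^ (k - i).
Proof.
move=> oq op qp iq ip ik.
pose l t := lg q t - lg p t; pose l' t := g' t / (g t - q) - g' t / (g t - p).
have Pl : C1path l l' by apply: C1pathB; exact: Plg.
have El t : 0 <= t <= 1 -> cexp (l t) = (g t - q) / (g t - p).
  by move=> t01; rewrite cexpB !Elg.
have l01 : l 0 = l 1.
  apply/esym/eqP; rewrite -subr_eq0 /l opprB addrACA [- _ + _]addrC.
  rewrite (_ : _ + _ = (lg q 1 - lg q 0) - (lg p 1 - lg p 0)); last by ring.
  by rewrite !lg_jump// iq ip subrr.
have pq0 : p - q != 0 by rewrite subr_eq0 eq_sym.
(* The function f takes the value 1 where g would be infinite and q / p where g would be 0: g' / g =
   f' / (f - q / p) - f' / (f - 1). *)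
have [t t01|j1 [E1 E1']] := exponential_loop (r := 1) Pl l01.
  rewrite El// -subr_eq0 (_ : _ - 1 = (p - q) / (g t - p)); last by field; rewrite gz.
  by rewrite mulf_neq0// invr_eq0 gz.
have H1 t : 0 <= t <= 1 -> cexp (l t) * l' t / (cexp (l t) - 1) = - (g' t / (g t - p)).
  move=> t01; rewrite El// /l'; have h1 := gz oq t01; have h2 := gz op t01.
  rewrite (_ : (g t - q) / (g t - p) - 1 = (p - q) / (g t - p)); last by field.
  by field; rewrite pq0 h1 h2.
rewrite exp1rz in E1'; have cl : pcont l by case: Pl.
have cexp1 : pcont (fun t => cexp (l t) * l' t / (cexp (l t) - 1)).
  have [ce ce' _] := C1path_cexp Pl; apply: pcontM => //; apply: pcontV.
    by apply: pcontD => //; exact: pcont_cst.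
  move=> t t01; rewrite El// (_ : _ - 1 = (p - q) / (g t - p)); last by field; rewrite gz.
  by rewrite mulf_neq0// invr_eq0 gz.
(* For p = 0 only the value 1 occurs: g' / g is minus f' / (f - 1), and k = i because p is the
   origin. *)
have [p0|p0] := eqVneq p 0.
  have -> : k = i by apply: intC; rewrite -ik -ip p0.
  rewrite subrr expr0z.
  have -> : log_integral l = - ((two_pi_i R)^-1 * cint (fun t => l t * (cexp (l t) * l' t / (cexp (l t) - 1)))).
    rewrite -mulrN -mulN1r -cintZ; last exact: pcontM.
    congr (_ * _); apply: cint_ext => t t01; rewrite H1// p0 subr0.
    by rewrite mulrN mulN1r opprK.
  by rewrite cexpN E1' invr1.
have [t t01|j2 [E2 E2']] := exponential_loop (r := q / p) Pl l01.
  rewrite El// -subr_eq0 (_ : _ - _ = g t * (p - q) / (p * (g t - p))); last by field; rewrite p0 gz.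
  by rewrite !mulf_neq0// ?invr_eq0 ?mulf_neq0 ?gz// g0.
have H2 t : 0 <= t <= 1 -> cexp (l t) * l' t / (cexp (l t) - q / p) = g' t / g t - g' t / (g t - p).
  move=> t01; rewrite El// /l'; have h1 := gz oq t01; have h2 := gz op t01; have h3 := g0 t01.
  rewrite (_ : (g t - q) / (g t - p) - q / p = g t * (p - q) / (p * (g t - p))); last by field; rewrite p0 h2.
  by field; rewrite p0 pq0 h1 h2 h3.
have -> : k - i = j2.
  apply: intC; rewrite -E2 intrB mulrBl -ik -ip; apply/eqP; rewrite subr_eq; apply/eqP.
  have cp : pcont (fun t => g' t / (g t - p)) by case: (Plg op).
  rewrite /index_integral -cintD//.
    by apply: cint_ext => t t01; rewrite H2// subr0 subrK.
  apply: (@pcont_ext _ (fun t => g' t / g t - g' t / (g t - p))).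
    by move=> t t01; rewrite H2.
  by apply: pcontD => //; exact: pcontN.
have -> : log_integral l = (two_pi_i R)^-1 * cint (fun t => l t * (cexp (l t) * l' t / (cexp (l t) - q / p)))
   - ((two_pi_i R)^-1 * cint (fun t => l t * (cexp (l t) * l' t / (cexp (l t) - 1)))).
  have c2 : pcont (fun t => cexp (l t) * l' t / (cexp (l t) - q / p)).
    apply: (@pcont_ext _ (fun t => g' t / g t - g' t / (g t - p))).
      by move=> t t01; rewrite H2.
    by apply: pcontD => //; apply: pcontN; case: (Plg op).
  rewrite -mulrBr; congr (_ * _); rewrite -cintB; [|exact: pcontM..].
  apply: cint_ext => t t01; rewrite H1// H2//.
  by field; rewrite gz// g0.
by rewrite cexpB E1' E2' divr1.
Qed.

End Logarithms.

End WindingNumbers.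

(** * Logarithmic integrals of a rational function *)

Section ZerosAndPoles.
Variable R : realType.
Local Notation C := R[i].

Lemma sum_zip (S T : Type) (V : zmodType) (s : seq S) (t : seq T) (f : S -> V) (h : T -> V) :
  size s = size t ->
  \sum_(x <- s) f x - \sum_(x <- t) h x = \sum_(x <- zip s t) (f x.1 - h x.2).
Proof.
elim: s t => [|a s IH] [|b t]//=; first by rewrite !big_nil subrr.
by move=> [/IH E]; rewrite !big_cons -E opprD addrACA.
Qed.

Lemma prod_zip (S T : Type) (F : fieldType) (s : seq S) (t : seq T) (f : S -> F) (h : T -> F) :
  size s = size t ->
  (\prod_(x <- s) f x) / (\prod_(x <- t) h x) = \prod_(x <- zip s t) (f x.1 / h x.2).
Proof.
elim: s t => [|a s IH] [|b t]//=; first by rewrite !big_nil divr1.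
by move=> [/IH E]; rewrite !big_cons -E invfM mulrACA.
Qed.

Lemma within_continuous_pcont (L : R -> C) : {within `[0, 1]%classic, continuous L} -> pcont L.
Proof.
move=> /subspace_continuousP cL t t01 e e0.
have t01' : `[0, 1]%classic t by rewrite /= in_itv.
have ec : 0 < e%:C by rewrite ltcR.
have FF : Filter (within `[0, 1]%classic (nbhs t)) by exact: within_filter.
have /(@cvgrPdist_lt _ _ _ _ FF)/(_ _ ec)/nbhs_ballP[d /= d0 H] := cL t t01'.
exists d => // s s01 sd; have := H s; rewrite /ball /= distrC => /(_ sd).
by rewrite in_itv /= s01 distrC normr_ltc; exact.
Qed.

Variables (g g' : R -> C).
Hypotheses (Pg : C1path g g') (g01 : g 0 = g 1).
Hypothesis g0 : off_curve g 0.

(** On the curve a default value keeps [lg z] continuous, so that sums over arbitrary lists are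
    continuous without side conditions. *)
Lemma logarithms_exist : exists lg : C -> R -> C, [/\
  forall z, pcont (lg z),
  forall z, off_curve g z -> C1path (lg z) (fun t => g' t / (g t - z)) &
  forall z, off_curve g z -> forall t : R, 0 <= t <= 1 -> cexp (lg z t) = g t - z].
Proof.
have /(_ _)/cid H z : exists l : R -> C, pcont l /\ (off_curve g z ->
    C1path l (fun t => g' t / (g t - z)) /\ forall t : R, 0 <= t <= 1 -> cexp (l t) = g t - z).
  have [oz|noz] := pselect (off_curve g z); last by exists (fun=> 0); split=> //; exact: pcont_cst.
  have Pz : C1path (fun t => g t - z) g'.
    by apply: C1path_ext (C1pathB Pg (C1path_cst z)) => // t _; rewrite subr0.
  have [|l Pl El] := log_exists Pz; first by move=> t t01; rewrite subr_eq0 oz.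
  by exists l; split=> //; case: Pl.
exists (fun z => sval (H z)).
by split=> z; case: (H z) => l [cl Hl] //= /Hl[].
Qed.

Lemma log_integral_ext l m : (forall t : R, 0 <= t <= 1 -> l t = m t) ->
  log_integral g g' l = log_integral g g' m.
Proof. by move=> lm; congr (_ * _); apply: cint_ext => t t01; rewrite lm. Qed.

Lemma log_integral_sum (I : Type) (s : seq I) (F : I -> R -> C) : (forall i, pcont (F i)) ->
  log_integral g g' (fun t => \sum_(i <- s) F i t) = \sum_(i <- s) log_integral g g' (F i).
Proof.
move=> cF; elim: s => [|i s IH].
  rewrite big_nil /log_integral -[RHS](mulr0 (two_pi_i R)^-1); congr (_ * _).
  by rewrite -[RHS]cint0; apply: cint_ext => t _; rewrite big_nil mul0r.
rewrite big_cons -IH -(log_integralD Pg)//; last by apply: pcont_sum.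
by apply: log_integral_ext => t _; rewrite big_cons.
Qed.

Lemma log_integralN l : pcont l -> log_integral g g' (fun t => - l t) = - log_integral g g' l.
Proof.
move=> cl; have [cg cg' _] := Pg.
have cI : pcont (fun t => l t * (g' t / g t)).
  by apply: pcontM => //; apply: pcontM => //; apply: pcontV => // t; exact: g0.
rewrite /log_integral -mulrN; congr (_ * _).
rewrite -[RHS]sub0r -(@cint0 R) -cintB//; last exact: pcont_cst.
by apply: cint_ext => t _; rewrite sub0r mulNr.
Qed.

(** L is a constant plus the logarithms of the linear factors. Those of inner points do not close
    up, but L does, so there are as many inner zeros as poles; each pair of them has a closed
    difference of logarithms, and outer points are treated one by one. *)
Lemma log_integral_zeros_poles (L : R -> C) (c : C) (qin qout pin pout : seq C) (i k : int) :
  i != 0 -> c != 0 ->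
  (forall z, z \in qin ++ pin -> off_curve g z /\ index_integral g g' z = i%:~R * two_pi_i R) ->
  (forall z, z \in qout ++ pout -> off_curve g z /\ index_integral g g' z = 0) ->
  index_integral g g' 0 = k%:~R * two_pi_i R ->
  (forall z, ~ (z \in qin /\ z \in pin)) ->
  pcont L -> L 0 = L 1 ->
  (forall t : R, 0 <= t <= 1 -> cexp (L t) =
     c * \prod_(w <- qin ++ qout) (g t - w) / \prod_(w <- pin ++ pout) (g t - w)) ->
  size qin = size pin /\
  cexp (log_integral g g' L) =
    c ^ k * \prod_(x <- zip qin pin) (x.1 / x.2) ^ (k - i) *
    (\prod_(w <- qout) (- w) ^ k / \prod_(w <- pout) (- w) ^ k).
Proof.
move=> i0 c0 Hin Hout Hk disj cL L01 EL.
have [lg [clg Plg Elg]] := logarithms_exist.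
have oqi z : z \in qin -> off_curve g z by move=> zq; apply: (Hin z _).1; rewrite mem_cat zq.
have opi z : z \in pin -> off_curve g z by move=> zq; apply: (Hin z _).1; rewrite mem_cat zq orbT.
have oqo z : z \in qout -> off_curve g z by move=> zq; apply: (Hout z _).1; rewrite mem_cat zq.
have opo z : z \in pout -> off_curve g z by move=> zq; apply: (Hout z _).1; rewrite mem_cat zq orbT.
pose Q t := \sum_(w <- qin ++ qout) lg w t; pose P t := \sum_(w <- pin ++ pout) lg w t.
have cQ : pcont Q by apply: pcont_sum.
have cP : pcont P by apply: pcont_sum.
have EQ (s : seq C) t : (forall z, z \in s -> off_curve g z) -> 0 <= t <= 1 ->
    cexp (\sum_(w <- s) lg w t) = \prod_(w <- s) (g t - w).
  move=> os t01; rewrite -(big_map (fun w => lg w t) predT id) cexp_sum big_map.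
  by apply: eq_big_seq => w /os ow; exact: Elg.
have oQ z : z \in qin ++ qout -> off_curve g z by rewrite mem_cat => /orP[/oqi|/oqo].
have oP z : z \in pin ++ pout -> off_curve g z by rewrite mem_cat => /orP[/opi|/opo].
(* A continuous logarithm of the constant c, hence itself constant. *)
pose K t := L t - Q t + P t.
have cK : pcont K by apply: pcontD => //; apply: pcontD => //; exact: pcontN.
have nz (s : seq C) t : (forall z, z \in s -> off_curve g z) -> 0 <= t <= 1 ->
    \prod_(w <- s) (g t - w) != 0.
  by move=> os t01; rewrite -EQ// cexp_neq0.
have EK t : 0 <= t <= 1 -> cexp (K t) = c.
  move=> t01; rewrite /K cexpD cexpB EL// /Q /P !EQ//.
  by field; rewrite !nz.
have PK := C1path_log (C1path_cst c) cK EK.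
have {}PK : C1path K (fun=> 0) by apply: C1path_ext PK => // t _; rewrite mul0r.
have K0 t : 0 <= t <= 1 -> K t = K 0 := C1path_constant PK (t := t).
have LE t : 0 <= t <= 1 -> L t = K 0 + (Q t - P t).
  by move=> t01; rewrite -(K0 t t01) /K; ring.
have u01 : 0 <= (1 : R) <= 1 by rewrite lexx ler01.
have z01 : 0 <= (0 : R) <= 1 by rewrite lexx ler01.
have tp := two_pi_i_neq0 R.
have jump (s : seq C) : (forall z, z \in s -> off_curve g z) ->
    \sum_(w <- s) lg w 1 - \sum_(w <- s) lg w 0 = \sum_(w <- s) index_integral g g' w.
  move=> os; rewrite -sumrB; apply: eq_big_seq => w /os ow.
  exact: (lg_jump Plg).
have sumin (s : seq C) : {subset s <= qin ++ pin} ->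
    \sum_(w <- s) index_integral g g' w = (size s)%:R * (i%:~R * two_pi_i R).
  move=> ss; rewrite (eq_big_seq (fun=> i%:~R * two_pi_i R)); last by move=> w /ss /Hin[].
  by rewrite big_const_seq count_predT iter_addr_0 mulr_natl.
have sumout (s : seq C) : {subset s <= qout ++ pout} ->
    \sum_(w <- s) index_integral g g' w = 0.
  by move=> ss; rewrite big_seq big1// => w /ss /Hout[].
have sz : size qin = size pin.
  have : (Q 1 - Q 0) - (P 1 - P 0) = 0.
    have := LE 1 u01; have := LE 0 z01; rewrite -L01 => -> E.
    have : (Q 1 - P 1) - (Q 0 - P 0) = 0 by move/addrI: E => ->; rewrite subrr.
    by move=> <-; ring.
  rewrite /Q /P !jump// !big_cat /= (sumin qin) ?(sumin pin) ?(sumout qout) ?(sumout pout);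
    try by move=> w wp; rewrite mem_cat wp ?orbT.
  rewrite !addr0 -mulrBl => /eqP; rewrite mulf_eq0 mulf_eq0 (negPf tp) intr_eq0 (negPf i0) !orbF.
  by rewrite subr_eq0 eqr_nat => /eqP.
split=> //.
have cLg (w : C) : pcont (lg w) by [].
rewrite (log_integral_ext LE) (log_integralD Pg)//; [|exact: pcont_cst|by apply: pcontD => //; exact: pcontN].
rewrite cexpD -mulrA; congr (_ * _); first by rewrite (log_integral_cst Pg g0 (K 0) Hk) EK.
have -> : log_integral g g' (fun t => Q t - P t) =
   \sum_(x <- zip qin pin) log_integral g g' (fun t => lg x.1 t - lg x.2 t) +
   (\sum_(w <- qout) log_integral g g' (lg w) - \sum_(w <- pout) log_integral g g' (lg w)).
  rewrite -!log_integral_sum//; last first.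
    by move=> x; apply: pcontD => //; exact: pcontN.
  rewrite -log_integralN; last exact: pcont_sum.
  have c1 : pcont (fun t => \sum_(w <- qout) lg w t) by exact: pcont_sum.
  have c2 : pcont (fun t => - \sum_(w <- pout) lg w t) by apply: pcontN; exact: pcont_sum.
  have c3 : pcont (fun t => \sum_(x <- zip qin pin) (lg x.1 t - lg x.2 t)).
    by apply: pcont_sum => x _; apply: pcontD => //; exact: pcontN.
  rewrite -(log_integralD Pg g0 c1 c2) -(log_integralD Pg g0 c3 (pcontD c1 c2)).
  apply: log_integral_ext => t _; rewrite /Q /P !big_cat /=.
  rewrite -(sum_zip (fun q => lg q t) (fun p => lg p t) sz); ring.
rewrite cexpD; congr (_ * _).
  rewrite -(big_map (fun x => log_integral g g' (fun t => lg x.1 t - lg x.2 t)) predT id) cexp_sum big_map.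
  apply: eq_big_seq => -[q p] /= qp.
  have /andP[qq pp] : (q \in qin) && (p \in pin).
    have H := qp; rewrite -[qin](unzip1_zip (s := qin) (t := pin)) ?sz// -[X in _ && (_ \in X)](unzip2_zip (s := qin) (t := pin)) ?sz//.
    by rewrite (map_f fst qp) (map_f snd qp).
  apply: (log_integral_pair Pg g0 Plg Elg) => //; [exact: oqi|exact: opi| | |].
  - by apply/eqP => E; apply: (disj q); split=> //; rewrite E.
  - by apply: (Hin q _).2; rewrite mem_cat qq.
  - by apply: (Hin p _).2; rewrite mem_cat pp orbT.
rewrite cexpB -!(big_map (fun x => log_integral g g' (lg x)) predT id) !cexp_sum !big_map.
congr (_ / _); apply: eq_big_seq => w ws.
  apply: (log_integral_outside g0 Plg Elg) => //; first exact: oqo.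
  by apply: (Hout w _).2; rewrite mem_cat ws.
apply: (log_integral_outside g0 Plg Elg) => //; first exact: opo.
by apply: (Hout w _).2; rewrite mem_cat ws orbT.
Qed.

End ZerosAndPoles.

(** * Tangent vectors as polynomials *)

Section PartialFractions.
Variables (F : fieldType) (r : seq nat) (p : nat -> F) (K : nat -> nat).
Hypotheses (ur : uniq r) (ip : {in r &, injective p}).
Implicit Types (q : {poly F}) (c : nat -> nat -> F) (z : F).

Definition pf_den : {poly F} := \prod_(i <- r) ('X - (p i)%:P) ^+ K i.
Definition pf_cofactor (i : nat) : {poly F} :=
  \prod_(l <- r | l != i) ('X - (p l)%:P) ^+ K l.
Definition pf_polar c (i : nat) : {poly F} :=
  \sum_(1 <= j < (K i).+1) c i j *: ('X - (p i)%:P) ^+ (K i - j).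
(** The numerator of q + sum c_ij (z - p_i)^-j over the denominator [pf_den] (see [pf_eval]). *)
Definition pf_num q c : {poly F} :=
  q * pf_den + \sum_(i <- r) pf_polar c i * pf_cofactor i.

Lemma pf_den_cofactor i : i \in r -> pf_den = ('X - (p i)%:P) ^+ K i * pf_cofactor i.
Proof. by move=> ir; rewrite /pf_den (bigD1_seq i). Qed.

Lemma pf_den_neq0 z : (forall i, i \in r -> z != p i) -> pf_den.[z] != 0.
Proof.
move=> zr; rewrite horner_prod prodf_seq_neq0; apply/allP => i ir /=.
by rewrite horner_exp hornerXsubC expf_neq0// subr_eq0 zr.
Qed.

Lemma pf_cofactor_neq0 i : i \in r -> (pf_cofactor i).[p i] != 0.
Proof.
move=> ir; rewrite horner_prod prodf_seq_neq0; apply/allP => l lr /=.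
apply/implyP => li; rewrite horner_exp hornerXsubC expf_neq0// subr_eq0.
by apply: contra li => /eqP/ip->.
Qed.

Lemma pf_polar_eval c i z : z != p i ->
  (pf_polar c i).[z] = (z - p i) ^+ K i * \sum_(1 <= j < (K i).+1) c i j * (z - p i) ^- j.
Proof.
move=> zp; rewrite /pf_polar horner_sum big_distrr /=; apply: eq_big_nat => j /andP[j1 jK].
rewrite hornerZ horner_exp hornerXsubC mulrCA; congr (_ * _).
by rewrite expfB_cond// subr_eq0 (negPf zp).
Qed.

Lemma pf_eval q c z : (forall i, i \in r -> z != p i) ->
  (pf_num q c).[z] = pf_den.[z] *
    (q.[z] + \sum_(i <- r) \sum_(1 <= j < (K i).+1) c i j * (z - p i) ^- j).
Proof.
move=> zr; rewrite /pf_num hornerD hornerM mulrDr mulrC; congr (_ + _).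
rewrite horner_sum mulr_sumr; apply: eq_big_seq => i ir.
rewrite hornerM pf_polar_eval ?zr// (pf_den_cofactor ir) hornerM horner_exp hornerXsubC.
by ring.
Qed.

Lemma pf_num_pole q c i : i \in r -> (0 < K i)%N ->
  (pf_num q c).[p i] = c i (K i) * (pf_cofactor i).[p i].
Proof.
move=> ir Ki; have root0 l : l \in r -> l != i -> (pf_cofactor l).[p i] = 0.
  move=> lr li; rewrite /pf_cofactor (big_rem i)//= eq_sym li hornerM horner_exp hornerXsubC.
  by rewrite subrr expr0n eqn0Ngt Ki mul0r.
rewrite /pf_num hornerD hornerM (pf_den_cofactor ir) hornerM horner_exp hornerXsubC.
rewrite subrr expr0n eqn0Ngt Ki mul0r mulr0 add0r horner_sum (bigD1_seq i)//=.
rewrite [X in _ + X]big_seq_cond big1 ?addr0; last first.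
  by move=> l /andP[lr li]; rewrite hornerM root0// mulr0.
rewrite hornerM; congr (_ * _); rewrite /pf_polar big_nat_recr//= hornerD horner_sum.
rewrite big_nat big1 ?add0r; last first.
  move=> j /andP[j1 jK]; rewrite hornerZ horner_exp hornerXsubC subrr expr0n subn_eq0.
  by rewrite leqNgt jK mulr0.
by rewrite hornerZ subnn expr0 hornerC mulr1.
Qed.

Lemma size_pf_polar c i : (size (pf_polar c i) <= K i)%N.
Proof.
apply: (leq_trans (size_sum _ _ _)); rewrite big_nat_cond; apply/bigmax_leqP_seq => j _.
move=> /andP[/andP[j1 jK] _]; apply: (leq_trans (size_scale_leq _ _)).
by rewrite size_exp_XsubC; lia.
Qed.

Lemma size_pf_den : size pf_den = (\sum_(i <- r) K i).+1.
Proof.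
rewrite /pf_den; elim: r => [|i s IH]; first by rewrite !big_nil size_poly1.
rewrite !big_cons size_monicM ?monic_exp ?monicXsubC// ?size_exp_XsubC ?IH ?addSn ?addnS//.
by rewrite -size_poly_eq0 IH.
Qed.

Lemma monic_pf_den : pf_den \is monic.
Proof. by apply: monic_prod => i _; rewrite monic_exp// monicXsubC. Qed.

Lemma size_pf_cofactor i : i \in r -> (size (pf_cofactor i) = (\sum_(l <- r) K l - K i).+1)%N.
Proof.
move=> ir; have := size_pf_den; rewrite (pf_den_cofactor ir) size_monicM ?monic_exp ?monicXsubC//.
  rewrite size_exp_XsubC => E.
  have E2 : (K i <= \sum_(l <- r) K l)%N by rewrite (bigD1_seq i)//= leq_addr.
  lia.
by apply: monic_neq0; apply: monic_prod => l _; rewrite monic_exp// monicXsubC.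
Qed.

Lemma size_pf_tail c : (size (\sum_(i <- r) pf_polar c i * pf_cofactor i)%R <= \sum_(i <- r) K i)%N.
Proof.
apply: (leq_trans (size_sum _ _ _)); apply/bigmax_leqP_seq => i ir _.
apply: (leq_trans (size_polyMleq _ _)); rewrite (size_pf_cofactor ir).
have := size_pf_polar c i.
have E2 : (K i <= \sum_(l <- r) K l)%N by rewrite (bigD1_seq i)//= leq_addr.
lia.
Qed.

Lemma size_pf_num q c k : (size q <= k)%N -> (size (pf_num q c) <= k + \sum_(i <- r) K i)%N.
Proof.
move=> qk; apply: (leq_trans (size_polyD _ _)); rewrite geq_max; apply/andP; split.
  by apply: (leq_trans (size_polyMleq _ _)); rewrite size_pf_den addnS leq_add2r.
by apply: (leq_trans (size_pf_tail c)); rewrite leq_addl.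
Qed.

(** The factor (X - p_i)^K_i divides the i-th polar numerator, since it is coprime to the cofactor;
    that numerator has smaller degree, so it is 0. Its coefficients are read off after a shift by
    p_i. *)
Lemma pf_unique q c : pf_num q c = 0 ->
  q = 0 /\ forall i j, i \in r -> (1 <= j <= K i)%N -> c i j = 0.
Proof.
move=> H.
have polar0 i : i \in r -> pf_polar c i = 0.
  move=> ir; apply/eqP; apply: contraT => n0.
  have dv : ('X - (p i)%:P) ^+ K i %| pf_polar c i * pf_cofactor i.
    have -> : pf_polar c i * pf_cofactor i = - (q * pf_den +
        \sum_(l <- r | l != i) pf_polar c l * pf_cofactor l).
      apply/eqP; rewrite -subr_eq0 opprK addrCA -[X in _ == X]H /pf_num.
      by rewrite [X in q * _ + X](bigD1_seq i).
    rewrite dvdpNr dvdp_add//; first by rewrite (pf_den_cofactor ir) mulrCA dvdp_mulr.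
    apply: (big_ind (fun f => _ %| f)) => [|f h|l li]; [exact: dvdp0|exact: dvdp_add|].
    by rewrite /pf_cofactor (big_rem i)//= eq_sym li mulrCA dvdp_mulr.
  rewrite Gauss_dvdpl in dv; last first.
    rewrite coprimep_expl// coprimep_sym coprimep_XsubC rootE.
    exact: pf_cofactor_neq0.
  by have := dvdp_leq n0 dv; rewrite size_exp_XsubC leqNgt ltnS size_pf_polar.
have q0 : q = 0.
  move: H; rewrite /pf_num [X in _ + X]big_seq big1 ?addr0.
    move=> /eqP; rewrite mulf_eq0 (negPf (monic_neq0 monic_pf_den)) orbF => /eqP //.
  by move=> i ir; rewrite polar0// mul0r.
split=> // i j ir /andP[j1 jK].
have E (k : nat) : ('X - (p i)%:P) ^+ k \Po ('X + (p i)%:P) = 'X^k.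
  by rewrite rmorphXn /= comp_polyB comp_polyX comp_polyC addrK.
have := congr1 (fun f => (f \Po ('X + (p i)%:P))`_(K i - j)) (polar0 i ir).
rewrite comp_poly0 coef0 /pf_polar raddf_sum /= coef_sum => <-.
rewrite (bigD1_seq j) ?iota_uniq//=; last by rewrite mem_index_iota; lia.
rewrite comp_polyZ E coefZ coefXn eqxx mulr1 big_nat_cond big1 ?addr0// => l.
move=> /andP[/andP[l1 lK] lj]; rewrite comp_polyZ E coefZ coefXn.
by rewrite (_ : _ == _ = false) ?mulr0//; apply/negP; move: lj => /eqP ? /eqP ?; lia.
Qed.

End PartialFractions.

(** Multiplied by the product over [s], the difference vanishes everywhere, in particular at more
    natural numbers than its degree allows. *)
Lemma poly_eq_off (R : numDomainType) (P Q : {poly R}) (s : seq R) :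
  (forall z, z \notin s -> P.[z] = Q.[z]) -> P = Q.
Proof.
move=> H; pose T := (P - Q) * \prod_(c <- s) ('X - c%:P).
have T0 z : root T z.
  rewrite rootM; have [zs|zs] := boolP (z \in s).
    by rewrite root_prod_XsubC zs orbT.
  by rewrite rootE hornerD hornerN H// subrr eqxx.
have T00 : T = 0.
  apply/eqP; apply: contraT => Tn0.
  have := max_poly_roots (rs := [seq (k%:R : R) | k <- iota 0 (size T)]) Tn0.
  rewrite size_map size_iota ltnn; apply.
    by apply/allP => z _; exact: T0.
  rewrite map_inj_uniq ?iota_uniq// => i j /eqP; by rewrite eqr_nat => /eqP.
move/eqP: T00; rewrite mulf_eq0 (negPf (monic_neq0 (monic_prod_XsubC _ _ _))) orbF.
by rewrite subr_eq0 => /eqP.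
Qed.

(** * The function lambda and its tangent vectors over common denominators *)

Section TodaAlgebra.
Variables (R : realType) (m : nat) (n : nat -> nat).
Hypotheses (hm : (0 < m)%N) (hn : forall i : nat, (i <= m)%N -> (0 < n i)%N).
Local Notation C := R[i].
Local Notation N := (toda_dim m n).
Implicit Types (a u v : 'rV[C]_N) (z : C) (i j : nat).

Local Notation r := (index_iota 1 m.+1).

Lemma coefZD i j (x : C) u v : coef (x *: u + v) i j = x * coef u i j + coef v i j.
Proof.
by rewrite /coef mulr_sumr -big_split; apply: eq_bigr => k _; rewrite !mxE.
Qed.

Lemma mem_toda_index i j : ((i, j) \in toda_index m n) =
  (i <= m)%N && (if i == 0%N then (j < n 0)%N else if i == 1%N then (1 <= j <= n 1)%N else (j <= n i)%N).
Proof.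
apply/allpairsPdep/idP => [[i' [j' []]]|].
  rewrite mem_iota => /andP[_ i'm] j'i [-> ->]; apply/andP; split; first by lia.
  by case: i' i'm j'i => [|[|i']] i'm; rewrite mem_iota /=; lia.
move=> /andP[im H]; exists i, j; split=> //; first by rewrite mem_iota; lia.
by case: i im H => [|[|i]] im; rewrite mem_iota /=; lia.
Qed.

Lemma toda_index_uniq : uniq (toda_index m n).
Proof.
apply: allpairs_uniq_dep; first exact: iota_uniq.
  by move=> [|[|i]] _; exact: iota_uniq.
by move=> [i j] [i' j'] _ _ [-> ->].
Qed.

Lemma coef_out i j u : (i, j) \notin toda_index m n -> coef u i j = 0.
Proof.
move=> ij; rewrite /coef big1// => k /eqP E; case/negP: ij; rewrite -E.
by apply: mem_nth; exact: ltn_ord.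
Qed.

Lemma coef_nth (k : 'I_N) u :
  coef u (nth (0%N, 0%N) (toda_index m n) k).1 (nth (0%N, 0%N) (toda_index m n) k).2 = u 0 k.
Proof.
rewrite /coef -surjective_pairing (bigD1 k)//= big1 ?addr0// => l /andP[/eqP E lk].
case/negP: lk; apply/eqP/val_inj/eqP => /=.
by rewrite -(nth_uniq (0%N, 0%N) _ _ toda_index_uniq) ?E//; exact: ltn_ord.
Qed.

Definition pole a i : C := coef a i 0.

Lemma pole1 a : pole a 1 = 0.
Proof. by rewrite /pole coef_out// mem_toda_index eqxx /= andbF. Qed.

Lemma mem_r i : (i \in r) = (1 <= i <= m)%N.
Proof. by rewrite mem_index_iota ltnS. Qed.

Lemma one_r : 1%N \in r. Proof. by rewrite mem_r hm. Qed.

Lemma uniq_r : uniq r. Proof. exact: iota_uniq. Qed.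
Local Hint Resolve uniq_r one_r : core.

Lemma pole_inj a : toda_manifold a -> {in r &, injective (pole a)}.
Proof.
move=> [_ H] i j; rewrite !mem_r => i1 j1 E; apply: contrapT => ij.
by have := H i j i1 j1 ij; rewrite /pole in E; rewrite E eqxx.
Qed.

Lemma npoleP a z : ~ lam_pole a z <-> forall i, i \in r -> z != pole a i.
Proof.
split=> [H i ir|H [i im E]].
  by apply/eqP => E; apply: H; exists i => //; rewrite -mem_r.
by have := H i; rewrite mem_r E => /(_ im); rewrite eqxx.
Qed.

Definition lam_poly a : {poly C} := (n 0)%:R^-1 *: 'X^(n 0) + \poly_(j < n 0) coef a 0 j.
Definition lamA a : {poly C} := pf_num r (pole a) n (lam_poly a) (coef a).
Definition lamB a : {poly C} := pf_den r (pole a) n.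

Lemma n0_neq0 : (n 0)%:R != 0 :> C.
Proof. by rewrite pnatr_eq0 -lt0n hn. Qed.

Lemma lamBn0 a z : ~ lam_pole a z -> (lamB a).[z] != 0.
Proof. by move=> /npoleP H; exact: pf_den_neq0. Qed.

Lemma lamE a z : ~ lam_pole a z -> lam a z = (lamA a).[z] / (lamB a).[z].
Proof.
move=> /[dup] /lamBn0 B0 /npoleP H; rewrite /lamA pf_eval// -/(lamB a) mulrC mulKf//.
rewrite /lam /lam_poly hornerD hornerZ hornerXn horner_poly big_mkord.
by congr (_ + _).
Qed.

(** Moving a pole raises its order by one in the derivative of lambda; the pole of index 1 stays at
    0. *)
Definition ordD i : nat := if i == 1%N then n i else (n i).+1.
Definition lamD a : {poly C} := pf_den r (pole a) ordD.

Definition dlam a u z : C :=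
  \sum_(0 <= j < n 0) coef u 0 j * z ^+ j +
  \sum_(1 <= i < m.+1) \sum_(1 <= j < (n i).+1)
    (coef u i j * (z - pole a i) ^- j + coef a i j * (j%:R * coef u i 0 * (z - pole a i) ^- j.+1)).

(** The coefficient of (z - a_i)^-j in the derivative of lambda: the variation of a_{i,j}, plus the
    term of order j - 1 differentiated in the pole a_{i,0}. *)
Definition tan_coef a u i j : C :=
  (if (j <= n i)%N then coef u i j else 0) +
  (if (1 < j)%N then coef a i j.-1 * (j.-1%:R * coef u i 0) else 0).

Definition tanP a u : {poly C} := pf_num r (pole a) ordD (\poly_(j < n 0) coef u 0 j) (tan_coef a u).

Lemma lamDn0 a z : ~ lam_pole a z -> (lamD a).[z] != 0.
Proof. by move=> /npoleP H; exact: pf_den_neq0. Qed.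

Lemma tanPE a u z : ~ lam_pole a z -> (tanP a u).[z] = (lamD a).[z] * dlam a u z.
Proof.
move=> /npoleP H; rewrite /tanP pf_eval// -/(lamD a) horner_poly /dlam big_mkord.
congr (_ * (_ + _)); apply: eq_big_seq => i; rewrite mem_r => /andP[i1 im].
rewrite big_split /= /ordD.
have S1 (k : nat) : (n i <= k)%N ->
    \sum_(1 <= j < k.+1) (if (j <= n i)%N then coef u i j else 0) * (z - pole a i) ^- j =
    \sum_(1 <= j < (n i).+1) coef u i j * (z - pole a i) ^- j.
  move=> nk; rewrite (big_cat_nat _ (n := (n i).+1))//=.
  rewrite [X in _ + X]big1_seq ?addr0 => [|j].
    by apply: eq_big_nat => j /andP[_ jn]; rewrite -ltnS jn.
  by rewrite mem_index_iota => /andP[_ /andP[j1 _]]; rewrite leqNgt j1 mul0r.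
rewrite /tan_coef; under eq_bigr do rewrite mulrDl; rewrite big_split /=.
have [E|i2] := eqVneq i 1%N.
  rewrite S1//; congr (_ + _); rewrite E -/(pole u 1) pole1 !big1// => j _.
    by rewrite mulr0 mul0r mulr0.
  by case: ifP; rewrite ?mulr0 mul0r.
rewrite S1//; congr (_ + _); rewrite big_add1 /= big_nat_recl//= mul0r add0r.
by rewrite big_add1 /=; apply: eq_bigr => j _; rewrite !mulrA.
Qed.

Lemma dimE : N = (n 0 + \sum_(i <- r) ordD i)%N.
Proof.
rewrite /toda_dim /toda_index size_allpairs_dep /= size_iota; congr (_ + _)%N.
rewrite sumnE big_map /index_iota subn1 /=.
by apply: eq_big_seq => i; rewrite mem_iota => /andP[i1 _]; case: i i1 => [|[|i]] //= _; rewrite size_iota.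
Qed.

Lemma tanP_linear a (x : C) u v : tanP a (x *: u + v) = x *: tanP a u + tanP a v.
Proof.
rewrite /tanP /pf_num; have -> : \poly_(j < n 0) coef (x *: u + v) 0 j =
    x *: (\poly_(j < n 0) coef u 0 j) + \poly_(j < n 0) coef v 0 j.
  by apply/polyP => k; rewrite coefD coefZ !coef_poly coefZD; case: ifP => //; rewrite mulr0 addr0.
rewrite mulrDl scalerDr -scalerAl addrACA; congr (_ + _).
rewrite scaler_sumr -big_split; apply: eq_bigr => i _ /=; rewrite scalerAl -mulrDl; congr (_ * _).
rewrite /pf_polar scaler_sumr -big_split; apply: eq_bigr => j _ /=; rewrite scalerA -scalerDl.
congr (_ *: _); rewrite /tan_coef !coefZD.
by case: ifP => _; case: ifP => _; ring.
Qed.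

Lemma size_tanP a u : (size (tanP a u) <= N)%N.
Proof. by rewrite dimE; apply: size_pf_num; [exact: uniq_r|exact: size_poly]. Qed.

(** The coefficient of order n_i + 1 determines the variation of a_{i,0}, because a_{i,n_i} is not
    0; the remaining coefficients then give the other variations. *)
Lemma tanP_inj a u : toda_manifold a -> tanP a u = 0 -> u = 0.
Proof.
move=> Ma /(pf_unique uniq_r (pole_inj Ma))[q0 c0].
apply/rowP => k; rewrite mxE -coef_nth.
have := mem_nth (0%N, 0%N) (ltn_ord k : (k < size (toda_index m n))%N).
case: (nth _ _ _) => i j /=; rewrite mem_toda_index => /andP[im].
have [->|i0] := eqVneq i 0%N.
  move=> jn; have := congr1 (fun f : {poly C} => f`_j) q0.
  by rewrite coef_poly jn coef0.
have ir : i \in r by rewrite mem_r im lt0n i0.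
have u0 : coef u i 0 = 0.
  have [->|i1] := eqVneq i 1%N; first exact: pole1.
  have := c0 i (n i).+1 ir; rewrite /ordD (negPf i1) leqnn => /(_ isT).
  rewrite /tan_coef ltnn add0r /=; have ni := hn im; rewrite ltnS ni => /eqP.
  rewrite !mulf_eq0 pnatr_eq0 eqn0Ngt ni /=.
  by have := Ma.1 i; rewrite -mem_r => /(_ ir) /negPf -> /= /eqP.
have key j' : (1 <= j' <= n i)%N -> coef u i j' = 0.
  move=> j1; have := c0 i j' ir; rewrite /tan_coef u0 !mulr0.
  have -> : (1 <= j' <= ordD i)%N by rewrite /ordD; case: ifP => _; lia.
  have -> : (j' <= n i)%N by case/andP: j1.
  by move=> /(_ isT); rewrite if_same addr0.
case: eqP key => [->|_] key; first exact: key.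
by case: j => [|j] // jn; apply: key.
Qed.

End TodaAlgebra.

Ltac dvd_split := repeat first [assumption | apply: dvdp_mulr; assumption |
  apply: dvdp_mull; assumption | apply: dvdp_sub | apply: dvdp_add].

(** * The Frobenius algebra of polynomials modulo W *)

Section QuotientAlgebra.
Variables (K : fieldType) (N : nat) (W D S X d x : {poly K}) (phi : 'rV[K]_N -> {poly K}).
Implicit Types (u v w y : 'rV[K]_N) (P Q T : {poly K}).
Hypotheses (sizeW : size W = N.+1).
Hypotheses (phiL : forall (k : K) u v, phi (k *: u + v) = k *: phi u + phi v).
Hypotheses (phi_size : forall u, (size (phi u) <= N)%N).
Hypotheses (phi_inj : forall u, phi u = 0 -> u = 0).
Hypotheses (Dd : W %| D * d - 1) (Xx : W %| X * x - 1).

Let Wn0 : W != 0. Proof. by rewrite -size_poly_eq0 sizeW. Qed.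

(** For monic W of degree N this is the sum of the residues of T / W at the roots of W. *)
Definition top_coef T : K := (T %% W)`_N.-1.

Lemma top_coefD T T' : top_coef (T + T') = top_coef T + top_coef T'.
Proof. by rewrite /top_coef modpD coefD. Qed.

Lemma top_coefN T : top_coef (- T) = - top_coef T.
Proof. by rewrite /top_coef modpN coefN. Qed.

Lemma top_coefZ (k : K) T : top_coef (k *: T) = k * top_coef T.
Proof. by rewrite /top_coef modpZl coefZ. Qed.

Lemma top_coef_dvd T : W %| T -> top_coef T = 0.
Proof. by move=> /modp_eq0P; rewrite /top_coef => ->; rewrite coef0. Qed.

Lemma top_coef_eq T T' : W %| T - T' -> top_coef T = top_coef T'.
Proof. by move=> /top_coef_dvd/eqP; rewrite top_coefD top_coefN subr_eq0 => /eqP. Qed.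

Lemma phi0 : phi 0 = 0.
Proof. by have := phiL (-1) 0 0; rewrite scaleN1r addNr scaleN1r addNr. Qed.

Lemma phiD u v : phi (u + v) = phi u + phi v.
Proof. by rewrite -[u in LHS]scale1r phiL scale1r. Qed.

Lemma phiZ (k : K) u : phi (k *: u) = k *: phi u.
Proof. by rewrite -[_ *: u]addr0 phiL phi0 addr0. Qed.

Lemma linear_fun_mx (f : 'rV[K]_N -> 'rV[K]_N) :
  (forall (k : K) u v, f (k *: u + v) = k *: f u + f v) -> forall u, u *m lin1_mx f = f u.
Proof.
move=> lf u; pose F : {linear 'rV[K]_N -> 'rV[K]_N} := HB.pack f (GRing.isLinear.Build K _ _ _ f lf).
exact: (mul_rV_lin1 F).
Qed.

Lemma injective_unitmx (A : 'M[K]_N) : (forall u, u *m A = 0 -> u = 0) -> A \in unitmx.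
Proof.
move=> H; rewrite -row_free_unit -kermx_eq0; apply/eqP/row_matrixP => i.
by rewrite row0; apply: H; apply/sub_kermxP; exact: row_sub.
Qed.

Lemma phi_surj T : exists u, W %| phi u - T.
Proof.
pose f u : 'rV[K]_N := poly_rV (phi u).
have fl (k : K) u v : f (k *: u + v) = k *: f u + f v by rewrite /f phiL linearP.
have fK u : rVpoly (f u) = phi u by rewrite poly_rV_K.
have U : lin1_mx f \in unitmx.
  apply: injective_unitmx => u; rewrite (linear_fun_mx fl) => E.
  by apply: phi_inj; rewrite -fK E linear0.
exists (poly_rV (T %% W) *m invmx (lin1_mx f)).
have -> : phi (poly_rV (T %% W) *m invmx (lin1_mx f)) = T %% W.
  rewrite -fK -(linear_fun_mx fl) mulmxKV// poly_rV_K//.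
  by rewrite -ltnS -sizeW ltn_modp.
by rewrite {2}(divp_eq T W) opprD addrCA subrr addr0 -mulNr dvdp_mull.
Qed.

Lemma phi_eq0 u : W %| phi u -> u = 0.
Proof.
move=> H; apply: phi_inj; apply/eqP; apply: contraT => n0.
by have := dvdp_leq n0 H; rewrite sizeW leqNgt ltnS phi_size.
Qed.

Lemma phi_eq u v : W %| phi u - phi v -> u = v.
Proof.
move=> H; apply/eqP; rewrite -subr_eq0; apply/eqP/phi_eq0.
by rewrite phiD -scaleN1r phiZ scaleN1r.
Qed.

(** Some [phi u] is congruent to the power of X that moves the leading coefficient of the remainder
    of T to degree N - 1. *)
Lemma top_coef_nondegenerate T : (forall u, top_coef (T * phi u) = 0) -> W %| T.
Proof.
move=> H; apply/modp_eq0P; set T0 := T %% W; apply/eqP; apply: contraT => n0.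
have dN : (size T0 <= N)%N by rewrite -ltnS -sizeW ltn_modp.
have d0 : (0 < size T0)%N by rewrite size_poly_gt0.
have [u uP] := phi_surj 'X^(N - size T0).
have := H u; rewrite (@top_coef_eq _ (T0 * 'X^(N - size T0))).
  rewrite /top_coef modp_small; last by rewrite size_mulXn// sizeW subnK.
  rewrite coefMXn; have -> : (N.-1 < N - size T0)%N = false by lia.
  have -> : (N.-1 - (N - size T0) = (size T0).-1)%N by lia.
  by move=> /eqP; rewrite -/(lead_coef T0) lead_coef_eq0 (negPf n0).
have -> : T * phi u - T0 * 'X^(N - size T0) = (T - T0) * phi u + T0 * (phi u - 'X^(N - size T0)) by ring.
rewrite dvdp_add ?(dvdp_mull _ uP)// dvdp_mulr//.
by rewrite {1}(divp_eq T W) addrK dvdp_mull.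
Qed.

(** With the derivative of lambda along u equal to phi u / D and W = z D lambda', the residues of
    [toda_eta] are those of phi u phi v / (z D W), and those of [toda_c] have phi u phi v phi w / (z
    D^2 W). Here [d] and [x] invert D and X modulo W. *)
Definition quotient_eta u v := top_coef (phi u * phi v * d * x).
Definition quotient_c u v w := top_coef (phi u * phi v * phi w * d * d * x).
Local Notation eta := quotient_eta.
Local Notation c := quotient_c.

Lemma eta_sym u v : eta u v = eta v u.
Proof. by rewrite /eta mulrC [phi u * _]mulrC mulrC. Qed.

Lemma eta_linear u (k : K) v w : eta u (k *: v + w) = k * eta u v + eta u w.
Proof.
rewrite /eta -top_coefZ -top_coefD; congr top_coef; rewrite phiL.
by rewrite mulrDr !mulrDl -!scalerAr -!scalerAl.
Qed.

Lemma linear_row_sum (f : 'rV[K]_N -> K) : (forall (k : K) v w, f (k *: v + w) = k * f v + f w) ->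
  forall y, f y = \sum_k y 0 k * f (delta_mx 0 k).
Proof.
move=> lf y; have f0 : f 0 = 0 by have := lf (-1) 0 0; rewrite scaleN1r addNr mulN1r addNr.
rewrite {1}(row_sum_delta y); apply: (big_ind2 (fun s t => f s = t)) => [//|s t s' t' <- <-|k _].
  by rewrite -{1}[s]scale1r lf mul1r.
by rewrite -[_ *: _]addr0 lf f0 addr0.
Qed.

Let Eta := \matrix_(i < N, j < N) eta (delta_mx 0 i) (delta_mx 0 j).

Lemma eta_matrix u v : eta u v = (u *m Eta *m v^T) 0 0.
Proof.
rewrite (linear_row_sum (eta_linear u)) mxE; apply: eq_bigr => k _; rewrite !mxE mulrC.
congr (_ * _); rewrite eta_sym (linear_row_sum (eta_linear _)); apply: eq_bigr => l _.
by rewrite mxE eta_sym.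
Qed.

Lemma coprime_dx : coprimep W (d * x).
Proof.
rewrite coprimepMr; apply/andP; split; apply/Bezout_eq1_coprimepP.
  have /dvdpP[k E] := Dd; exists (- k, D); rewrite /= mulNr -E; ring.
have /dvdpP[k E] := Xx; exists (- k, X); rewrite /= mulNr -E; ring.
Qed.

Lemma eta_nondegenerate u T : (forall y, eta u y = top_coef (T * phi y * d * x)) -> W %| phi u - T.
Proof.
move=> H; suff : W %| (phi u - T) * (d * x) by rewrite Gauss_dvdpl ?coprime_dx.
apply: top_coef_nondegenerate => y; have := H y; rewrite /eta => /eqP.
rewrite -subr_eq0 -top_coefN -top_coefD => /eqP E; rewrite -[RHS]E; congr top_coef; ring.
Qed.

Lemma Eta_unit : Eta \in unitmx.
Proof.
apply: injective_unitmx => u uE; apply: phi_eq0; rewrite -[phi u]subr0.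
apply: eta_nondegenerate => y; rewrite !mul0r eta_matrix uE mul0mx mxE.
by rewrite top_coef_dvd ?dvdp0.
Qed.

Lemma raiseP w y : eta (raise eta w) y = (w *m y^T) 0 0.
Proof. by rewrite eta_matrix /raise mulmxKV ?Eta_unit. Qed.

(** Thus u -> phi u / D is an isomorphism of the Frobenius algebra onto the polynomials modulo W;
    nondegeneracy of the metric identifies the product. *)
Lemma frob_mulP u v : W %| phi (frob_mul eta c u v) - phi u * phi v * d.
Proof.
apply: eta_nondegenerate => y; rewrite raiseP.
have -> : top_coef (phi u * phi v * d * phi y * d * x) = c u v y.
  by rewrite /c; congr top_coef; ring.
have cl : forall (k : K) v0 w, c u v (k *: v0 + w) = k * c u v v0 + c u v w.
  move=> k v0 w; rewrite /c -top_coefZ -top_coefD; congr top_coef; rewrite phiL -!mul_polyC; ring.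
by rewrite (linear_row_sum cl) mxE; apply: eq_bigr => k _; rewrite !mxE mulrC.
Qed.

Lemma frob_mulL u (k : K) v w :
  frob_mul eta c u (k *: v + w) = k *: frob_mul eta c u v + frob_mul eta c u w.
Proof.
apply: phi_eq; rewrite phiL.
have := frob_mulP u (k *: v + w); have := frob_mulP u v; have := frob_mulP u w.
rewrite phiL -!mul_polyC; set P := phi (frob_mul _ _ _ _); set P1 := phi (frob_mul _ _ _ _).
set P2 := phi (frob_mul _ _ _ _) => H H1 H2.
have -> : P2 - (k%:P * P1 + P) = (P2 - phi u * (k%:P * phi v + phi w) * d)
   - k%:P * (P1 - phi u * phi v * d) - (P - phi u * phi w * d) by ring.
by dvd_split.
Qed.

Variables e E : 'rV[K]_N.
Hypotheses (eP : W %| phi e - D) (EP : W %| phi E - S).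

Lemma frob_mul_EP u : W %| phi (frob_mul eta c E u) - S * phi u * d.
Proof.
have := frob_mulP E u; set P := phi _ => H.
have -> : P - S * phi u * d = (P - phi E * phi u * d) + (phi E - S) * (phi u * d) by ring.
by rewrite dvdp_add// dvdp_mulr.
Qed.

Lemma coprimeWd : coprimep W d.
Proof. by have := coprime_dx; rewrite coprimepMr => /andP[]. Qed.

(** The field E acts as multiplication by S / D. If g = gcd(S, W) is not constant, the class of W /
    g is nonzero and annihilated. *)
Lemma euler_unit : (lin1_mx (frob_mul eta c E) \in unitmx) = coprimep S W.
Proof.
apply/idP/idP => [U|cop]; last first.
  apply: injective_unitmx => u; rewrite (linear_fun_mx (frob_mulL E)) => Eu.
  have := frob_mul_EP u; rewrite Eu phi0 sub0r dvdpNr Gauss_dvdpl ?coprimeWd//.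
  by rewrite Gauss_dvdpr 1?coprimep_sym//; exact: phi_eq0.
apply: contraT => ncop; pose g := gcdp S W.
have gW : g %| W by exact: dvdp_gcdr.
have gS : g %| S by exact: dvdp_gcdl.
have [u uP] := phi_surj (W %/ g).
have Su : W %| S * phi u.
  have -> : S * phi u = S * (phi u - W %/ g) + S * (W %/ g) by ring.
  rewrite dvdp_add ?(dvdp_mull _ uP)//.
  by rewrite -(divpK gS) -mulrA [g * _]mulrC divpK// dvdp_mull.
have u0 : u = 0.
  rewrite -[u](mulmxK U) (linear_fun_mx (frob_mulL E)).
  have -> : frob_mul eta c E u = 0.
    apply: phi_eq0; have := frob_mul_EP u; set P := phi (frob_mul _ _ _ _) => H.
    rewrite -[P](subrK (S * phi u * d)) dvdp_add// dvdp_mulr//.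
  by rewrite mul0mx.
move: uP; rewrite u0 phi0 sub0r dvdpNr => H.
have g0 : g != 0 by rewrite gcdp_eq0 (negPf Wn0) andbF.
have Wg0 : W %/ g != 0 by apply: contra Wn0 => /eqP Wg; rewrite -(divpK gW) Wg mul0r.
have := dvdp_leq Wg0 H; rewrite size_divp// sizeW => K1.
by move: ncop; rewrite /coprimep -/g -size_poly_gt0 in g0 *; clear -K1 g0; lia.
Qed.

Lemma intersection_formE w1 w2 :
  intersection_form eta c E w1 w2 = (w2 *m (frob_mul eta c E (raise eta w1))^T) 0 0.
Proof.
rewrite /intersection_form /cofrob_mul.
have lowerE h y : (lower eta h *m y^T) 0 0 = eta h y.
  by rewrite (linear_row_sum (eta_linear h)) mxE; apply: eq_bigr => k _; rewrite !mxE mulrC.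
rewrite lowerE -raiseP; set u := raise eta w1; set v := raise eta w2.
apply: top_coef_eq; have := frob_mulP u v; have := frob_mul_EP u.
set P := phi _; set Q := phi (frob_mul _ _ u v) => H1 H2.
have -> : Q * phi E * d * x - phi v * P * d * x =
  (Q - phi u * phi v * d) * (phi E * d * x) + (phi E - S) * (phi u * phi v * d * d * x)
   - (P - S * phi u * d) * (phi v * d * x) by ring.
by dvd_split.
Qed.

(** The matrix of the form is the inverse of the matrix of [eta] times the matrix of multiplication
    by E. *)
Lemma intersection_unit : (\det (intersection_mx eta c E) != 0) = coprimep S W.
Proof.
rewrite -unitfE -/(intersection_mx eta c E \in unitmx) -euler_unit.
have -> : intersection_mx eta c E = invmx Eta *m lin1_mx (frob_mul eta c E).
  apply/row_matrixP => i; rewrite row_mul (linear_fun_mx (frob_mulL E)); apply/rowP => j.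
  have -> : row i (invmx Eta) = raise eta (delta_mx 0 i) by rewrite /raise rowE.
  set q := frob_mul _ _ _ _; rewrite !mxE intersection_formE -/q mxE (bigD1 j)//= big1 => [|k kj].
    by rewrite !mxE !eqxx mul1r addr0.
  by rewrite !mxE (negPf kj) andbF mul0r.
by rewrite -unitmxE unitmx_mul unitmx_inv Eta_unit.
Qed.

Hypothesis SW : coprimep S W.

(** The inverse of E corresponds to D / S, so that phi (u * v) / D = (D / S) (phi u / D) (phi v / D)
    modulo W. *)
Lemma starP u v : W %| S * phi (star eta c e E u v) - phi u * phi v.
Proof.
rewrite /star; set q := euler_inv eta c e E.
have Eq : frob_mul eta c E q = e.
  by rewrite -(linear_fun_mx (frob_mulL E)) /q /euler_inv mulmxKV// euler_unit.
have := frob_mul_EP q; rewrite Eq => H1.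
have H2 := frob_mulP q u; have H3 := frob_mulP (frob_mul eta c q u) v.
set P := phi (frob_mul _ _ (frob_mul _ _ _ _) _) in H3 *; set Q := phi (frob_mul _ _ q u) in H2 H3.
have -> : S * P - phi u * phi v = S * (P - Q * phi v * d) + (Q - phi q * phi u * d) * (S * phi v * d)
  - (phi e - S * phi q * d) * (phi u * phi v * d) + (phi e - D) * (phi u * phi v * d)
  + (D * d - 1) * (phi u * phi v) by ring.
by dvd_split.
Qed.

Variable s : {poly K}.
Hypothesis Ss : W %| S * s - 1.

(** The vector y is the image of the covector w1 under the intersection form. The bilinear form on
    the left, given by the residues of phi y phi y' / (z S W), is the corresponding metric on
    vectors. *)
Lemma intersection_inverse w1 : exists y,
  (forall y', top_coef (phi y * phi y' * s * x) = (w1 *m y'^T) 0 0) /\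
  (forall w2, intersection_form eta c E w1 w2 = (w2 *m y^T) 0 0).
Proof.
exists (frob_mul eta c E (raise eta w1)); split; last exact: intersection_formE.
move=> y; rewrite -raiseP; set u := raise eta w1; apply: top_coef_eq.
have := frob_mul_EP u; set P := phi (frob_mul _ _ _ _) => H.
have -> : P * phi y * s * x - phi u * phi y * d * x = (P - S * phi u * d) * (phi y * s * x)
  + (S * s - 1) * (phi u * phi y * d * x) by ring.
by rewrite dvdp_add// dvdp_mulr.
Qed.

End QuotientAlgebra.

(** * Residues *)

Section Circles.
Variable R : realType.
Local Notation C := R[i].
Implicit Types (c z w : C) (r t : R).

Lemma cder_cexp_linear w t : cder (fun s : R => cexp (s%:C * w)) t (w * cexp (t%:C * w)).
Proof.
move=> e e0; pose K := (cabs w + 1) * (cabs (cexp (t%:C * w)) + 1).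
have w0 := cabs_ge0 w; have x0 := cabs_ge0 (cexp (t%:C * w)).
have K0 : 0 < K by rewrite mulr_gt0 ?ltr_wpDl.
have [d d0 H] := cexp_first_order (divr_gt0 e0 K0).
exists (d / (cabs w + 1)); first by rewrite divr_gt0 ?ltr_wpDl.
move=> s st; set x := cexp (t%:C * w) in x0 K K0 H *.
have sw : cabs ((s - t)%:C * w) = `|s - t| * cabs w by rewrite cabsM cabsR.
have E : cexp (s%:C * w) - x - (s - t)%:C * (w * x) = x * (cexp ((s - t)%:C * w) - 1 - (s - t)%:C * w).
  have -> : s%:C * w = t%:C * w + (s - t)%:C * w by rewrite -mulrDl -rmorphD addrC subrK.
  rewrite cexpD -/x; ring.
have sd : cabs ((s - t)%:C * w) < d.
  move: st; rewrite sw ltr_pdivlMr ?ltr_wpDl// => st; apply: le_lt_trans st.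
  by rewrite ler_wpM2l// lerDl.
rewrite E cabsM; apply: (le_trans (ler_wpM2l x0 (H _ sd))).
rewrite sw; have -> : cabs x * (e / K * (`|s - t| * cabs w)) = e * `|s - t| * ((cabs w * cabs x) / K) by ring.
rewrite ler_piMr ?mulr_ge0 ?(ltW e0)// ler_pdivrMr// mul1r /K; nra.
Qed.

Lemma circleE c r t : circle c r t = c + r%:C * cexp (t%:C * two_pi_i R).
Proof.
rewrite /circle /two_pi_i /cexp /= !mul0r mulr0 subr0 expR0 addr0 mul1r.
by rewrite [t * _]mulrC.
Qed.

Definition circle_deriv r t : C := r%:C * (two_pi_i R * cexp (t%:C * two_pi_i R)).

Lemma cder_circle c r t : cder (circle c r) t (circle_deriv r t).
Proof.
have -> : circle c r = fun s => c + r%:C * cexp (s%:C * two_pi_i R).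
  by apply/funext => s; exact: circleE.
have := cderD (cder_cst c t) (cderZ r%:C (cder_cexp_linear (two_pi_i R) t)).
by rewrite add0r.
Qed.

Lemma cder_C1_curve (g g' g'' : R -> C) : (forall t, cder g t (g' t)) ->
  (forall t, cder g' t (g'' t)) -> C1_curve g.
Proof.
move=> H H'.
have E1 : derive1 (fun s => Re (g s)) = fun s => Re (g' s).
  apply/funext => s; rewrite derive1E; have [D _] := cder_is_derive (H s); exact: derive_val.
have E2 : derive1 (fun s => Im (g s)) = fun s => Im (g' s).
  apply/funext => s; rewrite derive1E; have [_ D] := cder_is_derive (H s); exact: derive_val.
split=> [t|t||].
- by have [D _] := cder_is_derive (H t); exact: ex_derive.
- by have [_ D] := cder_is_derive (H t); exact: ex_derive.
- rewrite E1 => t; apply: differentiable_continuous; apply/derivable1_diffP.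
  by have [D _] := cder_is_derive (H' t); exact: ex_derive.
- rewrite E2 => t; apply: differentiable_continuous; apply/derivable1_diffP.
  by have [_ D] := cder_is_derive (H' t); exact: ex_derive.
Qed.

Lemma C1_circle c r : C1_curve (circle c r).
Proof.
apply: (cder_C1_curve (cder_circle c r)) => t.
exact: (cderZ r%:C (cderZ (two_pi_i R) (cder_cexp_linear (two_pi_i R) t))).
Qed.

Lemma curve_deriv_circle c r : curve_deriv (circle c r) = circle_deriv r.
Proof. by apply/funext => t; apply: cder_curve_deriv; exact: cder_circle. Qed.

Lemma circle_path c r : C1path (circle c r) (circle_deriv r).
Proof. by rewrite -(curve_deriv_circle c); apply: C1_path; exact: C1_circle. Qed.

Lemma circle_closed c r : circle c r 0 = circle c r 1.
Proof. by have := cexp_period R 1; rewrite !mul1r => E; rewrite !circleE mul0r cexp0 mul1r E. Qed.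

Lemma cabs_circle c r t : 0 <= r -> cabs (circle c r t - c) = r.
Proof.
move=> r0; rewrite circleE addrC addKr cabsM cabsR ger0_norm//.
by rewrite cabs_cexp /two_pi_i /= mul0r mulr0 subr0 expR0 mulr1.
Qed.

Lemma circle_deriv_sub c r t : circle_deriv r t = two_pi_i R * (circle c r t - c).
Proof. by rewrite circleE /circle_deriv addrC addKr mulrCA. Qed.

Lemma circle_neq c r t : 0 < r -> circle c r t - c != 0.
Proof. by move=> r0; rewrite -cabs_gt0 cabs_circle// ltW. Qed.

Lemma cint_cst c : cint (fun=> c) = c.
Proof.
have P : C1path (fun t : R => c * (t%:C * 1)) (fun=> c).
  split; [|exact: pcont_cst|].
    apply: (@cder_pcont _ _ (fun=> c)) => t _ e e0; exists 1 => // s _.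
    by rewrite !mulr1 mulrC [c * t%:C]mulrC -mulrBl -rmorphB subrr cabs0 mulr_ge0// ltW.
  move=> t _ e e0; exists 1 => // s _.
  by rewrite !mulr1 mulrC [c * t%:C]mulrC -mulrBl -rmorphB subrr cabs0 mulr_ge0// ltW.
by rewrite (C1path_integral P) mulr1 mul0r mulr0 subr0 mulr1.
Qed.

Lemma circle_index_center c r : 0 < r -> cint (fun t => circle_deriv r t / (circle c r t - c)) = two_pi_i R.
Proof.
move=> r0; rewrite (_ : (fun t => _) = fun=> two_pi_i R) ?cint_cst//.
by apply/funext => t; rewrite (circle_deriv_sub c) mulfK// circle_neq.
Qed.

Lemma circle_index_inside c r z : 0 < r -> cabs (z - c) < r ->
  off_curve (circle c r) z /\ index_integral (circle c r) (circle_deriv r) z = two_pi_i R.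
Proof.
move=> r0 zc; have key (s t : R) : 0 <= s <= 1 -> circle c r t - c - s%:C * (z - c) != 0.
  move=> /andP[s0 s1]; rewrite -cabs_gt0; apply: lt_le_trans (cabs_lowtri _ _).
  rewrite cabs_circle ?(ltW r0)// cabsM cabsR ger0_norm// subr_gt0.
  by apply: le_lt_trans zc; rewrite ler_piMl// cabs_ge0.
split=> [t _|].
  have := key 1 t; rewrite lexx ler01 => /(_ isT); rewrite mul1r opprB addrA subrK subr_eq0.
  by [].
rewrite -(circle_index_center c r0); symmetry.
apply: (index_homotopy (circle_path c r) (circle_closed c r)) => s t s01 _; exact: key.
Qed.

(** The point is pushed radially away from [c] to a point [w] where [index_far] applies; the segment
    stays outside the circle. The factor [K] makes |w| exceed the bound [M]. *)
Lemma circle_index_outside c r z : 0 < r -> r < cabs (z - c) ->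
  off_curve (circle c r) z /\ index_integral (circle c r) (circle_deriv r) z = 0.
Proof.
move=> r0 zc; have [M M0 far] := index_far (circle_path c r) (circle_closed c r).
have off (w : C) t : r < cabs (w - c) -> circle c r t != w.
  by move=> wc; apply/eqP => E; move: wc; rewrite -E cabs_circle ?ltxx// ltW.
split=> [t _|]; first exact: off.
pose K := (M + cabs c) / r + 1; have K1 : 1 <= K.
  by rewrite /K lerDr divr_ge0 ?(ltW r0)// addr_ge0 ?cabs_ge0// ltW.
pose w := c + K%:C * (z - c).
have wz (s : R) : w * 0 = 0 -> 0 <= s <= 1 -> r < cabs (z + s%:C * (w - z) - c).
  move=> _ /andP[s0 s1]; have -> : z + s%:C * (w - z) - c = (1 + s * (K - 1))%:C * (z - c).
    by rewrite /w !(rmorphD, rmorphM, rmorphN, rmorph1) /=; ring.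
  have q : 1 <= 1 + s * (K - 1) by rewrite lerDl mulr_ge0// subr_ge0.
  rewrite cabsM cabsR ger0_norm ?(le_trans ler01 q)//; apply: (lt_le_trans zc).
  by rewrite ler_peMl// cabs_ge0.
have -> : index_integral (circle c r) (circle_deriv r) z = index_integral (circle c r) (circle_deriv r) w.
  apply: (index_homotopy (circle_path c r) (circle_closed c r)) => s t s01 _.
  have := off _ t (wz s (mulr0 _) s01); rewrite -subr_eq0; apply: contra => /eqP E.
  by rewrite -E opprD addrA.
suff /far[] : M < cabs w by [].
have := cabs_lowtri (K%:C * (z - c)) (- c); rewrite opprK addrC -/w cabsN cabsM cabsR.
rewrite ger0_norm ?(le_trans ler01 K1)// [_ + c]addrC -/w; apply: lt_le_trans.
have A : M + cabs c <= (K - 1) * cabs (z - c).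
  rewrite /K addrK; apply: (@le_trans _ _ ((M + cabs c) / r * r)); first by rewrite divfK// gt_eqF.
  by rewrite ler_wpM2l ?divr_ge0 ?addr_ge0 ?cabs_ge0 ?(ltW r0) ?(ltW M0) ?(ltW zc).
have : 0 < cabs (z - c) by exact: lt_trans zc.
nra.
Qed.

Lemma circle_pole c r (k : nat) : 0 < r ->
  cint (fun t => ((circle c r t - c)^-1) ^+ k.+2 * circle_deriv r t) = 0.
Proof.
move=> r0; have cn t : circle c r t - c != 0 by exact: circle_neq.
have P0 := C1pathB (circle_path c r) (C1path_cst c).
have P := C1pathX k (C1pathV P0 (fun t _ => cn t)).
have := C1path_integral P; rewrite -circle_closed subrr => E.
pose q : C := - k.+1%:R; have q0 : q != 0 by rewrite oppr_eq0 pnatr_eq0.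
have : q * cint (fun t => ((circle c r t - c)^-1) ^+ k.+2 * circle_deriv r t) = 0.
  rewrite -cintZ.
    rewrite -E; congr cint; apply/funext => t; rewrite subr0 /q -exprVn; set u := _^-1.
    by rewrite [u ^+ k.+2]exprS [u ^+ k.+1]exprS expr2; ring.
  apply: pcontM; last by case: (circle_path c r).
  apply: pcontX; apply: pcontV => [|t _]; last exact: cn.
  by case: P0.
by move=> /eqP; rewrite mulf_eq0 (negPf q0) => /eqP.
Qed.

End Circles.

Section Residues.
Variable R : realType.
Local Notation C := R[i].
Implicit Types (c z w : C) (f h : C -> C) (P Q : {poly C}).

Lemma poly_continuous_eps P c (e : R) : 0 < e ->
  exists2 d : R, 0 < d & forall z, cabs (z - c) < d -> cabs (P.[z] - P.[c]) < e.
Proof.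
elim/poly_ind: P e => [|P k IH] e e0.
  by exists 1 => // z _; rewrite !horner0 subrr cabs0.
have c0 := cabs_ge0 c; have P0 := cabs_ge0 P.[c].
have e1 : 0 < e / 2 / (cabs c + 1) by rewrite !divr_gt0 ?ltr_wpDl.
have e2 : 0 < e / 2 / (cabs P.[c] + 1) by rewrite !divr_gt0 ?ltr_wpDl.
have [d d0 H] := IH _ e1.
exists (Num.min (Num.min d 1) (e / 2 / (cabs P.[c] + 1))); first by rewrite !lt_min d0 e2 ltr01.
move=> z; rewrite !lt_min => /andP[/andP[zd z1] ze].
rewrite !hornerMXaddC opprD addrACA subrr addr0.
have -> : P.[z] * z - P.[c] * c = (P.[z] - P.[c]) * z + P.[c] * (z - c) by ring.
apply: (le_lt_trans (cabs_triangle _ _)); rewrite !cabsM.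
have zc : cabs z < cabs c + 1.
  by rewrite -[z](subrK c); apply: (le_lt_trans (cabs_triangle _ _)); rewrite addrC ltrD2l.
have A : cabs (P.[z] - P.[c]) * cabs z < e / 2.
  have := H z zd; rewrite ltr_pdivlMr ?ltr_wpDl//; apply: le_lt_trans.
  by rewrite ler_wpM2l ?cabs_ge0 ?(ltW zc).
have B : cabs P.[c] * cabs (z - c) <= e / 2.
  move: ze; rewrite ltr_pdivlMr ?ltr_wpDl// => /ltW; apply: le_trans.
  by rewrite mulrC ler_wpM2l ?cabs_ge0// lerDl.
by rewrite [e]splitr ltr_leD.
Qed.

Lemma pcont_poly P (h : R -> C) : pcont h -> pcont (fun t => P.[h t]).
Proof.
move=> ch; elim/poly_ind: P => [|P k IH].
  by apply: pcont_ext (pcont_cst 0) => t _; rewrite horner0.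
apply: pcont_ext (pcontD (pcontM IH ch) (pcont_cst k)) => t _.
by rewrite hornerMXaddC.
Qed.

Lemma seq_isolated (s : seq C) c : c \notin s ->
  exists2 d : R, 0 < d & forall z, cabs (z - c) < d -> z \notin s.
Proof.
elim: s => [|w s IH]; first by exists 1.
rewrite inE negb_or => /andP[cw /IH[d d0 H]].
exists (Num.min d (cabs (c - w))); first by rewrite lt_min d0 cabs_gt0 subr_eq0.
move=> z; rewrite lt_min => /andP[zd zw]; rewrite inE negb_or H// andbT.
by apply/eqP => E; move: zw; rewrite E cabs_distC ltxx.
Qed.

(** Continuity of the integrand on small circles is part of the condition, because additivity of
    [cint] relies on it. *)
Definition has_residue f c (rho : C) := forall e : R, 0 < e -> exists2 d : R, 0 < d &
  forall r : R, 0 < r < d -> pcont (fun t => f (circle c r t) * circle_deriv r t) /\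
    cabs ((two_pi_i R)^-1 * cint (fun t => f (circle c r t) * circle_deriv r t) - rho) <= e.

Lemma has_residueE f c rho : has_residue f c rho -> residue f c = rho.
Proof.
move=> H; rewrite /residue; apply: cvg_lim; first exact: norm_hausdorff.
apply/cvgrPdist_le => /= e e0; have [e' e'0 ->] := posc_real e0.
have [d d0 Hd] := H _ e'0.
near=> r; have rd : 0 < r < d.
  by apply/andP; split; near: r; [exact: nbhs_right_gt|exact: nbhs_right_lt].
have [_] := Hd r rd; rewrite normcabs lecR cabs_distC /contour_int curve_deriv_circle.
by [].
Unshelve. all: by end_near.
Qed.

Lemma has_residue_ext f h c rho : (exists2 d : R, 0 < d & forall z, 0 < cabs (z - c) < d -> f z = h z) ->
  has_residue f c rho -> has_residue h c rho.
Proof.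
move=> [d d0 fh] H e e0; have [d' d'0 H'] := H e e0.
exists (Num.min d d'); first by rewrite lt_min d0.
move=> r; rewrite lt_min => /andP[r0 /andP[rd rd']].
have E : (fun t => h (circle c r t) * circle_deriv r t) = (fun t => f (circle c r t) * circle_deriv r t).
  by apply/funext => t; rewrite fh// cabs_circle ?(ltW r0)// r0.
by rewrite E; apply: H'; rewrite r0.
Qed.

Lemma has_residueD f h c rho sig : has_residue f c rho -> has_residue h c sig ->
  has_residue (fun z => f z + h z) c (rho + sig).
Proof.
move=> H H' e e0; have e2 : 0 < e / 2 by rewrite divr_gt0.
have [d d0 Hd] := H _ e2; have [d' d'0 Hd'] := H' _ e2.
exists (Num.min d d'); first by rewrite lt_min d0.
move=> r; rewrite lt_min => /andP[r0 /andP[rd rd']].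
have [|p1 b1] := Hd r; first by rewrite r0.
have [|p2 b2] := Hd' r; first by rewrite r0.
have E : (fun t => (f (circle c r t) + h (circle c r t)) * circle_deriv r t) =
  (fun t => f (circle c r t) * circle_deriv r t + h (circle c r t) * circle_deriv r t).
  by apply/funext => t; rewrite mulrDl.
rewrite E; split; first exact: pcontD.
rewrite cintD// mulrDr opprD addrACA; apply: (le_trans (cabs_triangle _ _)).
by rewrite [e]splitr lerD.
Qed.

Lemma has_residueZ f c rho (k : C) : has_residue f c rho -> has_residue (fun z => k * f z) c (k * rho).
Proof.
move=> H e e0; have k0 := cabs_ge0 k; have K0 : 0 < cabs k + 1 by rewrite ltr_wpDl.
have [d d0 Hd] := H _ (divr_gt0 e0 K0); exists d => // r rd; have [p b] := Hd r rd.
have E : (fun t => k * f (circle c r t) * circle_deriv r t) =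
  (fun t => k * (f (circle c r t) * circle_deriv r t)) by apply/funext => t; rewrite mulrA.
rewrite E; split; first by apply: pcontM => //; exact: pcont_cst.
rewrite cintZ// mulrCA -mulrBr cabsM; move: b; rewrite ler_pdivlMr// => b.
apply: le_trans b; rewrite mulrC ler_wpM2l ?cabs_ge0// lerDl//.
Qed.

Lemma has_residue_simple c : has_residue (fun z => (z - c)^-1) c 1.
Proof.
move=> e e0; exists 1 => // r /andP[r0 _].
have E : (fun t => (circle c r t - c)^-1 * circle_deriv r t) = fun=> two_pi_i R.
  by apply/funext => t; rewrite (circle_deriv_sub c) mulrCA mulVf ?mulr1// circle_neq.
by rewrite E cint_cst mulVf ?two_pi_i_neq0// subrr cabs0 ltW//; split=> //; exact: pcont_cst.
Qed.

Lemma has_residue_multiple c (k : nat) : has_residue (fun z => ((z - c)^-1) ^+ k.+2) c 0.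
Proof.
move=> e e0; exists 1 => // r /andP[r0 _].
rewrite circle_pole// mulr0 subrr cabs0 ltW//; split=> //.
apply: pcontM; last by case: (circle_path c r).
apply: pcontX; apply: pcontV => [|t _]; last exact: circle_neq.
by case: (C1pathB (circle_path c r) (C1path_cst c)).
Qed.

(** The quotient is bounded near [c], while the speed of the circle is proportional to its
    radius. *)
Lemma has_residue_regular P Q c : Q.[c] != 0 -> has_residue (fun z => P.[z] / Q.[z]) c 0.
Proof.
move=> Qc; have q0 : 0 < cabs Q.[c] / 2 by rewrite divr_gt0// cabs_gt0.
have [d1 d10 H1] := poly_continuous_eps Q c q0.
have [d2 d20 H2] := poly_continuous_eps P c ltr01.
pose K := (cabs P.[c] + 1) / (cabs Q.[c] / 2); pose M := 2 * (K * cabs (two_pi_i R)) * cabs (two_pi_i R)^-1.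
have K0 : 0 <= K by rewrite divr_ge0 ?(ltW q0)// addr_ge0 ?cabs_ge0.
have M0 : 0 <= M by apply: mulr_ge0; rewrite ?cabs_ge0//; apply: mulr_ge0 => //; apply: mulr_ge0; rewrite ?cabs_ge0.
move=> e e0; exists (Num.min (Num.min d1 d2) (e / (M + 1))).
  by rewrite !lt_min d10 d20 divr_gt0// ltr_wpDl.
move=> r; rewrite !lt_min => /andP[r0 /andP[/andP[rd1 rd2] re]].
have cr t : cabs (circle c r t - c) = r by rewrite cabs_circle// ltW.
have Qb t : cabs Q.[c] / 2 <= cabs Q.[circle c r t].
  have := H1 (circle c r t); rewrite cr => /(_ rd1); rewrite cabs_distC => q1.
  have := cabs_lowtri Q.[c] Q.[circle c r t]; lra.
have Pb t : cabs P.[circle c r t] <= cabs P.[c] + 1.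
  have := H2 (circle c r t); rewrite cr => /(_ rd2) p1.
  have := cabs_lowtri P.[circle c r t] P.[c]; lra.
have Qn t : Q.[circle c r t] != 0 by rewrite -cabs_gt0; apply: lt_le_trans (Qb t).
have [cc cd _] := circle_path c r.
have pc : pcont (fun t => P.[circle c r t] / Q.[circle c r t] * circle_deriv r t).
  apply: pcontM => //; apply: pcontM; first exact: pcont_poly.
  by apply: pcontV => [|t _]; [exact: pcont_poly|exact: Qn].
split=> //; rewrite subr0 cabsM.
have B : cabs (cint (fun t => P.[circle c r t] / Q.[circle c r t] * circle_deriv r t)) <= 2 * (K * cabs (two_pi_i R) * r).
  apply: cint_bound => // t _; rewrite (circle_deriv_sub c) !cabsM cr mulrA ler_wpM2r ?(ltW r0)//.
  rewrite ler_wpM2r ?cabs_ge0// /K cabsV; apply: ler_pM => //; rewrite ?cabs_ge0// ?invr_ge0 ?cabs_ge0//.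
  by rewrite lef_pV2 ?posrE// ?cabs_gt0 ?Qn.
apply: (le_trans (ler_wpM2l (cabs_ge0 _) B)).
have -> : cabs (two_pi_i R)^-1 * (2 * (K * cabs (two_pi_i R) * r)) = M * r by rewrite /M; ring.
move: re; rewrite ltr_pdivlMr ?ltr_wpDl//; have := M0; nra.
Qed.

Lemma has_residue0 c : has_residue (fun=> 0) c 0.
Proof.
have := @has_residue_regular 0 1 c; rewrite hornerC oner_neq0 => /(_ isT).
by apply: has_residue_ext; exists 1 => // z _; rewrite horner0 mul0r.
Qed.

Local Notation prodX s := (\prod_(w <- s) ('X - w%:P)).

Lemma residue_pole c w k : has_residue (fun z => ((z - w)^-1) ^+ k.+1) c (if (c == w) && (k == 0) then 1 else 0).
Proof.
have [->|cw] := eqVneq c w.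
  by case: k => [|k]; [exact: has_residue_simple|exact: has_residue_multiple].
have := @has_residue_regular 1 (('X - w%:P) ^+ k.+1) c.
rewrite horner_exp hornerXsubC expf_neq0 ?subr_eq0// => /(_ isT).
apply: has_residue_ext; exists 1 => // z _.
by rewrite hornerC horner_exp hornerXsubC mul1r exprVn.
Qed.

(** Polar terms are split off one at a time. If w has multiplicity k + 1 in w :: s and Q is the
    product of the other factors, P = al Q + P1 (X - w), so the quotient is al / (z - w)^(k+1) plus
    P1 over the product of s. The total residue is the coefficient of 1 / z at infinity. *)
Lemma residues_exist (s : seq C) P : (size P <= size s)%N -> exists rho : C -> C,
  [/\ forall c, has_residue (fun z => P.[z] / (prodX s).[z]) c (rho c),
      forall c, c \notin s -> rho c = 0 &
      forall t, uniq t -> {subset s <= t} -> \sum_(c <- t) rho c = P`_(size s).-1].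
Proof.
have [l ls] := ubnP (size s); elim: l => // l IH in s P ls *.
case: s ls => [|w s] ls sP.
  move: sP; rewrite size_poly_leq0 => /eqP ->; exists (fun=> 0); split=> //.
    move=> c; apply: has_residue_ext (has_residue0 c); exists 1 => // z _.
    by rewrite horner0 mul0r.
  by move=> t _ _; rewrite big1// coef0.
pose k := count_mem w s; pose Q := \prod_(x <- s | x != w) ('X - x%:P).
have sQ : prodX s = ('X - w%:P) ^+ k * Q.
  rewrite (bigID (fun x => x == w)) /=; congr (_ * _).
  rewrite -big_filter; have -> : [seq i <- s | i == w] = nseq k w.
    by have /all_pred1P := filter_all (pred1 w) s; rewrite size_filter.
  by rewrite big_nseq iter_mulr_1.
have Qw : Q.[w] != 0.
  rewrite horner_prod prodf_seq_neq0; apply/allP => x _ /=; apply/implyP => xw.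
  by rewrite hornerXsubC subr_eq0 eq_sym.
pose al := P.[w] / Q.[w].
have /factor_theorem[P1 EP] : root (P - al *: Q) w.
  by rewrite rootE hornerD hornerN hornerZ divfK// subrr.
have mon : prodX s \is monic by apply: monic_prod => x _; exact: monicXsubC.
have monQ : Q \is monic by apply: monic_prod => x _; exact: monicXsubC.
have sizeQ : (size Q + k = (size s).+1)%N.
  have := size_prod_XsubC s id; rewrite sQ size_monicM ?monic_exp ?monicXsubC ?monic_neq0//.
  by rewrite size_exp_XsubC; lia.
have sizeP1 : (size P1 <= size s)%N.
  have [->|P10] := eqVneq P1 0; first by rewrite size_poly0.
  have := size_polyD P (- (al *: Q)); rewrite EP size_polyN size_Mmonic ?monicXsubC// size_XsubC addn2 /=.
  move=> h; rewrite -ltnS; apply: (leq_trans h); rewrite geq_max sP /=.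
  by apply: (leq_trans (size_scale_leq _ _)); rewrite -sizeQ leq_addr.
have [rho [H1 H2 H3]] := IH s P1 ls sizeP1.
exists (fun c => al * (if (c == w) && (k == 0)%N then 1 else 0) + rho c); split=> [c|c|t ut st].
- apply: has_residue_ext (has_residueD (has_residueZ al (residue_pole c w k)) (H1 c)).
  have cn : c \notin [seq x <- w :: s | x != c] by rewrite mem_filter eqxx.
  have [d d0 Hd] := seq_isolated cn.
  exists d => // z /andP[]; rewrite cabs_gt0 subr_eq0 => zc.
  move=> /Hd; rewrite mem_filter zc /= inE negb_or => /andP[zw zs].
  have n1 : z - w != 0 by rewrite subr_eq0.
  have n2 : (prodX s).[z] != 0.
    by rewrite -[_ == _]/(root _ _) root_prod_XsubC.
  have n3 : Q.[z] != 0 by move: n2; rewrite sQ hornerM mulf_eq0 negb_or => /andP[].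
  have EPz : P.[z] = al * Q.[z] + P1.[z] * (z - w).
    have := congr1 (fun p => p.[z]) EP; rewrite hornerD hornerN hornerZ hornerM hornerXsubC.
    by move=> /(canRL (subrK _)) ->; rewrite addrC.
  rewrite big_cons hornerM hornerXsubC sQ hornerM horner_exp hornerXsubC EPz.
  have n4 : (z - w) ^+ k != 0 by rewrite expf_neq0.
  rewrite exprVn exprS; move: n1 n3 n4; set A := z - w; set B := A ^+ k => n1 n3 n4.
  by field; rewrite n1 n3 n4.
- rewrite inE negb_or => /andP[/negPf -> cs]; rewrite mulr0 add0r; exact: H2.
have wt : w \in t by apply: st; rewrite inE eqxx.
rewrite big_split /= H3//; last by move=> x xs; apply: st; rewrite inE xs orbT.
rewrite -mulr_sumr (bigD1_seq w)//= eqxx /= big1 ?addr0; last by move=> x /negPf ->.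
have EPc : P`_(size s) = al * Q`_(size s) + (P1 * ('X - w%:P))`_(size s).
  have := congr1 (fun p : {poly C} => p`_(size s)) EP; rewrite coefB coefZ.
  by move=> /(canRL (subrK _)) ->; rewrite addrC.
rewrite EPc; congr (_ * _ + _).
  move: sizeQ; case: (k) => [|k'] E /=.
    by have := monicP monQ; rewrite lead_coefE -{1}[size Q]addn0 E.
  by rewrite nth_default//; move: E; rewrite addnS => -[<-]; exact: leq_addr.
rewrite mulrBr coefB coefMX mulrC coefCM [P1`_(size s)]nth_default// mulr0 subr0.
by case: (size s) sizeP1 => [|//]; rewrite size_poly_leq0 => /eqP ->; rewrite coef0.
Qed.

(** If Qi inverts Q modulo the product W, then P / (Q W) differs from the remainder of P Qi over W
    by a fraction with denominator Q, regular at the roots of W. *)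
Lemma residue_sum (s ps : seq C) f P Q Qi : (forall z, z \notin ps -> f z = P.[z] / (Q.[z] * (prodX s).[z])) ->
  (forall c, c \in s -> c \notin ps /\ Q.[c] != 0) -> prodX s %| Q * Qi - 1 ->
  \sum_(c \in [set` s]) residue f c = ((P * Qi) %% prodX s)`_(size s).-1.
Proof.
move=> fE cs /dvdpP[V QV]; set W := prodX s.
have mW : W \is monic by apply: monic_prod => x _; exact: monicXsubC.
have sW : size W = (size s).+1 by rewrite size_prod_XsubC.
pose T := (P * Qi) %/ W; pose P0 := (P * Qi) %% W.
have sP0 : (size P0 <= size s)%N by rewrite -ltnS -sW ltn_modp monic_neq0.
have [rho [H1 _ H3]] := residues_exist sP0.
rewrite -(H3 (undup s))// ?undup_uniq//; last by move=> x; rewrite mem_undup.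
have -> : [set` s] = [set` undup s] by apply/seteqP; split=> x /=; rewrite mem_undup.
rewrite -fsbig_seq ?undup_uniq//; apply: eq_big_seq => c; rewrite mem_undup => /cs[cps Qc].
apply: has_residueE; rewrite -[rho c]addr0.
apply: has_residue_ext (has_residueD (H1 c) (has_residue_regular (T * Q - P * V) Qc)).
have Qc0 : 0 < cabs Q.[c] by rewrite cabs_gt0.
have cn : c \notin [seq x <- s | x != c] by rewrite mem_filter eqxx.
have [d1 d10 Hd1] := seq_isolated cps.
have [d2 d20 Hd2] := seq_isolated cn.
have [d3 d30 Hd3] := poly_continuous_eps Q c Qc0.
exists (Num.min d1 (Num.min d2 d3)); first by rewrite !lt_min d10 d20.
move=> z; rewrite !lt_min => /andP[]; rewrite cabs_gt0 subr_eq0 => zc /andP[/Hd1 zps /andP[/Hd2 z2 /Hd3 z3]].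
have zs : z \notin s by move: z2; rewrite mem_filter zc.
have Wz : W.[z] != 0 by rewrite -[_ == _]/(root _ _) root_prod_XsubC.
have Qz : Q.[z] != 0.
  by apply/eqP => E; move: z3; rewrite E sub0r cabsN ltxx.
rewrite fE// -/W.
have A : P.[z] * Qi.[z] = T.[z] * W.[z] + P0.[z].
  by rewrite -!hornerM -hornerD -divp_eq.
have B : Q.[z] * Qi.[z] = 1 + V.[z] * W.[z].
  by rewrite -!hornerM -[1](hornerC 1 z) -hornerD -QV addrC subrK.
rewrite !(hornerD, hornerN, hornerM).
have -> : P0.[z] = P.[z] * Qi.[z] - T.[z] * W.[z] by rewrite A addrC addKr.
have -> : Qi.[z] = (1 + V.[z] * W.[z]) / Q.[z] by rewrite -B mulrAC divff// mul1r.
by field; rewrite Wz Qz.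
Qed.

End Residues.

Section PartialFractionDerivative.
Variables (F : fieldType) (r : seq nat) (p : nat -> F) (K : nat -> nat).
Local Notation one := (fun=> 1%N).

(** The logarithmic derivative sum K_i / (z - p_i), with denominators cleared. *)
Lemma pf_den_deriv : uniq r -> (pf_den r p K)^`() * pf_den r p one =
  pf_den r p K * \sum_(i <- r) (K i)%:R *: pf_cofactor r p one i.
Proof.
rewrite /pf_den /pf_cofactor; elim: r => [|i s IH] /=.
  by rewrite !big_nil -polyC1 derivC mul0r mulr0.
move=> /andP[ins us]; rewrite !big_cons derivM mulrDl eqxx /=.
have -> : \prod_(l <- s | l != i) ('X - (p l)%:P) ^+ 1 = \prod_(l <- s) ('X - (p l)%:P) ^+ 1.
  by rewrite big_seq_cond [RHS]big_seq_cond; apply: eq_bigl => l; case: eqP ins => [->|_ _]; rewrite ?andbT//= => /negPf ->.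
have -> : \sum_(j <- s) (K j)%:R *: \prod_(l <- i :: s | l != j) ('X - (p l)%:P) ^+ 1 =
    ('X - (p i)%:P) * \sum_(j <- s) (K j)%:R *: \prod_(l <- s | l != j) ('X - (p l)%:P) ^+ 1.
  rewrite mulr_sumr; apply: eq_big_seq => j js; rewrite big_cons.
  by case: eqP ins => [->|_ _] /=; [rewrite js|rewrite expr1 scalerAr].
have := IH us; set A := \prod_(l <- s) _ ^+ K l; set B := \prod_(l <- s) _; set M := \sum_(j <- s) _ => E.
have D : (('X - (p i)%:P) ^+ K i)^`() * ('X - (p i)%:P) = (K i)%:R *: ('X - (p i)%:P) ^+ K i.
  case: (K i) => [|k]; first by rewrite expr0 -polyC1 derivC mul0r scale0r.
  by rewrite deriv_exp derivXsubC mul1r /= mulrnAl -exprSr scaler_nat.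
rewrite expr1 mulrDr -scalerAr !scalerAl -D; move: E; set A' := A^`(); set Y' := _^`(); set X := 'X - _; set Y := X ^+ K i.
move=> E; have -> : Y * A' * (X * B) = Y * X * (A' * B) by ring.
by rewrite E; ring.
Qed.

End PartialFractionDerivative.

Lemma coef_top_mul (F : fieldType) (P Q : {poly F}) (i j : nat) :
  (size P <= i.+1)%N -> (size Q <= j.+1)%N -> (P * Q)`_(i + j) = P`_i * Q`_j.
Proof.
move=> Pi Qj; rewrite coefM.
have li : (i < (i + j).+1)%N by rewrite ltnS leq_addr.
rewrite (bigD1 (Ordinal li))//= addKn big1 ?addr0// => k ki.
have [ki'|ki'] := ltnP i k; first by rewrite nth_default ?mul0r// (leq_trans Pi).
rewrite [Q`_ _]nth_default ?mulr0//; apply: (leq_trans Qj).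
have : (k < i)%N by rewrite ltn_neqAle ki' andbT; exact: ki.
by lia.
Qed.

Section RationalDerivative.
Variable R : realType.
Local Notation C := R[i].

Lemma derive1_eps (f : C -> C) (z0 d : C) :
  (forall e : R, 0 < e -> exists2 del : R, 0 < del &
    forall z, z != z0 -> cabs (z - z0) < del -> cabs ((z - z0)^-1 * (f z - f z0) - d) < e) ->
  derive1 f z0 = d.
Proof.
move=> H; rewrite /derive1; apply: cvg_lim; first exact: norm_hausdorff.
apply/cvgrPdist_lt => /= e e0; have [e' e'0 ->] := posc_real e0.
have [del del0 Hd] := H _ e'0.
rewrite near_withinE; apply/nbhs_cabs; exists del => // h; rewrite subr0 => hd h0.
rewrite normr_ltc cabs_distC.
have := Hd (h + z0); rewrite addrK => Hz; apply: Hz => //.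
by rewrite -subr_eq0 addrK.
Qed.

(** With a0, b0 the values at z0, the polynomial b0 A - a0 B is divisible by X - z0, and the
    quotient Y expresses the difference quotient of A / B without a limit. *)
Lemma derive1_ratio (f : C -> C) (A B : {poly C}) (z0 : C) (del0 : R) : 0 < del0 ->
  (forall z, cabs (z - z0) < del0 -> B.[z] != 0 /\ f z = A.[z] / B.[z]) ->
  derive1 f z0 = (A^`().[z0] * B.[z0] - A.[z0] * B^`().[z0]) / B.[z0] ^+ 2.
Proof.
move=> del00 fE; have [B0 f0] := fE z0 ltac:(by rewrite subrr cabs0).
set a0 := A.[z0] in f0 *; set b0 := B.[z0] in B0 f0 *.
have /factor_theorem[Y EY] : root (b0 *: A - a0 *: B) z0.
  by rewrite rootE hornerD hornerN !hornerZ mulrC subrr.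
have Y0 : Y.[z0] = A^`().[z0] * b0 - a0 * B^`().[z0].
  have := congr1 (fun p : {poly C} => p^`().[z0]) EY.
  rewrite derivB !derivZ derivM derivXsubC mulr1 hornerD hornerN !hornerZ hornerD hornerM hornerXsubC.
  by rewrite subrr mulr0 add0r => <-; rewrite [b0 * _]mulrC.
rewrite -Y0; apply: derive1_eps => e e0.
pose Z := b0 *: Y - Y.[z0] *: B.
have Z0 : Z.[z0] = 0 by rewrite /Z hornerD hornerN !hornerZ mulrC subrr.
have b1 : 0 < cabs b0 by rewrite cabs_gt0.
have b2 : 0 < cabs b0 / 2 by rewrite divr_gt0.
have [d1 d10 H1] := poly_continuous_eps B z0 b2.
have e1 : 0 < e * (cabs b0 / 2 * cabs b0 ^+ 2) by rewrite !mulr_gt0// exprn_gt0.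
have [d2 d20 H2] := poly_continuous_eps Z z0 e1.
exists (Num.min del0 (Num.min d1 d2)); first by rewrite !lt_min del00 d10.
move=> z zz; rewrite !lt_min => /andP[/fE[Bz fz] /andP[/H1 zb /H2]].
rewrite Z0 subr0 => zZ; have z1 : z - z0 != 0 by rewrite subr_eq0.
have Bl : cabs b0 / 2 <= cabs B.[z].
  by move: zb; rewrite cabs_distC -/b0; have := cabs_lowtri b0 B.[z]; lra.
have -> : (z - z0)^-1 * (f z - f z0) - Y.[z0] / b0 ^+ 2 = Z.[z] / (B.[z] * b0 ^+ 2).
  have EYz := congr1 (fun p : {poly C} => p.[z]) EY.
  move: EYz; rewrite hornerM hornerXsubC hornerD hornerN !hornerZ => EYz.
  rewrite fz f0 /Z hornerD hornerN !hornerZ.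
  have -> : Y.[z] = (b0 * A.[z] - a0 * B.[z]) / (z - z0) by rewrite EYz mulfK.
  have aux (x y w a b b' : C) : b != 0 -> b' != 0 -> x != 0 ->
    x^-1 * (y / b - a / b') - w / b' ^+ 2 = (b' * ((b' * y - a * b) / x) - w * b) / (b * b' ^+ 2).
    by move=> ? ? ?; field; do ?[apply/andP; split].
  exact: aux.
have bb : 0 < cabs b0 / 2 * cabs b0 ^+ 2 by rewrite mulr_gt0// exprn_gt0.
rewrite cabsM cabsV cabsM cabsX.
have K : cabs b0 / 2 * cabs b0 ^+ 2 <= cabs B.[z] * cabs b0 ^+ 2 by rewrite ler_wpM2r// exprn_ge0// ltW.
rewrite ltr_pdivrMr ?(lt_le_trans bb K)//; apply: (lt_le_trans zZ).
by rewrite ler_wpM2l// ltW.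
Qed.

End RationalDerivative.

(** * The polynomials attached to lambda *)

Section TodaPolynomials.
Variables (R : realType) (m : nat) (n : nat -> nat).
Hypotheses (hm : (0 < m)%N) (hn : forall i : nat, (i <= m)%N -> (0 < n i)%N).
Local Notation C := R[i].
Local Notation N := (toda_dim m n).
Local Notation V := 'rV[C]_N.
Implicit Types (a u v : V) (z : C) (i j : nat).
Local Notation r := (index_iota 1 m.+1).
Local Notation one := (fun=> 1%N).
Let ur := uniq_r m.
Let r1 : 1%N \in r := one_r hm.

(** The product of z - a_{i,0} over i >= 2; the factor of index 1 is z itself ([lamPrE]). *)
Definition lamPi a : {poly C} := pf_cofactor r (pole a) one 1.
Definition lamPr a : {poly C} := pf_den r (pole a) one.
Definition lamM a : {poly C} := \sum_(i <- r) (n i)%:R *: pf_cofactor r (pole a) one i.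
Definition lamS a : {poly C} := lamA a * lamPi a.
(** Away from the poles this is z D lambda' ([lamW_off]); its roots are the critical points of
    lambda ([lam_critE]). *)
Definition lamW a : {poly C} := (lamA a)^`() * lamPr a - lamA a * lamM a.

Lemma lamPrE a : lamPr a = 'X * lamPi a.
Proof. by rewrite /lamPr (pf_den_cofactor _ _ ur r1) pole1// expr1 subr0. Qed.

Lemma lamDE a : lamD a = lamB a * lamPi a.
Proof.
rewrite /lamD /lamB /lamPi /pf_den /pf_cofactor [X in _ = _ * X]big_mkcond -big_split /=.
by apply: eq_bigr => i _; rewrite /ordD; case: eqP => _ /=; rewrite ?mulr1// exprSr.
Qed.

Lemma dimE' : (N = n 0 + (\sum_(i <- r) n i) + m.-1)%N.
Proof.
rewrite dimE// -addnA; congr (_ + _)%N; rewrite (bigD1_seq 1%N)//= [in RHS](bigD1_seq 1%N)//=.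
rewrite -addnA; congr (_ + _)%N; rewrite (eq_bigr (fun i => n i + 1)%N) => [|i /negPf i1].
  rewrite big_split /=; congr (_ + _)%N; rewrite sum1_count.
  have := count_predC (pred1 1%N) r; rewrite size_iota subn1 /= (count_uniq_mem _ ur) r1.
  by move=> E; apply/succn_inj; rewrite prednK// -[RHS]E.
by rewrite /ordD i1 addn1.
Qed.

Lemma coef_lamA_top a : (lamA a)`_(n 0 + \sum_(i <- r) n i) = (n 0)%:R^-1.
Proof.
rewrite /lamA /pf_num coefD coef_top_mul.
- rewrite [X in _ + X]nth_default ?addr0; last first.
    by apply: (leq_trans (size_pf_tail _ _ ur _)); exact: leq_addl.
  have /monicP := monic_pf_den r (pole a) n; rewrite lead_coefE size_pf_den /= => ->.
  by rewrite mulr1 /lam_poly coefD coefZ coefXn eqxx mulr1 coef_poly ltnn addr0.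
- rewrite /lam_poly; apply: (leq_trans (size_polyD _ _)); rewrite geq_max.
  rewrite (leq_trans (size_scale_leq _ _)) ?size_polyXn//=.
  by apply: (leq_trans (size_poly _ _)).
- by rewrite size_pf_den.
Qed.

Lemma size_lamA a : size (lamA a) = (n 0 + \sum_(i <- r) n i).+1.
Proof.
apply/eqP; rewrite eqn_leq; apply/andP; split.
  rewrite -addSn; apply: size_pf_num; first exact: ur.
  apply: (leq_trans (size_polyD _ _)); rewrite geq_max.
  rewrite (leq_trans (size_scale_leq _ _)) ?size_polyXn//=.
  by apply: (leq_trans (size_poly _ _)).
apply: contraT; rewrite -leqNgt => H; have := coef_lamA_top a; rewrite nth_default// => /eqP.
by rewrite eq_sym invr_eq0 (negPf (n0_neq0 R hn)).
Qed.

Lemma lead_lamA a : lead_coef (lamA a) = (n 0)%:R^-1.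
Proof. by rewrite lead_coefE size_lamA coef_lamA_top. Qed.

Lemma size_lamPi a : size (lamPi a) = m.
Proof. by rewrite size_pf_cofactor// sum1_size size_iota subn1 subn1 /= prednK. Qed.

Lemma monic_lamPi a : lamPi a \is monic.
Proof. by apply: monic_prod => i _; rewrite monic_exp// monicXsubC. Qed.

Lemma size_lamPr a : size (lamPr a) = m.+1.
Proof. by rewrite size_pf_den sum1_size size_iota subn1. Qed.

Lemma size_lamS a : size (lamS a) = N.+1.
Proof.
rewrite /lamS size_Mmonic ?monic_lamPi// -?size_poly_eq0 ?size_lamA// size_lamPi dimE'.
by rewrite addSn /= -addnS prednK.
Qed.

Lemma lamM_size a : (size (lamM a) <= m)%N /\ (lamM a)`_m.-1 = (\sum_(i <- r) n i)%:R.
Proof.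
have sz i : i \in r -> size (pf_cofactor r (pole a) one i) = m.
  by move=> ir; rewrite size_pf_cofactor// sum1_size size_iota subn1 subn1 /= prednK.
split.
  apply: (leq_trans (size_sum _ _ _)); apply/bigmax_leqP_seq => i ir _.
  by apply: (leq_trans (size_scale_leq _ _)); rewrite sz.
rewrite coef_sum natr_sum; apply: eq_big_seq => i ir.
rewrite coefZ -[m.-1](congr1 predn (sz i ir)) -lead_coefE.
suff /monicP -> : pf_cofactor r (pole a) one i \is monic by rewrite mulr1.
by apply: monic_prod => l _; rewrite monic_exp// monicXsubC.
Qed.

(** The leading coefficient is n_0^-1 times the degree of the numerator minus the total order of the
    finite poles, that is n_0^-1 n_0 = 1. *)
Lemma coef_lamW a : (size (lamW a) <= N.+1)%N /\ (lamW a)`_N = 1.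
Proof.
set d := (n 0 + \sum_(i <- r) n i)%N.
have d0 : (0 < d)%N by rewrite addn_gt0 hn.
have [sM cM] := lamM_size a.
have sA' : (size (lamA a)^`() <= d)%N by rewrite -(leq_add2r 1) !addn1 -(size_lamA a) lt_size_deriv// -size_poly_eq0 size_lamA.
have E1 : N = (d.-1 + m)%N by rewrite dimE' -/d; lia.
have E2 : N = (d + m.-1)%N by rewrite dimE'.
split.
  apply: (leq_trans (size_polyD _ _)); rewrite geq_max size_polyN; apply/andP; split.
    apply: (leq_trans (size_polyMleq _ _)); rewrite size_lamPr addnS /=.
    by apply: (leq_trans (leq_add sA' (leqnn _))); rewrite [X in (_ <= X.+1)%N]E1 -addSn prednK.
  apply: (leq_trans (size_polyMleq _ _)); rewrite size_lamA -/d addSn /=.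
  by apply: (leq_trans (leq_add (leqnn _) sM)); rewrite [X in (_ <= X.+1)%N]E2 -addnS prednK.
rewrite coefB {1}E1 E2 !coef_top_mul ?size_lamA// ?size_lamPr//; [|by rewrite prednK|by rewrite prednK].
have /monicP := monic_pf_den r (pole a) one; rewrite lead_coefE -/(lamPr a) size_lamPr /= => ->.
rewrite cM coef_deriv prednK// /d coef_lamA_top mulr1 -[X in X - _]mulr_natr natrD mulrDr.
have := n0_neq0 R hn; set x := (n 0)%:R; set y := (\sum_(i <- r) n i)%:R => x0.
by rewrite addrK mulVf.
Qed.

Lemma size_lamW a : size (lamW a) = N.+1.
Proof.
have [H1 H2] := coef_lamW a; apply/eqP; rewrite eqn_leq H1 /=; apply: contraT; rewrite -leqNgt => H.
by move: H2; rewrite nth_default// => /eqP; rewrite eq_sym oner_eq0.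
Qed.

Lemma monic_lamW a : lamW a \is monic.
Proof. by rewrite monicE lead_coefE size_lamW (coef_lamW a).2. Qed.

Section AtPoint.
Variable a : V.
Hypothesis Ma : toda_manifold a.
Let ip := pole_inj Ma.

Lemma lamA_pole i : i \in r -> (lamA a).[pole a i] != 0.
Proof.
move=> ir; have im : (1 <= i <= m)%N by rewrite -mem_r.
rewrite pf_num_pole//; last by apply: hn; case/andP: im.
rewrite mulf_neq0 ?pf_cofactor_neq0//.
by apply: Ma.1.
Qed.

Lemma lamPr_pole i : i \in r -> (lamPr a).[pole a i] = 0.
Proof. by move=> ir; rewrite /lamPr (pf_den_cofactor _ _ ur ir) hornerM horner_exp hornerXsubC subrr expr1 mul0r. Qed.

Lemma lamM_pole i : i \in r -> (lamM a).[pole a i] = (n i)%:R * (pf_cofactor r (pole a) one i).[pole a i].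
Proof.
move=> ir; rewrite /lamM horner_sum (bigD1_seq i)//= hornerZ big_seq_cond big1 ?addr0//.
move=> l /andP[lr li]; rewrite hornerZ /pf_cofactor (big_rem i)//= eq_sym li hornerM horner_exp hornerXsubC.
by rewrite subrr expr1 mul0r mulr0.
Qed.

(** At a pole [lamPr] vanishes, while the numerator of lambda and [lamM] do not. Hence no root of
    [lamW] is a spurious critical point. *)
Lemma lamW_pole i : i \in r -> (lamW a).[pole a i] != 0.
Proof.
move=> ir; have im : (1 <= i <= m)%N by rewrite -mem_r.
rewrite /lamW hornerD hornerN !hornerM lamPr_pole// mulr0 sub0r oppr_eq0 mulf_neq0 ?lamA_pole//.
rewrite lamM_pole// mulf_neq0 ?pf_cofactor_neq0// pnatr_eq0 -lt0n hn//.
by case/andP: im.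
Qed.

Lemma lamS_off z : ~ lam_pole a z -> (lamS a).[z] = (lamD a).[z] * lam a z.
Proof.
move=> Hz; rewrite lamE// lamDE /lamS !hornerM.
by have := lamBn0 Hz; set b := _.[z]; set c := _.[z]; set d := _.[z] => b0; field.
Qed.

Lemma pole_isolated z : ~ lam_pole a z -> exists2 d : R, 0 < d &
  forall w, cabs (w - z) < d -> ~ lam_pole a w.
Proof.
move=> /npoleP Hz; have zs : z \notin [seq pole a i | i <- r].
  by apply/mapP => -[i /Hz/eqP].
have [d d0 H] := seq_isolated zs; exists d => // w /H ws; apply/npoleP => i ir.
by apply: contra ws => /eqP ->; exact: map_f.
Qed.

Lemma lamW_off z : ~ lam_pole a z -> (lamW a).[z] = z * (lamD a).[z] * lam' a z.
Proof.
move=> Hz; have [d d0 Hd] := pole_isolated Hz.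
rewrite /lam' (@derive1_ratio _ _ (lamA a) (lamB a) _ _ d0); last first.
  by move=> w /Hd Hw; split; [exact: lamBn0|exact: lamE].
have B0 := lamBn0 Hz.
have := congr1 (fun P : {poly C} => P.[z]) (pf_den_deriv (pole a) n ur).
rewrite -/(lamB a) -/(lamPr a) -/(lamM a) !hornerM => E.
rewrite /lamW hornerD hornerN !hornerM lamDE hornerM.
have EP : (lamPr a).[z] = z * (lamPi a).[z] by rewrite lamPrE hornerM hornerX.
have EM : (lamM a).[z] = (lamB a)^`().[z] * (lamPr a).[z] / (lamB a).[z] by rewrite E mulrC mulKf.
rewrite EM EP; move: B0.
set b := (lamB a).[z]; set b' := (lamB a)^`().[z]; set A := (lamA a).[z]; set A' := (lamA a)^`().[z].
set q := (lamPi a).[z] => b0.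
have aux (x x' y y' w v : C) : x != 0 ->
  y' * (v * w) - y * (x' * (v * w) / x) = v * (x * w) * ((y' * x - y * x') / x ^+ 2).
  by move=> ?; field.
exact: aux.
Qed.

Lemma lamD0 z : ~ lam_pole a z -> (lamD a).[z] != 0.
Proof. by move=> /lamDn0. Qed.

Lemma pole_neq0 z : ~ lam_pole a z -> z != 0.
Proof. by move=> /npoleP/(_ 1%N r1); rewrite pole1. Qed.

Lemma lam_critE : lam_crit a = [set z | root (lamW a) z].
Proof.
apply/seteqP; split=> z /=.
  by move=> [Hz H]; rewrite /root lamW_off// H mulr0.
move=> /eqP Wz; have Hz : ~ lam_pole a z.
  by apply/npoleP => i ir; apply/eqP => E; move: (lamW_pole ir); rewrite -E Wz eqxx.
split=> //; move: Wz; rewrite lamW_off// => /eqP; rewrite !mulf_eq0.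
by rewrite (negPf (pole_neq0 Hz)) (negPf (lamD0 Hz)) => /eqP.
Qed.

End AtPoint.
End TodaPolynomials.

Section SmoothSums.
Variables (R : realType) (N : nat).
Local Notation C := R[i].
Local Notation V := 'rV[C]_N.
Implicit Types (a b v : V) (U : set V) (h : V -> R -> C).

Lemma udX h a (c : 'I_N -> R -> C) (j : nat) : pcont (h a) -> ud h a c ->
  ud (fun b t => h b t ^+ j) a (fun k t => j%:R * h a t ^+ j.-1 * c k t).
Proof.
move=> ch uh; elim: j => [|j IH].
  by apply: ud_eq (ud_cst (fun=> 1) a) => [b t|k t]; rewrite ?expr0// !mul0r.
have chj : pcont (fun t => h a t ^+ j) by exact: pcontX.
apply: ud_eq (udM ch chj uh IH) => [b t|k t]; first by rewrite exprS.
case: j {IH chj} => [|j] /=; first by rewrite expr0; ring.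
by rewrite exprS -[j.+2%:R]natr1; ring.
Qed.

Lemma ud_sum_seq (I : eqType) (s : seq I) (F : I -> V -> R -> C) a (c : I -> 'I_N -> R -> C) :
  (forall i, i \in s -> ud (F i) a (c i)) ->
  ud (fun b t => \sum_(i <- s) F i b t) a (fun k t => \sum_(i <- s) c i k t).
Proof.
elim: s => [|i s IH] H.
  by apply: ud_eq (ud_cst (fun=> 0) a) => [b t|k t]; rewrite big_nil.
have Hi := H i (mem_head _ _).
have Hs : ud (fun b t => \sum_(i <- s) F i b t) a (fun k t => \sum_(i <- s) c i k t).
  by apply: IH => j js; apply: H; rewrite inE js orbT.
by apply: ud_eq (udD Hi Hs) => [b t|k t]; rewrite big_cons.
Qed.

Lemma smooth_sum_seq n U (I : eqType) (s : seq I) (F : I -> V -> R -> C) :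
  (forall i, i \in s -> smooth n U (F i)) -> smooth n U (fun a t => \sum_(i <- s) F i a t).
Proof.
elim: s => [|i s IH] H.
  have -> : (fun a t => \sum_(i <- [::]) F i a t) = (fun _ _ => 0).
    by apply/funext => a; apply/funext => t; rewrite big_nil.
  exact: (smooth_cst n U (pcont_cst 0)).
have -> : (fun a t => \sum_(i <- i :: s) F i a t) = (fun a t => F i a t + \sum_(i <- s) F i a t).
  by apply/funext => a; apply/funext => t; rewrite big_cons.
apply: smoothD; first by apply: H; rewrite mem_head.
by apply: IH => j js; apply: H; rewrite inE js orbT.
Qed.

End SmoothSums.

(** * The Frobenius structure in the quotient algebra *)

Section TodaTangent.
Variables (R : realType) (m : nat) (n : nat -> nat).
Hypotheses (hm : (0 < m)%N) (hn : forall i : nat, (i <= m)%N -> (0 < n i)%N).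
Local Notation C := R[i].
Local Notation N := (toda_dim m n).
Local Notation V := 'rV[C]_N.
Implicit Types (a u v : V) (z : C) (i j : nat).
Local Notation r := (index_iota 1 m.+1).

Lemma coef_coord u i j : coef u i j = \sum_k u 0 k * (nth (0%N, 0%N) (toda_index m n) k == (i, j))%:R.
Proof. by rewrite /coef big_mkcond; apply: eq_bigr => k _; case: eqP; rewrite ?mulr1 ?mulr0. Qed.

Lemma coef_delta i j (k : 'I_N) :
  coef (delta_mx 0 k : V) i j = (nth (0%N, 0%N) (toda_index m n) k == (i, j))%:R.
Proof.
rewrite coef_coord (bigD1 k)//= big1 => [|l lk]; first by rewrite mxE !eqxx mul1r addr0.
by rewrite mxE (negPf lk) andbF mul0r.
Qed.

Lemma ud_coef a i j : ud (fun b _ => coef b i j) a (fun k _ => coef (delta_mx 0 k : V) i j).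
Proof.
apply: ud_eq (ud_linear (fun k : 'I_N => (nth (0%N, 0%N) (toda_index m n) k == (i, j))%:R) a).
  by move=> b t; rewrite coef_coord.
by move=> k t; rewrite coef_delta.
Qed.

Lemma smooth_coef l (U : set V) i j : smooth l U (fun a _ => coef a i j).
Proof.
have -> : (fun (a : V) (_ : R) => coef a i j) =
  (fun a _ => \sum_k a 0 k * (nth (0%N, 0%N) (toda_index m n) k == (i, j))%:R).
  by apply/funext => a; apply/funext => t; rewrite coef_coord.
exact: smooth_coord.
Qed.

Lemma ud_lam a (zeta : R -> C) : pcont zeta ->
  (forall t, 0 <= t <= 1 -> ~ lam_pole a (zeta t)) ->
  ud (fun b t => lam b (zeta t)) a (fun k t => dlam a (delta_mx 0 k) (zeta t)).
Proof.
move=> cz off.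
have ucz := ud_cst zeta a.
have P1 : ud (fun b t => \sum_(0 <= j < n 0) coef b 0 j * zeta t ^+ j) a
    (fun k t => \sum_(0 <= j < n 0) coef (delta_mx 0 k : V) 0 j * zeta t ^+ j).
  apply: ud_sum_seq => j _.
  have := udM (pcont_cst (coef a 0 j)) (pcontX j cz) (ud_coef a 0 j) (ud_cst (fun t => zeta t ^+ j) a).
  by apply: ud_eq => // k t; rewrite mulr0 add0r.
have P2 : ud (fun b t => \sum_(1 <= i < m.+1) \sum_(1 <= j < (n i).+1)
       coef b i j * (zeta t - coef b i 0) ^- j) a
    (fun k t => \sum_(1 <= i < m.+1) \sum_(1 <= j < (n i).+1)
       (coef (delta_mx 0 k : V) i j * (zeta t - pole a i) ^- j +
        coef a i j * (j%:R * coef (delta_mx 0 k : V) i 0 * (zeta t - pole a i) ^- j.+1))).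
  apply: ud_sum_seq => i ir; apply: ud_sum_seq => j _.
  have nz t : 0 <= t <= 1 -> zeta t - coef a i 0 != 0.
    by move=> /off/npoleP H; rewrite subr_eq0; exact: H.
  have cd : pcont (fun t => zeta t - coef a i 0) by apply: pcontD => //; exact: pcont_cst.
  have u1 : ud (fun b t => zeta t - coef b i 0) a (fun k _ => - coef (delta_mx 0 k : V) i 0).
    have := udM (pcont_cst (-1)) (pcont_cst _) (ud_cst (fun=> -1) a) (ud_coef a i 0).
    move=> /(udD ucz); apply: ud_eq => [b t|k t]; first by rewrite mulN1r.
    by rewrite mul0r addr0 add0r mulN1r.
  have u2 := udX j cd u1.
  have nzj t : 0 <= t <= 1 -> (zeta t - coef a i 0) ^+ j != 0 by move=> /nz; exact: expf_neq0.
  have u3 := udV (pcontX j cd) nzj u2.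
  have := udM (pcont_cst _) (pcontV (pcontX j cd) nzj) (ud_coef a i j) u3.
  apply: ud_ext; first by apply/nbhs_vabs; exists 1.
  move=> k t /nz; rewrite /pole; set x := zeta t - _; set c := coef a i j.
  set e := coef _ i 0; set f := coef _ i j => x0.
  rewrite addrC; congr (_ + _ * _); case: (j) => [|j'] /=; first by rewrite !mul0r oppr0 mul0r.
  rewrite mulrN opprK -!exprVn; set y := x^-1.
  have E : x ^+ j' * y ^+ j' = 1 by rewrite -exprMn mulfV// expr1n.
  have -> : (y ^+ j'.+1) ^+ 2 = y ^+ j' * y ^+ j'.+2 by rewrite -exprM -exprD; congr (_ ^+ _); lia.
  have aux (p A B D q : C) : A * B = 1 -> p * A * q * (B * D) = p * q * D.
    by move=> AB; rewrite -[RHS]mul1r -AB; ring.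
  exact: aux.
have := udD (udD (ud_cst (fun t => (n 0)%:R^-1 * zeta t ^+ n 0) a) P1) P2.
by apply: ud_eq => // k t; rewrite add0r.
Qed.

Lemma smooth_lam l (U : set V) (zeta : R -> C) : open U -> pcont zeta ->
  (forall a t, U a -> 0 <= t <= 1 -> ~ lam_pole a (zeta t)) ->
  smooth l U (fun a t => lam a (zeta t)).
Proof.
move=> oU cz off; rewrite /lam; apply: smoothD.
  apply: smoothD.
    apply: smooth_cst; apply: pcontM; [exact: pcont_cst|exact: pcontX].
  apply: smooth_sum_seq => j _; apply: smoothM; first exact: smooth_coef.
  by apply: smooth_cst; exact: pcontX.
apply: smooth_sum_seq => i ir; apply: smooth_sum_seq => j _; apply: smoothM; first exact: smooth_coef.
apply: smoothV => // [a t Ua t01|].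
  apply: expf_neq0; rewrite subr_eq0; have /npoleP := off a t Ua t01; exact.
apply: smoothX => //; apply: smoothD; first exact: smooth_cst.
by apply: smoothN => //; exact: smooth_coef.
Qed.

Lemma dlam_linear a z : ~ lam_pole a z -> forall (k : C) u v,
  dlam a (k *: u + v) z = k * dlam a u z + dlam a v z.
Proof.
move=> Hz k u v; have D0 := lamDn0 Hz; apply: (mulfI D0).
have := congr1 (fun P : {poly C} => P.[z]) (tanP_linear a k u v).
rewrite [in X in _ = X]hornerD [in X in _ = X]hornerZ !tanPE// => ->.
have aux (D x y : C) : k * (D * x) + D * y = D * (k * x + y) by ring.
exact: aux.
Qed.

Lemma tangent_lamE a u z : ~ lam_pole a z -> tangent_lam a u z = dlam a u z.
Proof.
move=> Hz; have U := ud_lam (pcont_cst z) (fun t _ => Hz).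
have [_ E] := ud_differentiable U.
by rewrite /tangent_lam E (linear_row_sum (dlam_linear Hz)).
Qed.

Lemma tanP_tangent a u z : ~ lam_pole a z -> (tanP a u).[z] = (lamD a).[z] * tangent_lam a u z.
Proof. by move=> Hz; rewrite tangent_lamE// tanPE. Qed.

Lemma poleP a z : z \notin [seq pole a i | i <- r] -> ~ lam_pole a z.
Proof.
by move=> zs; apply/npoleP => i ir; apply: contra zs => /eqP ->; exact: map_f.
Qed.

Section AtPoint.
Variable a : V.
Hypothesis Ma : toda_manifold a.

Lemma tanP_unit e : toda_unit_field e -> tanP a (e a) = lamD a.
Proof.
move=> he; apply: (@poly_eq_off _ _ _ [seq pole a i | i <- r]) => z /poleP Hz.
by rewrite tanP_tangent// he// mulr1.
Qed.

(** The term z lambda' / n_0 of the Euler field is a multiple of [lamW], so E acts like lambda. *)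
Lemma tanP_euler E : toda_euler_field E -> lamW a %| tanP a (E a) - lamS a.
Proof.
move=> hE; suff -> : tanP a (E a) - lamS a = - (n 0)%:R^-1 *: lamW a.
  by rewrite dvdpZr ?dvdpp// oppr_eq0 invr_eq0 (n0_neq0 R hn).
apply: (@poly_eq_off _ _ _ [seq pole a i | i <- r]) => z /poleP Hz.
rewrite hornerD hornerN hornerZ tanP_tangent// hE// lamS_off// lamW_off//.
by field; exact: (n0_neq0 R hn).
Qed.

Lemma coprime_closed (K : closedFieldType) (P Q : {poly K}) :
  (forall x, root P x -> ~~ root Q x) -> coprimep P Q.
Proof.
move=> H; apply: contraT => /closed_rootP[x]; rewrite root_gcd => /andP[Px Qx].
by have := H x Px; rewrite Qx.
Qed.

Lemma coprime_inverse (K : fieldType) (P Q : {poly K}) : coprimep P Q ->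
  exists q, P %| Q * q - 1.
Proof.
move=> /Bezout_eq1_coprimepP[[u v] /= E]; exists v.
have -> : Q * v - 1 = - u * P by rewrite -E; ring.
by rewrite dvdp_mull.
Qed.

Lemma lamW_root z : root (lamW a) z -> ~ lam_pole a z.
Proof.
move=> Wz; have : lam_crit a z; first by rewrite (lam_critE hm hn Ma).
by case.
Qed.

Lemma lamW_coprimeD : coprimep (lamW a) (lamD a).
Proof. by apply: coprime_closed => z /lamW_root Hz; exact: lamDn0. Qed.

Lemma lamW_coprimeX : coprimep (lamW a) 'X.
Proof.
by apply: coprime_closed => z /lamW_root/(pole_neq0 hm) z0; rewrite /root hornerX.
Qed.

(** Written over common denominators, the integrands have denominators z D W and z D^2 W. As z and D
    are units modulo W, [residue_sum] turns the sums of residues into top coefficients. *)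
Lemma toda_frobenius : exists d x, [/\ lamW a %| lamD a * d - 1, lamW a %| 'X * x - 1,
  toda_eta a = quotient_eta (lamW a) d x (tanP a) &
  toda_c a = quotient_c (lamW a) d x (tanP a)].
Proof.
have [d dP] := coprime_inverse lamW_coprimeD; have [x xP] := coprime_inverse lamW_coprimeX.
exists d, x; have [s sE] : exists s : seq C, lamW a = \prod_(z <- s) ('X - z%:P).
  have [s sE] := closed_field_poly_normal (lamW a); exists s.
  by rewrite sE (monicP (monic_lamW hm hn a)) scale1r.
have ss : size s = N by have := size_lamW hm hn a; rewrite sE size_prod_XsubC => -[].
have crit : lam_crit a = [set` s].
  by rewrite lam_critE//; apply/seteqP; split=> z /=; rewrite sE root_prod_XsubC.
pose ps := [seq pole a i | i <- r].
have sps z : z \in s -> z \notin ps.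
  move=> zs; have /lamW_root/npoleP Hz : root (lamW a) z by rewrite sE root_prod_XsubC.
  by apply/mapP => -[i /Hz/eqP].
have D0 z : z \in s -> (lamD a).[z] != 0 by move=> /sps/poleP; exact: lamDn0.
have X0 z : z \in s -> z != 0 by move=> /sps/poleP; exact: pole_neq0.
split=> //.
  apply/funext => u; apply/funext => v; rewrite /toda_eta crit.
  rewrite (@residue_sum _ s ps _ (tanP a u * tanP a v) ('X * lamD a) (d * x)).
  - by rewrite -sE ss /quotient_eta /top_coef !mulrA.
  - move=> z /poleP Hz; rewrite -sE !hornerM hornerX !tanP_tangent// lamW_off//.
    have := lamDn0 Hz; have := pole_neq0 hm Hz; set D := (lamD a).[z]; set l := lam' a z.
    set y := tangent_lam a u z; set w := tangent_lam a v z => z0 D1.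
    have aux (z' D' l' y' w' : C) : z' != 0 -> D' != 0 ->
       y' * w' / (z' ^+ 2 * l') = D' * y' * (D' * w') / (z' * D' * (z' * D' * l')).
      (* Where lambda' vanishes both sides are 0, because 0^-1 = 0. *)
      move=> z1 D2; have [->|l0] := eqVneq l' 0; first by rewrite !mulr0 invr0 !mulr0.
      by field; rewrite l0 D2 z1.
    exact: aux.
  - by move=> z zs; split; [exact: sps|by rewrite hornerM hornerX; apply: mulf_neq0; [exact: X0|exact: D0]].
  - rewrite -sE; have -> : 'X * lamD a * (d * x) - 1 = (lamD a * d - 1) * ('X * x) + ('X * x - 1) by ring.
    by rewrite dvdp_add// dvdp_mulr.
apply/funext => u; apply/funext => v; apply/funext => w; rewrite /toda_c crit.
rewrite (@residue_sum _ s ps _ (tanP a u * tanP a v * tanP a w) ('X * lamD a ^+ 2) (d * d * x)).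
- by rewrite -sE ss /quotient_c /top_coef !mulrA.
- move=> z /poleP Hz; rewrite -sE !hornerM hornerX !tanP_tangent// lamW_off//.
  have := lamDn0 Hz; have := pole_neq0 hm Hz; set D := (lamD a).[z]; set l := lam' a z.
  set y := tangent_lam a u z; set x' := tangent_lam a v z; set w' := tangent_lam a w z => z0 D1.
  have aux (p D' l' y' q s' : C) : p != 0 -> D' != 0 ->
     y' * q * s' / (p ^+ 2 * l') = D' * y' * (D' * q) * (D' * s') / (p * (D' * D') * (p * D' * l')).
    move=> z1 D2; have [->|l0] := eqVneq l' 0; first by rewrite !mulr0 invr0 !mulr0.
    by field; rewrite l0 D2 z1.
  exact: aux.
- by move=> z zs; split; [exact: sps|by rewrite !hornerM hornerX; do ?apply: mulf_neq0; by [exact: X0|exact: D0]].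
- rewrite -sE; have -> : 'X * lamD a ^+ 2 * (d * d * x) - 1 =
    (lamD a * d - 1) * ((lamD a * d + 1) * 'X * x) + ('X * x - 1) by ring.
  by rewrite dvdp_add// dvdp_mulr.
Qed.

End AtPoint.
End TodaTangent.

(** * The almost dual structure in terms of roots *)

Section Lagrange.
Variables (F : fieldType) (I : finType) (y : I -> F).
Hypothesis iy : injective y.
Implicit Types (P : {poly F}) (z : F) (k l : I).

Definition nodal : {poly F} := \prod_k ('X - (y k)%:P).
Definition conodal k : {poly F} := \prod_(l | l != k) ('X - (y l)%:P).

Lemma nodal_conodal k : nodal = ('X - (y k)%:P) * conodal k.
Proof. by rewrite /nodal (bigD1 k). Qed.

Lemma nodal_deriv k : nodal^`().[y k] = (conodal k).[y k].
Proof.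
rewrite (nodal_conodal k) derivM derivXsubC mul1r hornerD hornerM hornerXsubC.
by rewrite subrr mul0r addr0.
Qed.

Lemma conodal_neq0 k : (conodal k).[y k] != 0.
Proof.
rewrite horner_prod prodf_seq_neq0; apply/allP => l _; apply/implyP => lk.
by rewrite hornerXsubC subr_eq0; apply: contra lk => /eqP/iy->.
Qed.

Lemma conodal0 k l : k != l -> (conodal k).[y l] = 0.
Proof.
move=> kl; rewrite horner_prod (bigD1 l) 1?eq_sym//= hornerXsubC subrr mul0r.
by [].
Qed.

Lemma monic_conodal k : conodal k \is monic.
Proof. by apply: monic_prod => l _; exact: monicXsubC. Qed.

Lemma size_nodal : size nodal = #|I|.+1.
Proof. by rewrite /nodal size_prod_XsubC /index_enum -enumT -cardE. Qed.

Lemma size_conodal k : size (conodal k) = #|I|.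
Proof.
have := size_nodal; rewrite (nodal_conodal k) size_monicM ?monicXsubC ?monic_neq0 ?monic_conodal//.
by rewrite size_XsubC /= => -[].
Qed.

Lemma lagrange P : (size P <= #|I|)%N -> P = \sum_k (P.[y k] / nodal^`().[y k]) *: conodal k.
Proof.
move=> sP; apply/eqP; rewrite -subr_eq0; set T := _ - _; apply: contraT => T0.
have sT : (size T <= #|I|)%N.
  apply: (leq_trans (size_polyD _ _)); rewrite geq_max sP size_polyN.
  apply: (leq_trans (size_sum _ _ _)); apply/bigmax_leqP => k _.
  by apply: (leq_trans (size_scale_leq _ _)); rewrite size_conodal.
have := @max_poly_roots _ T [seq y k | k <- enum I] T0.
rewrite size_map -cardE ltnNge sT; apply.
  apply/allP => _ /mapP[l _ ->]; rewrite /root hornerD hornerN horner_sum (bigD1 l)//= big1 => [|k kl].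
    by rewrite hornerZ nodal_deriv divfK ?conodal_neq0// addr0 subrr.
  by rewrite hornerZ conodal0// mulr0.
by rewrite map_inj_uniq ?enum_uniq.
Qed.

Lemma lagrange_top P : (size P <= #|I|)%N -> P`_#|I|.-1 = \sum_k P.[y k] / nodal^`().[y k].
Proof.
move=> sP; rewrite {1}(lagrange sP) coef_sum; apply: eq_bigr => k _.
by rewrite coefZ -(size_conodal k) -lead_coefE (monicP (monic_conodal k)) mulr1.
Qed.

Lemma lagrange_eval P z : (size P <= #|I|)%N -> (forall k, z != y k) ->
  P.[z] / nodal.[z] = \sum_k P.[y k] / nodal^`().[y k] / (z - y k).
Proof.
move=> sP zy; rewrite {1}(lagrange sP) horner_sum mulr_suml; apply: eq_bigr => k _.
have zk : z - y k != 0 by rewrite subr_eq0.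
have ck : (conodal k).[z] != 0.
  rewrite horner_prod prodf_seq_neq0; apply/allP => l _; apply/implyP => _.
  by rewrite hornerXsubC subr_eq0.
rewrite hornerZ (nodal_conodal k) hornerM hornerXsubC -(nodal_conodal k).
by rewrite -!mulrA; congr (_ * (_ * _)); rewrite invfM mulrCA divff// mulr1.
Qed.

End Lagrange.

(** * The metric in terms of the roots of S *)

Section RootData.
Variables (F : fieldType) (N : nat) (W S : {poly F}) (rho e : 'I_N -> F) (n0 n1 : F).
Implicit Types (P Q : {poly F}) (z : F) (k l : 'I_N).

(** For lambda one has W / (X S) = lambda' / lambda, so the last equation says that [e k] is the
    residue of d log lambda at [rho k]. *)
Definition root_data := [/\ injective rho, S = n0^-1 *: nodal rho, forall k, e k != 0 &
  forall k, W.[rho k] = e k * rho k * S^`().[rho k]].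

Hypotheses (mW : W \is monic) (sW : size W = N.+1) (n00 : n0 != 0) (n10 : n1 != 0).
Hypotheses (W0 : W.[0] = - n1 * S.[0]) (S0 : S.[0] != 0) (RD : root_data).

Let ir : injective rho. Proof. by case: RD. Qed.
Let SE : S = n0^-1 *: nodal rho. Proof. by case: RD. Qed.
Let en k : e k != 0. Proof. by case: RD. Qed.
Let WE k : W.[rho k] = e k * rho k * S^`().[rho k]. Proof. by case: RD. Qed.
Let n0V : n0^-1 != 0. Proof. by rewrite invr_eq0. Qed.

Lemma root_data_root z : root S z = [exists k, z == rho k].
Proof.
rewrite SE rootZ//; apply/idP/existsP => [|[k /eqP ->]]; last first.
  by rewrite (nodal_conodal _ k) rootM root_XsubC eqxx.
rewrite /root horner_prod => /prodf_eq0[k _]; rewrite hornerXsubC subr_eq0 => zk.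
by exists k.
Qed.

Lemma rho_neq0 k : rho k != 0.
Proof. by apply: contra S0 => /eqP r0; apply/eqP/rootP; rewrite root_data_root; apply/existsP; exists k; rewrite r0. Qed.

Lemma S_deriv k : S^`().[rho k] = n0^-1 * (nodal rho)^`().[rho k].
Proof. by rewrite SE derivZ hornerZ. Qed.

Lemma S_deriv_neq0 k : S^`().[rho k] != 0.
Proof. by rewrite S_deriv mulf_neq0// nodal_deriv conodal_neq0. Qed.

(** If P represents a tangent vector, this is its value under d log rho_k
    ([derive_root_functions]). *)
Definition ell P k := - (P.[rho k] / (e k * rho k * S^`().[rho k])).

Let den k : e k * rho k * S^`().[rho k] != 0.
Proof. by rewrite !mulf_neq0 ?rho_neq0 ?S_deriv_neq0. Qed.

Lemma ell_value P k : P.[rho k] = - (ell P k * (e k * rho k * S^`().[rho k])).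
Proof. by rewrite /ell mulNr opprK divfK. Qed.

Lemma ell_eval P z : (size P <= N)%N -> (forall k, z != rho k) ->
  P.[z] / S.[z] = - \sum_k e k * rho k * ell P k / (z - rho k).
Proof.
move=> sP zr; rewrite SE hornerZ invfM invrK mulrCA lagrange_eval ?card_ord//.
rewrite mulr_sumr -sumrN; apply: eq_bigr => k _; rewrite (ell_value P k) S_deriv.
have d0 : (nodal rho)^`().[rho k] != 0 by rewrite nodal_deriv conodal_neq0.
have zk : z - rho k != 0 by rewrite subr_eq0.
move: d0 zk; set d := _.[_]; set x := z - _; set p := ell P k => d0 zk.
by field; rewrite n00 zk d0.
Qed.

Lemma ell_eval0 P : (size P <= N)%N -> P.[0] / S.[0] = \sum_k e k * ell P k.
Proof.
move=> sP; rewrite ell_eval// => [|k]; last by rewrite eq_sym rho_neq0.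
rewrite -sumrN; apply: eq_bigr => k _; rewrite sub0r.
by rewrite invrN mulrN opprK mulrAC mulfK ?rho_neq0.
Qed.

(** The residues of W / (X S) are - n1 at 0 and [e k] at [rho k], and the behaviour n0 / z at
    infinity gives their total. *)
Lemma sum_e : \sum_k e k = n0 + n1.
Proof.
have sS : size S = N.+1 by rewrite SE size_scale// size_nodal card_ord.
have /factor_theorem[T ET] : root (W + n1 *: S) 0 by rewrite /root hornerD hornerZ W0 mulNr addNr.
rewrite subr0 in ET.
have sT : (size T <= N)%N.
  have [->|T0] := eqVneq T 0; first by rewrite size_poly0.
  rewrite -ltnS -(size_mulX T0) -ET; apply: (leq_trans (size_polyD _ _)).
  by rewrite geq_max sW leqnn (leq_trans (size_scale_leq _ _)) ?sS.
have Tr k : T.[rho k] = e k * S^`().[rho k].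
  have := congr1 (fun p : {poly F} => p.[rho k]) ET.
  have /rootP Sk : root S (rho k) by rewrite root_data_root; apply/existsP; exists k.
  rewrite hornerM hornerX hornerD hornerZ Sk mulr0 addr0 WE => E.
  by apply: (mulIf (rho_neq0 k)); rewrite -E mulrAC.
have : T`_N.-1 = n0^-1 * \sum_k e k.
  have := lagrange_top ir (P := T); rewrite card_ord => /(_ sT) ->.
  rewrite mulr_sumr; apply: eq_bigr => k _; rewrite Tr S_deriv mulrA mulfK 1?mulrC//.
  by rewrite nodal_deriv conodal_neq0.
(* For N = 0 there is no coefficient of degree N - 1; then both sides are 0, as [W0] forces n1 = -
   n0. *)
have [N0|N0] := posnP N.
  have /size_poly1P[c c0 Sc] : size S == 1 by rewrite sS N0.
  have /eqP/size_poly1P[w w0 Ww] : size W = 1 by rewrite sW N0.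
  have w1 : w = 1 by have := monicP mW; rewrite Ww lead_coefC.
  have : c = n0^-1.
    have := congr1 (fun p : {poly F} => lead_coef p) SE; rewrite Sc lead_coefC lead_coefZ.
    by rewrite (monicP _) ?mulr1//; apply: monic_prod => k _; exact: monicXsubC.
  move=> cE _; rewrite big1; last by move=> k _; have := ltn_ord k; rewrite {2}N0.
  move: W0; rewrite Ww Sc !hornerC w1 cE => E.
  by rewrite -[n0]mulr1 E; field.
have -> : T`_N.-1 = 1 + n1 / n0.
  have := congr1 (fun p : {poly F} => p`_N) ET; rewrite coefMX eqn0Ngt N0 /= => <-.
  rewrite coefD coefZ; congr (_ + _ * _).
    by have := monicP mW; rewrite lead_coefE sW.
  have : lead_coef S = n0^-1.
    rewrite SE lead_coefZ (monicP _) ?mulr1//; apply: monic_prod => k _; exact: monicXsubC.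
  by rewrite lead_coefE sS.
move=> E; apply: (mulfI n0V); rewrite -E mulrDr mulVf//; congr (_ + _); exact: mulrC.
Qed.

Lemma root_data_coprime : coprimep S W.
Proof.
rewrite SE coprimepZl// /nodal; apply: (big_ind (fun p => coprimep p W)).
- by rewrite coprime1p.
- by move=> p q; rewrite coprimepMl => -> ->.
- by move=> k _; rewrite coprimep_sym coprimep_XsubC /root WE den.
Qed.

(* The sum of the residues of [P Q / (X S W)] at all its poles vanishes. *)
Lemma metric_roots s x P Q : W %| S * s - 1 -> W %| 'X * x - 1 ->
  (size P <= N)%N -> (size Q <= N)%N ->
  top_coef N W (P * Q * s * x) =
  - (\sum_k e k * ell P k * ell Q k) + n1^-1 * (\sum_k e k * ell P k) * (\sum_k e k * ell Q k).
Proof.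
(* The nodes [y] are the roots of X S, namely 0 and the [rho k]. *)
move=> Ss Xx sP sQ; pose y (k : 'I_N.+1) := if unlift ord0 k is Some l then rho l else 0.
have y0 : y ord0 = 0 by rewrite /y unlift_none.
have yl k : y (lift ord0 k) = rho k by rewrite /y liftK.
have iy : injective y.
  move=> k l; case: (unliftP ord0 k) => [k' ->|->]; case: (unliftP ord0 l) => [l' ->|->] //.
  - by rewrite !yl => /ir->.
  - by rewrite yl y0 => E; have := rho_neq0 k'; rewrite E eqxx.
  - by rewrite yl y0 => E; have := rho_neq0 l'; rewrite -E eqxx.
have nodal_y : nodal y = 'X * nodal rho.
  rewrite /nodal big_ord_recl y0 subr0; congr (_ * _); by apply: eq_bigr => k _; rewrite yl.
pose b := (P * Q * s * x) %% W; pose Z := 'X * S.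
have sb : (size b <= N)%N by rewrite -ltnS -sW ltn_modp monic_neq0.
(* Hence P Q / (Z W) = b / W + al / Z: [b] collects the residues at the roots of W and [al] those at
   the roots of Z. *)
have /dvdpP[al Eal] : W %| P * Q - b * Z.
  have -> : P * Q - b * Z = (P * Q * s * x - b) * Z - (S * s - 1) * (P * Q) * (x * 'X) - ('X * x - 1) * (P * Q).
    by rewrite /Z; ring.
  have H : W %| P * Q * s * x - b by rewrite {1}(divp_eq (P * Q * s * x) W) addrK dvdp_mull.
  apply: dvdp_sub; last exact: dvdp_mulr.
  by apply: dvdp_sub; [exact: dvdp_mulr|rewrite -mulrA; exact: dvdp_mulr].
have sS : size S = N.+1 by rewrite SE size_scale// size_nodal card_ord.
have S00 : S != 0 by rewrite -size_poly_eq0 sS.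
have sZ : size Z = N.+2 by rewrite /Z mulrC size_mulX// sS.
have sPQ : (size (P * Q)%R <= N + N)%N.
  by apply: (leq_trans (size_polyMleq _ _)); rewrite (leq_trans (leq_pred _))// leq_add.
have [N0|N0] := posnP N.
  have P0 : P = 0 by apply/eqP; rewrite -size_poly_leq0 -N0.
  rewrite /top_coef P0 !mul0r mod0p coef0 !big1 ?oppr0 ?mulr0 ?addr0// => k;
  by have := ltn_ord k; rewrite {2}N0.
have sbZ : (size (b * Z)%R <= N + N.+1)%N.
  apply: (leq_trans (size_polyMleq _ _)); rewrite sZ addnS /=; exact: leq_add.
have sal : (size al <= N.+1)%N.
  have [->|al0] := eqVneq al 0; first by rewrite size_poly0.
  have : (size (al * W)%R <= N + N.+1)%N.
    rewrite -Eal; apply: (leq_trans (size_polyD _ _)); rewrite geq_max size_polyN sbZ andbT.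
    by apply: (leq_trans sPQ); rewrite leq_add.
  by rewrite size_Mmonic// sW addnS /= addnC leq_add2l.
(* Coefficients of degree 2 N are compared; P Q has smaller degree. *)
have topal : al`_N = - (n0^-1 * b`_N.-1).
  have := congr1 (fun p : {poly F} => p`_(N + N)) Eal.
  rewrite coefB [X in X - _]nth_default// coef_top_mul ?sW//.
  have -> : (N + N = N.-1 + N.+1)%N by rewrite addnS -addSn prednK.
  rewrite coef_top_mul ?sZ ?prednK//.
  have -> : W`_N = 1 by have := monicP mW; rewrite lead_coefE sW.
  have -> : Z`_N.+1 = n0^-1.
    rewrite /Z mulrC coefMX /= SE coefZ.
    have := size_nodal rho; rewrite card_ord => E.
    have : nodal rho \is monic by apply: monic_prod => k _; exact: monicXsubC.
    by rewrite monicE lead_coefE E /= => /eqP ->; rewrite mulr1.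
  by rewrite mulr1 sub0r mulrC => <-.
have lag := lagrange_top iy (P := al); rewrite card_ord in lag.
have {lag} := lag sal; rewrite /= topal big_ord_recl y0 => lag.
have -> : top_coef N W (P * Q * s * x) = b`_N.-1 by [].
have -> : b`_N.-1 = - n0 * (- (n0^-1 * b`_N.-1)) by rewrite mulNr mulrN opprK mulrA divff// mul1r.
have alE z : root Z z -> al.[z] * W.[z] = P.[z] * Q.[z].
  by move=> /rootP Z0; rewrite -!hornerM -Eal hornerD hornerN [(b * Z).[_]]hornerM Z0 mulr0 subr0.
have W00 : W.[0] != 0 by rewrite W0 mulf_neq0// oppr_eq0.
have Wk k : W.[rho k] != 0 by rewrite WE den.
rewrite lag mulrDr addrC; congr (_ + _).
  rewrite mulr_sumr -sumrN; apply: eq_bigr => k _; rewrite yl.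
  have -> : al.[rho k] = P.[rho k] * Q.[rho k] / W.[rho k].
    rewrite -alE ?mulfK//; apply/rootP; rewrite /Z hornerM.
    have /rootP -> : root S (rho k) by rewrite root_data_root; apply/existsP; exists k.
    by rewrite mulr0.
  have -> : (nodal y)^`().[rho k] = rho k * (n0 * S^`().[rho k]).
    rewrite S_deriv [n0 * _]mulrA divff// mul1r nodal_y derivM derivX mul1r hornerD hornerM hornerX.
    by rewrite (nodal_conodal rho k) hornerM hornerXsubC subrr mul0r add0r -nodal_conodal.
  rewrite WE (ell_value P k) (ell_value Q k).
  have := rho_neq0 k; have := S_deriv_neq0 k; have := en k.
  set p := ell P k; set q := ell Q k; set d := S^`().[_]; set r := rho k; set f := e k => f0 d0 r0.
  have aux (n0' d' r' f' p' q' : F) : n0' != 0 -> d' != 0 -> r' != 0 -> f' != 0 ->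
    - n0' * (- (p' * (f' * r' * d')) * - (q' * (f' * r' * d')) / (f' * r' * d') / (r' * (n0' * d'))) =
    - (f' * p' * q').
    by move=> h1 h2 h3 h4; field; rewrite h1 h2 h3 h4.
  exact: aux.
have -> : al.[0] = P.[0] * Q.[0] / W.[0].
  by rewrite -alE ?mulfK//; apply/rootP; rewrite /Z hornerM hornerX mul0r.
have -> : (nodal y)^`().[0] = n0 * S.[0].
  rewrite SE hornerZ mulrA divff// mul1r nodal_y derivM derivX mul1r hornerD hornerM hornerX.
  by rewrite mul0r addr0.
rewrite -!ell_eval0// W0; move: n10 n00 S0; set p := P.[0]; set q := Q.[0]; set t := S.[0].
by move=> n1' n0' t0; rewrite [- n1 * t]mulNr invrN; field; do ?[apply/andP; split].
Qed.

End RootData.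

(** * The intersection form and the dual product in the coframe d log rho *)

Section DualAtPoint.
Variables (R : realType) (m : nat) (n : nat -> nat).
Hypotheses (hm : (0 < m)%N) (hn : forall i : nat, (i <= m)%N -> (0 < n i)%N).
Local Notation C := R[i].
Local Notation N := (toda_dim m n).
Local Notation V := 'rV[C]_N.
Implicit Types (a u v w y : V) (z : C).
Variables (e E : V -> V).
Hypotheses (he : toda_unit_field e) (hE : toda_euler_field E).

Let sW a := size_lamW hm hn a.
Let n00 := n0_neq0 R hn.

Lemma toda_dual_coprime a : toda_manifold a ->
  (toda_dual_manifold E a <-> coprimep (lamS a) (lamW a)).
Proof.
move=> Ma; have [d [x [Dd Xx Eeta Ec]]] := toda_frobenius hm hn Ma.
have U := intersection_unit (sW a) (tanP_linear a) (size_tanP a) (fun u => tanP_inj hm hn Ma (u := u)) Dd Xx (tanP_euler hm hn Ma hE).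
rewrite /toda_dual_manifold /= Eeta Ec U; split=> [[]|] //.
Qed.

Section WithRoots.
Variables (a : V) (rho eps : 'I_N -> C).
Hypothesis Ma : toda_manifold a.
Local Notation n0 := ((n 0)%:R : C).
Local Notation n1 := ((n 1)%:R : C).
Hypothesis RD : root_data (lamW a) (lamS a) rho eps n0.

Let n10 : n1 != 0. Proof. by rewrite pnatr_eq0 -lt0n hn. Qed.
Let r1 := one_r hm.

Lemma lamS0 : (lamS a).[0] != 0.
Proof.
rewrite /lamS hornerM mulf_neq0//.
  by have := lamA_pole hn Ma r1; rewrite (pole1 hm).
have := pf_cofactor_neq0 (fun=> 1%N) (pole_inj Ma) r1.
by rewrite (pole1 hm).
Qed.

Lemma lamW0 : (lamW a).[0] = - n1 * (lamS a).[0].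
Proof.
have := lamM_pole a r1; have := lamPr_pole a r1; rewrite (pole1 hm) => P0 M0.
rewrite /lamW hornerD hornerN !hornerM P0 M0 /lamPi.
set A := (lamA a).[0]; set q := _.[0]; ring.
Qed.

Definition tell u k := ell (lamS a) rho eps (tanP a u) k.

Let dn k : eps k * rho k * (lamS a)^`().[rho k] != 0.
Proof.
have [_ _ en _] := RD.
by rewrite !mulf_neq0 ?(rho_neq0 n00 lamS0 RD) ?(S_deriv_neq0 n00 RD).
Qed.

Lemma tell_linear k (c : C) u v : tell (c *: u + v) k = c * tell u k + tell v k.
Proof.
rewrite /tell /ell; have := congr1 (fun P : {poly C} => P.[rho k]) (tanP_linear a c u v).
rewrite [in X in _ = X]hornerD [in X in _ = X]hornerZ => ->.
set x := _.[_]; set y := _.[_]; set q := _^-1; ring.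
Qed.

Lemma tell_inj u : (forall k, tell u k = 0) -> u = 0.
Proof.
move=> H; apply: (tanP_inj hm hn Ma); have [ir _ _ _] := RD.
rewrite (lagrange ir (P := tanP a u)) ?card_ord ?(size_tanP)//.
rewrite big1// => k _; rewrite (ell_value n00 lamS0 RD) -/(tell u k) H.
by rewrite mul0r oppr0 mul0r scale0r.
Qed.

Lemma tell_surj (c : 'I_N -> C) : exists u, forall k, tell u k = c k.
Proof.
pose f u : V := \row_k tell u k.
have fl (x : C) u v : f (x *: u + v) = x *: f u + f v.
  by apply/rowP => k; rewrite !mxE tell_linear.
have U : lin1_mx f \in unitmx.
  apply: injective_unitmx => u; rewrite (linear_fun_mx fl) => H.
  by apply: tell_inj => k; have := congr1 (fun w : V => w 0 k) H; rewrite !mxE.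
exists ((\row_k c k) *m invmx (lin1_mx f)) => k.
have := linear_fun_mx fl ((\row_k c k) *m invmx (lin1_mx f)); rewrite mulmxKV//.
by move=> /(congr1 (fun w : V => w 0 k)); rewrite !mxE.
Qed.

Lemma root_data_dual : toda_dual_manifold E a.
Proof. by apply/toda_dual_coprime => //; exact: (root_data_coprime n00 lamS0 RD). Qed.

Lemma off_rho z : ~ lam_pole a z -> lam a z != 0 -> forall k, z != rho k.
Proof.
move=> Hz l0 k; apply/eqP => zE; have : root (lamS a) z.
  by rewrite (root_data_root n00 RD); apply/existsP; exists k; rewrite zE.
by rewrite /root lamS_off// mulf_eq0 (negPf l0) (negPf (lamDn0 Hz)).
Qed.

Lemma tangent_log u z : ~ lam_pole a z -> lam a z != 0 ->
  tangent_lam a u z / lam a z = - \sum_k eps k * rho k * tell u k / (z - rho k).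
Proof.
move=> Hz l0; have D0 := lamDn0 Hz.
rewrite /tell -(ell_eval n00 lamS0 RD (size_tanP a u) (off_rho Hz l0)).
rewrite (tanP_tangent hm)// lamS_off//; set t := tangent_lam _ _ _; set l := lam a z; set d := (lamD a).[z].
have aux (d' t' l' : C) : d' != 0 -> t' / l' = d' * t' / (d' * l').
  by move=> d0; rewrite invfM mulrACA divff// mul1r.
exact: aux.
Qed.

(** [metric_roots] gives the metric on vectors. The vector y that corresponds to the covector w is
    found by inverting a diagonal matrix plus one of rank one, with [sum_e] fixing the factor. *)
Lemma dual_form_roots (c c' : 'I_N -> C) w w' :
  (forall y, (w *m y^T) 0 0 = \sum_k c k * tell y k) ->
  (forall y, (w' *m y^T) 0 0 = \sum_k c' k * tell y k) ->
  toda_dual_form E a w w' =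
  - (\sum_k c k * c' k / eps k) + n0^-1 * (\sum_k c k) * (\sum_k c' k).
Proof.
move=> Hw Hw'; have [d [x [Dd Xx Eeta Ec]]] := toda_frobenius hm hn Ma.
have [_ _ en _] := RD.
have SW := root_data_coprime n00 lamS0 RD.
have [s Ss] : exists s, lamW a %| lamS a * s - 1 by apply: coprime_inverse; rewrite coprimep_sym.
have [y [Hy Hform]] := intersection_inverse (sW a) (tanP_linear a) (size_tanP a)
   (fun u => tanP_inj hm hn Ma (u := u)) Dd Xx (tanP_euler hm hn Ma hE) Ss w.
rewrite /toda_dual_form Eeta Ec Hform Hw'.
pose sg := \sum_k eps k * tell y k.
(* The pairing is tested on the vector on which d log rho_l is 1 for l = k and 0 otherwise. *)
have key k : - (eps k * tell y k) + n1^-1 * sg * eps k = c k.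
  have [y' yE] := tell_surj (fun l => (l == k)%:R).
  have := Hy y'; rewrite Hw (metric_roots (monic_lamW hm hn a) (sW a) n00 n10 lamW0 lamS0 RD)//; last first.
    exact: size_tanP. exact: size_tanP.
  move=> HH; have {}HH : - (\sum_l eps l * tell y l * tell y' l) + n1^-1 * sg * (\sum_l eps l * tell y' l) =
    \sum_l c l * tell y' l := HH.
  have S1 (f : 'I_N -> C) : \sum_l f l * tell y' l = f k.
    rewrite (bigD1 k)//= big1 ?addr0 => [|l lk]; first by rewrite yE eqxx mulr1.
    by rewrite yE (negPf lk) mulr0.
  by move: HH; rewrite (S1 (fun l => eps l * tell y l)) !S1.
have se := sum_e (monic_lamW hm hn a) (sW a) n00 lamW0 lamS0 RD.
have sc : \sum_k c k = n1^-1 * n0 * sg.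
  transitivity (\sum_k (- (eps k * tell y k) + n1^-1 * sg * eps k)).
    by apply: eq_bigr => k _; rewrite key.
  rewrite big_split /= sumrN -mulr_sumr se -/sg; field.
  exact: n10.
have tE k : tell y k = n0^-1 * (\sum_k c k) - c k / eps k.
  rewrite -(key k) sc; have := en k; set f := eps k; set t := tell y k => f0.
  have aux (q p f' t' s' : C) : q != 0 -> p != 0 -> f' != 0 ->
    t' = q^-1 * (p^-1 * q * s') - (- (f' * t') + p^-1 * s' * f') / f'.
    by move=> q0 p0 f1; field; rewrite q0 p0 f1.
  exact: aux.
under eq_bigr do rewrite tE mulrBr.
rewrite big_split /= addrC sumrN; congr (_ + _).
  by congr (- _); apply: eq_bigr => k _; rewrite mulrA; congr (_ / _); exact: mulrC.
by rewrite -mulr_suml; exact: mulrC.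
Qed.

(** By [starP], S phi (u * v) = phi u phi v + Q W for some Q. At a root of S this relation gives the
    component of Q as the product of those of u and v; away from the roots it is divided by S^2. *)
Lemma star_log u v z : ~ lam_pole a z -> lam a z != 0 ->
  tangent_lam a (toda_dual_star e E a u v) z / lam a z =
  (tangent_lam a u z / lam a z) * (tangent_lam a v z / lam a z) -
  z * lam' a z / lam a z * \sum_k eps k * rho k * (tell u k * tell v k) / (z - rho k).
Proof.
move=> Hz l0; have D0 := lamDn0 Hz; set h := toda_dual_star _ _ _ _ _.
have [d [x [Dd Xx Eeta Ec]]] := toda_frobenius hm hn Ma.
have SW := root_data_coprime n00 lamS0 RD.
have eP : lamW a %| tanP a (e a) - lamD a by rewrite (tanP_unit hm Ma he) subrr dvdp0.
have := starP (sW a) (tanP_linear a) (size_tanP a) (fun u => tanP_inj hm hn Ma (u := u)) Dd Xx eP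
   (tanP_euler hm hn Ma hE) SW u v.
rewrite -Eeta -Ec -/(toda_dual_star e E a u v) -/h => /dvdpP[Q QE].
have sQ : (size Q <= N)%N.
  have [->|Q0] := eqVneq Q 0; first by rewrite size_poly0.
  have : (size (Q * lamW a)%R <= N + N)%N.
    rewrite -QE; apply: (leq_trans (size_polyD _ _)); rewrite geq_max size_polyN; apply/andP; split.
      apply: (leq_trans (size_polyMleq _ _)); rewrite size_lamS// addSn /=.
      by rewrite leq_add// size_tanP.
    apply: (leq_trans (size_polyMleq _ _)); rewrite (leq_trans (leq_pred _))// leq_add// size_tanP//.
  by rewrite size_Mmonic ?monic_lamW// sW addnS /= leq_add2r.
have ellQ k : ell (lamS a) rho eps Q k = tell u k * tell v k.
  have := congr1 (fun P : {poly C} => P.[rho k]) QE.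
  rewrite hornerD hornerN hornerM [(_ * tanP a v).[_]]hornerM [(Q * _).[_]]hornerM.
  have /rootP -> : root (lamS a) (rho k) by rewrite (root_data_root n00 RD); apply/existsP; exists k.
  have [_ _ _ ->] := RD.
  rewrite (ell_value n00 lamS0 RD (tanP a u)) (ell_value n00 lamS0 RD (tanP a v)) (ell_value n00 lamS0 RD Q).
  have aux (x' p p' q f : C) : f != 0 -> 0 * x' - (- (p * f)) * (- (p' * f)) = - (q * f) * f -> q = p * p'.
    move=> f0 H; apply: (mulIf (mulf_neq0 f0 f0)); apply: oppr_inj.
    by move: H; rewrite mul0r sub0r mulrNN => H; rewrite [q * _]mulrA -mulNr -H; ring.
  exact: aux (dn k).
have QS := ell_eval n00 lamS0 RD sQ (off_rho Hz l0).
have -> : \sum_k eps k * rho k * (tell u k * tell v k) / (z - rho k) = - (Q.[z] / (lamS a).[z]).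
  by rewrite QS opprK; apply: eq_bigr => k _; rewrite ellQ.
have := congr1 (fun P : {poly C} => P.[z]) QE.
rewrite hornerD hornerN hornerM [(_ * tanP a v).[_]]hornerM [(Q * _).[_]]hornerM !(tanP_tangent hm)// lamS_off// (lamW_off hm Hz).
set t := tangent_lam a h z; set l := lam a z; set p := tangent_lam a u z; set p' := tangent_lam a v z.
set D := (lamD a).[z] in D0 *; set l' := lam' a z; set q := Q.[z] => H.
have aux (t1 l1 p1 p2 D1 l2 q1 : C) : l1 != 0 -> D1 != 0 ->
   D1 * l1 * (D1 * t1) - D1 * p1 * (D1 * p2) = q1 * (z * D1 * l2) ->
   t1 / l1 = p1 / l1 * (p2 / l1) - z * l2 / l1 * - (q1 / (D1 * l1)).
  move=> l10 D10 H1; have -> : t1 = (q1 * (z * D1 * l2) + D1 * p1 * (D1 * p2)) / (D1 * l1 * D1).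
    by rewrite -H1; field; rewrite l10 D10.
  by field; rewrite l10 D10.
exact: aux.
Qed.

End WithRoots.
End DualAtPoint.

(** * Zeros and moving poles of lambda in one list *)

Section RootVector.
Variables (R : realType) (m : nat) (n : nat -> nat).
Hypotheses (hm : (0 < m)%N) (hn : forall i : nat, (i <= m)%N -> (0 < n i)%N).
Local Notation C := R[i].
Local Notation N := (toda_dim m n).
Local Notation V := 'rV[C]_N.
Implicit Types (a u v : V).
Local Notation r := (index_iota 1 m.+1).
Definition deg_zeros : nat := (n 0 + \sum_(1 <= i < m.+1) n i)%N.
Local Notation dA := deg_zeros.

(* The roots of [lamS]: the zeros of lambda followed by its poles [a_i], [i >= 2]. *)
Definition root_vector (z : 'I_dA -> C) a (k : 'I_N) : C :=
  match fintype.split (cast_ord (dimE' n hm) k) with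
  | inl j => z j
  | inr i => pole a i.+2
  end.

Definition sign_vector (k : 'I_N) : C :=
  match fintype.split (cast_ord (dimE' n hm) k) with
  | inl j => 1
  | inr i => - (n i.+2)%:R
  end.

Definition zero_index (j : 'I_dA) : 'I_N := cast_ord (esym (dimE' n hm)) (lshift m.-1 j).
Definition pole_index (i : 'I_m.-1) : 'I_N := cast_ord (esym (dimE' n hm)) (rshift dA i).

Lemma root_index_case (P : 'I_N -> Prop) :
  (forall j, P (zero_index j)) -> (forall i, P (pole_index i)) -> forall k, P k.
Proof.
move=> H1 H2 k; rewrite -(cast_ordK (dimE' n hm) k).
by case: (split_ordP (cast_ord (dimE' n hm) k)) => j ->; [exact: H1|exact: H2].
Qed.

Lemma root_vector_zero z a j : root_vector z a (zero_index j) = z j.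
Proof. by rewrite /root_vector /zero_index cast_ordKV; case: split_ordP => l /= E; [rewrite (lshift_inj E)|move/eqP: E; rewrite eq_lrshift]. Qed.

Lemma root_vector_pole z a i : root_vector z a (pole_index i) = pole a i.+2.
Proof. by rewrite /root_vector /pole_index cast_ordKV; case: split_ordP => l /= E; [move/eqP: E; rewrite eq_rlshift|rewrite (rshift_inj E)]. Qed.

Lemma sign_zero j : sign_vector (zero_index j) = 1.
Proof. by rewrite /sign_vector /zero_index cast_ordKV; case: split_ordP => l //= E; move/eqP: E; rewrite eq_lrshift. Qed.

Lemma sign_pole i : sign_vector (pole_index i) = - (n i.+2)%:R.
Proof. by rewrite /sign_vector /pole_index cast_ordKV; case: split_ordP => l /= E; [move/eqP: E; rewrite eq_rlshift|rewrite (rshift_inj E)]. Qed.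

Lemma big_root_index (T : Type) (idx : T) (op : Monoid.com_law idx) (F : 'I_N -> T) :
  \big[op/idx]_k F k = op (\big[op/idx]_j F (zero_index j)) (\big[op/idx]_i F (pole_index i)).
Proof.
rewrite (reindex (cast_ord (esym (dimE' n hm)))) /=; first by rewrite big_split_ord.
by exists (cast_ord (dimE' n hm)) => k _; rewrite ?cast_ordK ?cast_ordKV.
Qed.

Lemma pole_range i : (i < m.-1)%N -> (1 <= i.+2 <= m)%N.
Proof. by move=> im; lia. Qed.

Lemma lamPi_prod a : lamPi a = \prod_(i < m.-1) ('X - (pole a i.+2)%:P).
Proof.
rewrite /lamPi /pf_cofactor big_ltn_cond ?eqxx /=; last by rewrite ltnS.
rewrite -{1}[2%N]add0n big_addn subSS subn1 big_mkord.
by apply: eq_big => [i|i _]; rewrite addn2 ?expr1.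
Qed.

Lemma sign_neq0 k : sign_vector k != 0.
Proof.
elim/root_index_case: k => [j|i]; first by rewrite sign_zero oner_eq0.
rewrite sign_pole oppr_eq0 pnatr_eq0 -lt0n hn//.
by have /pole_range/andP[] := ltn_ord i.
Qed.

Lemma lamW_horner a x : (lamW a).[x] =
  (lamA a)^`().[x] * (lamPr a).[x] - (lamA a).[x] * (lamM a).[x].
Proof. by rewrite /lamW hornerD hornerN !hornerM. Qed.

Lemma lamS_deriv_horner a x : (lamS a)^`().[x] =
  (lamA a)^`().[x] * (lamPi a).[x] + (lamA a).[x] * (lamPi a)^`().[x].
Proof. by rewrite /lamS derivM hornerD !hornerM. Qed.

Lemma lamPr_horner a x : (lamPr a).[x] = x * (lamPi a).[x].
Proof. by rewrite lamPrE// hornerM hornerX. Qed.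

Lemma root_vector_data a (z : 'I_dA -> C) : toda_manifold a -> injective z ->
  lamA a = (n 0)%:R^-1 *: \prod_j ('X - (z j)%:P) ->
  root_data (lamW a) (lamS a) (root_vector z a) sign_vector ((n 0)%:R : C).
Proof.
move=> Ma iz EA; have ip := pole_inj Ma.
have n0V : (n 0)%:R^-1 != 0 :> C by rewrite invr_eq0 (n0_neq0 R hn).
have Az j : (lamA a).[z j] = 0.
  by rewrite EA hornerZ horner_prod (bigD1 j)//= hornerXsubC subrr mul0r mulr0.
have ir2 (i : 'I_m.-1) : i.+2 \in r by rewrite mem_r pole_range.
have Ap (i : 'I_m.-1) : (lamA a).[pole a i.+2] != 0 by apply: lamA_pole => //; exact: ir2.
split.
- elim/root_index_case => [j|i]; elim/root_index_case => [j'|i'];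
    rewrite ?root_vector_zero ?root_vector_pole.
  + by move/iz ->.
  + by move=> E; have := Ap i'; rewrite -E Az eqxx.
  + by move=> E; have := Ap i; rewrite E Az eqxx.
  + move=> /(ip _ _ (ir2 i) (ir2 i')) [E]; congr pole_index; exact: val_inj.
- rewrite /lamS EA -scalerAl /nodal big_root_index lamPi_prod; congr (_ *: (_ * _)).
    by apply: eq_bigr => j _; rewrite root_vector_zero.
  by apply: eq_bigr => j _; rewrite root_vector_pole.
- exact: sign_neq0.
elim/root_index_case => [j|i]; rewrite ?root_vector_zero ?root_vector_pole ?sign_zero ?sign_pole.
  rewrite lamW_horner lamS_deriv_horner lamPr_horner Az !mul0r subr0 addr0 mul1r mulrCA.
  by [].
have Pip : (lamPi a).[pole a i.+2] = 0.
  by rewrite lamPi_prod horner_prod (bigD1 i)//= hornerXsubC subrr mul0r.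
(* X times [lamPi] equals X - a_i times the cofactor; both are differentiated at a_i, where [lamPi]
   and X - a_i vanish. *)
have key : pole a i.+2 * (lamPi a)^`().[pole a i.+2] = (pf_cofactor r (pole a) (fun=> 1%N) i.+2).[pole a i.+2].
  have := congr1 (fun P : {poly C} => P^`().[pole a i.+2]) (lamPrE hm a).
  rewrite /lamPr (pf_den_cofactor (pole a) _ (uniq_r m) (ir2 i)) expr1 !derivM derivX derivXsubC !mul1r.
  rewrite !hornerD [(('X - _) * _).[_]]hornerM hornerXsubC subrr mul0r addr0 [('X * _).[_]]hornerM hornerX.
  by rewrite Pip add0r => ->.
rewrite lamW_horner lamS_deriv_horner Pip lamPr_pole ?ir2// lamM_pole ?ir2// -key.
set A := (lamA a).[_]; set q := _.[_]; set p := pole a _; set A' := _.[_].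
set k := (n i.+2)%:R; ring.
Qed.

End RootVector.

(** * Polynomials with smooth coefficients *)

Section PolynomialFamilies.
Variables (R : realType) (N : nat).
Local Notation C := R[i].
Local Notation V := 'rV[C]_N.
Variable U : set V.
Hypothesis oU : open U.
Implicit Types (P Q : V -> {poly C}).

Definition smooth_poly P := forall i l, smooth l U (fun a _ => (P a)`_i).

Lemma smooth_poly_cst (p : {poly C}) : smooth_poly (fun=> p).
Proof. by move=> i l; exact: (smooth_cst l U (pcont_cst p`_i)). Qed.

Lemma smooth_polyD P Q : smooth_poly P -> smooth_poly Q -> smooth_poly (fun a => P a + Q a).
Proof.
move=> HP HQ i l; have -> : (fun (a : V) (_ : R) => (P a + Q a)`_i) = (fun a _ => (P a)`_i + (Q a)`_i).
  by apply/funext => a; apply/funext => t; rewrite coefD.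
exact: smoothD.
Qed.

Lemma smooth_polyM P Q : smooth_poly P -> smooth_poly Q -> smooth_poly (fun a => P a * Q a).
Proof.
move=> HP HQ i l.
have -> : (fun (a : V) (_ : R) => (P a * Q a)`_i) = (fun a _ => \sum_(j < i.+1) (P a)`_j * (Q a)`_(i - j)).
  by apply/funext => a; apply/funext => t; rewrite coefM.
by apply: smooth_sum_seq => j _; exact: smoothM.
Qed.

Lemma smooth_polyZ (f : V -> C) P : (forall l, smooth l U (fun a _ => f a)) -> smooth_poly P ->
  smooth_poly (fun a => f a *: P a).
Proof.
move=> Hf HP i l; have -> : (fun (a : V) (_ : R) => (f a *: P a)`_i) = (fun a _ => f a * (P a)`_i).
  by apply/funext => a; apply/funext => t; rewrite coefZ.
exact: smoothM.
Qed.

Lemma smooth_polyX P k : smooth_poly P -> smooth_poly (fun a => P a ^+ k).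
Proof.
move=> HP; elim: k => [|k IH].
  have -> : (fun a => P a ^+ 0) = fun=> 1 by apply/funext => a; rewrite expr0.
  exact: smooth_poly_cst.
have -> : (fun a => P a ^+ k.+1) = fun a => P a * P a ^+ k by apply/funext => a; rewrite exprS.
exact: smooth_polyM.
Qed.

Lemma smooth_poly_sum (I : Type) (s : seq I) (F : I -> V -> {poly C}) :
  (forall i, smooth_poly (F i)) -> smooth_poly (fun a => \sum_(i <- s) F i a).
Proof.
move=> H; elim: s => [|i s IH].
  have -> : (fun a => \sum_(i <- [::]) F i a) = fun=> 0 by apply/funext => a; rewrite big_nil.
  exact: smooth_poly_cst.
have -> : (fun a => \sum_(j <- i :: s) F j a) = fun a => F i a + \sum_(j <- s) F j a.
  by apply/funext => a; rewrite big_cons.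
exact: smooth_polyD.
Qed.

Lemma smooth_poly_prod (I : Type) (s : seq I) (P : pred I) (F : I -> V -> {poly C}) :
  (forall i, smooth_poly (F i)) -> smooth_poly (fun a => \prod_(i <- s | P i) F i a).
Proof.
move=> H; elim: s => [|i s IH].
  have -> : (fun a => \prod_(i <- [::] | P i) F i a) = fun=> 1 by apply/funext => a; rewrite big_nil.
  exact: smooth_poly_cst.
have -> : (fun a => \prod_(j <- i :: s | P j) F j a) =
    fun a => (if P i then F i a else 1) * \prod_(j <- s | P j) F j a.
  by apply/funext => a; rewrite big_cons; case: (P i); rewrite ?mul1r.
by apply: smooth_polyM => //; case: (P i) => //; exact: smooth_poly_cst.
Qed.

Lemma smooth_poly_XsubC (f : V -> C) : (forall l, smooth l U (fun a _ => f a)) ->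
  smooth_poly (fun a => 'X - (f a)%:P).
Proof.
move=> Hf; have -> : (fun a => 'X - (f a)%:P) = fun a => 'X + (- f a) *: 1.
  by apply/funext => a; rewrite -mul_polyC mulr1 polyCN.
apply: smooth_polyD; first exact: smooth_poly_cst.
apply: smooth_polyZ; last exact: smooth_poly_cst.
by move=> l; apply: smoothN.
Qed.

Lemma smooth_poly_deriv P : smooth_poly P -> smooth_poly (fun a => (P a)^`()).
Proof.
move=> HP i l; have -> : (fun (a : V) (_ : R) => ((P a)^`())`_i) = (fun a _ => i.+1%:R * (P a)`_i.+1).
  by apply/funext => a; apply/funext => t; rewrite coef_deriv mulr_natl.
by apply: smoothZ.
Qed.

Lemma smooth_poly_horner P (zeta : R -> C) (d l : nat) : smooth_poly P -> pcont zeta ->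
  (forall a, (size (P a) <= d)%N) -> smooth l U (fun a t => (P a).[zeta t]).
Proof.
move=> HP cz sP.
have -> : (fun a t => (P a).[zeta t]) = (fun a t => \sum_(i < d) (P a)`_i * zeta t ^+ i).
  by apply/funext => a; apply/funext => t; rewrite (horner_coef_wide _ (sP a)).
apply: smooth_sum_seq => i _; apply: smoothM => //.
by apply: smooth_cst; exact: pcontX.
Qed.

End PolynomialFamilies.

Section TodaFamilies.
Variables (R : realType) (m : nat) (n : nat -> nat).
Local Notation C := R[i].
Local Notation N := (toda_dim m n).
Local Notation V := 'rV[C]_N.

Lemma smooth_poly_lamA (U : set V) : open U -> smooth_poly U (fun a => lamA a).
Proof.
move=> oU; have cf i j l := @smooth_coef R m n l U i j.
have pX i k : smooth_poly U (fun a => ('X - (pole a i)%:P) ^+ k).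
  by apply: smooth_polyX => //; apply: smooth_poly_XsubC => // l; exact: cf.
rewrite /lamA /pf_num; apply: smooth_polyD.
  apply: smooth_polyM; last by apply: smooth_poly_prod => i; exact: pX.
  rewrite /lam_poly; apply: smooth_polyD; first exact: smooth_poly_cst.
  move=> i l; have -> : (fun (a : V) (_ : R) => (\poly_(j < n 0) coef a 0 j)`_i) =
      (fun a _ => if (i < n 0)%N then coef a 0 i else 0).
    by apply/funext => a; apply/funext => t; rewrite coef_poly.
  case: (i < n 0)%N; first exact: cf.
  exact: (smooth_cst l U (pcont_cst 0)).
apply: smooth_poly_sum => i; apply: smooth_polyM; last first.
  by apply: smooth_poly_prod => j; exact: pX.
rewrite /pf_polar; apply: smooth_poly_sum => j; apply: smooth_polyZ => [l|]; first exact: cf.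
exact: pX.
Qed.

End TodaFamilies.

(** * Root functions *)

Section LocalRoots.
Variables (R : realType) (N : nat).
Local Notation C := R[i].
Local Notation V := 'rV[C]_N.
Implicit Types (a b : V).

Lemma circle_surj (q w : C) (r : R) : 0 < r -> cabs (w - q) = r ->
  exists2 t : R, 0 <= t <= 1 & circle q r t = w.
Proof.
move=> r0 wr; have rC : r%:C != 0 :> C by rewrite -cabs_gt0 cabsR normr_gt0 gt_eqF.
have w0 : (w - q) / r%:C != 0.
  by rewrite mulf_neq0 ?invr_eq0// -cabs_gt0 wr.
have [x xE] := cexp_surj w0.
have Rex : Re x = 0.
  apply: expR_inj; rewrite expR0 -cabs_cexp xE cabsM wr cabsV cabsR ger0_norm ?(ltW r0)//.
  by rewrite divff// gt_eqF.
have pi0 : (2 * pi : R) != 0 by rewrite mulf_neq0// gt_eqF// pi_gt0.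
pose y := Im x / (2 * pi); pose k := Num.floor y.
have /andP[k1 k2] := floor_itv y.
exists (y - k%:~R).
  rewrite subr_ge0 k1 lerBlDr /=; apply: ltW; apply: (lt_le_trans k2).
  by rewrite intrD addrC.
rewrite circleE; have -> : (y - k%:~R)%:C * two_pi_i R = x + (- k)%:~R * two_pi_i R.
  rewrite rmorphB mulrBl mulrNz mulNr; congr (_ - _); last by rewrite rmorph_int.
  apply: cplx_eq; rewrite cplxE /=; first by rewrite Rex mulr0 mul0r subr0.
  by rewrite mul0r addr0 divfK.
by rewrite cexpD cexp_period mulr1 xE mulrC divfK// addrC subrK.
Qed.

Lemma open_locally (U : set V) : (forall a, U a -> \forall b \near a, U b) -> open U.
Proof. by move=> H; rewrite openE => a Ua; exact: H. Qed.

Lemma near_mono2 a (P Q S : V -> Prop) : (forall b, P b -> Q b -> S b) ->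
  (\forall b \near a, P b) -> (\forall b \near a, Q b) -> \forall b \near a, S b.
Proof.
move=> H /nbhs_vabs[d d0 Hd] /nbhs_vabs[d' d'0 Hd']; apply/nbhs_vabs.
exists (Num.min d d'); first by rewrite lt_min d0.
by move=> b; rewrite lt_min => /andP[/Hd Pb /Hd' Qb]; exact: H.
Qed.

Lemma open_near (U : set V) a : open U -> U a -> \forall b \near a, U b.
Proof. by move=> oU Ua; exact: (open_nbhs_nbhs (conj oU Ua)). Qed.

Lemma near_fin (I : finType) a (P : I -> V -> Prop) :
  (forall i, \forall b \near a, P i b) -> \forall b \near a, forall i, P i b.
Proof.
move=> H; have {}H i : exists2 d : R, 0 < d & forall b, vabs (b - a) < d -> P i b.
  by apply/nbhs_vabs; exact: H.
have [d dP] := choice (fun i => let: ex_intro2 x y z := H i in ex_intro _ x (conj y z)).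
apply/nbhs_vabs; exists (\big[Num.min/1]_i d i).
  by apply: lt_bigmin => // i _; case: (dP i).
move=> b ab i; have [_] := dP i; apply; apply: (lt_le_trans ab).
exact: bigmin_le_cond.
Qed.

Variables (P : V -> {poly C}) (d : nat) (c : C) (U0 : set V).
Hypotheses (oU0 : open U0) (sP : smooth_poly U0 P) (c0 : c != 0).
Hypotheses (size_P : forall a, size (P a) = d.+1) (lead_P : forall a, lead_coef (P a) = c).

Lemma family_split a : exists s : seq C, size s = d /\ P a = c *: \prod_(w <- s) ('X - w%:P).
Proof.
have [s sE] := closed_field_poly_normal (P a); exists s.
split; last by rewrite -(lead_P a).
by have := size_P a; rewrite {1}sE lead_P size_scale// size_prod_XsubC => -[].
Qed.

Section OneCircle.
Variables (q : C) (r : R).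
Hypothesis r0 : 0 < r.
Local Notation g := (circle q r).
Local Notation g' := (circle_deriv r).

Definition circle_free : set V := [set a | U0 a /\ forall t, 0 <= t <= 1 -> (P a).[g t] != 0].

Let Pg := circle_path q r.
Let cg : pcont g. Proof. by case: Pg. Qed.
Let cg' : pcont g'. Proof. by case: Pg. Qed.

Let smoothPg l (D : set V) : D `<=` U0 -> smooth l D (fun a t => (P a).[g t]).
Proof.
move=> DU; apply: (smooth_poly_horner (d := d.+1)) => // [i k|a]; last by rewrite size_P.
by apply: smooth_subset (sP i k).
Qed.

Lemma circle_free_open : open circle_free.
Proof.
apply: open_locally => a [Ua Ha]; have [cP [cc [H _]]] := (smoothSE 0 U0 _).1 (smoothPg 1 (fun _ => id)).
have K := ud_near_neq0 (H a Ua) (cP a Ua) Ha.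
by apply: (near_mono2 _ (open_near oU0 Ua) K) => b Ub Hb; split.
Qed.

Definition circle_logderiv a t := (P a)^`().[g t] / (P a).[g t] * g' t.
(** By the argument principle this counts the roots in the disc, and [circle_root] adds them up
    ([circle_values]). Both are integrals, hence smooth in [a]. *)
Definition circle_count a := (two_pi_i R)^-1 * cint (circle_logderiv a).
Definition circle_root a := (two_pi_i R)^-1 * cint (fun t => g t * circle_logderiv a t).

Lemma smooth_circle_logderiv l : smooth l circle_free circle_logderiv.
Proof.
have oF := circle_free_open; apply: smoothM; last exact: smooth_cst.
apply: smoothM.
  apply: (smooth_poly_horner (d := d.+1)) => // [|a]; last first.
    apply: (leq_trans (size_poly _ _)); by rewrite size_P.
  by apply: smooth_poly_deriv => // i k; apply: smooth_subset (sP i k) => a [].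
apply: smoothV => // [a t [_ H]|]; first exact: H.
by apply: smoothPg => a [].
Qed.

Lemma smooth_circle_count l : smooth l circle_free (fun a _ => circle_count a).
Proof.
apply: smoothZ; apply: smooth_cint; first exact: circle_free_open.
exact: smooth_circle_logderiv.
Qed.

Lemma smooth_circle_root l : smooth l circle_free (fun a _ => circle_root a).
Proof.
apply: smoothZ; apply: smooth_cint; first exact: circle_free_open.
by apply: smoothM; [exact: smooth_cst|exact: smooth_circle_logderiv].
Qed.

Lemma circle_values a s : circle_free a -> P a = c *: \prod_(w <- s) ('X - w%:P) ->
  circle_count a = (count (fun w => cabs (w - q) < r) s)%:R /\
  circle_root a = \sum_(w <- s | cabs (w - q) < r) w.
Proof.
move=> [_ Ha] EP.
have gs t : 0 <= t <= 1 -> g t \notin s.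
  move=> /Ha; rewrite EP hornerZ mulf_eq0 negb_or => /andP[_].
  by rewrite -[_ == _]/(root _ _) root_prod_XsubC.
have off w : w \in s -> off_curve g w.
  by move=> ws t /gs; apply: contra => /eqP ->.
have E t : 0 <= t <= 1 -> circle_logderiv a t = \sum_(w <- s) g' t / (g t - w).
  move=> t01; rewrite /circle_logderiv EP derivZ !hornerZ (prodXsubC_logderiv (gs t t01)).
  have n0 : (\prod_(w <- s) ('X - w%:P)).[g t] != 0.
    by rewrite -[_ == _]/(root _ _) root_prod_XsubC gs.
  set p := _.[_] in n0 *; set S := \sum_(w <- s) _^-1.
  have -> : c * (p * S) / (c * p) * g' t = g' t * S by field; rewrite n0 c0.
  by rewrite mulr_sumr.
have cw w : w \in s -> pcont (fun t => g' t / (g t - w)).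
  move=> /off ow; apply: pcontM => //; apply: pcontV => [|t t01].
    by apply: pcontD => //; exact: pcont_cst.
  by rewrite subr_eq0; exact: ow.
have idx w : w \in s -> index_integral g g' w = if cabs (w - q) < r then two_pi_i R else 0.
  move=> ws; case: ltrgtP => [H|H|H].
  - by have [] := circle_index_inside r0 H.
  - by have [] := circle_index_outside r0 H.
  - have [t t01 gt] := circle_surj r0 H.
    by have := off w ws t t01; rewrite gt eqxx.
have t0 := two_pi_i_neq0 R.
have sums (F : C -> R -> C) : (forall w, w \in s -> pcont (F w)) ->
    cint (fun t => \sum_(w <- s) F w t) = \sum_(w <- s) cint (F w).
  elim: (s) => [|w s' IH] H.
    rewrite big_nil (_ : (fun t => _) = fun=> 0) ?cint0//.
    by apply/funext => t; rewrite big_nil.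
  rewrite big_cons -IH => [|x xs]; last by apply: H; rewrite inE xs orbT.
  have -> : (fun t => \sum_(x <- w :: s') F x t) = fun t => F w t + \sum_(x <- s') F x t.
    by apply/funext => t; rewrite big_cons.
  apply: cintD; first by apply: H; rewrite mem_head.
  have H' x : x \in s' -> pcont (F x) by move=> xs; apply: H; rewrite inE xs orbT.
  elim: (s') H' => [|y s'' IH'] H'.
    by apply: pcont_ext (pcont_cst 0) => t _; rewrite big_nil.
  apply: pcont_ext (pcontD (H' y (mem_head _ _)) (IH' _)) => [t _|x xs]; first by rewrite big_cons.
  by apply: H'; rewrite inE xs orbT.
split.
  rewrite /circle_count (cint_ext E) sums// mulr_sumr -sum1_count natr_sum [RHS]big_mkcond /=.
  apply: eq_big_seq => w ws; rewrite -/(index_integral g g' w) idx//; case: ifP => _.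
    by rewrite mulVf.
  by rewrite mulr0.
have E2 t : 0 <= t <= 1 -> g t * circle_logderiv a t = \sum_(w <- s) (g' t + w * (g' t / (g t - w))).
  move=> t01; rewrite E// mulr_sumr; apply: eq_big_seq => w ws.
  have := off w ws t t01; rewrite -subr_eq0 => n0.
  have aux (x y z : C) : x - z != 0 -> x * (y / (x - z)) = y + z * (y / (x - z)) by move=> ?; field.
  exact: aux.
have cw2 w : w \in s -> pcont (fun t => w * (g' t / (g t - w))).
  by move=> ws; apply: pcontM; [exact: pcont_cst|exact: cw].
have g'0 : cint g' = 0 by rewrite (C1path_integral Pg) -circle_closed subrr.
rewrite /circle_root (cint_ext E2) sums => [|w ws]; last by apply: pcontD; [exact: cg'|exact: cw2].
rewrite mulr_sumr [RHS]big_mkcond /=; apply: eq_big_seq => w ws.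
rewrite cintD; [|exact: cg'|exact: cw2].
rewrite g'0 add0r cintZ; last exact: cw.
rewrite -/(index_integral g g' w) idx//; case: ifP => _; last by rewrite !mulr0.
by rewrite mulrCA mulVf// mulr1.
Qed.

End OneCircle.

(** Each root of the separable polynomial at a0 gets its own disc. Nearby polynomials keep exactly
    one root in each disc, which is then the integral [circle_root]; counting degrees shows that
    these are all the roots. *)
Lemma local_roots a0 : U0 a0 -> separable_poly (P a0) ->
  exists (U : set V) (z : 'I_d -> V -> C), [/\ open U, U a0, U `<=` U0,
    forall a, U a -> injective (z^~ a) /\ P a = c *: \prod_j ('X - (z j a)%:P) &
    forall j l, smooth l U (fun a _ => z j a)].
Proof.
move=> Ua0 sep; have [s [ss EP]] := family_split a0.
have us : uniq s.
  have /eqp_separable : P a0 %= \prod_(w <- s) ('X - w%:P).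
    by rewrite EP; apply: eqp_scale.
  by rewrite sep separable_prod_XsubC => <-.
pose q (j : 'I_d) := nth 0 s j.
have qs j : q j \in s by rewrite mem_nth// ss.
(* Twice the radius is at most the distance of distinct roots, so no point lies in two of the
   discs. *)
have [r r0 rP] : exists2 r : R, 0 < r & forall x y, x \in s -> y \in s -> cabs (x - y) < 2 * r -> x = y.
  have H (x : seq_sub s) : exists d0 : R, 0 < d0 /\ forall y, y \in s -> cabs (y - ssval x) < d0 -> ssval x = y.
    have cn : ssval x \notin [seq y <- s | y != ssval x] by rewrite mem_filter eqxx.
    have [d1 d10 Hd] := seq_isolated cn; exists d1; split=> // y ys /Hd.
    by rewrite mem_filter ys andbT negbK => /eqP.
  have [dd ddP] := choice H.
  exists (\big[Num.min/1]_x dd x / 2).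
    by rewrite divr_gt0//; apply: lt_bigmin => // x _; case: (ddP x).
  move=> x y xs ys; rewrite mulrC divfK// => xy.
  have [_ K] := ddP (SeqSub xs); apply: K => //=; rewrite cabs_distC; apply: (lt_le_trans xy).
  exact: bigmin_le_cond.
have r20 : r < 2 * r by rewrite ltr_pMl// ltr1n.
(* The count is a natural number, so a distance below 1 from 1 forces the value 1; in this form the
   condition is open. *)
pose Uj j : set V := [set a | circle_free (q j) r a /\ cabs (circle_count (q j) r a - 1) < 1].
pose U : set V := [set a | U0 a /\ forall j, Uj j a].
have free0 j : circle_free (q j) r a0.
  split=> // t t01; rewrite EP hornerZ mulf_neq0// -[_ == _]/(root _ _) root_prod_XsubC.
  apply/negP => gs; have gq := cabs_circle (q j) t (ltW r0).
  have E : circle (q j) r t = q j by apply: rP => //; rewrite gq.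
  by move: gq; rewrite E subrr cabs0 => E0; rewrite E0 ltxx in r0.
have cnt0 j : count (fun w => cabs (w - q j) < r) s = 1%N.
  rewrite -[1%N]/(true : nat) -(qs j) -(count_uniq_mem (q j) us); apply: eq_in_count => w ws /=.
  apply/idP/eqP => [wq|->]; last by rewrite subrr cabs0.
  by apply: rP => //; exact: lt_trans r20.
have one_in a j t : Uj j a -> P a = c *: \prod_(w <- t) ('X - w%:P) ->
    circle_root (q j) r a \in t /\ cabs (circle_root (q j) r a - q j) < r.
  move=> [Fa Ca] Et; have [E1 E2] := circle_values r0 Fa Et.
  have c1 : count (fun w => cabs (w - q j) < r) t = 1%N.
    move: Ca; rewrite E1; case: (count _ t) => [|[|k]] //.
      by rewrite sub0r cabsN cabs1 ltxx.
    by rewrite -[k.+2%:R]natr1 addrK cabs_nat ltrn1.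
  have : size [seq w <- t | cabs (w - q j) < r] = 1%N by rewrite size_filter.
  rewrite E2 -big_filter; case Ef: [seq w <- t | cabs (w - q j) < r] => [|w [|]] // _.
  rewrite big_seq1; have : w \in [seq w <- t | cabs (w - q j) < r] by rewrite Ef mem_head.
  by rewrite mem_filter => /andP[].
exists U, (fun j a => circle_root (q j) r a); split.
- apply: open_locally => a [Ua Ha].
  have K : \forall b \near a, forall j, Uj j b.
    apply: near_fin => j; have [Fa Ca] := Ha j.
    have S := smooth_circle_count (q j) r 1.
    have [cP [cc [H _]]] := (smoothSE 0 _ _).1 S.
    have e0 : 0 < 1 - cabs (circle_count (q j) r a - 1) by rewrite subr_gt0.
    have K1 := ud_near (H a Fa) e0.
    have K2 := open_near (@circle_free_open (q j) r) Fa.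
    apply: (near_mono2 _ K2 K1).
    move=> b Fb Hb; have {}Hb := Hb 0 (introT andP (conj (lexx 0) ler01)); split; first exact: Fb.
    have := cabs_tri3 (circle_count (q j) r b) 1 (circle_count (q j) r a).
    by move: Hb; set x := cabs _; set y := cabs _; set w := cabs _ => Hx Hy; lra.
  apply: (near_mono2 _ (open_near oU0 Ua) K).
  by move=> b Ub Hb; split; [exact: Ub|exact: Hb].
- split=> // j; split; first exact: free0.
  have [-> _] := circle_values r0 (free0 j) EP.
  by rewrite cnt0 subrr cabs0 ltr01.
- by move=> a [].
- move=> a [Ua Ha]; have iz : injective (fun j => circle_root (q j) r a).
    move=> i j E; have [t [_ Et]] := family_split a.
    have [_ H1] := one_in a i t (Ha i) Et; have [_ H2] := one_in a j t (Ha j) Et.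
    have E' : q i = q j.
      apply: rP => //; apply: (le_lt_trans (cabs_tri3 _ _ (circle_root (q i) r a))).
      rewrite mulr_natl mulr2n; apply: ltrD; first by rewrite cabs_distC.
      by rewrite E.
    apply/val_inj/eqP => /=; rewrite -(nth_uniq 0 _ _ us) ?ss//; exact/eqP.
  split=> //; have [t [st Et]] := family_split a.
  pose zs := [seq circle_root (q j) r a | j <- enum 'I_d].
  have uz : uniq zs by rewrite map_inj_uniq// enum_uniq.
  have zt : {subset zs <= t} by move=> _ /mapP[j _ ->]; case: (one_in a j t (Ha j) Et).
  have sz : (size t <= size zs)%N by rewrite size_map -cardE card_ord st.
  have pz : perm_eq t zs.
    apply: uniq_perm => //; first exact: leq_size_uniq uz zt sz.
    by move=> w; have [_ ->] := uniq_min_size uz zt sz.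
  by rewrite Et (perm_big _ pz) /= big_map big_enum.
- move=> j l; apply: smooth_subset (smooth_circle_root (q j) r l) => a [_ Ha].
  by case: (Ha j).
Qed.

End LocalRoots.

(** * Logarithmic differentials of products *)

Section LogarithmicDifferentials.
Variables (R : realType) (N : nat).
Local Notation C := R[i].
Local Notation V := 'rV[C]_N.
Implicit Types (a b : V) (f h : V -> C) (c : 'I_N -> C).

Definition dlog f a c := f a != 0 /\ ud (fun b _ => f b) a (fun k _ => f a * c k).

Lemma dlog_cst (x : C) a : x != 0 -> dlog (fun=> x) a (fun=> 0).
Proof.
move=> x0; split=> //; apply: ud_eq (ud_cst (fun=> x) a) => // k _.
by rewrite mulr0.
Qed.

Lemma dlogM f h a c c' : dlog f a c -> dlog h a c' -> dlog (fun b => f b * h b) a (fun k => c k + c' k).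
Proof.
move=> [f0 uf] [h0 uh]; split; first exact: mulf_neq0.
apply: ud_eq (udM (pcont_cst (f a)) (pcont_cst (h a)) uf uh) => // k _.
by rewrite mulrDr addrC; congr (_ + _); ring.
Qed.

Lemma dlogX f a c j : dlog f a c -> dlog (fun b => f b ^+ j) a (fun k => j%:R * c k).
Proof.
move=> H; elim: j => [|j IH].
  have [n0 U] := dlog_cst a (oner_neq0 C); split; first by rewrite expr0 oner_neq0.
  by apply: ud_eq U => [b _|k _]; rewrite ?expr0// mul0r.
have [n0 U] := dlogM H IH; split; first by rewrite exprS.
by apply: ud_eq U => [b _|k _]; rewrite ?exprS// -natr1; ring.
Qed.

Lemma dlog_prod (I : Type) (s : seq I) (F : I -> V -> C) a (c : I -> 'I_N -> C) :
  (forall i, dlog (F i) a (c i)) -> dlog (fun b => \prod_(i <- s) F i b) a (fun k => \sum_(i <- s) c i k).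
Proof.
move=> H; elim: s => [|i s IH].
  have [n0 U] := dlog_cst a (oner_neq0 C); split; first by rewrite big_nil oner_neq0.
  by apply: ud_eq U => [b _|k _]; rewrite ?big_nil.
have [n0 U] := dlogM (H i) IH; split; first by rewrite big_cons.
by apply: ud_eq U => [b _|k _]; rewrite ?big_cons.
Qed.

Lemma dlog_unique f h a c c' : (\forall b \near a, f b = h b) -> dlog f a c -> dlog h a c' ->
  forall k, c k = c' k.
Proof.
move=> /nbhs_vabs[d d0 E] [f0 uf] [h0 uh] k.
have fa : f a = h a by apply: E; rewrite subrr vabs0.
have uf' : ud (fun b _ => h b) a (fun k _ => f a * c k).
  apply: (ud_ext _ _ uf) => //; apply/nbhs_vabs; exists d => // b /E fb t _; exact: fb.
have [_ E1] := ud_differentiable uf'; have [_ E2] := ud_differentiable uh.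
have := E1 (delta_mx 0 k); rewrite E2 /lincomb.
have dl (g : 'I_N -> C) : \sum_l (delta_mx 0 k : V) 0 l * g l = g k.
  rewrite (bigD1 k)//= big1 => [|l lk]; first by rewrite mxE !eqxx mul1r addr0.
  by rewrite mxE (negPf lk) andbF mul0r.
by rewrite !dl fa => /(mulfI h0) ->.
Qed.

End LogarithmicDifferentials.

(** Multiplication by the nodal polynomial gives a polynomial that vanishes off a finite list, hence
    0; its value at [y k] isolates [x k]. *)
Lemma simple_fractions_eq0 (K : numFieldType) (I : finType) (y x : I -> K) (s : seq K) :
  injective y -> (forall z, z \notin s -> (forall k, z != y k) -> \sum_k x k / (z - y k) = 0) ->
  forall k, x k = 0.
Proof.
move=> iy H k; have T0 : \sum_k x k *: conodal y k = 0.
  apply: (@poly_eq_off _ _ _ (s ++ [seq y k | k <- enum I])) => z.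
  rewrite mem_cat negb_or horner0 => /andP[zs zy].
  have {}zy l : z != y l by apply: contra zy => /eqP ->; apply: map_f; rewrite mem_enum.
  have := H z zs zy; rewrite horner_sum => E.
  transitivity ((nodal y).[z] * \sum_k x k / (z - y k)); last by rewrite E mulr0.
  rewrite mulr_sumr; apply: eq_bigr => l _.
  rewrite hornerZ (nodal_conodal y l) hornerM hornerXsubC.
  have : z - y l != 0 by rewrite subr_eq0.
  by move=> n0; field.
have := congr1 (fun P : {poly K} => P.[y k]) T0; rewrite horner_sum horner0 (bigD1 k)//= big1 => [|l lk].
  by rewrite hornerZ addr0 => /eqP; rewrite mulf_eq0 (negPf (conodal_neq0 iy k)) orbF => /eqP.
by rewrite hornerZ conodal0// mulr0.
Qed.

(** * Derivatives of the root functions *)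

Section TodaRoots.
Variables (R : realType) (m : nat) (n : nat -> nat).
Hypotheses (hm : (0 < m)%N) (hn : forall i : nat, (i <= m)%N -> (0 < n i)%N).
Local Notation C := R[i].
Local Notation N := (toda_dim m n).
Local Notation V := 'rV[C]_N.
Implicit Types (a b u : V).
Local Notation n0 := ((n 0)%:R : C).
Local Notation Mt := (@toda_manifold R m n).
Variables (E : V -> V).
Hypothesis hE : toda_euler_field E.

Lemma near_neq0 (f : V -> C) a : (forall l, smooth l [set: V] (fun a _ => f a)) -> f a != 0 ->
  \forall b \near a, f b != 0.
Proof.
move=> S fa; have [cP [cc [H _]]] := (smoothSE 0 _ _).1 (S 1).
have := ud_near_neq0 (H a I) (cP a I) (fun _ _ => fa).
by apply: near_mono2 (open_near openT I) => b _ /(_ 0); rewrite lexx ler01; apply.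
Qed.

Lemma toda_open : open Mt.
Proof.
apply: open_locally => a [H1 H2].
have sc i j l : smooth l [set: V] (fun a _ => coef a i j) by exact: smooth_coef.
have K1 : \forall b \near a, forall i : 'I_m.+1, (1 <= i)%N -> coef b i (n i) != 0.
  apply: near_fin => i; have [i1|i1] := leqP 1 i; last first.
    by apply/nbhs_vabs; exists 1 => // b _; rewrite leqNgt i1.
  have ai : coef a i (n i) != 0 by apply: H1; rewrite i1 -ltnS ltn_ord.
  by apply: near_mono2 (near_neq0 (sc i (n i)) ai) (open_near openT I) => b Hb _ _.
have K2 : \forall b \near a, forall p : 'I_m.+1 * 'I_m.+1, (1 <= p.1)%N -> (1 <= p.2)%N ->
    p.1 != p.2 -> coef b p.1 0 - coef b p.2 0 != 0.
  apply: near_fin => -[i j] /=.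
  have [i1|i1] := leqP 1 i; last by apply/nbhs_vabs; exists 1 => // b _; rewrite leqNgt i1.
  have [j1|j1] := leqP 1 j; last by apply/nbhs_vabs; exists 1 => // b _; rewrite [(_ <= j)%N]leqNgt j1.
  have [ij|ij] := eqVneq i j; first by apply/nbhs_vabs; exists 1.
  have aij : coef a i 0 - coef a j 0 != 0.
    rewrite subr_eq0; apply: H2 => [||E'].
    - by rewrite i1 -ltnS ltn_ord.
    - by rewrite j1 -ltnS ltn_ord.
    - by case/negP: ij; apply/eqP/val_inj.
  have sd l : smooth l [set: V] (fun b _ => coef b i 0 - coef b j 0).
    by apply: smoothD => //; apply: smoothN => //; exact: openT.
  by apply: near_mono2 (near_neq0 sd aij) (open_near openT I) => b Hb _ _ _ _.
apply: near_mono2 K1 K2 => b B1 B2; split=> [i /andP[i1 im]|i j /andP[i1 im] /andP[j1 jm] ij].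
  have im' : (i < m.+1)%N by []. exact: (B1 (Ordinal im')).
have im' : (i < m.+1)%N by []. have jm' : (j < m.+1)%N by [].
rewrite -subr_eq0; apply: (B2 (Ordinal im', Ordinal jm')) => //.
by apply/eqP => -[].
Qed.

Definition lam_denominator a z : C := z ^+ n 1 * \prod_(i < m.-1) (z - pole a i.+2) ^+ n i.+2.

Lemma lamB_horner a z : (lamB a).[z] = lam_denominator a z.
Proof.
rewrite /lamB /pf_den horner_prod big_ltn ?ltnS// horner_exp hornerXsubC pole1// subr0.
congr (_ * _); rewrite -{1}[2%N]add0n big_addn subSS subn1 big_mkord.
by apply: eq_bigr => i _; rewrite addn2 horner_exp hornerXsubC.
Qed.

Lemma dlog_lam a z : ~ lam_pole a z -> lam a z != 0 ->
  dlog (fun b => lam b z) a (fun k => tangent_lam a (delta_mx 0 k) z / lam a z).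
Proof.
move=> Hz l0; split=> //; apply: ud_eq (ud_lam hm (pcont_cst z) (fun t _ => Hz)) => // k _.
by rewrite mulrC divfK// (tangent_lamE hm).
Qed.

Lemma dlog_linear_factor (f : V -> C) a z (c : 'I_N -> C) : ud (fun b _ => f b) a (fun k _ => c k) ->
  z - f a != 0 -> dlog (fun b => z - f b) a (fun k => - c k / (z - f a)).
Proof.
move=> uf n0'; split=> //.
have := udD (ud_cst (fun=> z) a) (udM (pcont_cst (-1)) (pcont_cst (f a)) (ud_cst (fun=> -1) a) uf).
apply: ud_eq => [b _|k _]; first by rewrite mulN1r.
by rewrite mul0r addr0 add0r mulN1r mulrC divfK.
Qed.

Section Derivatives.
Variables (U : set V) (z : 'I_(deg_zeros m n) -> V -> C).
Hypotheses (oU : open U) (UM : U `<=` Mt).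
Hypotheses (zinj : forall a, U a -> injective (z^~ a)).
Hypotheses (EA : forall a, U a -> lamA a = n0^-1 *: \prod_j ('X - (z j a)%:P)).
Hypotheses (sz : forall j l, smooth l U (fun a _ => z j a)).
Local Notation rho a := (root_vector hm (z^~ a) a).
Local Notation eps := (sign_vector R hm).

Lemma root_functions_data a : U a -> root_data (lamW a) (lamS a) (rho a) eps n0.
Proof. by move=> Ua; apply: root_vector_data => //; [exact: UM|exact: zinj|exact: EA]. Qed.

Lemma smooth_root_functions k l : smooth l U (fun a _ => rho a k).
Proof.
elim/root_index_case: k => [j|i].
  have -> : (fun (a : V) (_ : R) => rho a (zero_index hm j)) = (fun a _ => z j a).
    by apply/funext => a; apply/funext => t; rewrite root_vector_zero.
  exact: sz.
have -> : (fun (a : V) (_ : R) => rho a (pole_index n hm i)) = (fun a _ => coef a i.+2 0).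
  by apply/funext => a; apply/funext => t; rewrite root_vector_pole.
exact: smooth_coef.
Qed.

(** Logarithmic differentiation of the factorization of lambda at a fixed w gives a sum of simple
    fractions 1 / (w - rho_r). [tangent_log] gives another such expansion of the same quantity, and
    the coefficients agree. *)
Lemma derive_root_functions a u k : U a ->
  'D_u (fun b => rho b k) a = rho a k * tell a (rho a) eps u k.
Proof.
move=> Ua; have Ma := UM Ua; have RD := root_functions_data Ua.
have [irho _ en _] := RD.
have : exists d : 'I_N -> 'I_N -> C, forall k, ud (fun b _ => rho b k) a (fun l _ => d k l).
  have H (k' : 'I_N) : exists d : 'I_N -> C, ud (fun b _ => rho b k') a (fun l _ => d l).
    have [d [_ H _ _]] := smooth_derive (smooth_root_functions k' 1).
    by exists (d^~ a); exact: H.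
  by have [d dP] := choice H; exists d.
move=> [d dP].
have key (l k' : 'I_N) : d k' l = rho a k' * tell a (rho a) eps (delta_mx 0 l) k'.
  pose x k := eps k * (d k l - rho a k * tell a (rho a) eps (delta_mx 0 l) k).
  suff /(_ k')/eqP : forall k, x k = 0.
    by rewrite mulf_eq0 (negPf (en k')) subr_eq0 => /eqP.
  apply: (simple_fractions_eq0 (s := [seq pole a i | i <- index_iota 1 m.+1]) irho) => w /poleP Hw wr.
  have l0 : lam a w != 0.
    apply/eqP => l0; have : root (lamS a) w by rewrite /root lamS_off// l0 mulr0.
    rewrite (root_data_root (n0_neq0 R hn) RD) => /existsP[k'' /eqP E'].
    by have := wr k''; rewrite E' eqxx.
  have w0 : w != 0 by exact: (pole_neq0 hm Hw).
  have fac' k0 : dlog (fun b => w - rho b k0) a (fun l1 => - d k0 l1 / (w - rho a k0)).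
    by apply: dlog_linear_factor; [exact: dP|rewrite subr_eq0].
  have facz j := fac' (zero_index hm j); have facp i := fac' (pole_index n hm i).
  have n0V : n0^-1 != 0 by rewrite invr_eq0 (n0_neq0 R hn).
  have D1 := dlogM (dlog_lam Hw l0) (dlogM (dlog_cst a (expf_neq0 (n 1) w0))
     (dlog_prod (index_enum 'I_m.-1) (fun i => dlogX (n i.+2) (facp i)))).
  have D2 := dlogM (dlog_cst a n0V) (dlog_prod (index_enum _) facz).
  have eqn : \forall b \near a, lam b w * (w ^+ n 1 * \prod_(i < m.-1) (w - rho b (pole_index n hm i)) ^+ n i.+2) =
      n0^-1 * \prod_j (w - rho b (zero_index hm j)).
    have K : \forall b \near a, forall i : 'I_m.-1, w - rho b (pole_index n hm i) != 0.
      apply: near_fin => i; have [f0 uf] := facp i.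
      have := ud_near_neq0 uf (pcont_cst _) (fun _ _ => f0).
      by apply: near_mono2 (open_near openT I) => b _ /(_ 0); rewrite lexx ler01; apply.
    apply: near_mono2 (open_near oU Ua) K => b Ub Hb.
    have Hbw : ~ lam_pole b w.
      apply/npoleP => i; rewrite mem_index_iota ltnS => /andP[i1 im].
      have [->|i2] := eqVneq i 1%N; first by rewrite pole1.
      have im' : (i - 2 < m.-1)%N by lia.
      have := Hb (Ordinal im'); rewrite root_vector_pole /= subr_eq0; have -> : (i - 2).+2 = i by lia.
      by [].
    have -> : w ^+ n 1 * \prod_(i < m.-1) (w - rho b (pole_index n hm i)) ^+ n i.+2 = (lamB b).[w].
      by rewrite lamB_horner /lam_denominator; congr (_ * _); apply: eq_bigr => i _; rewrite root_vector_pole.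
    rewrite lamE// divfK ?lamBn0// EA// hornerZ horner_prod; congr (_ * _).
    by apply: eq_bigr => j _; rewrite hornerXsubC root_vector_zero.
  have := dlog_unique eqn D1 D2 l; rewrite !add0r => D3.
  have TL := tangent_log hm hn Ma RD (delta_mx 0 l) Hw l0.
  rewrite (big_root_index hm) /= /x.
  transitivity (- (tangent_lam a (delta_mx 0 l) w / lam a w) + tangent_lam a (delta_mx 0 l) w / lam a w); last exact: addNr.
  rewrite {2}TL (big_root_index hm) /= opprD -!sumrN.
  have -> : - (tangent_lam a (delta_mx 0 l) w / lam a w) =
     \sum_j d (zero_index hm j) l / (w - rho a (zero_index hm j)) -
     \sum_(i < m.-1) (n i.+2)%:R * d (pole_index n hm i) l / (w - rho a (pole_index n hm i)).
    move: D3; move=> /(canRL (addrK _)) ->; rewrite opprD opprK -sumrN; congr (_ + _).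
      by apply: eq_bigr => j _; rewrite mulNr opprK.
    by rewrite -sumrN; apply: eq_bigr => i _; rewrite mulNr mulrN mulrA.
  rewrite -sumrN addrACA -!big_split /=; congr (_ + _); apply: eq_bigr => i _.
    rewrite sign_zero; set q := _^-1; set p := rho _ _; set t := tell _ _ _ _ _; ring.
  rewrite sign_pole; set q := _^-1; set p := rho _ _; set t := tell _ _ _ _ _; ring.
have [_ ->] := ud_differentiable (dP k).
have -> : tell a (rho a) eps u k = \sum_l u 0 l * tell a (rho a) eps (delta_mx 0 l) k.
  apply: (@linear_row_sum _ _ (fun u => tell a (rho a) eps u k)) => c v w.
  exact: tell_linear.
rewrite /lincomb mulr_sumr; apply: eq_bigr => l _.
by rewrite key mulrCA.
Qed.

End Derivatives.

(** A multiple zero of lambda would be a common root of [lamS] and [lamW], so the zeros are simple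
    and [local_roots] applies. *)
Lemma dual_local a0 : toda_dual_manifold E a0 -> exists (U : set V) (z : 'I_(deg_zeros m n) -> V -> C),
  [/\ open U, U a0, U `<=` Mt,
   forall a, U a -> injective (z^~ a) /\ lamA a = n0^-1 *: \prod_j ('X - (z j a)%:P) &
   forall j l, smooth l U (fun a _ => z j a)].
Proof.
move=> /[dup] Da [Ma _].
have cop := (toda_dual_coprime hm hn hE Ma).1 Da.
have sep : separable_poly (lamA a0).
  rewrite separable_poly.unlock; apply: coprime_closed => x /rootP Ax; apply/negP => /rootP A'x.
  have Sx : root (lamS a0) x by rewrite /root /lamS hornerM Ax mul0r.
  have := coprimep_root cop Sx.
  by rewrite lamW_horner Ax A'x !mul0r subrr eqxx.
have := local_roots toda_open (smooth_poly_lamA toda_open) (_ : n0^-1 != 0) (size_lamA hn) (lead_lamA hn) Ma sep.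
by apply; rewrite invr_eq0 (n0_neq0 R hn).
Qed.

End TodaRoots.

Lemma cder_poly (R : realType) (P : {poly R[i]}) (g : R -> R[i]) t d : cder g t d ->
  cder (fun s => P.[g s]) t (P^`().[g t] * d).
Proof.
move=> Hg; elim/poly_ind: P => [|P c IH].
  have -> : (fun s => (0 : {poly R[i]}).[g s]) = fun=> 0 by apply/funext => s; rewrite horner0.
  by rewrite deriv0 horner0 mul0r; exact: cder_cst.
have -> : (fun s => (P * 'X + c%:P).[g s]) = fun s => P.[g s] * g s + c.
  by apply/funext => s; rewrite hornerMXaddC.
have -> : (P * 'X + c%:P)^`().[g t] * d = P.[g t] * d + (P^`().[g t] * d) * g t + 0.
  by rewrite derivD derivM derivX derivC addr0 mulr1 hornerD hornerMX; ring.
by apply: cderD; [exact: cderM|exact: cder_cst].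
Qed.

(** * Balls and joint continuity *)

Section Balls.
Variables (R : realType) (N : nat).
Local Notation C := R[i].
Local Notation V := 'rV[C]_N.

Definition vball (a : V) (d : R) : set V := [set b | vabs (b - a) < d].

Lemma vball_open a d : open (vball a d).
Proof.
apply: open_locally => b; rewrite /vball /= => ab; apply/nbhs_vabs.
exists (d - vabs (b - a)); first by rewrite subr_gt0.
move=> x; rewrite ltrBrDr => xb; apply: le_lt_trans xb.
by rewrite (_ : x - a = (x - b) + (b - a)) ?vabsD// addrA subrK.
Qed.

Lemma vball_center a d : 0 < d -> vball a d a.
Proof. by rewrite /vball /= subrr vabs0. Qed.

Lemma within_joint_continuous (U : set V) (L : V -> R -> C) :
  (forall a t, U a -> 0 <= t <= 1 -> forall e : R, 0 < e ->
     exists d : R, 0 < d /\ forall b s, U b -> 0 <= s <= 1 -> vabs (b - a) < d -> `|s - t| < d ->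
       cabs (L b s - L a t) < e) <->
  {within U `*` `[0, 1]%classic, continuous (fun x => L x.1 x.2)}.
Proof.
split=> [H|/subspace_continuousP H a t Ua t01 e e0].
  apply/subspace_continuousP => -[a t] /= [Ua t01].
  apply/cvgrPdist_lt => /= e e0; have [e' e'0 ->] := posc_real e0.
  move: t01; rewrite /= in_itv /= => t01; have [d [d0 Hd]] := H a t Ua t01 e' e'0.
  rewrite near_withinE /=.
  exists ([set b | vabs (b - a) < d], [set s | `|s - t| < d]) => /=.
    split; first by apply/nbhs_vabs; exists d.
    by apply/nbhs_ballP; exists d => //= s; rewrite /ball /= distrC.
  move=> [b s] /= [Hb Hs] [Ub]; rewrite /= in_itv /= => s01.
  by rewrite normr_ltc cabs_distC; exact: Hd.
have t01' : (`[0, 1]%classic : set R) t by rewrite /= in_itv.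
have /cvgrPdist_lt K := H (a, t) (conj Ua t01').
have eC : 0 < e%:C by rewrite ltcR.
have := K _ eC; rewrite near_withinE /= => -[[Q1 Q2] /= [N1 N2] HQ].
have [d1 d10 Hd1] := (nbhs_vabs a Q1).1 N1.
have /nbhs_ballP[d2 /= d20 Hd2] := N2.
exists (Num.min d1 d2); split; first by rewrite lt_min d10.
move=> b s Ub s01; rewrite !lt_min => /andP[/Hd1 B1 _] /andP[_ B2].
have s01' : (`[0, 1]%classic : set R) s by rewrite /= in_itv.
have B2' : Q2 s by apply: Hd2; rewrite /ball /= distrC.
have := HQ (b, s) (conj B1 B2') (conj Ub s01').
by rewrite /= normr_ltc cabs_distC.
Qed.

End Balls.

(** * Branches of log lambda along a curve *)

Section TodaCurves.
Variables (R : realType) (m : nat) (n : nat -> nat).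
Hypotheses (hm : (0 < m)%N) (hn : forall i : nat, (i <= m)%N -> (0 < n i)%N).
Local Notation C := R[i].
Local Notation N := (toda_dim m n).
Local Notation V := 'rV[C]_N.
Local Notation Mt := (@toda_manifold R m n).
Implicit Types (a b u : V) (t : R).
Variables (g : R -> C).
Hypotheses (Cg : C1_curve g) (g01 : g 0 = g 1).
Local Notation g' := (curve_deriv g).
Let Pg := C1_path Cg.
Let cg : pcont g. Proof. by case: Pg. Qed.
Let cg' : pcont g'. Proof. by case: Pg. Qed.

Definition off_zeros_poles a := forall t, 0 <= t <= 1 -> ~ lam_pole a (g t) /\ lam a (g t) != 0.

Lemma cder_lam a t : ~ lam_pole a (g t) -> cder (fun s => lam a (g s)) t (lam' a (g t) * g' t).
Proof.
move=> Hz; have [d d0 Hd] := pole_isolated Hz.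
have B0 := lamBn0 Hz; have cgt := C1_cder Cg t.
have [d1 d10 H1] := cder_cont cgt d0.
have := cderM (cder_poly (lamA a) cgt) (cderV B0 (cder_poly (lamB a) cgt)).
have -> : lam' a (g t) = ((lamA a)^`().[g t] * (lamB a).[g t] - (lamA a).[g t] * (lamB a)^`().[g t]) / (lamB a).[g t] ^+ 2.
  apply: (derive1_ratio d0) => w /Hd Hw; split; [exact: lamBn0|exact: lamE].
set A := (lamA a).[g t]; set A' := (lamA a)^`().[g t]; set B := (lamB a).[g t] in B0 *; set B' := (lamB a)^`().[g t].
have -> : A * (- (B' * g' t) / B ^+ 2) + A' * g' t * B^-1 = (A' * B - A * B') / B ^+ 2 * g' t.
  have aux (y y' q q' x : C) : q != 0 -> y * (- (q' * x) / q ^+ 2) + y' * x * q^-1 = (y' * q - y * q') / q ^+ 2 * x.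
    by move=> ?; field.
  exact: aux.
apply: cder_ext; apply/nbhs_ballP; exists d1 => //= s; rewrite /ball /= distrC => /H1/Hd Hs.
by rewrite -lamE.
Qed.

Lemma pcont_lam a : (forall t, 0 <= t <= 1 -> ~ lam_pole a (g t)) -> pcont (fun t => lam a (g t)).
Proof.
move=> H; apply: (@pcont_ext _ (fun t => (lamA a).[g t] / (lamB a).[g t])) => [t /H Ht|]; first by rewrite lamE.
apply: pcontM; first exact: pcont_poly.
by apply: pcontV => [|t /H/lamBn0 //]; exact: pcont_poly.
Qed.

Lemma lam_path a : (forall t, 0 <= t <= 1 -> ~ lam_pole a (g t)) ->
  C1path (fun t => lam a (g t)) (fun t => lam' a (g t) * g' t).
Proof.
move=> H; split; [exact: pcont_lam| |].
  apply: pcontM => //; apply: (@pcont_ext _ (fun t => (lamW a).[g t] / (g t * (lamD a).[g t]))) => [t /H Ht|].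
    have z0 := pole_neq0 hm Ht; have D0 := lamDn0 Ht; rewrite lamW_off//.
    by rewrite mulrC mulKf// mulf_neq0.
  apply: pcontM; first exact: pcont_poly.
  apply: pcontV => [|t /H Ht]; first by apply: pcontM => //; exact: pcont_poly.
  by rewrite mulf_neq0 ?(pole_neq0 hm Ht) ?(lamDn0 Ht).
by move=> t /andP[t0 t1]; apply: cder_lam; apply: H; rewrite !ltW.
Qed.

Lemma winding_log a (L : R -> C) : off_zeros_poles a -> pcont L ->
  (forall t, 0 <= t <= 1 -> cexp (L t) = lam a (g t)) ->
  winding (fun t => lam a (g t)) 0 = (two_pi_i R)^-1 * (L 1 - L 0).
Proof.
move=> H cL EL; have off t (t01 : 0 <= t <= 1) := (H t t01).1.
rewrite -(C1path_integral (C1path_log (lam_path off) cL EL)) /winding /contour_int.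
congr (_ * _); apply: cint_ext => t t01; rewrite subr0 mulrC.
by rewrite (cder_curve_deriv (cder_lam (off t t01))).
Qed.

Lemma zero_winding_closed a (L : R -> C) : zero_winding a g -> log_along a g L -> L 0 = L 1.
Proof.
move=> [H W] [cL EL]; have := winding_log H (within_continuous_pcont cL) EL; rewrite W.
move/esym/eqP; rewrite mulf_eq0 invr_eq0 (negPf (two_pi_i_neq0 R)) subr_eq0 => /eqP; exact: esym.
Qed.

Lemma off_near a : off_zeros_poles a -> \forall b \near a, off_zeros_poles b.
Proof.
move=> H; have off t (t01 : 0 <= t <= 1) := (H t t01).1.
have K1 : \forall b \near a, forall i : 'I_m.+1, (1 <= i)%N -> forall t, 0 <= t <= 1 -> g t - coef b i 0 != 0.
  apply: near_fin => i; have [i1|i1] := leqP 1 i; last first.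
    by apply/nbhs_vabs; exists 1 => // b _; rewrite leqNgt i1.
  have cc : pcont (fun t => g t - coef a i 0) by apply: pcontD => //; exact: pcont_cst.
  have nz t : 0 <= t <= 1 -> g t - coef a i 0 != 0.
    move=> /off/npoleP K; rewrite subr_eq0; apply: K; rewrite mem_r i1 -ltnS; exact: ltn_ord.
  have u1 := udD (ud_cst g a) (udM (pcont_cst (-1)) (pcont_cst _) (ud_cst (fun=> -1) a) (ud_coef a i 0)).
  have {}u1 : ud (fun b t => g t - coef b i 0) a (fun k t => 0 + (-1 * coef (delta_mx 0 k : V) i 0 + 0 * coef a i 0)).
    by apply: ud_eq u1 => // b t; rewrite mulN1r.
  by apply: near_mono2 (ud_near_neq0 u1 cc nz) (open_near openT I) => b Hb _ _.
have K2 := ud_near_neq0 (ud_lam hm cg off) (pcont_lam off) (fun t t01 => (H t t01).2).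
apply: near_mono2 K1 K2 => b B1 B2 t t01; split; last exact: B2.
apply/npoleP => i; rewrite mem_r => /andP[i1 im]; have im' : (i < m.+1)%N by [].
by have := B1 (Ordinal im') i1 t t01; rewrite subr_eq0.
Qed.

Lemma ratio_small a (e : R) : off_zeros_poles a -> 0 < e ->
  \forall b \near a, off_zeros_poles b /\ forall t, 0 <= t <= 1 ->
    0 < Re (lam b (g t) / lam a (g t)) /\ cabs (clog (lam b (g t) / lam a (g t))) < e.
Proof.
move=> H e0; have off t (t01 : 0 <= t <= 1) := (H t t01).1.
have [d d0 Hd] := clog_small e0.
have [K K0 HK] := pcont_lower (pcont_lam off) (fun t t01 => (H t t01).2).
have dK : 0 < d * K by rewrite mulr_gt0.
apply: near_mono2 (off_near H) (ud_near (ud_lam hm cg off) dK) => b Hb B; split=> // t t01.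
apply: Hd; have l0 := (H t t01).2.
have -> : lam b (g t) / lam a (g t) - 1 = (lam b (g t) - lam a (g t)) / lam a (g t).
  by rewrite mulrBl divff.
rewrite cabsM cabsV ltr_pdivrMr ?cabs_gt0//; apply: (lt_le_trans (B t t01)).
by rewrite ler_wpM2l ?HK// ltW.
Qed.

Lemma ratio_path a b : off_zeros_poles a -> off_zeros_poles b ->
  (forall t, 0 <= t <= 1 -> 0 < Re (lam b (g t) / lam a (g t))) ->
  pcont (fun t => clog (lam b (g t) / lam a (g t))).
Proof.
move=> Ha Hb Hr; have offa t (t01 : 0 <= t <= 1) := (Ha t t01).1.
have offb t (t01 : 0 <= t <= 1) := (Hb t t01).1.
have P := C1pathM (lam_path offb) (C1pathV (lam_path offa) (fun t t01 => (Ha t t01).2)).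
by have [] := C1path_clog P Hr.
Qed.

Lemma log_branch_pcont (U : set V) (L : V -> R -> C) a : log_branch U g L -> U a -> pcont (L a).
Proof. by move=> [_ H] Ua; have [cL _] := H a Ua; exact: within_continuous_pcont. Qed.

(** L b - L a - clog (lambda_b / lambda_a) is constant along the curve, since its exponential is 1.
    At t = 0 joint continuity makes this multiple of 2 pi i smaller than 2 pi, so it vanishes;
    uniformity in t then comes from the ratio. *)
Lemma log_branch_near (U : set V) (L : V -> R -> C) a (e : R) : open U ->
  (forall b, U b -> off_zeros_poles b) -> log_branch U g L -> U a -> 0 < e ->
  \forall b \near a, forall t, 0 <= t <= 1 -> cabs (L b t - L a t) < e.
Proof.
move=> oU HU HL Ua e0; have [/within_joint_continuous cL EL] := HL.
have pi0 := pi_gt0 R.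
pose e' := Num.min e pi; have e'0 : 0 < e' by rewrite lt_min e0.
have t00 : 0 <= (0 : R) <= 1 by rewrite lexx ler01.
have [d [d0 Hd]] := cL a 0 Ua t00 _ pi0.
have K1 : \forall b \near a, U b /\ cabs (L b 0 - L a 0) < pi.
  have := open_near oU Ua; have B : \forall b \near a, vabs (b - a) < d by apply/nbhs_vabs; exists d.
  move=> K; apply: near_mono2 K B => b Ub Hb; split=> //.
  by apply: Hd => //; rewrite subrr normr0.
apply: near_mono2 K1 (ratio_small (HU a Ua) e'0) => b [Ub B0] [Hb Hr].
pose D t := L b t - L a t - clog (lam b (g t) / lam a (g t)).
have cD : pcont D.
  apply: pcontD; last by apply: pcontN; apply: ratio_path; [exact: HU|exact: HU|move=> t /Hr[]].
  by apply: pcontD; [exact: log_branch_pcont HL Ub|apply: pcontN; exact: log_branch_pcont HL Ua].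
have eD t : 0 <= t <= 1 -> cexp (D t) = 1.
  move=> t01; rewrite /D !cexpB clogK ?(Hr t t01).1//.
  rewrite (EL b Ub).2// (EL a Ua).2// divff// mulf_neq0 ?invr_eq0 ?(HU b Ub t t01).2 ?(HU a Ua t t01).2//.
have PD := C1path_log (C1path_cst 1) cD eD.
have {PD} DC t : 0 <= t <= 1 -> D t = D 0.
  by apply: C1path_constant; apply: C1path_ext PD => // s _; rewrite mul0r.
have D0 : D 0 = 0.
  have [k kE] := cexp_eq1 (eD 0 t00).
  have : cabs (D 0) < 2 * pi.
    rewrite mulr_natl mulr2n; apply: (le_lt_trans (cabs_triangle _ _)); rewrite cabsN.
    apply: ltrD => //; apply: (lt_le_trans (Hr 0 t00).2); by rewrite /e' ge_min lexx orbT.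
  rewrite kE cabsM -[k%:~R](rmorph_int (real_complex R)) cabsR.
  have -> : cabs (two_pi_i R) = 2 * pi.
    by rewrite /cabs /two_pi_i /= expr0n add0r sqrtr_sqr ger0_norm// mulr_ge0// ltW.
  rewrite gtr_pMl ?mulr_gt0// -intr_norm -[1]/(1%:~R) ltr_int => k1.
  have -> : k = 0 by lia.
  by rewrite mul0r.
move=> t t01; have -> : L b t - L a t = clog (lam b (g t) / lam a (g t)).
  by have /eqP := DC t t01; rewrite D0 /D subr_eq0 => /eqP.
by apply: (lt_le_trans (Hr t t01).2); rewrite /e' ge_min lexx.
Qed.

Variable E : V -> V.
Hypothesis hE : toda_euler_field E.

(** The branch is a logarithm at a0 plus [clog] of lambda_b / lambda_{a0}. It closes up because the
    logarithm at a0 does, so the winding number stays 0 on the ball. *)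
Lemma ball_log_branch a0 (P : V -> Prop) : zero_winding a0 g -> (\forall b \near a0, P b) ->
  exists (d : R) (L : V -> R -> C), [/\ 0 < d, forall b, vball a0 d b -> P b,
    forall b, vball a0 d b -> zero_winding b g & log_branch (vball a0 d) g L].
Proof.
move=> Z0 HP; have [H0 _] := Z0.
have off0 t (t01 : 0 <= t <= 1) := (H0 t t01).1.
have [L0 PL0 EL0] := log_exists (lam_path off0) (fun t t01 => (H0 t t01).2).
have cL0 : pcont L0 by case: PL0.
have L01 : L0 0 = L0 1.
  have [_ W] := Z0; have := winding_log H0 cL0 EL0; rewrite W.
  by move/esym/eqP; rewrite mulf_eq0 invr_eq0 (negPf (two_pi_i_neq0 R)) subr_eq0 => /eqP.
have := near_mono2 (fun b => @conj _ _) HP (ratio_small H0 ltr01).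
move=> /nbhs_vabs[d d0 Hd].
pose q b t := lam b (g t) / lam a0 (g t).
pose L b t := L0 t + clog (q b t).
have offb b : vball a0 d b -> off_zeros_poles b by move=> /Hd[_ []].
have Req b t : vball a0 d b -> 0 <= t <= 1 -> 0 < Re (q b t).
  by move=> /Hd[_ [_ H]] /H[].
have cL b : vball a0 d b -> pcont (L b).
  move=> Bb; apply: pcontD => //; apply: ratio_path => // [|t]; [exact: offb|exact: Req].
have EL b t : vball a0 d b -> 0 <= t <= 1 -> cexp (L b t) = lam b (g t).
  move=> Bb t01; rewrite cexpD clogK ?Req// EL0// /q mulrC divfK//.
  by have [] := H0 t t01.
exists d, L; split; [exact: d0|by move=> b /Hd[]|move=> b Bb|].
  split; first exact: offb.
  rewrite (winding_log (offb b Bb) (cL b Bb) (fun t => EL b t Bb)).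
  by rewrite /L /q L01 -g01 subrr mulr0.
split.
  apply/within_joint_continuous => a t Ba t01 e e0; have e2 : 0 < e / 2 by rewrite divr_gt0.
  have Pq b : vball a0 d b -> pcont (q b).
    move=> Bb; apply: pcontM; first by apply: pcont_lam => s s01; have [] := offb b Bb s s01.
    by apply: pcontV => [|s s01]; [exact: pcont_lam|have [] := H0 s s01].
  have qn s : 0 <= s <= 1 -> q a s != 0.
    by move=> s01; apply: Re_gt0_neq0; exact: Req.
  have [K K0 HK] := pcont_lower (Pq a Ba) qn.
  have [d1 d10 H1] := clog_cont K0 e2.
  have offa s (s01 : 0 <= s <= 1) := (offb a Ba s s01).1.
  have cl0 := pcont_lam off0.
  have cl0V : pcont (fun s => (lam a0 (g s))^-1) by apply: pcontV => // s s01; have [] := H0 s s01.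
  have Uq := udM (pcont_lam offa) cl0V (ud_lam hm cg offa) (ud_cst _ a).
  have [d2 d20 H2] := (nbhs_vabs a _).1 (ud_near Uq d10).
  have [d3 d30 H3] := cL a Ba t t01 _ e2.
  exists (Num.min d2 d3); split; first by rewrite lt_min d20.
  move=> b s Bb s01; rewrite !lt_min => /andP[ba _] /andP[_ st].
  have -> : L b s - L a t = (clog (q b s) - clog (q a s)) + (L a s - L a t).
    have aux (x y z w : C) : x + y - w = (y - z) + (x + z - w) by ring.
    exact: aux.
  apply: (le_lt_trans (cabs_triangle _ _)); rewrite [e]splitr; apply: ltrD; last exact: H3.
  by apply: H1; [exact: Req|exact: Req|exact: HK|exact: H2].
move=> b Bb; split; last by move=> t; exact: EL.
have /pcontP[K1 K2] := cL b Bb.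
have H : forall x, (`[0, 1]%classic : set R) x -> forall e : R, 0 < e ->
    exists2 dd : R, 0 < dd & forall y, (`[0, 1]%classic : set R) y -> `|y - x| < dd -> cabs (L b y - L b x) < e.
  move=> x; rewrite /= in_itv /= => x01 e e0; have [dd dd0 Hdd] := cL b Bb x x01 e e0.
  by exists dd => // y; rewrite in_itv /= => y01; exact: Hdd.
apply/subspace_continuousP => x x01; apply/cvgrPdist_lt => /= e e0.
have [e' e'0 ->] := posc_real e0; have [dd dd0 Hdd] := H x x01 e' e'0.
rewrite near_withinE; apply/nbhs_ballP; exists dd => //= y; rewrite /ball /= => xy y01.
by rewrite normr_ltc cabs_distC; apply: Hdd => //; rewrite distrC.
Qed.

Lemma dual_near a0 : toda_dual_manifold E a0 -> \forall b \near a0, toda_dual_manifold E b.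
Proof.
move=> Da; have [U [z [oU Ua UM HU sz]]] := dual_local hm hn hE Da.
have RD b : U b -> _ := root_functions_data hm hn UM (fun b Ub => (HU b Ub).1) (fun b Ub => (HU b Ub).2) (a := b).
apply: near_mono2 (open_near oU Ua) (open_near oU Ua) => b Ub _.
exact: (root_data_dual hm hn hE (UM b Ub) (RD b Ub)).
Qed.

End TodaCurves.

(** * Flat coordinates *)

Section BraidSymmetry.
Variables (K : numFieldType) (N : nat).
Implicit Types (i j k l q r s : 'I_N).

(** Alternating the two symmetries six times returns the same triple of indices after three changes
    of sign, as in the uniqueness of the Levi-Civita connection. *)
Lemma antisym_sym_eq0 (D : 'I_N -> 'I_N -> 'I_N -> K) :
  (forall i j l, D i j l = - D j i l) -> (forall i j l, D i j l = D i l j) ->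
  forall i j l, D i j l = 0.
Proof.
move=> A S i j l; have E : D i j l = - D i j l.
  by rewrite {1}S A S A opprK S A.
have : D i j l *+ 2 = 0 by rewrite mulr2n {1}E addNr.
by move/eqP; rewrite mulrn_eq0 => /eqP.
Qed.

(* The components of the coframe derivatives are antisymmetric in the first
   pair of indices and symmetric in the second pair. *)
Lemma coframe_constant (dY : 'I_N -> 'M[K]_N) (Y J H : 'M[K]_N) :
  J \in unitmx -> Y \in unitmx -> H \in unitmx -> H^T = H ->
  (forall i q l, (dY q *m J) i l = (dY l *m J) i q) ->
  (forall q, dY q *m H *m Y^T + Y *m H *m (dY q)^T = 0) ->
  forall q, dY q = 0.
Proof.
move=> UJ UY UH HT S A.
(* [B s] is the derivative of Y along the s-th vector of the frame dual to the rows of J. *)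
pose Ji := invmx J; pose B s : 'M[K]_N := \sum_q Ji q s *: dY q.
have dYB q : dY q = \sum_s J s q *: B s.
  rewrite /B; under eq_bigr do rewrite scaler_sumr.
  rewrite exchange_big /= (bigD1 q)//= [X in _ + X]big1 ?addr0 => [|l lq].
    have -> : \sum_s J s q *: (Ji q s *: dY q) = (Ji *m J) q q *: dY q.
      by rewrite mxE scaler_suml; apply: eq_bigr => s _; rewrite scalerA mulrC.
    by rewrite mulVmx// mxE eqxx scale1r.
  have -> : \sum_s J s q *: (Ji l s *: dY l) = (Ji *m J) l q *: dY l.
    by rewrite mxE scaler_suml; apply: eq_bigr => s _; rewrite scalerA mulrC.
  by rewrite mulVmx// mxE (negPf lq) scale0r.
have BS i r s : B s i r = B r i s.
  have E s0 r0 : B s0 i r0 = \sum_q \sum_l Ji q s0 * Ji l r0 * (dY q *m J) i l.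
    rewrite /B summxE; apply: eq_bigr => q _; rewrite mxE -{1}[dY q](mulmxK UJ) mxE mulr_sumr.
    by apply: eq_bigr => l _; rewrite -/Ji mulrCA mulrC -!mulrA; congr (_ * _); exact: mulrC.
  rewrite E E exchange_big /=; apply: eq_bigr => l _; apply: eq_bigr => q _.
  by rewrite S; congr (_ * _); exact: mulrC.
have BA s : B s *m H *m Y^T + Y *m H *m (B s)^T = 0.
  have -> : (B s)^T = \sum_q Ji q s *: (dY q)^T.
    by apply/matrixP => i j; rewrite /B mxE !summxE; apply: eq_bigr => q _; rewrite !mxE.
  rewrite /B !mulmx_suml mulmx_sumr -big_split big1//= => q _.
  by rewrite -!scalemxAl -scalemxAr -scalerDr A scaler0.
pose P := H *m Y^T; have UP : P \in unitmx by rewrite unitmx_mul UH unitmx_tr.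
(* With all indices referred to the coframe Y, constancy of the Gram matrix is antisymmetry in i, j,
   and closedness is symmetry in j, l. *)
pose D i j l := \sum_s P s l * (B s *m P) i j.
have D0 : forall i j l, D i j l = 0.
  apply: antisym_sym_eq0 => i j l.
    rewrite /D -sumrN; apply: eq_bigr => s _; rewrite -mulrN; congr (_ * _).
    have := congr1 (fun M : 'M[K]_N => M i j) (BA s); rewrite mxE [RHS]mxE -mulmxA -/P.
    move=> /eqP; rewrite addr_eq0 => /eqP ->; congr (- _).
    have -> : Y *m H *m (B s)^T = (B s *m P)^T by rewrite /P !trmx_mul trmxK HT.
    by rewrite mxE.
  rewrite /D.
  have E j0 l0 : \sum_s P s l0 * (B s *m P) i j0 = \sum_s \sum_r P s l0 * P r j0 * B s i r.
    apply: eq_bigr => s _; rewrite [(B s *m P) i j0]mxE mulr_sumr; apply: eq_bigr => r _.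
    by rewrite -mulrA; congr (_ * _); exact: mulrC.
  rewrite !E exchange_big /=; apply: eq_bigr => r _; apply: eq_bigr => s _.
  by rewrite BS; congr (_ * _); exact: mulrC.
have BP s : B s *m P = 0.
  apply/matrixP => i j; rewrite [RHS]mxE.
  have : \sum_l D i j l * invmx P l s = (B s *m P) i j.
    rewrite /D; under eq_bigr do rewrite mulr_suml.
    rewrite exchange_big /= (bigD1 s)//= [X in _ + X]big1 ?addr0 => [|s' ss].
      have -> : \sum_l P s l * (B s *m P) i j * invmx P l s = (P *m invmx P) s s * (B s *m P) i j.
        by rewrite [(P *m invmx P) _ _]mxE mulr_suml; apply: eq_bigr => l _; rewrite mulrAC.
      by rewrite mulmxV// mxE eqxx mul1r.
    have -> : \sum_l P s' l * (B s' *m P) i j * invmx P l s = (P *m invmx P) s' s * (B s' *m P) i j.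
      by rewrite [(P *m invmx P) _ _]mxE mulr_suml; apply: eq_bigr => l _; rewrite mulrAC.
    by rewrite mulmxV// mxE (negPf ss) mul0r.
  by move=> <-; rewrite big1// => l _; rewrite D0 mul0r.
have B0 s : B s = 0 by rewrite -[B s](mulmxK UP) BP mul0mx.
by move=> q; rewrite dYB big1// => s _; rewrite B0 scaler0.
Qed.

End BraidSymmetry.

(** * Partial derivatives of smooth functions *)

Section Partials.
Variables (R : realType) (N : nat).
Local Notation C := R[i].
Local Notation V := 'rV[C]_N.
Implicit Types (a b v : V) (f : V -> C).
Variable U : set V.
Hypothesis oU : open U.

Definition partial l f a : C := 'D_(delta_mx 0 l) f a.

Lemma sum_delta (l : 'I_N) (c : 'I_N -> C) : \sum_k (delta_mx 0 l : V) 0 k * c k = c l.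
Proof.
rewrite (bigD1 l)//= big1 => [|k kl]; first by rewrite mxE !eqxx mul1r addr0.
by rewrite mxE (negPf kl) andbF mul0r.
Qed.

Lemma derive_ud f a c v : ud (fun b _ => f b) a (fun k _ => c k) -> 'D_v f a = \sum_k v 0 k * c k.
Proof. by move=> H; have [_ ->] := ud_differentiable H. Qed.

Lemma partial_ud f a c l : ud (fun b _ => f b) a (fun k _ => c k) -> partial l f a = c l.
Proof. by move=> H; rewrite /partial (derive_ud _ H) sum_delta. Qed.

Definition all_smooth f := forall n, smooth n U (fun a _ => f a).

Lemma smooth_partial l f : all_smooth f -> all_smooth (partial l f).
Proof.
move=> H n; have [d [S D _ _]] := smooth_derive (H n.+1).
apply: smooth_ext (S l) => // a t Ua _; by rewrite (partial_ud _ (D a Ua)).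
Qed.

Lemma ud_partial f a : all_smooth f -> U a -> ud (fun b _ => f b) a (fun k _ => partial k f a).
Proof.
move=> H Ua; have [d [_ D _ _]] := smooth_derive (H 1).
by apply: ud_eq (D a Ua) => // k _; rewrite (partial_ud _ (D a Ua)).
Qed.

Lemma derive_partial f a v : all_smooth f -> U a -> 'D_v f a = \sum_k v 0 k * partial k f a.
Proof. by move=> H Ua; apply: derive_ud; exact: ud_partial. Qed.

Lemma partialC f a k l : all_smooth f -> U a -> partial k (partial l f) a = partial l (partial k f) a.
Proof.
move=> H Ua; apply: (Clairaut oU Ua (f := f) (c := fun k b => partial k f b)
  (cc := fun i j => partial j (partial i f) a)) => [b Ub|i]; first exact: ud_partial.
by apply: ud_partial => //; exact: smooth_partial.
Qed.

Lemma smooth_prod n (I : Type) (s : seq I) (F : I -> V -> R -> C) :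
  (forall i, smooth n U (F i)) -> smooth n U (fun a t => \prod_(i <- s) F i a t).
Proof.
move=> H; elim: s => [|i s IH].
  have -> : (fun a t => \prod_(i <- [::]) F i a t) = (fun _ _ => 1).
    by apply/funext => a; apply/funext => t; rewrite big_nil.
  exact: (smooth_cst n U (pcont_cst 1)).
have -> : (fun a t => \prod_(i <- i :: s) F i a t) = (fun a t => F i a t * \prod_(i <- s) F i a t).
  by apply/funext => a; apply/funext => t; rewrite big_cons.
exact: smoothM.
Qed.

Lemma smooth_det k (A : V -> 'M[C]_k) : (forall i j, all_smooth (fun a => A a i j)) ->
  all_smooth (fun a => \det (A a)).
Proof.
move=> H n; rewrite /determinant; apply: smooth_sum => // s; apply: smoothZ.
by apply: smooth_prod => i; exact: H.
Qed.

Lemma smooth_invmx (A : V -> 'M[C]_N) : (forall i j, all_smooth (fun a => A a i j)) ->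
  (forall a, U a -> A a \in unitmx) -> forall i j, all_smooth (fun a => invmx (A a) i j).
Proof.
move=> H UA i j n.
apply: (@smooth_ext _ _ n U (fun a _ => (\det (A a))^-1 * ((-1) ^+ (j + i) * \det (row' j (col' i (A a)))))) => //.
  by move=> a t Ua _; rewrite /invmx UA// !mxE.
apply: smoothM.
  apply: smoothV => // [a t Ua _|]; last exact: smooth_det.
  by have := UA a Ua; rewrite unitmxE unitfE.
apply: smoothZ; apply: smooth_det => k l n'.
have -> : (fun (a : V) (_ : R) => row' j (col' i (A a)) k l) = (fun a _ => A a (lift j k) (lift i l)).
  by apply/funext => a; apply/funext => t; rewrite !mxE.
exact: H.
Qed.

Lemma smooth_mulmx (A B : V -> 'M[C]_N) : (forall i j, all_smooth (fun a => A a i j)) ->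
  (forall i j, all_smooth (fun a => B a i j)) -> forall i j, all_smooth (fun a => (A a *m B a) i j).
Proof.
move=> HA HB i j n.
have -> : (fun (a : V) (_ : R) => (A a *m B a) i j) = (fun a _ => \sum_k A a i k * B a k j).
  by apply/funext => a; apply/funext => t; rewrite mxE.
by apply: smooth_sum => // k; apply: smoothM; [exact: HA|exact: HB].
Qed.

End Partials.

Section BallConnected.
Variables (R : realType) (N : nat).
Local Notation C := R[i].
Local Notation V := 'rV[C]_N.

Lemma segment_continuous (a v : V) : continuous (fun s : R => a + s%:C *: v).
Proof.
move=> s A /= /nbhs_vabs[d d0 H]; have v0 := vabs_ge0 v.
have d1 : 0 < d / (vabs v + 1) by rewrite divr_gt0// ltr_wpDl.
apply/nbhs_ballP; exists (d / (vabs v + 1)) => //= x; rewrite /ball /= distrC => xs.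
apply: H; have -> : a + x%:C *: v - (a + s%:C *: v) = (x - s)%:C *: v.
  by rewrite rmorphB scalerBl opprD addrACA subrr add0r.
rewrite vabsZ cabsR; move: xs; rewrite ltr_pdivlMr ?ltr_wpDl// => xs; apply: le_lt_trans xs.
by rewrite ler_wpM2l// lerDl.
Qed.

Lemma vball_connected (a : V) (d : R) : 0 < d -> connected (vball a d).
Proof.
move=> d0; pose seg (b : V) : set V := (fun s : R => a + s%:C *: (b - a)) @` `[0, 1]%classic.
have -> : vball a d = \bigcup_(b in vball a d) seg b.
  apply/seteqP; split=> [b Hb|x [b Hb [s]]].
    exists b => //; exists 1; first by rewrite /= in_itv /= ler01 lexx.
    by rewrite rmorph1 scale1r addrC subrK.
  rewrite /= in_itv /= => /andP[s0 s1] <-; rewrite /vball /= addrC addKr vabsZ cabsR ger0_norm//.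
  by apply: le_lt_trans Hb; rewrite ler_piMl// vabs_ge0.
apply: bigcup_connected.
  exists a => b _; exists 0; first by rewrite /= in_itv /= lexx ler01.
  by rewrite rmorph0 scale0r addr0.
move=> b _; apply: connected_continuous_connected; first exact: segment_connected.
by apply: continuous_subspaceT; exact: segment_continuous.
Qed.

End BallConnected.

Section PartialRules.
Variables (R : realType) (N : nat).
Local Notation C := R[i].
Local Notation V := 'rV[C]_N.
Implicit Types (a b v : V) (f h : V -> C).
Variable U : set V.
Hypothesis oU : open U.
Local Notation all_smooth := (all_smooth U).

Lemma partial_eq f h a l : (forall b, U b -> f b = h b) -> all_smooth f -> U a ->
  partial l f a = partial l h a.
Proof.
move=> E Sf Ua; symmetry; apply: (partial_ud (c := fun k => partial k f a)).
apply: (ud_ext _ _ (ud_partial Sf Ua)) => //.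
by apply: near_mono2 (open_near oU Ua) (open_near oU Ua) => b Ub _ t _; exact: E.
Qed.

Lemma partialM f h a l : all_smooth f -> all_smooth h -> U a ->
  partial l (fun b => f b * h b) a = f a * partial l h a + partial l f a * h a.
Proof.
move=> Sf Sh Ua; apply: (partial_ud (c := fun l => f a * partial l h a + partial l f a * h a)).
exact: (udM (pcont_cst (f a)) (pcont_cst (h a)) (ud_partial Sf Ua) (ud_partial Sh Ua)).
Qed.

Lemma partial_sum (I : finType) (F : I -> V -> C) a l : (forall i, all_smooth (F i)) -> U a ->
  partial l (fun b => \sum_i F i b) a = \sum_i partial l (F i) a.
Proof.
move=> SF Ua; apply: (partial_ud (c := fun l => \sum_i partial l (F i) a)).
by apply: ud_sum_seq => i _; exact: (ud_partial (SF i) Ua).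
Qed.

Lemma partial_cst (c : C) a l : partial l (fun=> c) a = 0.
Proof. exact: (partial_ud (c := fun=> 0)) (ud_cst (fun=> c) a). Qed.

Lemma all_smooth_cst (c : C) : all_smooth (fun=> c).
Proof. by move=> n; exact: (smooth_cst n U (pcont_cst c)). Qed.

Lemma all_smoothM f h : all_smooth f -> all_smooth h -> all_smooth (fun b => f b * h b).
Proof. by move=> Sf Sh n; apply: smoothM; [exact: Sf|exact: Sh]. Qed.

Lemma all_smooth_sum (I : finType) (F : I -> V -> C) : (forall i, all_smooth (F i)) ->
  all_smooth (fun b => \sum_i F i b).
Proof. by move=> SF n; apply: smooth_sum => // i; exact: SF. Qed.

Lemma all_smoothV f : (forall a, U a -> f a != 0) -> all_smooth f -> all_smooth (fun b => (f b)^-1).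
Proof. by move=> f0 Sf n; apply: smoothV => // a t Ua _; exact: f0. Qed.

Lemma partialV f a l : all_smooth f -> U a -> f a != 0 ->
  partial l (fun b => (f b)^-1) a = - partial l f a / f a ^+ 2.
Proof.
move=> Sf Ua f0; apply: (partial_ud (c := fun l => - partial l f a / f a ^+ 2)).
exact: (udV (pcont_cst (f a)) (fun _ _ => f0) (ud_partial Sf Ua)).
Qed.

Lemma partial0_constant f : connected U -> all_smooth f -> (forall a l, U a -> partial l f a = 0) ->
  forall a b, U a -> U b -> f a = f b.
Proof.
move=> cU Sf H; apply: derivative0_constant => // a Ua.
by apply: ud_eq (ud_partial Sf Ua) => // k _; rewrite H.
Qed.

End PartialRules.

(** * Flat coordinates against the coframe d log rho *)

Section FlatFrame.
Variables (R : realType) (m : nat) (n : nat -> nat).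
Hypotheses (hm : (0 < m)%N) (hn : forall i : nat, (i <= m)%N -> (0 < n i)%N).
Local Notation C := R[i].
Local Notation N := (toda_dim m n).
Local Notation V := 'rV[C]_N.
Local Notation Mt := (@toda_manifold R m n).
Local Notation n0 := ((n 0)%:R : C).
Local Notation n1 := ((n 1)%:R : C).
Implicit Types (a b u : V).
Variables (e E : V -> V).
Hypotheses (he : toda_unit_field e) (hE : toda_euler_field E).
Local Notation eps := (sign_vector R hm).

Definition gram : 'M[C]_N := \matrix_(r, s) (n0^-1 - (r == s)%:R / eps r).

Lemma gram_sym : gram^T = gram.
Proof.
apply/matrixP => r s; rewrite !mxE; have [->//|rs] := eqVneq r s.
by rewrite !mul0r.
Qed.

Lemma sum_gram (c c' : 'I_N -> C) :
  - (\sum_k c k * c' k / eps k) + n0^-1 * (\sum_k c k) * (\sum_k c' k) =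
  \sum_r \sum_s c r * gram r s * c' s.
Proof.
have -> : n0^-1 * (\sum_k c k) * (\sum_k c' k) = \sum_r \sum_s c r * n0^-1 * c' s.
  rewrite -mulrA mulr_suml mulr_sumr; apply: eq_bigr => r _; rewrite !mulr_sumr.
  by apply: eq_bigr => s _; rewrite mulrCA mulrA.
rewrite addrC -sumrN -big_split; apply: eq_bigr => r _ /=.
have -> : c r * c' r / eps r = \sum_s c r * ((r == s)%:R / eps r) * c' s.
  rewrite (bigD1 r)//= big1 ?addr0 => [|s sr]; first by rewrite eqxx mul1r mulrAC.
  by rewrite eq_sym (negPf sr) !mul0r mulr0 mul0r.
by rewrite -sumrB; apply: eq_bigr => s _; rewrite mxE; ring.
Qed.

Section Chart.
Variables (U : set V) (z : 'I_(deg_zeros m n) -> V -> C).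
Hypotheses (oU : open U) (UM : U `<=` Mt).
Hypotheses (zinj : forall a, U a -> injective (z^~ a)).
Hypotheses (EA : forall a, U a -> lamA a = n0^-1 *: \prod_j ('X - (z j a)%:P)).
Hypotheses (sz : forall j l, smooth l U (fun a _ => z j a)).
Local Notation rho a := (root_vector hm (z^~ a) a).
Local Notation all_smooth := (all_smooth U).

Let RD a (Ua : U a) := root_functions_data hm hn UM zinj EA Ua.
Let n00 := n0_neq0 R hn.

(** A vector of the kernel is proportional to [eps]. Summing its entries with sum eps = n_0 + n_1
    forces the factor to be 0, because n_1 is not. *)
Lemma gram_unit a : U a -> gram \in unitmx.
Proof.
move=> Ua; have Ma := UM Ua; have [_ _ en _] := RD Ua.
have n10 : n1 != 0 by rewrite pnatr_eq0 -lt0n hn.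
apply: injective_unitmx => u H.
have key s : u 0 s = n0^-1 * (\sum_r u 0 r) * eps s.
  have := congr1 (fun w : V => w 0 s) H; rewrite !mxE.
  have -> : \sum_j u 0 j * gram j s = n0^-1 * (\sum_r u 0 r) - u 0 s / eps s.
    rewrite mulr_sumr; under eq_bigr do rewrite mxE mulrBr.
    rewrite sumrB; congr (_ - _); first by apply: eq_bigr => j _; exact: mulrC.
    rewrite (bigD1 s)//= big1 ?addr0 => [|j js]; first by rewrite eqxx mul1r.
    by rewrite (negPf js) mul0r mulr0.
  by move/eqP; rewrite subr_eq0 => /eqP ->; rewrite divfK.
have : \sum_r u 0 r = 0.
  have se := sum_e (monic_lamW hm hn a) (size_lamW hm hn a) n00 (lamW0 hm a) (lamS0 hm hn Ma) (RD Ua).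
  have : \sum_r u 0 r = n0^-1 * (\sum_r u 0 r) * (n0 + n1).
    by rewrite {1}(eq_bigr _ (fun s _ => key s)) -mulr_sumr se.
  set S := \sum_r _ => ES; have : n0^-1 * S * n1 = 0.
    have -> : n0^-1 * S * n1 = n0^-1 * S * (n0 + n1) - S by field.
    by rewrite -ES subrr.
  by move/eqP; rewrite !mulf_eq0 invr_eq0 (negPf n00) (negPf n10) orbF => /eqP.
by move=> S0; apply/rowP => s; rewrite key S0 mulr0 mul0r mxE.
Qed.

(** The rows are the components of the one-forms d log rho_r ([frame_partial]). *)
Definition frame_mx a : 'M[C]_N := \matrix_(r, l) tell a (rho a) eps (delta_mx 0 l) r.

Lemma tell_frame a u r : U a -> tell a (rho a) eps u r = \sum_l u 0 l * frame_mx a r l.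
Proof.
move=> Ua; rewrite (linear_row_sum (f := fun u => tell a (rho a) eps u r)) => [|c v w].
  by apply: eq_bigr => l _; rewrite mxE.
exact: tell_linear.
Qed.

Lemma frame_unit a : U a -> frame_mx a \in unitmx.
Proof.
move=> Ua; rewrite -unitmx_tr; apply: injective_unitmx => u H.
apply: (tell_inj hm hn (UM Ua) (RD Ua)) => r; rewrite tell_frame//.
transitivity ((u *m (frame_mx a)^T) 0 r); last by rewrite H mxE.
by rewrite mxE; apply: eq_bigr => l _; rewrite [in RHS]mxE.
Qed.

Lemma rho_n0 a r : U a -> rho a r != 0.
Proof. by move=> Ua; exact: (rho_neq0 n00 (lamS0 hm hn (UM Ua)) (RD Ua)). Qed.

Lemma smooth_rho r : all_smooth (fun a => rho a r).
Proof. by move=> l; exact: smooth_root_functions. Qed.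

Lemma frame_partial a r l : U a -> frame_mx a r l = partial l (fun b => rho b r) a * (rho a r)^-1.
Proof.
move=> Ua; rewrite mxE /partial (derive_root_functions hm hn oU UM zinj EA sz)//.
by rewrite mulrAC divff ?rho_n0// mul1r.
Qed.

Lemma smooth_frame r l : all_smooth (fun a => frame_mx a r l).
Proof.
move=> k; apply: (@smooth_ext _ _ k U (fun a _ => partial l (fun b => rho b r) a * (rho a r)^-1)) => //.
  by move=> a t Ua _; rewrite frame_partial.
apply: smoothM; first exact: (smooth_partial oU l (smooth_rho r)).
by apply: (all_smoothV oU) => [b Ub|]; [exact: rho_n0|exact: smooth_rho].
Qed.

(** The one-forms d log rho_r are closed. *)
Lemma frame_symmetric a r q l : U a ->
  partial q (fun b => frame_mx b r l) a = partial l (fun b => frame_mx b r q) a.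
Proof.
move=> Ua; have S1 k := smooth_partial oU k (smooth_rho r).
have S2 : all_smooth (fun a => (rho a r)^-1).
  by apply: (all_smoothV oU) => [b Ub|]; [exact: rho_n0|exact: smooth_rho].
have E1 k k' : partial k (fun b => frame_mx b r k') a =
    partial k' (fun b => rho b r) a * (- partial k (fun b => rho b r) a / rho a r ^+ 2) +
    partial k (partial k' (fun b => rho b r)) a * (rho a r)^-1.
  rewrite (partial_eq oU (h := fun b => partial k' (fun b => rho b r) b * (rho b r)^-1)) => //.
  - by rewrite (partialM _ (S1 k') S2)// (partialV _ (smooth_rho r))// rho_n0.
  - by move=> b Ub; rewrite frame_partial.
  - exact: smooth_frame.
have aux (x y d1 d2 p w f1 f2 : C) : f1 = y * (- x / p) + d1 * w -> f2 = x * (- y / p) + d2 * w ->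
    d1 = d2 -> f1 = f2.
  by move=> -> -> ->; ring.
exact: (aux _ _ _ _ _ _ _ _ (E1 q l) (E1 l q) (partialC oU q l (smooth_rho r) Ua)).
Qed.

Section Coordinates.
Variables (t : 'I_N -> V -> C) (G : 'M[C]_N).
Hypotheses (cU : connected U) (St : forall i, all_smooth (t i)).
Hypotheses (Ut : forall a, U a -> jac_mx t a \in unitmx).
Hypothesis Gt : forall a i j, U a ->
  toda_dual_form E a (differential (t i) a) (differential (t j) a) = G i j.

(** The components of the differentials dt^i in the coframe d log rho_r. *)
Definition coframe_mx a : 'M[C]_N := jac_mx t a *m invmx (frame_mx a).

Let smooth_jac i l : all_smooth (fun a => jac_mx t a i l).
Proof.
have -> : (fun a => jac_mx t a i l) = partial l (t i).
  by apply/funext => a; rewrite !mxE.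
exact: smooth_partial.
Qed.

Lemma smooth_coframe i r : all_smooth (fun a => coframe_mx a i r).
Proof.
apply: smooth_mulmx => //; apply: smooth_invmx => // [k l|a]; first exact: smooth_frame.
exact: frame_unit.
Qed.

Lemma coframe_frame a : U a -> coframe_mx a *m frame_mx a = jac_mx t a.
Proof. by move=> Ua; rewrite mulmxKV// frame_unit. Qed.

Lemma coframe_unit a : U a -> coframe_mx a \in unitmx.
Proof. by move=> Ua; rewrite unitmx_mul unitmx_inv frame_unit// Ut. Qed.

Lemma differential_coframe a i u : U a ->
  (differential (t i) a *m u^T) 0 0 = \sum_r coframe_mx a i r * tell a (rho a) eps u r.
Proof.
move=> Ua; rewrite mxE; have E1 l : differential (t i) a 0 l = \sum_r coframe_mx a i r * frame_mx a r l.
  have := congr1 (fun M : 'M[C]_N => M i l) (coframe_frame Ua); rewrite mxE => ->.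
  by rewrite [in RHS]mxE.
under eq_bigr do rewrite E1 mulr_suml.
rewrite exchange_big /=; apply: eq_bigr => r _; rewrite tell_frame// mulr_sumr.
by apply: eq_bigr => l _; rewrite [u^T _ _]mxE -mulrA; congr (_ * _); exact: mulrC.
Qed.

Lemma coframe_gram a i j : U a -> \sum_r \sum_s coframe_mx a i r * gram r s * coframe_mx a j s = G i j.
Proof.
move=> Ua; rewrite -(Gt i j Ua) -sum_gram.
by rewrite (dual_form_roots hm hn hE (UM Ua) (RD Ua) (fun y => differential_coframe i y Ua)
  (fun y => differential_coframe j y Ua)).
Qed.

(** Both coframes are closed and both have constant Gram matrices, which are the two hypotheses of
    [coframe_constant]; connectedness of the domain does the rest. *)
Lemma coframe_locally_constant a b : U a -> U b -> coframe_mx a = coframe_mx b.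
Proof.
move=> Ua Ub; apply/matrixP => i r.
apply: (partial0_constant oU cU (smooth_coframe i r)) => // {Ub}b q Ub; clear a Ua.
pose dY q : 'M[C]_N := \matrix_(i, r) partial q (fun a => coframe_mx a i r) b.
suff : dY q = 0 by move/matrixP/(_ i r); rewrite !mxE.
apply: (coframe_constant (frame_unit Ub) (coframe_unit Ub) (gram_unit Ub) gram_sym) => [{}i k l|k].
  (* In mixed second derivatives of t^i the terms with derivatives of d log rho_s are symmetric and
     cancel, which leaves the symmetry of the derivatives of the components. *)
  have E1 k' l' : partial k' (partial l' (t i)) b =
     \sum_s coframe_mx b i s * partial k' (fun a => frame_mx a s l') b + (dY k' *m frame_mx b) i l'.
    rewrite (partial_eq oU (h := fun a => \sum_s coframe_mx a i s * frame_mx a s l')) => //.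
    - rewrite (partial_sum (U := U)) => // [|s]; last first.
        by apply: all_smoothM; [exact: smooth_coframe|exact: smooth_frame].
      rewrite [X in _ = _ + X]mxE -big_split; apply: eq_bigr => s _ /=.
      by rewrite (partialM _ (smooth_coframe i s) (smooth_frame s l'))// [dY k' i s]mxE.
    - move=> a Ua; have := congr1 (fun M : 'M[C]_N => M i l') (coframe_frame Ua).
      by rewrite [X in X = _ -> _]mxE => ->; rewrite !mxE.
    - exact: smooth_partial.
  have := partialC oU k l (St i) Ub; rewrite !E1 => H.
  have E2 : \sum_s coframe_mx b i s * partial k (fun a => frame_mx a s l) b =
     \sum_s coframe_mx b i s * partial l (fun a => frame_mx a s k) b.
    by apply: eq_bigr => s _; rewrite frame_symmetric.
  have aux (x y w v : C) : x + w = y + v -> x = y -> w = v by move=> + xy; rewrite xy => /addrI.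
  exact: aux H E2.
apply/matrixP => i' j'; rewrite [RHS]mxE mxE.
have SF (i1 i2 s1 s2 : 'I_N) : all_smooth (fun a => coframe_mx a i1 s1 * gram s1 s2 * coframe_mx a i2 s2).
  apply: all_smoothM; last exact: smooth_coframe.
  by apply: all_smoothM; [exact: smooth_coframe|exact: all_smooth_cst].
(* The constant Gram matrix of the dt^i is differentiated. *)
have := partial_eq oU (h := fun=> G i' j') k (fun a Ua => coframe_gram i' j' Ua)
  (all_smooth_sum oU (fun s1 => all_smooth_sum oU (SF i' j' s1))) Ub.
rewrite partial_cst => H.
rewrite -[RHS]H (partial_sum (U := U)) => // [|s1]; last exact: (all_smooth_sum oU (SF i' j' s1)).
have -> : (dY k *m gram *m (coframe_mx b)^T) i' j' =
    \sum_r \sum_s dY k i' r * gram r s * coframe_mx b j' s.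
  rewrite mxE exchange_big /=; apply: eq_bigr => s _; rewrite mxE mulr_suml.
  by apply: eq_bigr => r' _; rewrite [_^T _ _]mxE.
have -> : (coframe_mx b *m gram *m (dY k)^T) i' j' =
    \sum_r \sum_s coframe_mx b i' r * gram r s * dY k j' s.
  rewrite mxE exchange_big /=; apply: eq_bigr => s _; rewrite mxE mulr_suml.
  by apply: eq_bigr => r' _; rewrite [_^T _ _]mxE.
rewrite -big_split; apply: eq_bigr => s1 _ /=; rewrite (partial_sum (U := U)) => //.
rewrite -big_split; apply: eq_bigr => s2 _ /=.
rewrite (partialM _ _ (smooth_coframe j' s2))//; last first.
  by apply: all_smoothM; [exact: smooth_coframe|exact: all_smooth_cst].
rewrite (partialM _ (smooth_coframe i' s1) (all_smooth_cst U (gram s1 s2)))// partial_cst mulr0 add0r.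
by rewrite addrC [dY k i' s1]mxE [dY k j' s2]mxE.
Qed.

Lemma coord_field_tell a b k r : U a -> U b ->
  tell b (rho b) eps (coord_field t k b) r = invmx (coframe_mx a) r k.
Proof.
move=> Ua Ub; rewrite (coframe_locally_constant Ua Ub).
pose Mb : 'M[C]_N := \matrix_(r, k) tell b (rho b) eps (coord_field t k b) r.
suff YM : coframe_mx b *m Mb = 1%:M.
  have := mulKmx (coframe_unit Ub) Mb; rewrite YM mulmx1 => E'.
  by rewrite E' mxE.
apply/matrixP => i j; rewrite !mxE.
have := differential_coframe i (coord_field t j b) Ub.
have -> : (differential (t i) b *m (coord_field t j b)^T) 0 0 = (i == j)%:R.
  have <- : (jac_mx t b *m invmx (jac_mx t b)) i j = (i == j)%:R by rewrite mulmxV ?Ut// mxE.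
  rewrite mxE [RHS]mxE; apply: eq_bigr => l _; congr (_ * _); first by rewrite [in RHS]mxE.
  by rewrite /coord_field trmxK mxE.
by move=> ->; apply: eq_bigr => s _; rewrite [Mb s j]mxE.
Qed.

End Coordinates.
End Chart.
End FlatFrame.

(** * The recursion *)

Section IntegralDerivatives.
Variables (R : realType) (N : nat).
Local Notation C := R[i].
Local Notation V := 'rV[C]_N.
Implicit Types (a b u : V).

Lemma smooth_empty n (U : set V) (h : V -> R -> C) : (forall a, ~ U a) -> smooth n U h.
Proof.
move=> U0; elim: n h => [|n IH] h; first by split=> // a /U0.
split=> [a /U0 //|]; exists (fun _ => h); split=> [a /U0 //|k]; exact: IH.
Qed.

Lemma derive_cint (h : V -> R -> C) a (c : 'I_N -> R -> C) (x : C) u :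
  (\forall b \near a, pcont (h b)) -> (forall k, pcont (c k)) -> ud h a c ->
  'D_u (fun b => x * cint (h b)) a = x * cint (fun s => \sum_k u 0 k * c k s).
Proof.
move=> ch cc uh; have := udM (pcont_cst x) (pcont_cst (cint (h a))) (ud_cst (fun=> x) a) (ud_cint ch cc uh).
move/derive_ud => ->; rewrite cint_sum => [|k _]; last by apply: pcontM => //; exact: pcont_cst.
rewrite mulr_sumr; apply: eq_bigr => k _; rewrite mul0r addr0 cintZ//.
by rewrite mulrCA.
Qed.

Lemma near_vball (U : set V) a : open U -> U a -> exists2 d : R, 0 < d & vball a d `<=` U.
Proof. by move=> oU Ua; have /nbhs_vabs[d d0 H] := open_near oU Ua; exists d. Qed.

End IntegralDerivatives.

(** * Derivatives of F along fields with constant logarithmic components *)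

Section PrincipalHierarchy.
Variables (R : realType) (m : nat) (n : nat -> nat).
Hypotheses (hm : (0 < m)%N) (hn : forall i : nat, (i <= m)%N -> (0 < n i)%N).
Local Notation C := R[i].
Local Notation N := (toda_dim m n).
Local Notation V := 'rV[C]_N.
Local Notation Mt := (@toda_manifold R m n).
Local Notation n0 := ((n 0)%:R : C).
Local Notation eps := (sign_vector R hm).
Implicit Types (a b u : V) (s : R).
Variables (e E : V -> V).
Hypotheses (he : toda_unit_field e) (hE : toda_euler_field E).
Variables (g : R -> C).
Hypotheses (Cg : C1_curve g) (g01 : g 0 = g 1).
Local Notation g' := (curve_deriv g).
Let Pg := C1_path Cg.
Let cg : pcont g. Proof. by case: Pg. Qed.
Let cg' : pcont g'. Proof. by case: Pg. Qed.

Variables (U : set V) (L : V -> R -> C).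
Hypotheses (oU : open U) (UM : U `<=` Mt).
Hypotheses (HZ : forall a, U a -> zero_winding a g) (HL : log_branch U g L).

Let off a : U a -> off_zeros_poles g a. Proof. by move=> /HZ[]. Qed.
Let offp a s : U a -> 0 <= s <= 1 -> ~ lam_pole a (g s). Proof. by move=> Ua s01; have [] := off Ua s01. Qed.
Let lam0 a s : U a -> 0 <= s <= 1 -> lam a (g s) != 0. Proof. by move=> Ua s01; have [] := off Ua s01. Qed.
Let cL a : U a -> pcont (L a). Proof. exact: log_branch_pcont HL. Qed.
Let EL a s : U a -> 0 <= s <= 1 -> cexp (L a s) = lam a (g s).
Proof. by move=> Ua; have [_ H] := HL; have [_ K] := H a Ua; exact: K. Qed.
Let clam a : U a -> pcont (fun s => lam a (g s)).
Proof. by move=> Ua; apply: (pcont_lam Cg) => s; exact: offp. Qed.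
Let Lnear a (x : R) : U a -> 0 < x ->
  \forall b \near a, forall s, 0 <= s <= 1 -> cabs (L b s - L a s) < x.
Proof. exact: (log_branch_near hm Cg oU off HL). Qed.

Definition log_form a u s : C := tangent_lam a u (g s) / lam a (g s).

Lemma smooth_log_lam l : smooth l U L.
Proof.
have S : smooth l U (fun a s => lam a (g s)) by apply: smooth_lam => // a s; exact: offp.
exact: (smooth_log oU (fun a => @cL a) (fun a s => @EL a s) (fun a Ua x => @Lnear a x Ua) S).
Qed.

Lemma ud_log_lam a : U a -> ud L a (fun k s => dlam a (delta_mx 0 k) (g s) / lam a (g s)).
Proof.
move=> Ua; apply: (ud_log (h := fun a s => lam a (g s))); first exact: clam.
- by apply: near_mono2 (open_near oU Ua) (open_near oU Ua) => b Ub _ s s01; exact: EL.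
- by move=> x x0; exact: Lnear.
- by apply: (ud_lam hm) => // s; exact: offp.
Qed.

Lemma log_form_sum a u s : U a -> 0 <= s <= 1 ->
  \sum_k u 0 k * (dlam a (delta_mx 0 k) (g s) / lam a (g s)) = log_form a u s.
Proof.
move=> Ua s01; have Hs := offp Ua s01; rewrite /log_form (tangent_lamE hm u Hs).
rewrite (linear_row_sum (dlam_linear hm Hs)) mulr_suml.
by apply: eq_bigr => k _; rewrite mulrA.
Qed.

Definition log_power q a s : C := L a s ^+ q / q`!%:R.

Lemma pcont_log_power q a : U a -> pcont (log_power q a).
Proof. by move=> Ua; apply: pcontM; [apply: pcontX; exact: cL|exact: pcont_cst]. Qed.

Lemma log_power_deriv q a (x : C) s : q.+1%:R * L a s ^+ q * x / q.+1`!%:R = log_power q a s * x.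
Proof.
rewrite /log_power factS natrM; have a0 : q.+1%:R != 0 :> C by rewrite pnatr_eq0.
have b0 : q`!%:R != 0 :> C by rewrite pnatr_eq0 -lt0n fact_gt0.
have aux (x1 x2 y : C) : x1 != 0 -> x2 != 0 -> x1 * y * x / (x1 * x2) = y / x2 * x.
  by move=> h1 h2; field; rewrite h1 h2.
exact: aux.
Qed.

Lemma pcont_dlam a k : U a -> pcont (fun s => dlam a (delta_mx 0 k) (g s) / lam a (g s)).
Proof.
move=> Ua; have [cP [d [H S]]] := (smoothSE 0 _ _).1 (smooth_log_lam 1).
apply: pcontM; last by apply: pcontV => [|s]; [exact: clam|exact: lam0].
apply: (@pcont_ext _ (fun s => (tanP a (delta_mx 0 k)).[g s] / (lamD a).[g s])) => [s s01|].
  by rewrite (tanPE hm _ (offp Ua s01)) mulrAC divff ?mul1r// (lamDn0 (offp Ua s01)).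
apply: pcontM; first exact: pcont_poly.
by apply: pcontV => [|s s01]; [exact: pcont_poly|exact: (lamDn0 (offp Ua s01))].
Qed.

Lemma ud_log_power q a : U a -> ud (log_power q) a
  (fun k s => (if q is q'.+1 then log_power q' a s else 0) * (dlam a (delta_mx 0 k) (g s) / lam a (g s))).
Proof.
move=> Ua; have := udM (pcontX q (cL Ua)) (pcont_cst (q`!%:R^-1)) (udX q (cL Ua) (ud_log_lam Ua))
  (ud_cst (fun=> q`!%:R^-1) a).
apply: ud_eq => // k s; rewrite mulr0 add0r; case: q => [|q]; first by rewrite !mul0r.
by rewrite -(log_power_deriv q a _ s).
Qed.

Lemma pcont_log_form a u : U a -> pcont (log_form a u).
Proof.
move=> Ua; apply: (@pcont_ext _ (fun s => \sum_k u 0 k * (dlam a (delta_mx 0 k) (g s) / lam a (g s)))).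
  by move=> s s01; exact: log_form_sum.
by apply: pcont_sum => k _; apply: pcontM; [exact: pcont_cst|exact: pcont_dlam].
Qed.

Section DG.
Hypothesis gn0 : forall s, 0 <= s <= 1 -> g s != 0.
Local Notation dg := (fun s => g' s / g s).
Let cdg : pcont dg. Proof. by apply: pcontM => //; apply: pcontV. Qed.

Lemma smooth_toda_F p : all_smooth U (fun a => toda_F g (L a) p).
Proof.
move=> l; apply: smoothZ; apply: smooth_cint => //; apply: smoothM; last exact: smooth_cst.
apply: smoothM; last by apply: smooth_cst; exact: pcont_cst.
by apply: smoothX => //; exact: smooth_log_lam.
Qed.

Lemma derive_toda_F a u p : U a -> 'D_u (fun b => toda_F g (L b) p) a =
  (two_pi_i R)^-1 * cint (fun s => log_power p a s * log_form a u s * dg s).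
Proof.
move=> Ua; have cp q b : U b -> pcont (log_power q b) by exact: pcont_log_power.
have := udM (cp p.+1 a Ua) cdg (ud_log_power p.+1 Ua) (ud_cst dg a).
have nr : \forall b \near a, pcont (fun s => log_power p.+1 b s * dg s).
  by apply: near_mono2 (open_near oU Ua) (open_near oU Ua) => b Ub _; apply: pcontM => //; exact: cp.
have cc k : pcont (fun s => log_power p.+1 a s * 0 +
    log_power p a s * (dlam a (delta_mx 0 k) (g s) / lam a (g s)) * dg s).
  apply: pcontD; first by apply: pcontM; [exact: cp|exact: pcont_cst].
  by apply: pcontM => //; apply: pcontM; [exact: cp|exact: pcont_dlam].
move=> /(derive_cint (two_pi_i R)^-1 u nr cc) H; rewrite /toda_F.
transitivity ('D_u (fun b => (two_pi_i R)^-1 * cint (fun s => log_power p.+1 b s * dg s)) a) => //.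
rewrite H; congr (_ * _); apply: cint_ext => s s01 /=.
rewrite -(log_form_sum u Ua s01) mulr_sumr mulr_suml; apply: eq_bigr => k _.
by rewrite mulr0 add0r; set x := log_power _ _ _; set y := dlam _ _ _ / _; set w := g' s / _; ring.
Qed.

Section Chart.
Variables (B : set V) (z : 'I_(deg_zeros m n) -> V -> C).
Hypotheses (oB : open B) (BU : B `<=` U).
Hypotheses (zinj : forall a, B a -> injective (z^~ a)).
Hypotheses (EA : forall a, B a -> lamA a = n0^-1 *: \prod_j ('X - (z j a)%:P)).
Hypotheses (sz : forall j l, smooth l B (fun a _ => z j a)).
Local Notation rho a := (root_vector hm (z^~ a) a).
Let BM : B `<=` Mt. Proof. by move=> b /BU/UM. Qed.
Let RD a (Ba : B a) := root_functions_data hm hn BM zinj EA Ba.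
Let n00 := n0_neq0 R hn.

Variables (X : 'I_N -> V -> V) (M : 'M[C]_N).
Hypothesis XM : forall b k r, B b -> tell b (rho b) eps (X k b) r = M r k.

Lemma log_form_roots a u s : B a -> 0 <= s <= 1 ->
  log_form a u s = - \sum_r eps r * rho a r * tell a (rho a) eps u r / (g s - rho a r).
Proof.
move=> Ba s01; apply: (tangent_log hm hn (BM Ba) (RD Ba)); [exact: offp (BU Ba) s01|exact: lam0 (BU Ba) s01].
Qed.

Let grho a s r : B a -> 0 <= s <= 1 -> g s - rho a r != 0.
Proof.
move=> Ba s01; rewrite subr_eq0.
exact: (off_rho hn (RD Ba) (offp (BU Ba) s01) (lam0 (BU Ba) s01)).
Qed.

Definition field_log_form k b s : C := - \sum_r eps r * M r k * (rho b r / (g s - rho b r)).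

Lemma field_log_formE k b s : B b -> 0 <= s <= 1 -> log_form b (X k b) s = field_log_form k b s.
Proof.
move=> Bb s01; rewrite log_form_roots//; congr (- _); apply: eq_bigr => r _.
by rewrite XM//; set x := _^-1; ring.
Qed.

Let crho a r : B a -> pcont (fun s => g s - rho a r).
Proof. by move=> Ba; apply: pcontD => //; exact: pcont_cst. Qed.

Let crhoV a r : B a -> pcont (fun s => (g s - rho a r)^-1).
Proof. by move=> Ba; apply: pcontV => [|s]; [exact: crho|exact: grho]. Qed.

Lemma pcont_field_log_form k b : B b -> pcont (field_log_form k b).
Proof.
move=> Bb; apply: pcontN; apply: pcont_sum => r _; apply: pcontM; first exact: pcont_cst.
by apply: pcontM; [exact: pcont_cst|exact: crhoV].
Qed.

Definition field_log_form_partial k l a s : C :=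
  - \sum_r eps r * M r k * (partial l (fun b => rho b r) a * g s / (g s - rho a r) ^+ 2).

Lemma ud_field_log_form k a : B a -> ud (field_log_form k) a (fun l => field_log_form_partial k l a).
Proof.
move=> Ba; have H : forall r, r \in index_enum 'I_N -> ud (fun b s => eps r * M r k * (rho b r / (g s - rho b r))) a
   (fun l s => eps r * M r k * (partial l (fun b => rho b r) a * g s / (g s - rho a r) ^+ 2)).
  move=> r _; have u1 := ud_partial (smooth_rho hm sz r) Ba.
  have u2 : ud (fun b s => g s - rho b r) a (fun l _ => - partial l (fun b => rho b r) a).
    have := udD (ud_cst g a) (udM (pcont_cst (-1)) (pcont_cst _) (ud_cst (fun=> -1) a) u1).
    by apply: ud_eq => [b s|l s]; rewrite ?mulN1r// mul0r addr0 add0r.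
  have u3 := udV (crho r Ba) (fun s => grho r Ba (s := s)) u2.
  have := udM (pcont_cst (eps r * M r k)) (pcontM (pcont_cst (rho a r)) (crhoV r Ba)) (ud_cst (fun=> eps r * M r k) a)
    (udM (pcont_cst (rho a r)) (crhoV r Ba) u1 u3).
  apply: ud_ext; first by apply/nbhs_vabs; exists 1.
  move=> l s s01; rewrite mul0r addr0; congr (_ * _).
  have aux (p d w : C) : w - p != 0 -> p * (- - d / (w - p) ^+ 2) + d * (w - p)^-1 = d * w / (w - p) ^+ 2.
    by move=> w0; field.
  by apply: aux; exact: grho.
have := udM (pcont_cst (-1)) (_ : pcont (fun s => \sum_r eps r * M r k * (rho a r / (g s - rho a r)))) (ud_cst (fun=> -1) a) (ud_sum_seq H).
have cs : pcont (fun s => \sum_r eps r * M r k * (rho a r / (g s - rho a r))).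
  apply: pcont_sum => r _; apply: pcontM; first exact: pcont_cst.
  by apply: pcontM; [exact: pcont_cst|exact: crhoV].
by move=> /(_ cs); apply: ud_eq => [b s|l s]; rewrite ?mulN1r// mul0r addr0.
Qed.

Lemma pcont_field_log_form_partial k l a : B a -> pcont (field_log_form_partial k l a).
Proof.
move=> Ba; apply: pcontN; apply: pcont_sum => r _; apply: pcontM; first exact: pcont_cst.
apply: pcontM; first by apply: pcontM => //; exact: pcont_cst.
apply: (@pcont_ext _ (fun s => ((g s - rho a r)^-1) ^+ 2)) => [s _|]; first by rewrite exprVn.
by apply: pcontX; exact: crhoV.
Qed.

Definition chi j k a s : C := \sum_r eps r * rho a r * (M r j * M r k) / (g s - rho a r).
Definition chi' j k a s : C := - \sum_r eps r * rho a r * (M r j * M r k) * (g' s / (g s - rho a r) ^+ 2).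

Lemma chi_path j k a : B a -> C1path (chi j k a) (chi' j k a).
Proof.
move=> Ba; have P r : C1path (fun s => eps r * rho a r * (M r j * M r k) / (g s - rho a r))
   (fun s => - (eps r * rho a r * (M r j * M r k) * (g' s / (g s - rho a r) ^+ 2))).
  have := C1pathZ (eps r * rho a r * (M r j * M r k)) (C1pathV (C1pathB Pg (C1path_cst (rho a r))) (fun s => grho r Ba (s := s))).
  by apply: C1path_ext => s _ //; rewrite subr0 mulNr mulrN.
rewrite /chi /chi'; elim: (index_enum _) => [|r w IH].
  by apply: C1path_ext (C1path_cst 0) => s _; rewrite big_nil ?oppr0.
by apply: C1path_ext (C1pathD (P r) IH) => s _; rewrite big_cons// opprD.
Qed.

(** The derivative falls either on the power of log lambda, lowering its degree (with 0 for degree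
    0), or on the logarithmic form, where it produces the derivative of [chi] along the curve. *)
Lemma second_derive_log j k q a : B a ->
  'D_(X j a) (fun b => (two_pi_i R)^-1 * cint (fun s => log_power q b s * field_log_form k b s * dg s)) a =
  (two_pi_i R)^-1 * cint (fun s => (if q is q'.+1 then log_power q' a s else 0) *
     field_log_form j a s * field_log_form k a s * dg s + log_power q a s * chi' j k a s).
Proof.
move=> Ba; have Ua := BU Ba; have cp b : U b -> pcont (log_power q b) by exact: pcont_log_power.
have u1 := udM (cp a Ua) (pcont_field_log_form k Ba) (ud_log_power q Ua) (ud_field_log_form k Ba).
have u2 := udM (pcontM (cp a Ua) (pcont_field_log_form k Ba)) cdg u1 (ud_cst dg a).
have nr : \forall b \near a, pcont (fun s => log_power q b s * field_log_form k b s * dg s).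
  apply: near_mono2 (open_near oB Ba) (open_near oB Ba) => b Bb _; apply: pcontM => //.
  by apply: pcontM; [exact: cp (BU Bb)|exact: pcont_field_log_form].
rewrite (derive_cint _ _ nr _ u2) => [|l]; last first.
  apply: pcontD.
    by apply: pcontM; [apply: pcontM; [exact: cp|exact: pcont_field_log_form]|exact: pcont_cst].
  apply: pcontM => //; apply: pcontD; first by apply: pcontM; [exact: cp|exact: pcont_field_log_form_partial].
  apply: pcontM; last exact: pcont_field_log_form.
  apply: pcontM; last exact: pcont_dlam.
  by case: (q) => [|q']; [exact: pcont_cst|exact: pcont_log_power].
congr (_ * _); apply: cint_ext => s s01.
set P := if q is _.+1 then _ else _.
have E1 : \sum_l X j a 0 l * (dlam a (delta_mx 0 l) (g s) / lam a (g s)) = field_log_form j a s.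
  by rewrite (log_form_sum _ Ua s01) field_log_formE.
(* The derivative of rho / (z - rho) in rho is z / (z - rho)^2; its factor z cancels the denominator
   of g' / g. *)
have E2 : \sum_l X j a 0 l * field_log_form_partial k l a s * dg s = chi' j k a s.
  rewrite /field_log_form_partial /chi' /=.
  transitivity (- \sum_l \sum_r eps r * M r k * (X j a 0 l * partial l (fun b => rho b r) a * g s / (g s - rho a r) ^+ 2) * (g' s / g s)).
    rewrite -sumrN; apply: eq_bigr => l _; rewrite mulrN mulNr mulr_sumr mulr_suml; congr (- _).
    by apply: eq_bigr => r _; set x := _^-1; set y := partial _ _ _; set v := g' s / _; ring.
  rewrite exchange_big /=; congr (- _); apply: eq_bigr => r _.
  have Dr : \sum_l X j a 0 l * partial l (fun b => rho b r) a = rho a r * M r j.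
    rewrite -(XM j r Ba) -(derive_root_functions hm hn oB BM zinj EA sz (X j a) r Ba).
    by rewrite (derive_partial (X j a) (smooth_rho hm sz r) Ba).
  transitivity (eps r * M r k * ((\sum_l X j a 0 l * partial l (fun b => rho b r) a) * g s / (g s - rho a r) ^+ 2) * (g' s / g s)).
    rewrite !mulr_suml mulr_sumr mulr_suml; apply: eq_bigr => l _; rewrite !mulrA.
    by [].
  rewrite Dr; have := gn0 s01; have := grho r Ba s01; set x := g s - _; set y := g s; set v := g' s => x0 y0.
  by field; rewrite x0 y0.
rewrite -E1 -E2 [P * \sum_l _]mulr_sumr !mulr_suml [log_power q a s * \sum_l _]mulr_sumr -big_split; apply: eq_bigr => l _ /=.
set p := log_power _ _ _; set f := field_log_form _ _ _; set h := field_log_form_partial _ _ _ _.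
set d := _ / lam _ _; set v := g' s / _; set y := X _ _ _ _; ring.
Qed.

(** For the power 0 what remains is the integral of the derivative of the closed path [chi]. *)
Lemma second_derive_zero j k a : B a ->
  'D_(X j a) (fun b => (two_pi_i R)^-1 * cint (fun s => log_power 0 b s * field_log_form k b s * dg s)) a = 0.
Proof.
move=> Ba; rewrite second_derive_log//; have -> : cint (fun s => 0 * field_log_form j a s * field_log_form k a s * dg s +
    log_power 0 a s * chi' j k a s) = cint (chi' j k a).
  by apply: cint_ext => s _; rewrite !mul0r add0r /log_power expr0 fact0 divr1 mul1r.
by rewrite (C1path_integral (chi_path j k Ba)) /chi g01 subrr mulr0.
Qed.

(** By [star_log] the two sides differ by the integral of the derivative of (log lambda)^(p+1) /
    (p+1)! times [chi]. This path is closed because [zero_winding] closes the logarithm. *)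
Lemma second_derive_star j k p a : B a ->
  'D_(X j a) (fun b => (two_pi_i R)^-1 * cint (fun s => log_power p.+1 b s * field_log_form k b s * dg s)) a =
  'D_(toda_dual_star e E a (X j a) (X k a)) (fun b => toda_F g (L b) p) a.
Proof.
move=> Ba; have Ua := BU Ba; rewrite second_derive_log// derive_toda_F//; congr (_ * _).
have offa s : 0 <= s <= 1 -> ~ lam_pole a (g s) by exact: offp.
have PL := C1path_log (lam_path hm Cg offa) (cL Ua) (fun s => EL Ua (s := s)).
have Pp : C1path (log_power p.+1 a) (fun s => log_power p a s * (lam' a (g s) * g' s / lam a (g s))).
  have := C1pathZ ((p.+1)`!%:R^-1) (C1pathX p PL).
  apply: C1path_ext => s _; first by rewrite mulrC.
  by rewrite -log_power_deriv mulrC.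
have Pc := C1pathM Pp (chi_path j k Ba).
have L01 : L a 0 = L a 1.
  apply: (zero_winding_closed hm Cg (HZ Ua)); have [_ H] := HL; exact: H.
have I0 : cint (fun s => log_power p.+1 a s * chi' j k a s +
    log_power p a s * (lam' a (g s) * g' s / lam a (g s)) * chi j k a s) = 0.
  by rewrite (C1path_integral Pc) /log_power /chi L01 g01 subrr.
have cpp := pcont_log_power p Ua; have cpp1 := pcont_log_power p.+1 Ua.
have [_ cPL _] := PL; have [cchi cchi' _] := chi_path j k Ba.
have cj := pcont_field_log_form j Ba; have ck := pcont_field_log_form k Ba.
rewrite -[RHS]addr0 -I0 -cintD; last 2 first.
- by apply: pcontM => //; apply: pcontM => //; exact: pcont_log_form.
- by apply: pcontD; [exact: pcontM|apply: pcontM => //; exact: pcontM].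
apply: cint_ext => s s01.
have RDa := RD Ba.
have S : log_form a (toda_dual_star e E a (X j a) (X k a)) s =
    log_form a (X j a) s * log_form a (X k a) s - g s * lam' a (g s) / lam a (g s) *
    \sum_r eps r * rho a r * (tell a (rho a) eps (X j a) r * tell a (rho a) eps (X k a) r) / (g s - rho a r).
  exact: (star_log hm hn he hE (BM Ba) RDa (X j a) (X k a) (offa s s01) (lam0 Ua s01)).
have Sc : \sum_r eps r * rho a r * (tell a (rho a) eps (X j a) r * tell a (rho a) eps (X k a) r) / (g s - rho a r) = chi j k a s.
  by apply: eq_bigr => r _; rewrite !XM.
rewrite S Sc (field_log_formE j Ba s01) (field_log_formE k Ba s01).
have := gn0 s01; have := lam0 Ua s01.
move: (log_power p a s) (log_power p.+1 a s) (field_log_form j a s) (field_log_form k a s) (chi j k a s) (chi' j k a s).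
move=> x1 x2 x3 x4 x5 x6; set l := lam a (g s); set l' := lam' a (g s); set v := g s; set v' := g' s => l0 v0.
by field; rewrite l0 v0.
Qed.

End Chart.
End DG.
End PrincipalHierarchy.

(** * The densities in flat coordinates *)

Section CoordinateFields.
Variables (R : realType) (m : nat) (n : nat -> nat).
Hypotheses (hm : (0 < m)%N) (hn : forall i : nat, (i <= m)%N -> (0 < n i)%N).
Local Notation C := R[i].
Local Notation N := (toda_dim m n).
Local Notation V := 'rV[C]_N.
Local Notation n0 := ((n 0)%:R : C).
Local Notation eps := (sign_vector R hm).
Implicit Types (a b u : V) (f : V -> C).
Variables (e E : V -> V).
Hypotheses (he : toda_unit_field e) (hE : toda_euler_field E).
Variables (U : set V) (t : 'I_N -> V -> C) (G : 'M[C]_N).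
Hypothesis FC : flat_coordinates E U t G.

Let oU := flat_open FC.
Let Ut := flat_jac FC.
Let Gt := flat_const FC.
Let St i : all_smooth U (t i).
Proof. by move=> l; apply: holomorphic_smooth; exact: (flat_holomorphic FC). Qed.

Lemma coord_derivE k f a : all_smooth U f -> U a ->
  coord_deriv t k f a = \sum_l invmx (jac_mx t a) l k * partial l f a.
Proof.
move=> Sf Ua; rewrite /coord_deriv (derive_partial _ Sf Ua); apply: eq_bigr => l _.
by rewrite /coord_field !mxE.
Qed.

Lemma smooth_coord_deriv k f : all_smooth U f -> all_smooth U (coord_deriv t k f).
Proof.
move=> Sf l; apply: (@smooth_ext _ _ l U (fun a _ => \sum_q invmx (jac_mx t a) q k * partial q f a)) => //.
  by move=> a s Ua _; rewrite coord_derivE.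
apply: smooth_sum => // q; apply: smoothM; last exact: (smooth_partial oU q Sf).
apply: smooth_invmx => // i j.
have -> : (fun a => jac_mx t a i j) = partial j (t i) by apply/funext => a; rewrite !mxE.
exact: smooth_partial.
Qed.

Lemma derive_coord f a u : all_smooth U f -> U a ->
  'D_u f a = \sum_i 'D_u (t i) a * coord_deriv t i f a.
Proof.
move=> Sf Ua; rewrite (derive_partial u Sf Ua).
have aux (v : V) (J : 'M[C]_N) (h T D : 'I_N -> C) : J \in unitmx ->
    (forall i, T i = \sum_l v 0 l * J i l) -> (forall i, D i = \sum_q invmx J q i * h q) ->
    \sum_l v 0 l * h l = \sum_i T i * D i.
  move=> UJ ET ED; have -> : \sum_i T i * D i = ((v *m J^T) *m ((invmx J)^T *m \col_q h q)) 0 0.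
    rewrite mxE; apply: eq_bigr => i _; congr (_ * _).
      by rewrite ET mxE; apply: eq_bigr => l _; rewrite mxE.
    by rewrite ED mxE; apply: eq_bigr => q _; rewrite !mxE.
  rewrite mulmxA -(mulmxA v) -trmx_mul mulVmx// trmx1 mulmx1 mxE.
  by apply: eq_bigr => l _; rewrite mxE.
apply: (aux u (jac_mx t a) (fun q => partial q f a) (fun i => 'D_u (t i) a) (fun i => coord_deriv t i f a)).
- exact: Ut.
- by move=> i; rewrite (derive_partial u (St i) Ua); apply: eq_bigr => l _; rewrite !mxE.
- by move=> i; exact: coord_derivE.
Qed.

Lemma derive_local_eq (B : set V) f h a u : open B -> B a -> B `<=` U -> (forall b, B b -> f b = h b) ->
  all_smooth U f -> 'D_u f a = 'D_u h a.
Proof.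
move=> oB Ba BU fh Sf; have H := ud_partial Sf (BU a Ba).
rewrite (derive_ud u H); symmetry; apply: derive_ud; apply: (ud_ext _ _ H) => //.
by apply: near_mono2 (open_near oB Ba) (open_near oB Ba) => b Bb _ s _; exact: fh.
Qed.

(** Root functions exist only near a point, so the constant components of the coordinate fields are
    obtained on a ball inside U. The matrix G is invertible as the congruence transform of
    [gram]. *)
Lemma flat_chart a : U a -> exists (B : set V) (z : 'I_(deg_zeros m n) -> V -> C) (M : 'M[C]_N),
  [/\ open B /\ B a, B `<=` U,
    forall b, B b -> injective (z^~ b) /\ lamA b = n0^-1 *: \prod_j ('X - (z j b)%:P),
    forall j l, smooth l B (fun b _ => z j b) &
    (forall b k r, B b -> tell b (root_vector hm (z^~ b) b) eps (coord_field t k b) r = M r k) /\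
    G \in unitmx].
Proof.
move=> Ua; have [U1 [z [oU1 U1a U1M HU1 sz]]] := dual_local hm hn hE (flat_sub FC Ua).
have [d d0 Hd] := near_vball (openI oU oU1) (conj Ua U1a : (U `&` U1) a).
pose B := vball a d; have oB : open B := @vball_open _ _ a d.
have Ba : B a := vball_center a d0.
have BU : B `<=` U by move=> b /Hd[].
have BU1 : B `<=` U1 by move=> b /Hd[].
have BM b : B b -> toda_manifold b by move=> /BU1/U1M.
have zinj b : B b -> injective (z^~ b) by move=> /BU1/HU1[].
have EA b : B b -> lamA b = n0^-1 *: \prod_j ('X - (z j b)%:P) by move=> /BU1/HU1[].
have szB j l : smooth l B (fun b _ => z j b) by apply: smooth_subset (sz j l).
have StB i : all_smooth B (t i) by move=> l; apply: smooth_subset (St i l).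
have UtB b : B b -> jac_mx t b \in unitmx by move=> /BU; exact: Ut.
have GtB b i j : B b -> toda_dual_form E b (differential (t i) b) (differential (t j) b) = G i j.
  by move=> /BU; exact: Gt.
exists B, z, (invmx (coframe_mx hm z t a)); split=> //.
  by move=> b Bb; split; [exact: zinj|exact: EA].
split=> [b k r Bb|].
  exact: (coord_field_tell hm hn hE oB BM zinj EA szB (vball_connected (a := a) d0) StB UtB GtB k r Ba Bb).
have GE : G = coframe_mx hm z t a *m gram R n hm *m (coframe_mx hm z t a)^T.
  apply/matrixP => i j; rewrite -(coframe_gram hm hn hE BM zinj EA GtB i j Ba).
  rewrite mxE exchange_big /=; apply: eq_bigr => s _; rewrite [(_ *m gram _ _ _) _ _]mxE mulr_suml.
  by apply: eq_bigr => r' _; rewrite [(_)^T _ _]mxE.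
have UY := coframe_unit hm hn BM zinj EA UtB Ba.
have UG := gram_unit hm hn BM zinj EA Ba.
have aux (Y H : 'M[C]_N) : Y \in unitmx -> H \in unitmx -> Y *m H *m Y^T \in unitmx.
  by move=> UY' UH; rewrite !unitmx_mul unitmx_tr UY' UH.
by rewrite GE; exact: (aux _ _ UY UG).
Qed.

Section Hierarchy.
Variables (g : R -> C) (L : V -> R -> C).
Hypotheses (Cg : C1_curve g) (g01 : g 0 = g 1).
Hypotheses (HZ : forall a, U a -> zero_winding a g) (HL : log_branch U g L).
Local Notation F p := (fun a => toda_F g (L a) p).

Let UM : U `<=` @toda_manifold R m n. Proof. by move=> a /(flat_sub FC)[]. Qed.

Lemma curve_neq0 a : U a -> forall s : R, 0 <= s <= 1 -> g s != 0.
Proof. by move=> Ua s s01; have [H _] := HZ Ua; have [Hp _] := H s s01; exact: (pole_neq0 hm Hp). Qed.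

Lemma smooth_F p : all_smooth U (F p).
Proof.
move=> l; have [[a Ua]|U0] := pselect (exists a, U a); last first.
  by apply: smooth_empty => a Ua; apply: U0; exists a.
exact: (smooth_toda_F hm Cg oU HZ HL (curve_neq0 Ua)).
Qed.

(** The first derivative is written as an explicit integral on an open set, and not only at [a],
    because the recursion differentiates it once more. *)
Lemma coord_deriv_F k p a : U a -> exists B : set V, [/\ open B /\ B a, B `<=` U &
  exists (z : 'I_(deg_zeros m n) -> V -> C) (M : 'M[C]_N), [/\
    forall b, B b -> injective (z^~ b) /\ lamA b = n0^-1 *: \prod_j ('X - (z j b)%:P),
    forall j l, smooth l B (fun b _ => z j b),
    (forall b k r, B b -> tell b (root_vector hm (z^~ b) b) eps (coord_field t k b) r = M r k) &
    forall b, B b -> coord_deriv t k (F p) b = (two_pi_i R)^-1 *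
      cint (fun s => log_power L p b s * field_log_form hm g z M k b s * (curve_deriv g s / g s))]].
Proof.
move=> Ua; have [B [z [M [[oB Ba] BU zEA sz [XM _]]]]] := flat_chart Ua.
exists B; split=> //; exists z, M; split=> // b Bb.
rewrite /coord_deriv (derive_toda_F hm Cg oU HZ HL (curve_neq0 Ua) _ p (BU b Bb)); congr (_ * _).
apply: cint_ext => s s01; congr (_ * _ * _).
exact: (field_log_formE (X := coord_field t) hn UM HZ BU (fun b Bb => (zEA b Bb).1) (fun b Bb => (zEA b Bb).2) XM k Bb s01).
Qed.

Lemma F_recursion : density_recursion e E U t (fun p a => F p a).
Proof.
move=> p j k a Ua; have [B [[oB Ba] BU [z [M [zEA sz XM HB]]]]] := coord_deriv_F k p.+1 Ua.
rewrite {1}/coord_deriv (derive_local_eq _ oB Ba BU HB); last exact: smooth_coord_deriv (smooth_F p.+1).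
rewrite (second_derive_star (X := coord_field t) hn he hE Cg g01 oU UM HZ HL (curve_neq0 Ua) oB BU
  (fun b Bb => (zEA b Bb).1) (fun b Bb => (zEA b Bb).2) sz XM j k p Ba).
by rewrite (derive_coord _ (smooth_F p) Ua).
Qed.

Lemma F0_coord_constant k a b : U a -> U b -> coord_deriv t k (F 0) a = coord_deriv t k (F 0) b.
Proof.
apply: (partial0_constant oU (flat_connected FC)); first exact: smooth_coord_deriv (smooth_F 0).
move=> {}a l Ua; have S0 := smooth_coord_deriv k (smooth_F 0).
rewrite /partial (derive_coord _ S0 Ua) big1// => j _.
have [B [[oB Ba] BU [z [M [zEA sz XM HB]]]]] := coord_deriv_F k 0 Ua.
rewrite {1}/coord_deriv (derive_local_eq _ oB Ba BU HB S0).
rewrite (second_derive_zero (X := coord_field t) hn Cg g01 oU UM HZ HL (curve_neq0 Ua) oB BU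
  (fun b Bb => (zEA b Bb).1) (fun b Bb => (zEA b Bb).2) sz XM j k Ba).
by rewrite mulr0.
Qed.

(** All second derivatives of F_{g,0} in the flat coordinates vanish by [second_derive_zero], so on
    the connected set U it is affine in them. *)
Lemma F0_affine : exists (k : 'I_N -> C) (k0 : C), forall a, U a ->
  F 0 a = \sum_i k i * (\sum_j invmx G i j * t j a) + k0.
Proof.
have [[a1 Ua1]|U0] := pselect (exists a, U a); last first.
  by exists (fun=> 0), 0 => a Ua; case: U0; exists a.
pose c k := coord_deriv t k (F 0) a1; pose f a := F 0 a - \sum_k c k * t k a.
have Sc : all_smooth U (fun a => \sum_k c k * t k a).
  by apply: (all_smooth_sum oU) => k l; apply: smoothZ; exact: St.
have Sf : all_smooth U f.
  by move=> l; apply: smoothD; [exact: smooth_F|apply: smoothN => //; exact: Sc].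
have fC a : U a -> f a = f a1.
  move=> Ua; apply: (partial0_constant oU (flat_connected FC) Sf) => // b l Ub.
  have u1 := ud_partial (smooth_F 0) Ub; have u2 := ud_partial Sc Ub.
  have := udD u1 (udM (pcont_cst (-1)) (pcont_cst _) (ud_cst (fun=> -1) b) u2).
  move=> H; have {}H : ud (fun b _ => f b) b (fun k _ => partial k (F 0) b +
      (-1 * partial k (fun a0 => \sum_k0 c k0 * t k0 a0) b + 0 * \sum_k0 c k0 * t k0 b)).
    by apply: ud_eq H => // b' _; rewrite /f mulN1r.
  rewrite (partial_ud l H) mul0r addr0 mulN1r.
  rewrite (partial_sum (U := U))// => [|k l']; last by apply: smoothZ; exact: St.
  rewrite /partial (derive_coord _ (smooth_F 0) Ub) -sumrB big1// => k _.
  rewrite -/(partial l (fun a => c k * t k a) b) (partialM l (all_smooth_cst U (c k)) (St k) Ub).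
  have aux (x y w w' d : C) : w' = w -> d = 0 -> x * w - (w' * x + d * y) = 0 by move=> -> ->; ring.
  apply: aux; [exact: (F0_coord_constant k Ua1 Ub)|exact: partial_cst].
have [_ [_ [_ [_ _ _ _ [_ UG]]]]] := flat_chart Ua1.
(* The coefficients refer to the coordinates with lowered index, so those of the t_k are multiplied
   by G. *)
exists (fun i => ((\row_k c k) *m G) 0 i), (f a1) => a Ua.
rewrite -(fC a Ua) /f; have -> : \sum_i ((\row_k c k) *m G) 0 i * (\sum_j invmx G i j * t j a) = \sum_k c k * t k a.
  under eq_bigr do rewrite mulr_sumr.
  rewrite exchange_big /=; apply: eq_bigr => j _.
  have aux (v : V) (H : 'M[C]_N) (y : C) : H \in unitmx -> \sum_i (v *m H) 0 i * (invmx H i j * y) = v 0 j * y.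
    move=> UH; rewrite -[in RHS](mulmxK UH v) [RHS]mulrC [X in _ = _ * X]mxE mulr_sumr.
    by apply: eq_bigr => i _; rewrite mulrA mulrC.
  by rewrite (aux (\row_k c k) G (t j a) UG) mxE.
by rewrite addrC subrK.
Qed.

Lemma holomorphic_F p : holomorphic_on U (F p).
Proof. by apply: smooth_holomorphic => //; exact: smooth_F. Qed.

End Hierarchy.
End CoordinateFields.

Lemma interpolation_exists (F : fieldType) (s : seq F) (f : F -> F) :
  uniq s -> exists p : {poly F}, forall x, x \in s -> p.[x] = f x.
Proof.
elim: s => [|x s IH] /=; first by exists 0.
move=> /andP[xs us]; have [p Hp] := IH us.
pose q := \prod_(y <- s) ('X - y%:P); have qx : q.[x] != 0 by rewrite -rootE root_prod_XsubC.
exists (p + ((f x - p.[x]) / q.[x]) *: q) => y; rewrite inE => /predU1P[->|ys].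
  by rewrite hornerD hornerZ divfK// addrC subrK.
have qy : root q y by rewrite root_prod_XsubC.
by rewrite hornerD hornerZ (rootP qy) mulr0 addr0 Hp.
Qed.

(** * Completeness *)

Section SeparatingCurves.
Variable R : realType.
Local Notation C := R[i].
Implicit Types (z w u c : C) (s t : R).

(** For a pair with distinct imaginary parts a single value [bad] of k fails; k is larger than the
    absolute values of all of them. *)
Lemma linear_form_separates (s : seq C) : exists k : R,
  {in s &, injective (fun z => Re z + k * Im z)}.
Proof.
pose bad (p : C * C) := (Re p.1 - Re p.2) / (Im p.2 - Im p.1).
pose k := 1 + \sum_(p <- [seq (z, w) | z <- s, w <- s]) `|bad p|.
exists k => z w zs ws H; have [Izw|Izw] := eqVneq (Im z) (Im w).
  by apply: cplx_eq => //; move: H; rewrite Izw => /addIr.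
have I0 : Im w - Im z != 0 by rewrite subr_eq0 eq_sym.
have kE : k = bad (z, w).
  apply: (mulIf I0); rewrite /bad /= divfK//; move: H.
  by move: k (Re z) (Re w) (Im z) (Im w) => k x y x' y' H; lra.
have : `|bad (z, w)| < k.
  have zw : (z, w) \in [seq (z, w) | z <- s, w <- s] by apply/allpairsP; exists (z, w).
  rewrite /k (big_rem _ zw) /=.
  have : 0 <= \sum_(p <- rem (z, w) [seq (z, w) | z <- s, w <- s]) `|bad p| by apply: sumr_ge0.
  lra.
by rewrite -kE => /(le_lt_trans (ler_norm k)); rewrite ltxx.
Qed.

Lemma Re_circle0 (r : R) t : ((Re (circle 0 r t))%:C : C) =
  (r / 2)%:C * (cexp (t%:C * two_pi_i R) + cexp (t%:C * - two_pi_i R)).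
Proof.
rewrite circleE add0r mulrN /cexp /two_pi_i; apply: cplx_eq; rewrite !cplxE /= ?cosN ?sinN;
  rewrite ?mul0r ?mulr0 ?subr0 ?add0r ?addr0 ?sub0r ?oppr0 ?expR0 ?cosN ?sinN; lra.
Qed.

Lemma imaginary_horner (p : {poly R}) (x : R) :
  'i * (map_poly (real_complex R) p).[x%:C] = 0 +i* p.[x].
Proof. by rewrite horner_map /=; apply: cplx_eq; rewrite !cplxE /=; lra. Qed.

Section Shear.
Variables (p : {poly R}) (u : C) (r : R).
Hypotheses (u0 : u != 0) (r0 : 0 < r).
Local Notation gam := (circle 0 r).
Local Notation P := (map_poly (real_complex R) p).
Local Notation X := (fun t => (Re (gam t))%:C : C).
Let X' t : C := (r / 2)%:C * (two_pi_i R * cexp (t%:C * two_pi_i R) + - two_pi_i R * cexp (t%:C * - two_pi_i R)).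
Let X'' t : C := (r / 2)%:C * (two_pi_i R * (two_pi_i R * cexp (t%:C * two_pi_i R)) +
   - two_pi_i R * (- two_pi_i R * cexp (t%:C * - two_pi_i R))).

Let dX t : cder X t (X' t).
Proof.
have -> : X = (fun t => (r / 2)%:C * (cexp (t%:C * two_pi_i R) + cexp (t%:C * - two_pi_i R))).
  by apply/funext => s; exact: Re_circle0.
exact: cderZ (cderD (cder_cexp_linear _ _) (cder_cexp_linear _ _)).
Qed.

Let dX' t : cder X' t (X'' t).
Proof. exact: cderZ (cderD (cderZ _ (cder_cexp_linear _ _)) (cderZ _ (cder_cexp_linear _ _))). Qed.

(** The preimage of a circle under z -> u z + i p(Re (u z)), a bijection of the plane because p is
    real and the shear preserves real parts. A simple curve therefore stays simple. *)
Definition sheared_circle t : C := u^-1 * (gam t - 'i * P.[X t]).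
Definition sheared_circle' t : C := u^-1 * (circle_deriv r t - 'i * (P^`().[X t] * X' t)).

Lemma cder_sheared_circle t : cder sheared_circle t (sheared_circle' t).
Proof.
apply: cderZ; apply: cderD; first exact: cder_circle.
by apply: cderN; apply: cderZ; exact: (cder_poly _ (dX t)).
Qed.

Lemma sheared_circle_C1 : C1_curve sheared_circle.
Proof.
apply: (cder_C1_curve cder_sheared_circle) => t.
apply: cderZ; apply: cderD; first exact: (cderZ r%:C (cderZ (two_pi_i R) (cder_cexp_linear (two_pi_i R) t))).
by apply: cderN; apply: cderZ; apply: cderM; [exact: (cder_poly _ (dX t))|exact: dX'].
Qed.

Lemma Re_shear z (x : R) : Re (z - 'i * P.[x%:C]) = Re z.
Proof. by rewrite horner_map /= !cplxE /=; lra. Qed.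

Lemma sheared_circle_simple : simple_closed_curve sheared_circle.
Proof.
split; first exact: sheared_circle_C1.
  by rewrite /sheared_circle (circle_closed 0 r).
move=> s t s01 t01; have uV : u^-1 != 0 by rewrite invr_eq0.
move=> /(mulfI uV) H.
have ReE : Re (gam s) = Re (gam t) by rewrite -(Re_shear _ (Re (gam s))) H Re_shear.
have r1 : (r%:C : C) != 0 by rewrite eq_complex /= gt_eqF.
move: H; rewrite ReE => /addIr; rewrite !circleE => /addrI/(mulfI r1) H.
have : cexp ((s - t)%:C * two_pi_i R) = 1.
  by rewrite rmorphB mulrBl cexpB H divff// cexp_neq0.
move=> /cexp_eq1[k] /(mulIf (two_pi_i_neq0 R)) /(congr1 (@complex.Re R)).
have -> : (k%:~R : C) = (k%:~R : R)%:C by rewrite rmorph_int.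
move=> /= st; have : `|(k%:~R : R)| < 1 by rewrite -st ltr_norml; lra.
rewrite -intr_norm ltrz1 => k1; have k0 : k = 0 by lia.
by move: st; rewrite k0; lra.
Qed.

(** Scaling the shear by s in [0, 1] deforms the situation into a circle and the point w. The
    correction is purely imaginary and vanishes where the real parts agree, so the point is never
    crossed. *)
Lemma sheared_circle_index z w : w = u * z + 'i * P.[(Re (u * z))%:C] -> cabs w != r ->
  off_curve sheared_circle z /\
  index_integral sheared_circle (curve_deriv sheared_circle) z = if cabs w < r then two_pi_i R else 0.
Proof.
move=> wE wr; pose x := Re (u * z).
have [offw indw] : off_curve gam w /\ index_integral gam (circle_deriv r) w = if cabs w < r then two_pi_i R else 0.
  case: ltP => wr'; first by apply: circle_index_inside; rewrite ?subr0.
  by apply: circle_index_outside => //; rewrite subr0 lt_neqAle eq_sym wr.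
pose al t := gam t - w; pose be t := - ('i * (P.[X t] - P.[x%:C])).
have gE t : sheared_circle t - z = u^-1 * (al t + be t).
  rewrite /sheared_circle /al /be wE -/x.
  have -> : z = u^-1 * (u * z) by rewrite mulKf.
  by rewrite -mulrBr; congr (_ * _); rewrite mulKf//; ring.
have H (s t : R) : 0 <= s <= 1 -> 0 <= t <= 1 -> al t + s%:C * be t != 0.
  move=> s01 t01; apply/eqP => /[dup] H0 /(congr1 (@complex.Re R)).
  have Rbe : Re (be t) = 0 by rewrite /be mulrBr !imaginary_horner /= subrr oppr0.
  have Rw : Re w = x by rewrite wE imaginary_horner ReD /= addr0.
  rewrite [Re (_ + _)]ReD [Re (_ * _)]ReM Rbe /= mulr0 mul0r subrr addr0 [Re (_ + _)]ReD ReN Rw => Hx.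
  move: H0; have -> : be t = 0.
    rewrite /be; have -> : Re (gam t) = x by move: Hx => /=; lra.
    by rewrite subrr mulr0 oppr0.
  by rewrite mulr0 addr0 /al => /eqP; rewrite subr_eq0; apply/negP; exact: offw.
split=> [t t01|].
  rewrite -subr_eq0 gE mulf_neq0 ?invr_eq0//.
  by have := H 1 t; rewrite mul1r; apply; rewrite ?lexx ?ler01.
have Pal : C1path al (circle_deriv r).
  have := C1pathB (circle_path 0 r) (C1path_cst w); apply: C1path_ext => // t _; by rewrite subr0.
have Pg := C1_path sheared_circle_C1.
have Pbe : C1path be (fun t => u * sheared_circle' t - circle_deriv r t).
  have := C1pathB (C1pathZ u (C1pathB Pg (C1path_cst z))) Pal.
  apply: C1path_ext => t _; first by rewrite gE mulVKf// addrC addKr.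
  by rewrite subr0 (cder_curve_deriv (cder_sheared_circle t)).
have al01 : al 0 = al 1 by rewrite /al (circle_closed 0 r).
have be01 : be 0 = be 1 by rewrite /be (circle_closed 0 r).
rewrite -indw /index_integral [RHS](homotopy_winding Pal Pbe al01 be01 H).
apply: cint_ext => t _; rewrite gE (cder_curve_deriv (cder_sheared_circle t)).
by rewrite [circle_deriv r t + _]addrC subrK invfM invrK mulrA [_ * u]mulrC.
Qed.

End Shear.

(** After multiplication by a suitable u all points have distinct real parts, and an interpolating
    shear moves those of A into a large disc and those of B out of it. *)
Lemma separating_curve (A B : seq C) : (forall z, z \in A -> z \notin B) ->
  exists g : R -> C, [/\ simple_closed_curve g,
    forall z, z \in A -> off_curve g z /\ index_integral g (curve_deriv g) z = two_pi_i R &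
    forall z, z \in B -> off_curve g z /\ index_integral g (curve_deriv g) z = 0].
Proof.
move=> AB; have [k Hk] := linear_form_separates (A ++ B).
pose u : C := 1 +i* - k; have ReuE z : Re (u * z) = Re z + k * Im z by rewrite !cplxE /=; lra.
have u0 : u != 0 by rewrite eq_complex /= oner_eq0.
pose r := 1 + \sum_(z <- A ++ B) `|Re (u * z)|.
have r0 : 0 < r by rewrite /r; have : 0 <= \sum_(z <- A ++ B) `|Re (u * z)| by [apply: sumr_ge0]; lra.
have rz z : z \in A ++ B -> `|Re (u * z)| < r.
  move=> zs; rewrite /r (big_rem _ zs) /=.
  have : 0 <= \sum_(y <- rem z (A ++ B)) `|Re (u * y)| by apply: sumr_ge0.
  lra.
pose xs := undup [seq Re (u * z) | z <- A ++ B].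
pose pt x := nth 0 (A ++ B) (index x [seq Re (u * z) | z <- A ++ B]).
have ptE z : z \in A ++ B -> pt (Re (u * z)) = z.
  move=> zs; have zi : Re (u * z) \in [seq Re (u * z) | z <- A ++ B] by apply: map_f.
  have ps : pt (Re (u * z)) \in A ++ B by apply: mem_nth; rewrite -(size_map (fun z => Re (u * z))) index_mem.
  apply: Hk => //; rewrite -!ReuE /pt -(nth_map 0 0 (fun z => Re (u * z))); first by rewrite nth_index.
  by rewrite -(size_map (fun z => Re (u * z))) index_mem.
(* Above each abscissa lies one point of the list; the shear brings it to height 0 if it belongs to
   A and to height r + 1 otherwise, while abscissas stay below r in absolute value. *)
have [p Hp] := interpolation_exists (fun x => (if pt x \in A then 0 else r + 1) - Im (u * pt x)) (undup_uniq [seq Re (u * z) | z <- A ++ B]).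
have wE z : z \in A ++ B -> u * z + 'i * (map_poly (real_complex R) p).[(Re (u * z))%:C] =
    Re (u * z) +i* (if z \in A then 0 else r + 1).
  move=> zs; rewrite imaginary_horner Hp ?mem_undup ?(map_f (fun z => Re (u * z)) zs)// (ptE z zs).
  by apply: cplx_eq; rewrite ?ReD ?ImD /= ?addr0// addrC subrK.
exists (sheared_circle p u r); split; first exact: sheared_circle_simple.
  move=> z zA; have zs : z \in A ++ B by rewrite mem_cat zA.
  have w1 : cabs (Re (u * z) +i* 0) < r.
    by apply: le_lt_trans (cabs_ReIm _) _; rewrite /= normr0 addr0; exact: rz.
  have := sheared_circle_index u0 r0 (esym (wE z zs)); rewrite zA w1; apply; by rewrite lt_eqF.
move=> z zB; have zs : z \in A ++ B by rewrite mem_cat zB orbT.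
have zA : z \notin A by apply/negP => /AB; rewrite zB.
have w1 : r < cabs (Re (u * z) +i* (r + 1)).
  apply: lt_le_trans (Im_cabs _); rewrite /= ger0_norm; lra.
have := sheared_circle_index u0 r0 (esym (wE z zs)); rewrite (negPf zA) ltNge (ltW w1) /=; apply; by rewrite gt_eqF.
Qed.

End SeparatingCurves.

Lemma subset_of_card (T : finType) (A : {set T}) k : (k <= #|A|)%N ->
  exists2 B : {set T}, B \subset A & #|B| = k.
Proof.
move=> kA; exists [set x in take k (enum A)].
  by apply/fintype.subsetP => x; rewrite inE => /mem_take; rewrite mem_enum.
rewrite cardsE; apply/eqP; rewrite (card_uniqP _) ?take_uniq ?enum_uniq// size_take -cardE.
by case: ltnP kA => // A1 A2; rewrite eqn_leq A2 A1.
Qed.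

(** * Sets of roots that a curve of winding number 0 can enclose *)

Section BalancedSets.
Variables (R : realType) (m : nat) (n : nat -> nat).
Hypotheses (hm : (0 < m)%N) (hn : forall i : nat, (i <= m)%N -> (0 < n i)%N).
Local Notation C := R[i].
Local Notation N := (toda_dim m n).
Local Notation dA := (deg_zeros m n).
Local Notation n0 := ((n 0)%:R : C).
Local Notation n1 := ((n 1)%:R : C).
Local Notation eps := (sign_vector R hm).

Implicit Types (b : bool) (T : {set 'I_N}) (K : {set 'I_dA}) (Q : {set 'I_m.-1}).

(* [T] collects the roots to be enclosed by a curve, and [b] tells whether the
   pole 0 is enclosed: the winding number of lambda along it then vanishes. *)
Definition balanced b T := \sum_(r in T) eps r = n1 * b%:R.

(** The components of dF_{g,0} in the coframe d log rho_r for a curve with index 1 at the roots in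
    T, 0 at the others, and index b at the origin (compare [derive_F0]). *)
Definition balanced_row b T : 'rV[C]_N := \row_r - (eps r * ((r \in T)%:R - b%:R)).

Definition root_set K Q : {set 'I_N} :=
  [set r | match fintype.split (cast_ord (dimE' n hm) r) with inl j => j \in K | inr i => i \in Q end].

Lemma root_set_zero K Q j : (zero_index hm j \in root_set K Q) = (j \in K).
Proof. by rewrite inE /zero_index cast_ordKV; case: split_ordP => l /= E; [rewrite (lshift_inj E)|move/eqP: E; rewrite eq_lrshift]. Qed.

Lemma root_set_pole K Q i : (pole_index n hm i \in root_set K Q) = (i \in Q).
Proof. by rewrite inE /pole_index cast_ordKV; case: split_ordP => l /= E; [move/eqP: E; rewrite eq_rlshift|rewrite (rshift_inj E)]. Qed.

Lemma sum_root_set K Q (F : 'I_N -> C) :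
  \sum_(r in root_set K Q) F r = \sum_(j in K) F (zero_index hm j) + \sum_(i in Q) F (pole_index n hm i).
Proof.
rewrite big_mkcond big_root_index /= [in RHS]big_mkcond [X in _ = _ + X]big_mkcond.
by congr (_ + _); apply: eq_bigr => k _; rewrite ?root_set_zero ?root_set_pole.
Qed.

Lemma sum_sign_root_set K Q : \sum_(r in root_set K Q) eps r = #|K|%:R - \sum_(i in Q) (n i.+2)%:R.
Proof.
rewrite sum_root_set; congr (_ + _).
  by rewrite -sum1_card natr_sum; apply: eq_bigr => j _; rewrite sign_zero.
by rewrite -sumrN; apply: eq_bigr => i _; rewrite sign_pole.
Qed.

Lemma deg_zerosE : dA = (n 0 + (n 1 + \sum_(i < m.-1) n i.+2))%N.
Proof.
rewrite /deg_zeros; congr (_ + _)%N.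
case: m hm => // k _; rewrite big_ltn//; congr (_ + _)%N.
by rewrite big_add1 /= big_add1 /= big_mkord.
Qed.

Lemma sum_sign : \sum_(r < N) eps r = n0 + n1.
Proof.
rewrite big_root_index /= (eq_bigr (fun=> 1)) => [|j _]; last by rewrite sign_zero.
rewrite [X in _ + X](eq_bigr (fun i : 'I_m.-1 => - (n i.+2)%:R)) => [|i _]; last by rewrite sign_pole.
by rewrite sumrN sumr_const card_ord deg_zerosE !natrD natr_sum addrA addrK.
Qed.

(** Let y be orthogonal to all rows. Sets of n_1 zeros taken with the origin, in which one zero is
    exchanged, show that y is constant on zeros; a pole with n_i zeros gives the same value d at the
    pole; n_1 zeros with the origin finally give n_0 d = 0. *)
Lemma balanced_rows_span (y : 'I_N -> C) :
  (forall b T, balanced b T -> \sum_r balanced_row b T 0 r * y r = 0) -> forall r, y r = 0.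
Proof.
move=> H; have n0p : (0 < n 0)%N by exact: hn.
have n1p : (0 < n 1)%N by exact: hn.
have rowE b T : \sum_r balanced_row b T 0 r * y r =
    b%:R * (\sum_r eps r * y r) - \sum_(r in T) eps r * y r.
  rewrite [X in _ = _ - X]big_mkcond mulr_sumr -sumrB; apply: eq_bigr => r _; rewrite mxE.
  by case: (r \in T); rewrite /= ?mulr1n ?mulr0n; ring.
have sumT K Q : \sum_(r in root_set K Q) eps r * y r =
    \sum_(j in K) y (zero_index hm j) - \sum_(i in Q) (n i.+2)%:R * y (pole_index n hm i).
  rewrite sum_root_set -sumrN; congr (_ + _); apply: eq_bigr => j _.
    by rewrite sign_zero mul1r.
  by rewrite sign_pole mulNr.
have Q0 (F : 'I_m.-1 -> C) : \sum_(i in (finset.set0 : {set 'I_m.-1})) F i = 0 by apply: big_pred0 => i; rewrite inE.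
have swap j j' : y (zero_index hm j) = y (zero_index hm j').
  have [->//|jj'] := eqVneq j j'.
  have cK : ((n 1).-1 <= #|~: [set j; j']%SET|)%N.
    by have := cardsC [set j; j']%SET; have := deg_zerosE; rewrite cards2 jj' card_ord; lia.
  have [K /fintype.subsetP KS cKE] := subset_of_card cK.
  have jK : j \notin K by apply/negP => /KS; rewrite !inE eqxx.
  have j'K : j' \notin K by apply/negP => /KS; rewrite !inE eqxx orbT.
  have bal k : k \notin K -> balanced true (root_set (k |: K) finset.set0).
    by move=> kK; rewrite /balanced sum_sign_root_set cardsU1 kK cKE Q0 subr0 mulr1 add1n prednK.
  have E k : k \notin K -> y (zero_index hm k) = \sum_r eps r * y r - \sum_(j in K) y (zero_index hm j).
    move=> kK; have := H _ _ (bal k kK); rewrite rowE sumT big_setU1//= Q0 subr0 mul1r.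
    by move/eqP; rewrite opprD addrA addrAC subr_eq0 => /eqP <-.
  by rewrite (E j jK) (E j' j'K).
have j0 : 'I_dA by apply: (Ordinal (n := dA) (m := 0)); rewrite deg_zerosE; lia.
pose d := y (zero_index hm j0); have yz j : y (zero_index hm j) = d by exact: swap.
have zeros k : (k <= dA)%N -> exists K : {set 'I_dA}, #|K| = k.
  by move=> kd; have [|K _ KE] := @subset_of_card _ [set: 'I_dA]%SET k; [rewrite cardsT card_ord|exists K].
have sumK K : \sum_(j in K) y (zero_index hm j) = #|K|%:R * d.
  by rewrite (eq_bigr (fun=> d)) => [|j _]; [rewrite sumr_const mulr_natl|exact: yz].
have yp i : y (pole_index n hm i) = d.
  have ni : (n i.+2 <= dA)%N by rewrite deg_zerosE (bigD1 i)//=; lia.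
  have [K KE] := zeros _ ni.
  have bal : balanced false (root_set K [set i]%SET).
    by rewrite /balanced sum_sign_root_set KE big_set1 subrr mulr0.
  have := H _ _ bal; rewrite rowE sumT sumK KE big_set1 mul0r sub0r -mulrBr => /eqP.
  have npos : (n i.+2)%:R != 0 :> C by rewrite pnatr_eq0 -lt0n hn//; have := ltn_ord i; lia.
  by rewrite oppr_eq0 mulf_eq0 (negPf npos) subr_eq0 => /eqP.
have yd r : y r = d by apply: (root_index_case (P := fun r => y r = d) yz yp).
suff d0 : d = 0 by move=> r; rewrite yd.
have n1d : (n 1 <= dA)%N by rewrite deg_zerosE; lia.
have [K KE] := zeros _ n1d.
have bal : balanced true (root_set K finset.set0).
  by rewrite /balanced sum_sign_root_set KE Q0 subr0 mulr1.
have := H _ _ bal; rewrite rowE sumT sumK KE Q0 subr0 mul1r.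
have -> : \sum_r eps r * y r = (n0 + n1) * d by rewrite -sum_sign mulr_suml; apply: eq_bigr => r _; rewrite yd.
rewrite mulrDl addrK => /eqP; rewrite mulf_eq0 pnatr_eq0 => /orP[|/eqP//].
by rewrite eqn0Ngt n0p.
Qed.

Lemma balanced_basis : exists (b : 'I_N -> bool) (T : 'I_N -> {set 'I_N}),
  (forall i, balanced (b i) (T i)) /\ \matrix_(i, r) balanced_row (b i) (T i) 0 r \in unitmx.
Proof.
pose I : finType := (bool * {set 'I_N})%type; pose bal (x : I) := \sum_(r in x.2) eps r == n1 * x.1%:R.
(* Unbalanced pairs give zero rows, which cannot occur in an invertible selection. *)
pose M : 'M[C]_(#|I|, N) := \matrix_(k, r) if bal (enum_val k) then balanced_row (enum_val k).1 (enum_val k).2 0 r else 0.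
have fM : row_full M.
  rewrite /row_full -mxrank_tr -/(row_free M^T) -kermx_eq0; apply/eqP/row_matrixP => k; rewrite row0.
  have K0 : row k (kermx M^T) *m M^T = 0 by apply/sub_kermxP; exact: row_sub.
  apply/rowP => r; rewrite [RHS]mxE.
  apply: (balanced_rows_span (y := fun r => row k (kermx M^T) 0 r)) => b T bT.
  have := congr1 (fun w : 'rV[C]_#|I| => w 0 (enum_rank (b, T))) K0; rewrite [RHS]mxE; apply: etrans.
  rewrite [RHS]mxE; apply: eq_bigr => q _; rewrite mulrC; congr (_ * _).
  by rewrite [M^T _ _]mxE [M _ _]mxE enum_rankK /bal /= bT eqxx.
pose f := fullrankfun fM; pose x i := enum_val (f i) : I.
have uM : rowsub f M \in unitmx by rewrite -row_full_unit; exact: fullrowsub_full.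
have balx i : bal (x i).
  apply/negPn/negP => nb; have : row i (rowsub f M) = 0.
    by apply/rowP => r; rewrite !mxE (negPf nb).
  move=> r0; have := congr1 (fun A => row i A) (mulmxV uM); rewrite row_mul r0 mul0mx => /rowP/(_ i).
  by rewrite !mxE eqxx => /esym/eqP; rewrite oner_eq0.
exists (fun i => (x i).1), (fun i => (x i).2); split=> [i|]; first by apply/eqP; exact: balx.
suff -> : \matrix_(i, r) balanced_row (x i).1 (x i).2 0 r = rowsub f M by [].
by apply/matrixP => i r; rewrite [LHS]mxE [RHS]mxE [RHS]mxE -/(x i) balx.
Qed.

End BalancedSets.

(** * Winding number and dF for a curve with prescribed indices *)

Section BalancedCurves.
Variables (R : realType) (m : nat) (n : nat -> nat).
Hypotheses (hm : (0 < m)%N) (hn : forall i : nat, (i <= m)%N -> (0 < n i)%N).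
Local Notation C := R[i].
Local Notation N := (toda_dim m n).
Local Notation V := 'rV[C]_N.
Local Notation n0 := ((n 0)%:R : C).
Local Notation n1 := ((n 1)%:R : C).
Local Notation eps := (sign_vector R hm).
Local Notation Mt := (@toda_manifold R m n).
Implicit Types (a b u : V).

Section OneCurve.
Variables (g : R -> C).
Hypotheses (Cg : C1_curve g) (g01 : g 0 = g 1).
Local Notation g' := (curve_deriv g).
Let Pg := C1_path Cg.

Section AtPoint.
Variables (a : V) (z : 'I_(deg_zeros m n) -> C).
Hypothesis EA : lamA a = n0^-1 *: \prod_j ('X - (z j)%:P).
Local Notation rho := (root_vector hm z a).
Hypotheses (off : forall r, off_curve g (rho r)) (off0 : off_curve g 0).

Lemma off_roots_poles (t : R) : 0 <= t <= 1 -> ~ lam_pole a (g t).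
Proof.
move=> t01; apply/npoleP => i; rewrite mem_r; case: i => [|[|i]] // Hi.
  by have := off0 t01; rewrite pole1.
have ii : (i < m.-1)%N by lia.
by have := off (pole_index n hm (Ordinal ii)) t01; rewrite root_vector_pole.
Qed.

Lemma lam_product (t : R) : 0 <= t <= 1 -> lam a (g t) =
  n0^-1 * \prod_j (g t - z j) / ((g t - 0) ^+ n 1 * \prod_(i < m.-1) (g t - pole a i.+2) ^+ n i.+2).
Proof.
move=> t01; rewrite (lamE (off_roots_poles t01)) EA (lamB_horner hm) hornerZ horner_prod subr0.
congr (_ * _ / _); apply: eq_bigr => j _; exact: hornerXsubC.
Qed.

Lemma off_roots : off_zeros_poles g a.
Proof.
move=> t t01; have Hp := off_roots_poles t01; split=> //; rewrite lam_product//.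
have g0 : g t - 0 != 0 by rewrite subr_eq0; exact: off0.
rewrite mulf_neq0// ?mulf_neq0// ?invr_eq0 ?mulf_neq0 ?expf_neq0// ?invr_eq0 ?(n0_neq0 R hn)//.
  by apply/prodf_neq0 => j _; rewrite subr_eq0; have := off (zero_index hm j) t01; rewrite root_vector_zero.
apply/prodf_neq0 => i _; rewrite expf_neq0// subr_eq0.
by have := off (pole_index n hm i) t01; rewrite root_vector_pole.
Qed.

(** The argument principle: a logarithm of lambda along g is assembled from logarithms of its linear
    factors, each of which jumps by its index integral. *)
Lemma winding_lam : winding (fun t => lam a (g t)) 0 =
  (two_pi_i R)^-1 * (\sum_r eps r * index_integral g g' (rho r) - n1 * index_integral g g' 0).
Proof.
have [lg [clg Plg Elg]] := logarithms_exist Pg.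
have [c0 Ec0] : exists c, cexp c = n0^-1 by apply: cexp_surj; rewrite invr_eq0 (n0_neq0 R hn).
pose L t := c0 + \sum_j lg (z j) t - (n1 * lg 0 t + \sum_(i < m.-1) (n i.+2)%:R * lg (pole a i.+2) t).
have offz j : off_curve g (z j) by have := off (zero_index hm j); rewrite root_vector_zero.
have offp (i : 'I_m.-1) : off_curve g (pole a i.+2).
  by have := off (pole_index n hm i); rewrite root_vector_pole.
have cexp_prod (I : finType) (F : I -> C) : cexp (\sum_i F i) = \prod_i cexp (F i).
  exact: (big_morph _ (@cexpD R) (@cexp0 R)).
have cL : pcont L.
  apply: pcontD; first by apply: pcontD; [exact: pcont_cst|apply: pcont_sum => j _; exact: clg].
  apply: pcontN; apply: pcontD; first by apply: pcontM; [exact: pcont_cst|exact: clg].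
  by apply: pcont_sum => i _; apply: pcontM; [exact: pcont_cst|exact: clg].
have EL (t : R) : 0 <= t <= 1 -> cexp (L t) = lam a (g t).
  move=> t01; rewrite lam_product// /L cexpB !cexpD Ec0 cexpMn (Elg _ off0 t t01) !cexp_prod.
  congr (_ * _ / (_ * _)); apply: eq_bigr => i _; first by rewrite Elg.
  by rewrite cexpMn Elg.
rewrite (winding_log hm Cg off_roots cL EL); congr (_ * _).
have jump w : off_curve g w -> lg w 1 - lg w 0 = index_integral g g' w by exact: (lg_jump Plg).
rewrite big_root_index /= -(jump 0 off0).
have -> : \sum_j eps (zero_index hm j) * index_integral g g' (rho (zero_index hm j)) =
    \sum_j lg (z j) 1 - \sum_j lg (z j) 0.
  rewrite -sumrB; apply: eq_bigr => j _.
  by rewrite sign_zero mul1r root_vector_zero (jump _ (offz j)).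
have -> : \sum_i eps (pole_index n hm i) * index_integral g g' (rho (pole_index n hm i)) =
    \sum_(i < m.-1) (n i.+2)%:R * lg (pole a i.+2) 0 - \sum_(i < m.-1) (n i.+2)%:R * lg (pole a i.+2) 1.
  rewrite -sumrB; apply: eq_bigr => i _.
  by rewrite sign_pole root_vector_pole -(jump _ (offp i)) mulNr -mulrBr -mulrN opprB.
rewrite /L; move: (\sum_j _) (\sum_j _) (\sum_i _) (\sum_i _) (lg 0 1) (lg 0 0) => x1 x2 x3 x4 x5 x6.
by ring.
Qed.

Lemma balanced_zero_winding (b : bool) (T : {set 'I_N}) : balanced R hm b T ->
  (forall r, index_integral g g' (rho r) = two_pi_i R * (r \in T)%:R) ->
  index_integral g g' 0 = two_pi_i R * b%:R -> zero_winding a g.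
Proof.
move=> bT Hr H0; split; first exact: off_roots.
rewrite winding_lam H0 (eq_bigr (fun r => two_pi_i R * (eps r * (r \in T)%:R))) => [|r _]; last first.
  by rewrite Hr mulrCA.
rewrite -mulr_sumr; have -> : \sum_r eps r * (r \in T)%:R = n1 * b%:R.
  by rewrite -bT [RHS]big_mkcond; apply: eq_bigr => r _; case: (r \in T); rewrite /= ?mulr1 ?mulr0.
by rewrite [n1 * (_ * _)]mulrCA subrr mulr0.
Qed.

End AtPoint.

Section Derivative.
Variables (U : set V) (L : V -> R -> C).
Hypotheses (oU : open U) (UM : U `<=` Mt).
Hypotheses (HZ : forall a, U a -> zero_winding a g) (HL : log_branch U g L).
Variables (z : 'I_(deg_zeros m n) -> V -> C).
Hypotheses (zinj : forall a, U a -> injective (z^~ a)).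
Hypotheses (EA : forall a, U a -> lamA a = n0^-1 *: \prod_j ('X - (z j a)%:P)).
Local Notation rho a := (root_vector hm (z^~ a) a).
Hypotheses (off : forall a r, U a -> off_curve g (rho a r)) (off0 : off_curve g 0).

(** The partial fractions rho / (z (z - rho)) = 1 / (z - rho) - 1 / z turn the integral into index
    integrals. *)
Lemma derive_F0 a u : U a -> 'D_u (fun b => toda_F g (L b) 0) a =
  \sum_r - (eps r * ((two_pi_i R)^-1 * index_integral g g' (rho a r) -
     (two_pi_i R)^-1 * index_integral g g' 0)) * tell a (rho a) eps u r.
Proof.
move=> Ua; have gn0 (s : R) : 0 <= s <= 1 -> g s != 0 by exact: off0.
rewrite (derive_toda_F hm Cg oU HZ HL gn0 u 0 Ua).
have BU : U `<=` U by [].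
have cV w : off_curve g w -> pcont (fun s => g' s / (g s - w)).
  move=> ow; have [cg cg' _] := Pg; apply: pcontM => //; apply: pcontV => [|s s01].
    by apply: pcontD => //; exact: pcont_cst.
  by rewrite subr_eq0; exact: ow.
have -> : cint (fun s => log_power L 0 a s * log_form g a u s * (g' s / g s)) =
   cint (fun s => \sum_r (- (eps r * tell a (rho a) eps u r)) * (g' s / (g s - rho a r) - g' s / (g s - 0))).
  apply: cint_ext => s s01; rewrite /log_power expr0 fact0 divr1 mul1r.
  rewrite (log_form_roots hm hn UM HZ BU zinj EA u Ua s01) mulNr mulr_suml -sumrN; apply: eq_bigr => r _.
  rewrite subr0; have := gn0 s s01; have : g s - rho a r != 0 by rewrite subr_eq0; exact: off.
  move: (tell _ _ _ _ _) (eps r) (g' s) => y x v; set w := g s; set p := rho a r => w0 wp.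
  by field; rewrite wp w0.
rewrite cint_sum => [|r _]; last first.
  apply: pcontM; first exact: pcont_cst.
  by apply: pcontD; [exact: cV (off r Ua)|apply: pcontN; exact: cV].
rewrite mulr_sumr; apply: eq_bigr => r _.
rewrite cintZ ?cintB; [|exact: cV (off r Ua)|exact: cV|]; last first.
  by apply: pcontD; [exact: cV (off r Ua)|apply: pcontN; exact: cV].
rewrite -/(index_integral g g' _) -/(index_integral g g' 0).
move: (tell _ _ _ _ _) (eps r) (two_pi_i R)^-1 => y x v.
move: (index_integral _ _ _) (index_integral _ _ _) => p q.
by ring.
Qed.

End Derivative.
End OneCurve.
End BalancedCurves.

(** * Local injectivity from an invertible Jacobian *)

Section LocalInjectivity.
Variables (R : realType) (N : nat).
Local Notation C := R[i].
Local Notation V := 'rV[C]_N.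
Implicit Types (a b v : V).

Lemma vball_segment a0 (d : R) a b (s : R) : vball a0 d a -> vball a0 d b -> 0 <= s <= 1 ->
  vball a0 d (a + s%:C *: (b - a)).
Proof.
rewrite /vball /= => Ha Hb /andP[s0 s1].
have -> : a + s%:C *: (b - a) - a0 = (1 - s)%:C *: (a - a0) + s%:C *: (b - a0).
  by rewrite rmorphB rmorph1 scalerBl scale1r !scalerBr; apply/rowP => k; rewrite !mxE; ring.
apply: (le_lt_trans (vabsD _ _)); rewrite !vabsZ !cabsR !ger0_norm ?subr_ge0//.
have x0 := vabs_ge0 (a - a0); have y0 := vabs_ge0 (b - a0).
move: Ha Hb x0 y0; set x := vabs _; set y := vabs _ => xd yd x0 y0.
have [xy|/ltW yx] := leP x y.
  have : (1 - s) * x <= (1 - s) * y by rewrite ler_wpM2l// subr_ge0.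
  lra.
have : s * y <= s * x by rewrite ler_wpM2l.
lra.
Qed.

(** After composition with the inverse Jacobian at a0 the derivative is close to the identity. If
    all t_i agree at a and b, the mean value inequality gives |b - a| <= |b - a| / 2. *)
Lemma locally_injective (U : set V) (t : 'I_N -> V -> C) a0 : open U -> U a0 ->
  (forall i, all_smooth U (t i)) -> (\matrix_(i, l) partial l (t i) a0) \in unitmx ->
  exists2 d : R, 0 < d & forall a b, vball a0 d a -> vball a0 d b ->
    (forall i, t i a = t i b) -> a = b.
Proof.
move=> oU Ua St UJ; set J := \matrix_(i, l) _ in UJ.
pose f i b := \sum_j invmx J i j * t j b.
have Stj i j : all_smooth U (fun b => invmx J i j * t j b) by move=> k; apply: smoothZ; exact: St.
have Sf i : all_smooth U (f i) by apply: all_smooth_sum.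
have fJ i l : partial l (f i) a0 = (i == l)%:R.
  rewrite (partial_sum l (Stj i) Ua).
  have := congr1 (fun M : 'M[C]_N => M i l) (mulVmx UJ); rewrite !mxE => <-.
  apply: eq_bigr => j _; rewrite (partialM l (all_smooth_cst U (invmx J i j)) (St j) Ua).
  by rewrite partial_cst mul0r addr0; congr (_ * _); rewrite mxE.
pose x : R := (4 * N.+1%:R)^-1; have x0 : 0 < x by rewrite invr_gt0 mulr_gt0// ltr0n.
have nr i l : \forall b \near a0, cabs (partial l (f i) b - (i == l)%:R) < x.
  have := ud_near (ud_partial (smooth_partial oU l (Sf i)) Ua) x0; rewrite -fJ.
  have i0 : 0 <= (0 : R) <= 1 by rewrite lexx ler01.
  by move=> /nbhs_vabs[d d0 Hd]; apply/nbhs_vabs; exists d => // b /Hd H; exact: (H 0 i0).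
have := near_mono2 (fun b => @conj _ _) (open_near oU Ua) (near_fin (fun i => near_fin (nr i))).
move=> /nbhs_vabs[d d0 Hd]; exists d => // a b Ba Bb tab; apply/eqP; rewrite eq_sym -subr_eq0.
set v := b - a.
have vi i : cabs (v 0 i) <= 2 * (vabs v * x).
  have H (s : R) : 0 <= s <= 1 -> _ := fun s01 => Hd _ (vball_segment Ba Bb s01).
  have fab : f i (a + v) - f i a = 0.
    by rewrite /v [a + _]addrC subrK; apply/eqP; rewrite subr_eq0; apply/eqP; apply: eq_bigr => j _; rewrite tab.
  rewrite -cabsN -[- _]add0r -fab.
  apply: (mean_value (c := fun k => partial k (f i))) => s s01.
    exact: (ud_partial (Sf i) (H s s01).1).
  have -> : v 0 i = \sum_k v 0 k * (i == k)%:R.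
    by rewrite (bigD1 i)//= eqxx mulr1 big1 ?addr0// => k ki; rewrite eq_sym (negPf ki) mulr0.
  rewrite -sumrB; apply: (le_trans (cabs_sum _ _ _)); rewrite mulr_suml; apply: ler_sum => k _.
  by rewrite -mulrBr cabsM ler_wpM2l ?cabs_ge0// ltW//; exact: (H s s01).2.
have : vabs v <= vabs v * 2^-1.
  apply: (@le_trans _ _ (\sum_(i < N) 2 * (vabs v * x))); first by apply: ler_sum => i _; exact: vi.
  rewrite sumr_const card_ord; have V0 : 0 <= vabs v * x by rewrite mulr_ge0 ?vabs_ge0// ltW.
  have xN : x * (N%:R + 1) = 4^-1 by rewrite natr1 /x invfM divfK// pnatr_eq0.
  have -> : 2 * (vabs v * x) *+ N = 2 * vabs v * (x * (N%:R + 1)) - 2 * (vabs v * x) by rewrite -[LHS]mulr_natl; ring.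
  by rewrite xN; move: V0; set y := vabs v * x; lra.
have v0 := vabs_ge0 v => vv; have {}v0 : vabs v = 0 by move: v0 vv; set y := vabs v; lra.
apply/eqP/rowP => k; rewrite [RHS]mxE; apply/eqP; rewrite -cabs_eq0 eq_le cabs_ge0 andbT -v0.
exact: vabs_entry.
Qed.

End LocalInjectivity.

(** * Complete systems of densities near a point *)

Section CompleteSystems.
Variables (R : realType) (m : nat) (n : nat -> nat).
Hypotheses (hm : (0 < m)%N) (hn : forall i : nat, (i <= m)%N -> (0 < n i)%N).
Local Notation C := R[i].
Local Notation N := (toda_dim m n).
Local Notation V := 'rV[C]_N.
Local Notation n0 := ((n 0)%:R : C).
Local Notation eps := (sign_vector R hm).
Implicit Types (a b u : V).
Variables (e E : V -> V).
Hypotheses (he : toda_unit_field e) (hE : toda_euler_field E).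

Lemma enclosing_curve (rho : 'I_N -> C) (b : bool) (T : {set 'I_N}) :
  injective rho -> (forall r, rho r != 0) -> exists g : R -> C, [/\ simple_closed_curve g,
    forall r, off_curve g (rho r) /\ index_integral g (curve_deriv g) (rho r) = two_pi_i R * (r \in T)%:R,
    off_curve g 0 & index_integral g (curve_deriv g) 0 = two_pi_i R * b%:R].
Proof.
move=> ri r0; pose s (Q : {set 'I_N}) (c : bool) := nseq c 0 ++ [seq rho r | r <- enum Q].
have sE (Q : {set 'I_N}) c r : (rho r \in s Q c) = (r \in Q).
  by rewrite mem_cat mem_nseq (negPf (r0 r)) andbF mem_map// mem_enum.
have s0 (Q : {set 'I_N}) c : (0 \in s Q c) = c.
  rewrite mem_cat mem_nseq eqxx andbT lt0b; case: c => //=.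
  by apply/negP => /mapP[r _ /eqP]; rewrite eq_sym (negPf (r0 r)).
have [|g [sg gA gB]] := @separating_curve R (s T b) (s (~: T)%SET (~~ b)).
  move=> z; rewrite mem_cat => /orP[|/mapP[r rT ->]]; last by rewrite sE inE negbK -mem_enum.
  by case: (b) => //=; rewrite inE => /eqP ->; rewrite s0.
exists g; split=> // [r||].
- by case rT: (r \in T); [rewrite mulr1; apply: gA; rewrite sE|rewrite mulr0; apply: gB; rewrite sE inE rT].
- by case bb: b; [have [] := gA 0 _|have [] := gB 0 _]; rewrite ?s0 ?bb.
- by case bb: b; [rewrite mulr1; apply: (gA 0 _).2|rewrite mulr0; apply: (gB 0 _).2]; rewrite s0 bb.
Qed.

Lemma index_near (U : set V) (f : V -> C) (g : R -> C) a : C1_curve g -> g 0 = g 1 ->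
  all_smooth U f -> U a -> off_curve g (f a) -> \forall b \near a, off_curve g (f b) /\
    index_integral g (curve_deriv g) (f b) = index_integral g (curve_deriv g) (f a).
Proof.
move=> Cg g01 Sf Ua offa; have [d d0 Hd] := index_locally_constant (C1_path Cg) g01 offa.
have /nbhs_vabs[x x0 Hx] := ud_near (ud_partial Sf Ua) d0.
by apply/nbhs_vabs; exists x => // b /Hx H; apply: Hd; apply: (H 0); rewrite lexx ler01.
Qed.

(** If functions F_i have Gram matrix Y H Y^T, the functions t = (Y H Y^T)^-1 F have the inverse
    matrix G as Gram matrix, and F_i = sum_j (G^-1)_{ij} t_j is the required initial density. *)
Lemma inverse_gram (Y H : 'M[C]_N) : Y \in unitmx -> H \in unitmx -> H^T = H ->
  [/\ Y *m H *m Y^T \in unitmx, invmx (Y *m H *m Y^T) *m Y \in unitmx &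
    (invmx (Y *m H *m Y^T) *m Y) *m H *m (invmx (Y *m H *m Y^T) *m Y)^T = invmx (Y *m H *m Y^T)].
Proof.
move=> UY UH HT; have UG : Y *m H *m Y^T \in unitmx by rewrite !unitmx_mul unitmx_tr UY UH.
split=> //; first by rewrite unitmx_mul unitmx_inv UG UY.
set Gh := Y *m H *m Y^T in UG *; have GT : Gh^T = Gh by rewrite !trmx_mul trmxK HT mulmxA.
rewrite trmx_mul trmx_inv GT; transitivity (invmx Gh *m Gh *m invmx Gh); first by rewrite /Gh !mulmxA.
by rewrite mulVmx// mul1mx.
Qed.

(** The flat coordinates are built from the densities: the curves of [balanced_basis] give N
    functions F_{g,0} with independent differentials of constant components in d log rho, hence with
    a constant Gram matrix. *)
Lemma complete_densities a0 : toda_dual_manifold E a0 ->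
  exists (U : set V) (t : 'I_N -> V -> C) (G : 'M[C]_N) (g : 'I_N -> R -> C) (L : 'I_N -> V -> R -> C),
    [/\ U a0, flat_coordinates E U t G, forall i, simple_closed_curve (g i),
      forall i, (forall a, U a -> zero_winding a (g i)) /\ log_branch U (g i) (L i) &
      hamiltonian_densities e E U t G (fun i p a => toda_F (g i) (L i a) p)].
Proof.
move=> Da0; have [U1 [z [oU1 U1a U1M HU1 sz]]] := dual_local hm hn hE Da0.
pose rho a := root_vector hm (z^~ a) a.
have zinj1 a : U1 a -> injective (z^~ a) by move=> /HU1[].
have EA1 a : U1 a -> lamA a = n0^-1 *: \prod_j ('X - (z j a)%:P) by move=> /HU1[].
have RD0 := root_functions_data hm hn U1M zinj1 EA1 U1a.
have [b [T [bT UY]]] := balanced_basis R hm hn; set Y := \matrix_(i, r) _ in UY.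
have rho0 a r : U1 a -> rho a r != 0 by exact: rho_n0.
have /choice[g Hg] i := enclosing_curve (b i) (T i) (let: And4 H _ _ _ := RD0 in H) (fun r => rho0 a0 r U1a).
have sg i : simple_closed_curve (g i) by case: (Hg i).
have Cg i : C1_curve (g i) by case: (sg i).
have g01 i : g i 0 = g i 1 by case: (sg i).
have ind0 i : index_integral (g i) (curve_deriv (g i)) 0 = two_pi_i R * (b i)%:R by case: (Hg i).
have off0 i : off_curve (g i) 0 by case: (Hg i).
pose good a := U1 a /\ (toda_dual_manifold E a /\ forall i r, off_curve (g i) (rho a r) /\
  index_integral (g i) (curve_deriv (g i)) (rho a r) = two_pi_i R * (r \in T i)%:R).
(* Indices are locally constant, so curves chosen at a0 enclose the same roots at nearby points. *)
have nind : \forall a \near a0, forall i r, off_curve (g i) (rho a r) /\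
    index_integral (g i) (curve_deriv (g i)) (rho a r) = two_pi_i R * (r \in T i)%:R.
  apply: near_fin => i; apply: near_fin => r; have [_ /(_ r)[or <-] _ _] := Hg i.
  exact: (index_near (Cg i) (g01 i) (smooth_rho hm sz r) U1a or).
have ngood : \forall a \near a0, good a.
  have := near_mono2 (fun a => @conj _ _) (open_near oU1 U1a) (near_mono2 (fun a => @conj _ _) (dual_near hm hn hE Da0) nind).
  by move=> /nbhs_vabs[x x0 Hx]; apply/nbhs_vabs; exists x; [exact: x0|exact: Hx].
have /choice[dL HdL] i : exists dL : R * (V -> R -> C), [/\ 0 < dL.1, forall a, vball a0 dL.1 a -> good a,
    forall a, vball a0 dL.1 a -> zero_winding a (g i) & log_branch (vball a0 dL.1) (g i) dL.2].
  have [_ Hi _ _] := Hg i.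
  have Z0 := balanced_zero_winding hn (Cg i) (EA1 _ U1a) (fun r => (Hi r).1) (off0 i) (bT i) (fun r => (Hi r).2) (ind0 i).
  by have [d [L HL]] := ball_log_branch hm (Cg i) (g01 i) Z0 ngood; exists (d, L).
pose L i := (dL i).2.
have nballs : \forall a \near a0, forall i, vball a0 (dL i).1 a.
  apply: near_fin => i; apply: open_near; first exact: (@vball_open _ _ a0).
  by apply: vball_center; case: (HdL i).
have [d d0 Hd] := (nbhs_vabs _ _).1 (near_mono2 (fun a => @conj _ _) ngood nballs).
have zw i a : vball a0 d a -> zero_winding a (g i).
  by move=> /Hd[_ /(_ i)]; case: (HdL i) => _ _ H _; exact: H.
have lb (D : set V) i : D `<=` vball a0 d -> log_branch D (g i) (L i).
  have [_ _ _ [c1 c2]] := HdL i => sub; split=> [|a Da]; last by apply: c2; exact: ((Hd _ (sub a Da)).2 i).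
  apply/within_joint_continuous => a s Da s01 x x0.
  have [y [y0 Hy]] := (within_joint_continuous _ _).2 c1 a s ((Hd _ (sub a Da)).2 i) s01 x x0.
  by exists y; split=> // a' s' Da' s01' ? ?; apply: Hy => //; exact: ((Hd _ (sub a' Da')).2 i).
pose H := gram R n hm; have UH : H \in unitmx := gram_unit hm hn U1M zinj1 EA1 U1a.
have [UGh UZ GE] := inverse_gram UY UH (gram_sym R n hm).
set Gh := Y *m H *m Y^T in UGh UZ GE; set G := invmx Gh in UZ GE; set Z := G *m Y in UZ GE.
(* With this choice F_i is the coordinate with index lowered by the inverse of G. *)
pose F i a := toda_F (g i) (L i a) 0; pose t i a := \sum_k G i k * F k a.
have ovd x : open (vball a0 x) := @vball_open _ _ a0 x.
have subU1 : vball a0 d `<=` U1 by move=> a /Hd[[]].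
have subM : vball a0 d `<=` @toda_manifold R m n by move=> a /subU1/U1M.
have zinj a : vball a0 d a -> injective (z^~ a) by move=> /subU1/zinj1.
have EA a : vball a0 d a -> lamA a = n0^-1 *: \prod_j ('X - (z j a)%:P) by move=> /subU1/EA1.
have ind a i r : vball a0 d a -> off_curve (g i) (rho a r) /\
    index_integral (g i) (curve_deriv (g i)) (rho a r) = two_pi_i R * (r \in T i)%:R.
  by move=> /Hd[[_ [_ Hi]] _]; exact: Hi.
have sF i : all_smooth (vball a0 d) (F i).
  exact: (smooth_toda_F hm (Cg i) (ovd d) (zw i) (lb _ i (fun a Ha => Ha)) (off0 i) 0).
have dF i l a : vball a0 d a -> partial l (F i) a = (Y *m frame_mx hm z a) i l.
  move=> Ba; rewrite /partial (derive_F0 hn (Cg i) (ovd d) subM (zw i) (lb _ i (fun a Ha => Ha)) zinj EA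
    (fun a r Ba => (ind a i r Ba).1) (off0 i) (delta_mx 0 l) Ba) mxE; apply: eq_bigr => r _.
  by rewrite (ind a i r Ba).2 ind0 !mulKf ?two_pi_i_neq0// [Y i r]mxE [balanced_row R hm (b i) (T i) 0 r]mxE [frame_mx hm z a r l]mxE.
have sGF i k : all_smooth (vball a0 d) (fun a => G i k * F k a) by move=> l; apply: smoothZ; exact: sF.
have st i : all_smooth (vball a0 d) (t i) by apply: all_smooth_sum.
have dt i l a : vball a0 d a -> partial l (t i) a = (Z *m frame_mx hm z a) i l.
  move=> Ba; rewrite (partial_sum l (sGF i) Ba) /Z -mulmxA mxE; apply: eq_bigr => k _.
  by rewrite (partialM l (all_smooth_cst _ (G i k)) (sF k) Ba) partial_cst mul0r addr0 dF.
have Ba0 : vball a0 d a0 := vball_center a0 d0.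
have jacE a : vball a0 d a -> \matrix_(i, l) partial l (t i) a = Z *m frame_mx hm z a.
  by move=> Ba; apply/matrixP => i l; rewrite mxE dt.
have Ufr a : vball a0 d a -> frame_mx hm z a \in unitmx by exact: frame_unit.
have UJ a : vball a0 d a -> \matrix_(i, l) partial l (t i) a \in unitmx.
  move=> Ba; rewrite (jacE a Ba); have aux (A B : 'M[C]_N) : A \in unitmx -> B \in unitmx -> A *m B \in unitmx.
    by move=> UA UB; rewrite unitmx_mul UA UB.
  exact: (aux _ _ UZ (Ufr a Ba)).
have [d1 d10 inj1] := locally_injective (ovd d) Ba0 st (UJ a0 Ba0).
pose x := Num.min d d1; have x0 : 0 < x by rewrite lt_min d0.
have sub : vball a0 x `<=` vball a0 d by move=> a; rewrite /vball /= lt_min => /andP[].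
have FC : flat_coordinates E (vball a0 x) t G.
  split; first exact: ovd.
  - exact: vball_connected.
  - by move=> a /sub/Hd[[_ [? _]] _].
  - by move=> i; apply: smooth_holomorphic => [|l]; [exact: ovd|exact: (smooth_subset sub (st i l))].
  - by move=> a c; rewrite /vball /= !lt_min => /andP[_ Ha] /andP[_ Hc]; exact: inj1.
  - move=> a /sub Ba; have -> : jac_mx t a = \matrix_(i, l) partial l (t i) a by apply/matrixP => i l; rewrite !mxE.
    exact: UJ.
  move=> a i j /sub Ba; have dE k y : (differential (t k) a *m y^T) 0 0 = \sum_r Z k r * tell a (rho a) eps y r.
    rewrite mxE; under [RHS]eq_bigr => r _ do rewrite (tell_frame hm z y r (subU1 a Ba)) mulr_sumr.
    rewrite exchange_big /=; apply: eq_bigr => l _; rewrite !mxE -/(partial l (t k) a) dt// mxE mulr_suml.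
    by apply: eq_bigr => r _; rewrite mulrCA mulrC.
  have RDa := root_functions_data hm hn subM zinj EA Ba.
  rewrite (dual_form_roots hm hn hE (subM a Ba) RDa (dE i) (dE j)) (sum_gram hm) -GE.
  rewrite [RHS]mxE exchange_big /=; apply: eq_bigr => s _; rewrite [(_ *m H) _ _]mxE mulr_suml.
  by apply: eq_bigr => r _; rewrite [Z^T _ _]mxE.
have zwx i a : vball a0 x a -> zero_winding a (g i) by move=> /sub; exact: zw.
exists (vball a0 x), t, G, g, L; split=> //; first exact: vball_center.
  by move=> i; split; [exact: zwx|exact: lb].
split=> [i p|i a Ba|i].
- exact: (holomorphic_F hm FC (Cg i) (zwx i) (lb _ i sub) p).
- rewrite /G invmxK /t; under eq_bigr => j _ do rewrite mulr_sumr.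
  rewrite exchange_big /= (bigD1 i)//= [X in _ + X]big1 ?addr0 => [|k ki].
    have := congr1 (fun M : 'M[C]_N => M i i) (mulmxV UGh); rewrite !mxE eqxx => H1.
    rewrite -[LHS]mul1r -[1]H1 mulr_suml; apply: eq_bigr => j _; exact/esym/mulrA.
  have := congr1 (fun M : 'M[C]_N => M i k) (mulmxV UGh); rewrite !mxE eq_sym (negPf ki) => H1.
  by under eq_bigr => j _ do rewrite mulrA; rewrite -mulr_suml H1 mul0r.
- exact: (F_recursion hm hn he hE FC (Cg i) (g01 i) (zwx i) (lb _ i sub)).
Qed.

End CompleteSystems.

(** * The value of the first density *)

Section ValueOfF0.
Variables (R : realType) (m : nat) (n : nat -> nat).
Hypotheses (hm : (0 < m)%N) (hn : forall i : nat, (i <= m)%N -> (0 < n i)%N).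
Local Notation C := R[i].
Local Notation N := (toda_dim m n).
Local Notation V := 'rV[C]_N.
Local Notation n0 := ((n 0)%:R : C).
Local Notation prodX s := (\prod_(w <- s) ('X - w%:P)).

(** After clearing denominators, leading coefficients fix the constant as n_0^-1, and degrees show
    that zeros outnumber poles by n_0. *)
Lemma zeros_and_poles_poly (a : V) (q p : seq C) : zeros_and_poles (lam a) q p ->
  lamA a * prodX p = n0^-1 *: (prodX q * lamB a) /\ size q = (size p + n 0)%N.
Proof.
move=> [_ [c c0 Hc]]; have E : lamA a * prodX p = c *: (prodX q * lamB a).
  apply: (poly_eq_off (s := p ++ [seq pole a i | i <- index_iota 1 m.+1])) => z.
  rewrite mem_cat negb_or => /andP[zp /poleP zl].
  have B0 := lamBn0 zl; have P0 : (prodX p).[z] != 0 by rewrite -rootE root_prod_XsubC.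
  have := Hc z zp; rewrite (lamE zl) -!horner_prodXsubC hornerM hornerZ [(prodX q * _).[_]]hornerM.
  by move=> /eqP; rewrite eqr_div// => /eqP ->; rewrite mulrA.
have mB : lamB a \is monic by exact: monic_pf_den.
have mp (s : seq C) : prodX s \is monic by exact: monic_prod_XsubC.
have cE : c = n0^-1.
  have := congr1 (fun P => lead_coef P) E.
  by rewrite lead_coefZ !lead_coefM lead_lamA// (monicP mB) (monicP (mp p)) (monicP (mp q)) !mulr1.
rewrite -cE; split=> //; have A0 : lamA a != 0 by rewrite -size_poly_gt0 size_lamA.
have aux (A P Q B : {poly C}) : A != 0 -> P != 0 -> Q != 0 -> B != 0 -> A * P = c *: (Q * B) ->
    (size A + size P = size Q + size B)%N.
  move=> hA hP hQ hB /(congr1 (fun S : {poly C} => size S)); rewrite size_scale// !size_mul//.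
  move: hA hP hQ hB; rewrite -!size_poly_gt0.
  by move: (size A) (size P) (size Q) (size B) => x1 x2 x3 x4; lia.
have := aux _ _ _ _ A0 (monic_neq0 (mp p)) (monic_neq0 (mp q)) (monic_neq0 mB) E.
rewrite size_lamA// !size_prod_XsubC (size_pf_den _ _ _).
by lia.
Qed.

Lemma prod_expz (I : Type) (s : seq I) (F : I -> C) (k : int) :
  \prod_(x <- s) F x ^ k = (\prod_(x <- s) F x) ^ k.
Proof. by rewrite (big_morph _ (fun x y => expfzMl x y k) (exp1rz _ k)). Qed.

Lemma cexp_signed (b : bool) (x : C) : cexp ((-1) ^+ b * x) = cexp x ^ ((-1) ^+ b : int).
Proof. by case: b; rewrite /= ?expr1 ?expr0 ?mul1r ?expr1z// mulN1r cexpN exprN1. Qed.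

Lemma cexp_pi_i : cexp (0 +i* pi : C) = -1.
Proof. by rewrite /cexp /= expR0 cospi sinpi mul1r; apply: cplx_eq; rewrite /= ?oppr0. Qed.

Lemma cexp_ln_nat (k : nat) : (0 < k)%N -> cexp ((ln k%:R)%:C : C) = k%:R.
Proof.
move=> k0; rewrite -(rmorph_nat (real_complex R)) /cexp /= cos0 sin0 lnK ?posrE ?ltr0n//.
by apply: cplx_eq; rewrite !cplxE /=; lra.
Qed.

Lemma cexp_mod (x y : C) : cexp x = cexp y -> exists j : int, x = y + j%:~R * two_pi_i R.
Proof.
move=> H; have /cexp_eq1[j E] : cexp (x - y) = 1 by rewrite cexpB H divff// cexp_neq0.
by exists j; rewrite -E addrC subrK.
Qed.

(** The index of 0 is 0 or that of the orientation. With 0 enclosed, the leading coefficient n_0^-1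
    contributes log n_0, and the n_0 excess zeros outside, through factors - q, contribute n_0 pi i.
    As the lists of logarithms are arbitrary, values are determined modulo 2 pi i. *)
Lemma value_F0 (a : V) (g L : R -> C) (b : bool) (qin qout pin pout : seq C) :
  simple_closed_curve g -> has_orientation b g -> zero_winding a g -> log_along a g L ->
  zeros_and_poles (lam a) (qin ++ qout) (pin ++ pout) ->
  (forall z, z \in qin ++ pin -> enclosed g z) -> (forall z, z \in qout ++ pout -> ~ enclosed g z) ->
  [/\ size qin = size pin,
      ~ enclosed g 0 -> forall lq lp : seq C, map (@cexp R) lq = qin -> map (@cexp R) lp = pin ->
        exists j : int, toda_F g L 0%N =
          (-1) ^+ b * (\sum_(x <- lp) x - \sum_(x <- lq) x) + j%:~R * two_pi_i R &
      enclosed g 0 -> forall lq lp : seq C, map (@cexp R) lq = qout -> map (@cexp R) lp = pout ->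
        exists j : int, toda_F g L 0%N =
          - (-1) ^+ b * (\sum_(x <- lp) x - \sum_(x <- lq) x + (ln (n 0%N)%:R)%:C + n0 * (0 +i* pi))
          + j%:~R * two_pi_i R].
Proof.
move=> [Cg g01 _] ori Z HL zp Hin Hout; have Pg := C1_path Cg.
have [E sqp] := zeros_and_poles_poly zp; have [dis _] := zp; have [off _] := Z.
have offE (t : R) : 0 <= t <= 1 -> (g t \notin qin ++ qout) /\ (g t \notin pin ++ pout).
  move=> t01; have [Hp lam0] := off t t01; have B0 := lamBn0 Hp.
  have A0 : (lamA a).[g t] != 0 by apply: contraNneq lam0 => A0; rewrite (lamE Hp) A0 mul0r.
  have := congr1 (fun P => root P (g t)) E.
  rewrite /= rootM rootZ ?invr_eq0 ?(n0_neq0 R hn)// rootM !root_prod_XsubC !rootE (negPf A0) (negPf B0) orbF /= => Epq.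
  by have := dis (g t); rewrite Epq; case: (g t \in _) => // H; case: H.
have offz z : z \in (qin ++ qout) ++ (pin ++ pout) -> off_curve g z.
  by move=> zs t t01; apply: contraTneq zs => <-; rewrite mem_cat negb_or; have [-> ->] := offE t t01.
have off0 : off_curve g 0 by move=> t t01; have [Hp _] := off t t01; exact: (pole_neq0 hm Hp).
have ind z : index_integral g (curve_deriv g) z = two_pi_i R * winding g z.
  rewrite /winding mulVKf ?two_pi_i_neq0//; apply: cint_ext => t _; exact: mulrC.
pose i : int := (-1) ^+ b; have iE : (i%:~R : C) = (-1) ^+ b by rewrite /i rmorphXn /= rmorphN1.
have i0 : i != 0 by rewrite /i expf_neq0.
have indin z : enclosed g z -> index_integral g (curve_deriv g) z = i%:~R * two_pi_i R.
  by move=> zi; rewrite ind (ori z zi) iE mulrC.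
have [HL1 HL2] := HL; have cL := within_continuous_pcont HL1.
have L01 : L 0 = L 1 := zero_winding_closed hm Cg Z HL.
have inP z : z \in qin ++ pin -> off_curve g z /\ index_integral g (curve_deriv g) z = i%:~R * two_pi_i R.
  move=> zs; split; last by apply: indin; exact: Hin.
  by apply: offz; move: zs; rewrite !mem_cat => /orP[] ->; rewrite ?orbT.
have outP z : z \in qout ++ pout -> off_curve g z /\ index_integral g (curve_deriv g) z = 0.
  move=> zs; have oz : off_curve g z by apply: offz; move: zs; rewrite !mem_cat => /orP[] ->; rewrite ?orbT.
  by split=> //; apply: (not_enclosed_index Pg g01 oz); exact: Hout.
have disio z : ~ (z \in qin /\ z \in pin) by move=> [z1 z2]; apply: (dis z); rewrite !mem_cat z1 z2.
have EL (t : R) : 0 <= t <= 1 -> cexp (L t) =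
    n0^-1 * \prod_(w <- qin ++ qout) (g t - w) / \prod_(w <- pin ++ pout) (g t - w).
  move=> t01; have [Hp _] := off t t01; have [_ gp] := offE t t01.
  have B0 := lamBn0 Hp; have P0 : (prodX (pin ++ pout)).[g t] != 0 by rewrite -rootE root_prod_XsubC.
  rewrite (HL2 t t01) (lamE Hp) -!horner_prodXsubC; apply/eqP; rewrite eqr_div// -hornerM E hornerZ hornerM mulrA.
  by [].
have FE : toda_F g L 0 = log_integral g (curve_deriv g) L.
  by congr (_ * _); apply: cint_ext => t _; rewrite expr1 (_ : 1`!%:R = 1) ?divr1.
have c0 : n0^-1 != 0 by rewrite invr_eq0 (n0_neq0 R hn).
have main (k : int) (Hk : index_integral g (curve_deriv g) 0 = k%:~R * two_pi_i R) :=
  log_integral_zeros_poles Pg off0 i0 c0 inP outP Hk disio cL L01 EL.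
have szin : size qin = size pin.
  have [k Hk] := index_integer Pg g01 off0.
  by have [] := main k Hk.
have cprod (l s : seq C) : map (@cexp R) l = s -> cexp (\sum_(x <- l) x) = \prod_(w <- s) w.
  by move=> <-; rewrite cexp_sum big_map.
have zipE : \prod_(x <- zip qin pin) (x.1 / x.2) = (\prod_(w <- qin) w) / (\prod_(w <- pin) w).
  by rewrite -(prod_zip id id szin).
split=> // [n0e lq lp Eq Ep|e0 lq lp Eq Ep]; apply: cexp_mod; rewrite FE.
  have H0 : index_integral g (curve_deriv g) 0 = (0 : int)%:~R * two_pi_i R.
    by rewrite mul0r; exact: (not_enclosed_index Pg g01 off0 n0e).
  have [_ ->] := main 0 H0.
  rewrite cexp_signed cexpB (cprod _ _ Ep) (cprod _ _ Eq) -/i sub0r !prod_expz zipE !expr0z mul1r divr1 mulr1.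
  by rewrite -exprz_inv invf_div.
(* Here k = i: the exponents k - i of the inner pairs vanish, and the outer points and the constant
   remain. *)
have [_ ->] := main i (indin 0 e0).
have sqo : size qout = (size pout + n 0)%N by move: sqp; rewrite !size_cat szin; lia.
have sg (s : seq C) : \prod_(w <- s) (- w) = (-1) ^+ size s * \prod_(w <- s) w.
  by elim: s => [|w s IH]; rewrite ?big_nil ?mulr1// !big_cons IH exprS mulN1r !mulNr mulrCA.
rewrite mulNr -mulrN cexp_signed -/i cexpN !cexpD cexpN cexpMn cexp_pi_i (cprod _ _ Ep) (cprod _ _ Eq).
rewrite cexp_ln_nat ?hn// subrr !prod_expz expr0z mulr1 !sg sqo expfV -!expfzMl; congr (_ ^ _); rewrite exprD.
have P0 : \prod_(w <- pout) w != 0 by rewrite -(cprod _ _ Ep) cexp_neq0.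
have Q0 : \prod_(w <- qout) w != 0 by rewrite -(cprod _ _ Eq) cexp_neq0.
have t2 : (-1) ^+ n 0 * (-1) ^+ n 0 = 1 :> C by rewrite -exprMn mulrNN mulr1 expr1n.
have s0 : (-1) ^+ size pout != 0 :> C by rewrite expf_neq0// oppr_eq0 oner_eq0.
have := n0_neq0 R hn; move: P0 Q0 t2 s0; move: (\prod_(w <- pout) w) (\prod_(w <- qout) w) ((-1) ^+ n 0 : C) ((-1) ^+ size pout : C).
move=> P Q t s P0 Q0 t2 s0 n00; have t0 : t != 0 by apply: contraTneq (oner_neq0 C) => tz; rewrite -t2 tz mul0r eqxx.
have tV : t^-1 = t by apply: (mulfI t0); rewrite mulfV.
rewrite -{1}tV; move: n00; set v := (n 0)%:R => v0.
by field; rewrite ?P0 ?Q0 ?s0 ?t0 ?v0.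
Qed.

End ValueOfF0.

Theorem theorem1p6 (R : realType) (m : nat) (n : nat -> nat)
  (hm : (0 < m)%N) (hn : forall i : nat, (i <= m)%N -> (0 < n i)%N)
  (e E : 'rV[R[i]]_(toda_dim m n) -> 'rV[R[i]]_(toda_dim m n))
  (he : toda_unit_field e) (hE : toda_euler_field E) :
  [/\
   (* F_{g,p} is defined near every point at which the winding number of
      lambda along g vanishes *)
      forall (a0 : 'rV[R[i]]_(toda_dim m n)) (g : R -> R[i]),
        toda_dual_manifold E a0 -> simple_closed_curve g ->
        zero_winding a0 g ->
        exists (U : set 'rV[R[i]]_(toda_dim m n))
               (L : 'rV[R[i]]_(toda_dim m n) -> R -> R[i]),
          [/\ open U, U a0, U `<=` toda_dual_manifold E,
              forall a, U a -> zero_winding a g & log_branch U g L],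
   (* every family F_{g,p} consists of Hamiltonian densities *)
      forall (U : set 'rV[R[i]]_(toda_dim m n))
             (t : 'I_(toda_dim m n) -> 'rV[R[i]]_(toda_dim m n) -> R[i])
             (G : 'M[R[i]]_(toda_dim m n)) (g : R -> R[i])
             (L : 'rV[R[i]]_(toda_dim m n) -> R -> R[i]),
        flat_coordinates E U t G -> simple_closed_curve g ->
        (forall a, U a -> zero_winding a g) -> log_branch U g L ->
        [/\ forall p, holomorphic_on U (fun a => toda_F g (L a) p),
            exists (k : 'I_(toda_dim m n) -> R[i]) (k0 : R[i]),
              forall a, U a ->
                toda_F g (L a) 0%N =
                \sum_i k i * (\sum_j invmx G i j * t j a) + k0 &
            density_recursion e E U t (fun p a => toda_F g (L a) p)],
   (* near every point the F_{g,p} of suitable curves form a complete system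
      of Hamiltonian densities *)
      forall a0 : 'rV[R[i]]_(toda_dim m n), toda_dual_manifold E a0 ->
        exists (U : set 'rV[R[i]]_(toda_dim m n))
               (t : 'I_(toda_dim m n) -> 'rV[R[i]]_(toda_dim m n) -> R[i])
               (G : 'M[R[i]]_(toda_dim m n))
               (g : 'I_(toda_dim m n) -> R -> R[i])
               (L : 'I_(toda_dim m n) ->
                    'rV[R[i]]_(toda_dim m n) -> R -> R[i]),
          [/\ U a0, flat_coordinates E U t G,
              forall i, simple_closed_curve (g i),
              forall i, (forall a, U a -> zero_winding a (g i)) /\
                        log_branch U (g i) (L i) &
              hamiltonian_densities e E U t G
                (fun i p a => toda_F (g i) (L i a) p)] &
   (* the value of F_{g,0} *)
      forall (a : 'rV[R[i]]_(toda_dim m n)) (g L : R -> R[i]) (b : bool)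
             (qin qout pin pout : seq R[i]),
        toda_dual_manifold E a -> simple_closed_curve g ->
        has_orientation b g -> zero_winding a g -> log_along a g L ->
        zeros_and_poles (lam a) (qin ++ qout) (pin ++ pout) ->
        (forall z, z \in qin ++ pin -> enclosed g z) ->
        (forall z, z \in qout ++ pout -> ~ enclosed g z) ->
        [/\ size qin = size pin,
            ~ enclosed g 0 ->
              forall lq lp : seq R[i],
                map (@cexp R) lq = qin -> map (@cexp R) lp = pin ->
                exists j : int,
                  toda_F g L 0%N =
                  (-1) ^+ b * (\sum_(x <- lp) x - \sum_(x <- lq) x)
                  + j%:~R * two_pi_i R &
            enclosed g 0 ->
              forall lq lp : seq R[i],
                map (@cexp R) lq = qout -> map (@cexp R) lp = pout ->
                exists j : int,
                  toda_F g L 0%N =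
                  - (-1) ^+ b * (\sum_(x <- lp) x - \sum_(x <- lq) x
                                 + (ln (n 0%N)%:R)%:C
                                 + (n 0%N)%:R * (0 +i* pi))
                  + j%:~R * two_pi_i R]].
Proof.
split.
- move=> a0 g Da0 [Cg g01 _] Z.
  have [d [L [d0 Hd Hz HL]]] := ball_log_branch hm Cg g01 Z (dual_near hm hn hE Da0).
  exists (vball a0 d), L; split; [exact: (@vball_open _ _ a0 d)|exact: vball_center|exact: Hd|exact: Hz|exact: HL].
- move=> U t G g L FC [Cg g01 _] HZ HL; split.
  + exact: (holomorphic_F hm FC Cg HZ HL).
  + exact: (F0_affine hm hn hE FC Cg g01 HZ HL).
  + exact: (F_recursion hm hn he hE FC Cg g01 HZ HL).
- exact: (complete_densities hm hn he hE).
- move=> a g L b qin qout pin pout _; exact: (value_F0 hm hn).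
Qed.
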